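(* Let $\alpha>0$, and let $1<p<\infty$ if $d=1,2$, and $1<p<\frac{d}{d-2}$ if $d\ge 3$. Let $(u_0,u_1)\in\mathcal H=H^1(\mathbb R^d)\times L^2(\mathbb R^d)$ and let $u$ be the maximal forward solution of $$u_{tt}-\Delta u+u+2\alpha u_t-|u|^{p-1}u=0,\qquad u(0)=u_0,\quad \partial_tu(0)=u_1 .$$ Then either (a) $u$ blows up at a finite positive time; or (b) $u$ exists on $[0,\infty)$, $\lim_{t\to\infty}\partial_tu(t)=0$ in $L^2(\mathbb R^d)$, and for every time sequence $t_n\to\infty$ there exist, after passing to a subsequence, an integer $0\le J<\infty$, equilibrium points $Q^1,\dots,Q^J$, and points $x_{j,n}\in\mathbb R^d$ ($1\le j\le J$) such that $$u(t_n)=\sum_{j=1}^{J}Q^j(\cdot-x_{j,n})+o_{H^1}(1)\quad\text{as } n\to\infty,$$ and $\lim_{n\to\infty}|x_{j,n}-x_{i,n}|=\infty$ for all $i\ne j$.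
   Context: Functions are real-valued. A solution on $[0,T)$ means a function $u$ with $(u,\partial_tu)\in C([0,T);\mathcal H)$ and $|u|^{p-1}u\in L^1_{loc}([0,T);L^2(\mathbb R^d))$ satisfying the equation in the sense of distributions (equivalently, Duhamel's formula). The Cauchy problem is locally well-posed in $\mathcal H$, so there is a unique maximal forward solution on some $[0,T_+)$, $0<T_+\le\infty$; it ''blows up at finite positive time'' if $T_+<\infty$. An equilibrium point is a function $Q\in H^1(\mathbb R^d)$ with $-\Delta Q+Q-|Q|^{p-1}Q=0$. The notation $o_{H^1}(1)$ denotes a sequence tending to $0$ in $H^1(\mathbb R^d)$. *)

(* Defs.v *)
From HB Require Import structures.
From mathcomp Require Import all_boot all_order all_algebra.
From mathcomp Require Import all_classical all_reals all_analysis.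
Import Order.TTheory GRing.Theory Num.Theory.
Import numFieldNormedType.Exports.

Set Implicit Arguments.
Unset Strict Implicit.
Unset Printing Implicit Defensive.

Local Open Scope classical_set_scope.
Local Open Scope ring_scope.

(* 'rV[R]_n carries the sigma-algebra generated by the coordinates, which is
   the Borel sigma-algebra of R^n. *)
Definition measure_rV_display : measure_display.
Proof. exact: default_measure_display. Qed.

Section measurable_rV.
Context {R : realType} (n : nat).

Let coors : 'I_n -> 'rV[R]_n -> R := fun i x => x ord0 i.

Let rV_set0 : g_sigma_preimage coors set0.
Proof. exact: sigma_algebra0. Qed.

Let rV_setC A : g_sigma_preimage coors A -> g_sigma_preimage coors (~` A).
Proof. exact: sigma_algebraC. Qed.

Let rV_bigcup (F : _^nat) : (forall i, g_sigma_preimage coors (F i)) ->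
  g_sigma_preimage coors (\bigcup_i (F i)).
Proof. exact: sigma_algebra_bigcup. Qed.

HB.instance Definition _ := @isMeasurable.Build measure_rV_display
  'rV[R]_n (g_sigma_preimage coors) rV_set0 rV_setC rV_bigcup.

End measurable_rV.

Section lebesgue_rV.
Context {R : realType}.

Definition consrV n (z : R * 'rV[R]_n) : 'rV[R]_n.+1 :=
  \row_i oapp (z.2 ord0) z.1 (unlift ord0 i).

Definition unconsrV n (w : 'rV[R]_n.+1) : R * 'rV[R]_n :=
  (w ord0 ord0, \row_i w ord0 (lift ord0 i)).

Lemma consrVK n : cancel (@consrV n) (@unconsrV n).
Proof.
move=> [a x]; congr pair => /=; first by rewrite mxE unlift_none.
by apply/rowP => i; rewrite !mxE liftK.
Qed.

Lemma unconsrVK n : cancel (@unconsrV n) (@consrV n).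
Proof.
move=> w; apply/rowP => i; rewrite mxE.
by have [j ->|->] := unliftP ord0 i; rewrite ?liftK ?unlift_none //= mxE.
Qed.

Lemma measurable_coord n (i : 'I_n) :
  measurable_fun [set: 'rV[R]_n] (fun x : 'rV[R]_n => x ord0 i).
Proof.
move=> _ Y mY; rewrite setTI; apply: sub_sigma_algebra => /=.
rewrite -bigcup_seq/=; exists i => /=; first by rewrite mem_index_enum.
by exists Y => //; rewrite setTI.
Qed.

Lemma measurable_fun_rV d (T : measurableType d) n (f : T -> 'rV[R]_n) :
  (forall i, measurable_fun [set: T] (fun t => f t ord0 i)) ->
  measurable_fun [set: T] f.
Proof.
move=> mf _ Y mY; rewrite setTI.
suff : g_sigma_preimage (fun i : 'I_n => (fun x : 'rV[R]_n => x ord0 i)) `<=`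
    [set A | measurable (f @^-1` A)] by exact.
apply: smallest_sub.
  split => /=.
  - by rewrite preimage_set0.
  - by move=> A mA; rewrite setTD preimage_setC; exact: measurableC.
  - by move=> F mF; rewrite preimage_bigcup; exact: bigcup_measurable.
rewrite -bigcup_seq => A [i _ [B mB <-]] /=; rewrite setTI -comp_preimage.
by rewrite -[X in measurable X]setTI; exact: mf.
Qed.

Lemma measurable_consrV n : measurable_fun setT (@consrV n).
Proof.
apply: measurable_fun_rV => i.
have [j ->|->] := unliftP ord0 i; last first.
  rewrite [X in measurable_fun _ X](_ : _ = fst)//.
  by apply/funext => z; rewrite mxE unlift_none.
rewrite [X in measurable_fun _ X]
  (_ : _ = (fun x : 'rV[R]_n => x ord0 j) \o snd).
  by apply: measurableT_comp => //; exact: measurable_coord.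
by apply/funext => z; rewrite mxE liftK.
Qed.

Lemma measurable_unconsrV n : measurable_fun setT (@unconsrV n).
Proof.
apply: measurable_fun_pair; first exact: measurable_coord.
apply: measurable_fun_rV => i.
rewrite [X in measurable_fun _ X]
  (_ : _ = (fun x : 'rV[R]_n.+1 => x ord0 (lift ord0 i))).
  exact: measurable_coord.
by apply/funext => w /=; rewrite mxE.
Qed.

Section step.
Variables (n : nat) (m : {sigma_finite_measure set 'rV[R]_n -> \bar R}).

Definition lebesgue_step : set 'rV[R]_n.+1 -> \bar R :=
  pushforward (@lebesgue_measure R \x m)%E (@consrV n).

Let mconsrV := @measurable_consrV n.

Let lebesgue_step0 : lebesgue_step set0 = 0%E.
Proof. exact: measure0. Qed.

Let lebesgue_step_ge0 A : (0 <= lebesgue_step A)%E.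
Proof. exact: measure_ge0. Qed.

Let lebesgue_step_sigma_additive : semi_sigma_additive lebesgue_step.
Proof. exact: measure_semi_sigma_additive. Qed.

HB.instance Definition _ := isMeasure.Build _ _ _ lebesgue_step
  lebesgue_step0 lebesgue_step_ge0 lebesgue_step_sigma_additive.

Let lebesgue_step_sigma_finite : sigma_finite setT lebesgue_step.
Proof.
have /sigma_finiteP[F [TF ndF Foo]] := sigma_finiteT (@lebesgue_measure R).
have /sigma_finiteP[G [TG ndG Goo]] := sigma_finiteT m.
exists (fun k => @unconsrV n @^-1` (F k `*` G k)).
  rewrite -preimage_bigcup -[LHS](preimage_setT (@unconsrV n)); congr preimage.
  apply/seteqP; split => // -[a x] _.
  have [i _ Fa] : (\bigcup_k F k) a by rewrite -TF.
  have [j _ Gx] : (\bigcup_k G k) x by rewrite -TG.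
  exists (maxn i j) => //; split.
  - by move: a Fa; exact/subsetPset/ndF/leq_maxl.
  - by move: x Gx; exact/subsetPset/ndG/leq_maxr.
move=> k; have [mF Fk] := Foo k; have [mG Gk] := Goo k; split.
  rewrite -[X in measurable X]setTI; apply: measurable_unconsrV => //.
  exact: measurableX.
rewrite /lebesgue_step /pushforward -comp_preimage.
rewrite (_ : _ \o _ = id); last by apply/funext => z; exact: consrVK.
by rewrite preimage_id product_measure1E// lte_mul_pinfty// ge0_fin_numE.
Qed.

HB.instance Definition _ := Measure_isSigmaFinite.Build _ _ _ lebesgue_step
  lebesgue_step_sigma_finite.

End step.

(* Recursion R^(k+1) = R x R^k; the values on boxes (lebesgue_rV_box)
   characterize it. *)
Fixpoint lebesgue_rV n : {sigma_finite_measure set 'rV[R]_n -> \bar R} :=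
  match n with
  | 0 => dirac (0 : 'rV[R]_0)
  | k.+1 => lebesgue_step (lebesgue_rV k)
  end.

Lemma lebesgue_rV_box n (A : 'I_n -> set R) : (forall i, measurable (A i)) ->
  lebesgue_rV n [set x | forall i, A i (x ord0 i)]
  = (\prod_(i < n) lebesgue_measure (A i))%E.
Proof.
elim: n A => [|n ih] A mA.
  transitivity (lebesgue_rV 0 setT); last by rewrite big_ord0 /= diracT.
  by congr (lebesgue_rV 0 _); rewrite -subTset => x _ [].
rewrite big_ord_recl /= /lebesgue_step /pushforward.
rewrite (_ : _ @^-1` _ =
  A ord0 `*` [set x : 'rV[R]_n | forall i, A (lift ord0 i) (x ord0 i)]).
  rewrite product_measure1E; [by congr (_ * _)%E; exact: ih|exact: mA|].
  rewrite [X in measurable X](_ : _ = \bigcap_(i : 'I_n)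
    ((fun x : 'rV[R]_n => x ord0 i) @^-1` A (lift ord0 i))); last first.
    by apply/seteqP; split => x /= Ax i => [_|]; exact: Ax.
  apply: fin_bigcap_measurable => // i _.
  by rewrite -[X in measurable X]setTI; exact: measurable_coord.
apply/seteqP; split => [[a x] /= Ax|[a x] /= [Aa Ax] i].
  split=> [|i]; first by have := Ax ord0; rewrite mxE unlift_none.
  by have := Ax (lift ord0 i); rewrite mxE liftK.
by have [j ->|->] := unliftP ord0 i; rewrite mxE ?liftK ?unlift_none//=; exact: Ax.
Qed.

End lebesgue_rV.

Section test_functions.
Context {R : realType} {V : normedModType R}.

(* C^oo: every iterated directional derivative exists and is continuous. *)
Definition smooth (f : V -> R) : Prop :=
  forall s : seq V, let g := foldr (fun v h => 'D_v h) f s in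
    continuous g /\ (forall x v, derivable g x v).

Definition support (f : V -> R) : set V := closure [set x | f x != 0].

Definition test_function (U : set V) (f : V -> R) : Prop :=
  [/\ smooth f, compact (support f) & support f `<=` U].

End test_functions.

(* Elements of L^2 and H^1 are represented by measurable functions, not by
   classes; all the notions below depend on the a.e. class only. *)
Section spaces.
Context {R : realType} {d : nat}.
Local Notation E := 'rV[R]_d.
Local Notation leb := (@lebesgue_rV R d).
Implicit Types (f g Q : E -> R) (i : 'I_d).

(* The library norm on 'rV[R]_d is the maximum norm. *)
Definition euclidean_norm (x : E) : R := Num.sqrt (\sum_i x ord0 i ^+ 2).

Definition dir i : E := delta_mx ord0 i.

Definition laplacian (f : E -> R) (x : E) : R :=
  \sum_i 'D_(dir i) ('D_(dir i) f) x.

Definition L2 : set (E -> R) := [set f | f \in Lfun leb 2%:E].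

Definition L2norm f : R := fine ('N[leb]_(2%:E) [EFin \o f])%E.

Definition weak_partial i f g : Prop :=
  forall phi : E -> R, test_function setT phi ->
    \int[leb]_x (f x * 'D_(dir i) phi x) = - \int[leb]_x (g x * phi x).

Definition H1 : set (E -> R) :=
  [set f | L2 f /\ forall i, exists g, L2 g /\ weak_partial i f g].

(* A chosen weak partial derivative, determined a.e. when f is in H^1. *)
Definition wpartial i f : E -> R :=
  xget (cst 0) [set g | L2 g /\ weak_partial i f g].

Definition H1norm f : R :=
  Num.sqrt (L2norm f ^+ 2 + \sum_i L2norm (wpartial i f) ^+ 2).

Definition nonlinearity (p a : R) : R := `|a| `^ (p - 1) * a.

Definition equilibrium (p : R) (Q : E -> R) : Prop :=
  H1 Q /\
  forall phi : E -> R, test_function setT phi ->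
    \int[leb]_x (- (Q x * laplacian phi x) + Q x * phi x
                  - nonlinearity p (Q x) * phi x) = 0.

End spaces.

Section solutions.
Context {R : realType} {d : nat}.
Local Notation E := 'rV[R]_d.
Local Notation leb := (@lebesgue_rV R d).
Local Notation mu := (@lebesgue_measure R).
Implicit Types (T : \bar R) (u v F : R -> E -> R).

Definition before T : set R := [set t | 0 <= t /\ (t%:E < T)%E].

(* F is continuous on [0, T) with values in X normed by N. *)
Definition continuous_in (X : set (E -> R)) (N : (E -> R) -> R) T F : Prop :=
  forall t, before T t ->
    X (F t) /\ N (F s - F t) @[s --> within (before T) (nbhs t)] --> 0.

(* Bochner's strong measurability of L^2-valued functions: an a.e. limit of
   L^2-valued simple functions. *)
Definition simple_L2 F : Prop :=
  exists n (A : 'I_n -> set R) (g : 'I_n -> E -> R),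
    (forall k, measurable (A k) /\ L2 (g k)) /\
    F = fun t x => \sum_(k < n) \1_(A k) t * g k x.

Definition strongly_measurable (I : set R) F : Prop :=
  exists s : nat -> R -> E -> R, (forall n, simple_L2 (s n)) /\
    {ae mu, forall t, I t ->
      L2 (F t) /\ L2norm (s n t - F t) @[n --> \oo] --> 0}.

Definition L1loc_L2 T F : Prop :=
  forall S : R, before T S ->
    strongly_measurable `[0, S] F /\
    (\int[mu]_(t in `[0%R, S]) 'N[leb]_(2%:E) [EFin \o F t] < +oo)%E.

(* Distributions on ]0, T[ x R^d. The pairings are iterated integrals in (t, x):
   only t |-> u t is determined as a curve in L^2, so that an arbitrary choice
   of representatives u t need not be jointly measurable. *)
Definition dt (phi : R^o * E -> R) : R^o * E -> R := 'D_((1, 0)) phi.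

Definition slab T : set (R^o * E) := [set z | 0 < z.1 /\ (z.1%:E < T)%E].

Definition weak_dt T u v : Prop :=
  forall phi, test_function (slab T) phi ->
    \int[mu]_t (\int[leb]_x (u t x * dt phi (t, x)))
    = - \int[mu]_t (\int[leb]_x (v t x * phi (t, x))).

(* The constant-coefficient derivatives are moved onto phi; the integration by
   parts changes the sign of the first-order term only. *)
Definition weak_equation (alpha p : R) T u : Prop :=
  forall phi, test_function (slab T) phi ->
    \int[mu]_t (\int[leb]_x
      (u t x * dt (dt phi) (t, x)
       - u t x * laplacian (fun y => phi (t, y)) x
       + u t x * phi (t, x)
       - 2 * alpha * u t x * dt phi (t, x)
       - nonlinearity p (u t x) * phi (t, x))) = 0.

Definition solution (alpha p : R) T u v : Prop :=
  [/\ continuous_in H1 H1norm T u /\ continuous_in L2 L2norm T v,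
      L1loc_L2 T (fun t x => nonlinearity p (u t x)),
      weak_dt T u v
    & weak_equation alpha p T u].

(* A solution with data (u0, u1) that no solution on a longer interval
   extends. *)
Definition maximal_solution (alpha p : R) (u0 u1 : E -> R) T u v : Prop :=
  [/\ (0 < T)%E,
      solution alpha p T u v,
      u 0 = u0 %[ae leb] /\ v 0 = u1 %[ae leb]
    & forall T' u' v', (T < T')%E -> solution alpha p T' u' v' ->
        ~ (forall t, before T t ->
             u' t = u t %[ae leb] /\ v' t = v t %[ae leb])].

End solutions.

(* Main.v *)
(* Idea.  The energy [E] decreases, [E' = - 2 alpha |u_t|^2].  If [|u_t|^2 + |u|_{H^1}^2] were eventually
   larger than a constant depending on [E], Levine's concavity method would exclude a global solution; so
   this quantity is bounded along a sequence of times, [E] is bounded below, and the drop of [E] over time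
   windows of fixed length tends to 0.  On a window where the drop is small, the increments
   [u(t + h) - u(t)] solve a linear damped equation whose energy hardly varies and has, by the virial
   identity, a small mean; hence they are small, [u_t] is small and [u(t)] is almost critical for the
   functional.  Almost critical functions of bounded energy satisfy a bound depending on the energy alone,
   so the windows can be chained: the trajectory is bounded, [u_t -> 0], and [u(t_n)] is a Palais-Smale
   sequence.  Along an ultrafilter all translates of [u(t_n)] have weak limits; these are equilibria, and
   the nonzero ones have H^1 norm bounded below, so a maximal family of weak limits along mutually diverging
   translations is finite.  All translates of the remainder then tend weakly to 0, its averages over small
   cubes tend to 0 uniformly, the subcritical nonlinearity of the remainder vanishes in L^2, and the
   Palais-Smale property turns this into strong convergence in H^1. *)
From HB Require Import structures.
Require Import Defs.
From mathcomp Require Import all_boot all_order all_algebra.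
From mathcomp Require Import all_classical all_reals all_analysis.
From mathcomp Require Import measurable_realfun.
From mathcomp Require Import ring lra zify.
Import Order.TTheory GRing.Theory Num.Theory.
Import numFieldNormedType.Exports.

Set Implicit Arguments.
Unset Strict Implicit.
Unset Printing Implicit Defensive.

Local Open Scope classical_set_scope.
Local Open Scope ring_scope.

(** Two obstacles shape the proof. A global solution is not known to be bounded, and the dissipation
    controls only [u_t] in L^2. Differentiating the equation in time would produce [|u|^(p-1) u_t],
    which is not controlled by [u_t] in L^2; finite increments avoid this term, because they only
    need the nonlinearity to be uniformly continuous from H^1-bounded sets to L^2 for the L^2
    distance. Boundedness is replaced by windows whose length depends only on the size of the
    solution at their start. The bound on [p] enters solely through L^2 estimates of the
    nonlinearity, obtained from dyadic averages. Solutions satisfy the equation only as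
    distributions, so each use of a time derivative rests on scalar pairings, and the energy
    identity on a regularization by resolvents. Ultrafilters replace repeated extraction: all
    translates have weak limits along one fixed ultrafilter, so a maximal family of profiles makes
    sense, and a genuine subsequence is chosen only once, at the very end. *)

Local Notation supp := Defs.support.

(** * Affine changes of variables for Lebesgue measure *)

Section affine_invariance.
Context {R : realType}.

Definition affine n (s : R) (a : 'rV[R]_n) (x : 'rV[R]_n) : 'rV[R]_n := s *: x + a.

Lemma measurable_affine n (s : R) (a : 'rV[R]_n) :
  measurable_fun setT (affine s a).
Proof.
apply: measurable_fun_rV => i.
rewrite (_ : (fun t => _) = (fun x : 'rV[R]_n => s * x ord0 i + a ord0 i)).
  apply: measurable_funD => //; apply: measurable_funM => //.
  exact: measurable_coord.
by apply/funext => x; rewrite /affine !mxE.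
Qed.

Lemma measurable_scale_add (s a : R) : measurable_fun setT (fun x : R => s * x + a).
Proof. by apply: measurable_funD => //; exact: measurable_funM. Qed.

Lemma lebesgue_affine1 (s a : R) (A : set R) : s = 1 \/ s = -1 -> measurable A ->
  lebesgue_measure ((fun x : R => s * x + a) @^-1` A) = lebesgue_measure A.
Proof.
move=> hs mA.
have mf0 := measurable_scale_add s a.
have mf : measurable_fun setT ((fun x : R => s * x + a) : measurableTypeR R -> measurableTypeR R) := mf0.
pose mu0 := isMeasurableFun.Build _ _ _ _ _ mf.
pose f : {mfun measurableTypeR R >-> measurableTypeR R} := MeasurableFun.Pack (MeasurableFun.Class mu0).
apply/esym/(@lebesgue_measure_unique _ (pushforward (@lebesgue_measure R) f)) => //= _ [[x y]] _ <-.
rewrite /pushforward/=; case: hs => ->.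
  rewrite (_ : _ @^-1` _ = [set` `]x - a, y - a]]); last first.
    by apply/seteqP; split => z /=; rewrite !in_itv/= mul1r ltrBlDr lerBrDr.
  rewrite !lebesgue_measure_itv/= !lte_fin ltrD2r.
  by case: ifP => // _; rewrite -!EFinD; congr (_%:E); ring.
rewrite (_ : _ @^-1` _ = [set` `[a - y, a - x[]); last first.
  apply/seteqP; split => z /=; rewrite !in_itv/= => /andP[h1 h2]; apply/andP; split; lra.
rewrite !lebesgue_measure_itv/= !lte_fin ltrD2l ltrN2.
by case: ifP => // _; rewrite -!EFinD; congr (_%:E); ring.
Qed.

(** Induction on the dimension: under [consrV] the map splits into an affine map of the line and one
    of [R^n], and a product measure is determined by its values on rectangles. *)
Lemma lebesgue_affine n (s : R) (a : 'rV[R]_n) (A : set 'rV[R]_n) :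
  s = 1 \/ s = -1 -> measurable A ->
  lebesgue_rV n (affine s a @^-1` A) = lebesgue_rV n A.
Proof.
move=> hs; elim: n a A => [|n ih] a A mA.
  congr (lebesgue_rV 0 _); apply/seteqP.
  by split=> x; rewrite /= (thinmx0 (affine s a x)) (thinmx0 x).
rewrite /= /lebesgue_step /pushforward.
have mc : measurable (@consrV R n @^-1` A).
  by rewrite -[X in measurable X]setTI; exact: measurable_consrV.
pose a0 := a ord0 ord0; pose a' : 'rV[R]_n := \row_i a ord0 (lift ord0 i).
pose g (z : measurableTypeR R * 'rV[R]_n) : measurableTypeR R * 'rV[R]_n :=
  (s * z.1 + a0, affine s a' z.2).
have mg : measurable_fun setT g.
  apply: measurable_fun_pair.
    exact: (measurableT_comp (measurable_scale_add s a0) (@measurable_fst _ _ _ _)).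
  by apply: measurableT_comp => //; exact: measurable_affine.
rewrite [X in _ X = _](_ : _ = g @^-1` (@consrV R n @^-1` A)); last first.
  apply/seteqP; split => -[z x] /=; rewrite [affine s a _](_ : _ = consrV (g (z, x))) //;
    apply/rowP => i; rewrite !mxE /=;
    by have [j ->|->] := unliftP ord0 i; rewrite ?liftK ?unlift_none /= ?mxE.
pose g0 := isMeasurableFun.Build _ _ _ _ _ mg.
pose gm : {mfun (measurableTypeR R * 'rV[R]_n)%type >-> (measurableTypeR R * 'rV[R]_n)%type} :=
  MeasurableFun.Pack (MeasurableFun.Class g0).
apply/esym/(@product_measure_unique _ _ _ _ _ _ _ (pushforward (@lebesgue_measure R \x lebesgue_rV n)%E gm)) => // B C mB mC.
have mB' : measurable ((fun x : R => s * x + a0) @^-1` B).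
  rewrite -[X in measurable X]setTI.
  exact: (measurable_scale_add s a0).
have mC' : measurable (affine s a' @^-1` C).
  by rewrite -[X in measurable X]setTI; exact: measurable_affine.
pose phi (x : R) := s * x + a0.
transitivity (lebesgue_measure (phi @^-1` B)
  * lebesgue_rV n (affine s a' @^-1` C))%E; first exact: product_measure1E.
by congr (_ * _)%E; [exact: lebesgue_affine1|exact: ih].
Qed.

End affine_invariance.

Section integrals.
Context {R : realType} {d : nat}.
Local Notation E := 'rV[R]_d.
Local Notation leb := (@lebesgue_rV R d).

Lemma ge0_integral_affine (s : R) (a : E) (f : E -> \bar R) : s = 1 \/ s = -1 ->
  measurable_fun setT f -> (forall x, 0 <= f x)%E ->
  (\int[leb]_x f (affine s a x) = \int[leb]_x f x)%E.
Proof.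
move=> hs mf f0.
have mg := measurable_affine s a.
rewrite -[LHS]/(\int[leb]_(x in affine s a @^-1` setT) (f \o affine s a) x)%E.
rewrite -(ge0_integral_pushforward mg)//.
apply: eq_measure_integral => A mA _; first
  [exact: (lebesgue_affine a hs mA) | exact: esym (lebesgue_affine a hs mA)].
Qed.

Lemma integral_affine (s : R) (a : E) (f : E -> \bar R) : s = 1 \/ s = -1 ->
  measurable_fun setT f ->
  (\int[leb]_x f (affine s a x) = \int[leb]_x f x)%E.
Proof.
move=> hs mf; rewrite integralE [RHS]integralE; congr (_ - _)%E.
  transitivity (\int[leb]_x (f^\+)%E (affine s a x))%E.
    by apply: eq_integral => x _; rewrite !funeposE.
  exact: (ge0_integral_affine a hs (measurable_funepos mf) (funepos_ge0 f)).
transitivity (\int[leb]_x (f^\-)%E (affine s a x))%E.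
  by apply: eq_integral => x _; rewrite !funenegE.
exact: (ge0_integral_affine a hs (measurable_funeneg mf) (funeneg_ge0 f)).
Qed.

Lemma integrable_affine (s : R) (a : E) (f : E -> \bar R) : s = 1 \/ s = -1 ->
  leb.-integrable setT f -> leb.-integrable setT (f \o affine s a).
Proof.
move=> hs /integrableP[mf intf]; apply/integrableP; split.
  by apply: measurableT_comp => //; exact: measurable_affine.
have mabs : measurable_fun setT (abse \o f) by exact: measurableT_comp.
have h0 x : (0 <= (abse \o f) x)%E by exact: abse_ge0.
by have := ge0_integral_affine a hs mabs h0 => /= ->.
Qed.

Lemma ball_rVP (x y : E) (e : R) : 0 < e ->
  ball x e y <-> forall i, `|x ord0 i - y ord0 i| < e.
Proof.
move=> e0; split.
  by case=> _ h i; exact: (h ord0 i).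
by move=> h; split => // i j; rewrite (ord1 i); exact: h.
Qed.

Lemma measurable_ball_rV (x : E) (e : R) : measurable (ball x e).
Proof.
have [e0|e0] := ltP 0 e; last first.
  rewrite (_ : ball x e = set0) //; apply/seteqP; split => // y [].
  by rewrite ltNge e0.
rewrite (_ : ball x e = \bigcap_(i : 'I_d) ((fun y : E => y ord0 i) @^-1` ball (x ord0 i) e)).
  apply: fin_bigcap_measurable => // i _.
  rewrite -[X in measurable X]setTI; apply: measurable_coord => //.
  exact: measurable_ball.
apply/seteqP; split => y /=.
  by move=> /(ball_rVP _ _ e0) h i _; exact: h.
by move=> h; apply/ball_rVP => // i; exact: h.
Qed.

(** The sigma-algebra is the one generated by the coordinates. An open set is a countable union of
    balls with rational centre and radius [1/(n+1)], and a ball of the maximum norm is a finite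
    intersection of coordinate conditions. *)
Lemma open_measurable_rV (U : set E) : open U -> measurable U.
Proof.
move=> oU.
pose Q := ('rV[rat]_d * nat)%type.
pose c (q : Q) : E := map_mx ratr q.1.
pose B (q : Q) : set E := if `[< ball (c q) q.2.+1%:R^-1 `<=` U >] then ball (c q) q.2.+1%:R^-1 else set0.
rewrite (_ : U = \bigcup_q B q).
  apply: countable_bigcupT_measurable => [|q]; first exact/countableP.
  by rewrite /B; case: ifP => _ //; exact: measurable_ball_rV.
apply/seteqP; split => x; last first.
  by move=> [q _]; rewrite /B; case: ifP => // /asboolP; apply.
move=> Ux; have /nbhs_ballP[e /= e0 eU] := oU x Ux.
have [n hn] : exists n : nat, n.+1%:R^-1 < e / 2.
  have e20 : 0 < e / 2 by rewrite divr_gt0.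
  have [n _ hn] := near_infty_natSinv_lt (PosNum e20).
  by exists n; apply: hn => /=.
have n0 : 0 < n.+1%:R^-1 :> R by rewrite invr_gt0.
have hq i : exists q : rat, `|ratr q - x ord0 i| < n.+1%:R^-1.
  have := @rat_in_itvoo _ (x ord0 i - n.+1%:R^-1) (x ord0 i + n.+1%:R^-1).
  have -> : x ord0 i - n.+1%:R^-1 < x ord0 i + n.+1%:R^-1.
    by rewrite ltrBlDr -addrA ltrDl addr_gt0.
  move=> /(_ isT)[q]; rewrite in_itv/= => /andP[h1 h2]; exists q.
  by rewrite ltr_distl h1 h2.
have [q hq'] := choice hq.
exists (\row_i q i, n) => //; rewrite /B /=.
have -> : `[< ball (c (\row_i q i, n)) n.+1%:R^-1 `<=` U >].
  apply/asboolP => y /(ball_rVP _ _ n0) hy; apply: eU; apply/ball_rVP => // i.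
  have := hy i; rewrite /c !mxE => h1; have h2 := hq' i.
  have -> : x ord0 i - y ord0 i = (ratr (q i) - y ord0 i) - (ratr (q i) - x ord0 i) by ring.
  apply: (le_lt_trans (ler_normB _ _)).
  by move: (n.+1%:R^-1) hn h1 h2 => k *; lra.
by apply/ball_rVP => // i; rewrite /c !mxE; exact: hq'.
Qed.

Lemma continuous_measurable_rV (f : E -> R) : continuous f -> measurable_fun setT f.
Proof.
move=> cf; apply: (measurability _ (RGenOpens.measurableE R)).
move=> /= _ [_ [a [b ->]] <-]; rewrite setTI; apply: open_measurable_rV.
by apply: open_comp => [x _|]; [exact: cf|exact: interval_open].
Qed.

Lemma lebesgue_ball_lty (x : E) (r : R) : (leb (ball x r) < +oo)%E.
Proof.
have [e0|e0] := ltP 0 r; last first.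
  rewrite (_ : ball x r = set0) ?measure0 //; apply/seteqP; split => // y [].
  by rewrite ltNge e0.
rewrite (_ : ball x r = [set y | forall i, ball (x ord0 i) r (y ord0 i)]).
  rewrite (lebesgue_rV_box (A := fun i => ball (x ord0 i) r)) => [|i]; last exact: measurable_ball.
  under eq_bigr do rewrite lebesgue_measure_ball ?(ltW e0)//.
  rewrite ltey_eq; apply/orP; left.
  by apply: (big_ind (fun z : \bar R => z \is a fin_num)) => // a b; exact: fin_numM.
by apply/seteqP; split => y /(ball_rVP _ _ e0).
Qed.

Lemma coord_le_norm (x : E) i : `|x ord0 i| <= `|x|.
Proof.
rewrite [leRHS]mx_normrE.
exact: (le_bigmax _ (fun ij : 'I_1 * 'I_d => `|x ij.1 ij.2|) (ord0, i)).
Qed.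

Lemma norm_rV_le (x : E) c : 0 <= c -> (forall i, `|x ord0 i| <= c) -> `|x| <= c.
Proof.
move=> c0 h; rewrite [leLHS]mx_normrE; apply/bigmax_leP; split => // -[j i] _ /=.
by rewrite (ord1 j).
Qed.

Lemma compact_sub_ball (K : set E) : compact K -> exists r : R, 0 < r /\ K `<=` ball (0 : E) r.
Proof.
move=> /compact_bounded[M [Mr hM]].
exists (`|M| + 2); split; first by rewrite ltr_wpDl.
move=> x Kx; apply/ball_rVP; first by rewrite ltr_wpDl.
move=> i; have := hM (`|M| + 1); rewrite (le_lt_trans (ler_norm M)) ?ltrDl// => /(_ isT x Kx) h.
rewrite mxE sub0r normrN; apply: (le_lt_trans (coord_le_norm x i)).
by apply: (le_lt_trans h); rewrite ltrD2l ltr1n.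
Qed.

End integrals.

(** * Semi-inner products *)

(* [B] is positive semidefinite on the subspace [D] only, so that L^2 and H^1 can be handled as spaces
   of functions, without a quotient by equality almost everywhere. *)
Section semi_inner.
Context {R : realType} {V : lmodType R}.
Variables (D : set V) (B : V -> V -> R).

Definition semi_inner : Prop :=
  [/\ D 0, forall a f g, D f -> D g -> D (a *: f + g),
      forall f g, D f -> D g -> B f g = B g f,
      forall a f g h, D f -> D g -> D h -> B (a *: f + g) h = a * B f h + B g h
    & forall f, D f -> 0 <= B f f].

Hypothesis hB : semi_inner.

Definition snorm (f : V) : R := Num.sqrt (B f f).

Lemma si0 : D 0. Proof. by case: hB. Qed.
Lemma siP a f g : D f -> D g -> D (a *: f + g). Proof. by case: hB => _ + _ _ _; exact. Qed.
Lemma siC f g : D f -> D g -> B f g = B g f. Proof. by case: hB => _ _ + _ _; exact. Qed.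
Lemma siDZl a f g h : D f -> D g -> D h -> B (a *: f + g) h = a * B f h + B g h.
Proof. by case: hB => _ _ _ + _; exact. Qed.
Lemma si_ge0 f : D f -> 0 <= B f f. Proof. by case: hB => _ _ _ _; exact. Qed.
Lemma siZ a f : D f -> D (a *: f).
Proof. by move=> Df; rewrite -[X in D X]addr0; apply: siP => //; exact: si0. Qed.
Lemma siD f g : D f -> D g -> D (f + g).
Proof. by move=> Df Dg; rewrite -[f]scale1r; exact: siP. Qed.
Lemma siN f : D f -> D (- f). Proof. by rewrite -scaleN1r; exact: siZ. Qed.
Lemma siB f g : D f -> D g -> D (f - g).
Proof. by move=> Df Dg; apply: siD => //; exact: siN. Qed.
Lemma si_sum (I : Type) (r : seq I) (P : pred I) (F : I -> V) :
  (forall i, P i -> D (F i)) -> D (\sum_(i <- r | P i) F i).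
Proof. by move=> h; apply: big_ind => //; [exact: si0|exact: siD]. Qed.
Lemma si0l f : D f -> B 0 f = 0.
Proof.
by move=> Df; have := siDZl 1 si0 si0 Df; rewrite scaler0 add0r mul1r => h; lra.
Qed.
Lemma siDl f g h : D f -> D g -> D h -> B (f + g) h = B f h + B g h.
Proof. by move=> Df Dg Dh; rewrite -[f]scale1r siDZl// scale1r mul1r. Qed.
Lemma siZl a f h : D f -> D h -> B (a *: f) h = a * B f h.
Proof. by move=> Df Dh; rewrite -[a *: f]addr0 siDZl// ?si0l ?addr0 //; exact: si0. Qed.
Lemma siNl f h : D f -> D h -> B (- f) h = - B f h.
Proof. by move=> Df Dh; rewrite -scaleN1r siZl// mulN1r. Qed.
Lemma siBl f g h : D f -> D g -> D h -> B (f - g) h = B f h - B g h.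
Proof. by move=> Df Dg Dh; rewrite siDl ?siNl//; exact: siN. Qed.
Lemma siDr f g h : D f -> D g -> D h -> B h (f + g) = B h f + B h g.
Proof.
by move=> Df Dg Dh; rewrite siC ?siDl ?(siC _ Dh)//; exact: siD.
Qed.
Lemma siZr a f h : D f -> D h -> B h (a *: f) = a * B h f.
Proof. by move=> Df Dh; rewrite siC ?siZl ?(siC Df)//; exact: siZ. Qed.
Lemma siNr f h : D f -> D h -> B h (- f) = - B h f.
Proof. by move=> Df Dh; rewrite -scaleN1r siZr// mulN1r. Qed.
Lemma siBr f g h : D f -> D g -> D h -> B h (f - g) = B h f - B h g.
Proof. by move=> Df Dg Dh; rewrite siDr ?siNr//; exact: siN. Qed.
Lemma si_suml (I : Type) (r : seq I) (P : pred I) (F : I -> V) h :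
  (forall i, P i -> D (F i)) -> D h ->
  B (\sum_(i <- r | P i) F i) h = \sum_(i <- r | P i) B (F i) h.
Proof.
move=> DF Dh; suff [] : D (\sum_(i <- r | P i) F i) /\
  B (\sum_(i <- r | P i) F i) h = \sum_(i <- r | P i) B (F i) h by [].
apply: (big_ind2 (fun f b => D f /\ B f h = b)).
- by split; [exact: si0|exact: si0l].
- by move=> f b g c [Df <-] [Dg <-]; split; [exact: siD|exact: siDl].
- by move=> i Pi; split => //; exact: DF.
Qed.

Lemma snorm_ge0 f : 0 <= snorm f. Proof. exact: sqrtr_ge0. Qed.
Lemma snorm_sqr f : D f -> snorm f ^+ 2 = B f f.
Proof. by move=> Df; rewrite sqr_sqrtr// si_ge0. Qed.

Lemma si_CS f g : D f -> D g -> `|B f g| <= snorm f * snorm g.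
Proof.
move=> Df Dg.
have q t : 0 <= B f f + t * B f g *+ 2 + t ^+ 2 * B g g.
  have := si_ge0 (siP t Dg Df).
  have Dh := siP t Dg Df.
  rewrite siDZl// siDr//; [|exact: siZ]; rewrite siZr// siDr// ?siZr//; last exact: siZ.
  by rewrite (siC Dg Df) => h; apply: le_trans h _; rewrite le_eqVlt; apply/orP; left; apply/eqP; ring.
rewrite -[leRHS]ger0_norm ?mulr_ge0 ?snorm_ge0//.
rewrite -ler_sqr ?nnegrE// !real_normK ?num_real// exprMn !snorm_sqr//.
have f0 := si_ge0 Df; have g0 := si_ge0 Dg.
(* A null vector [g] need not be [0]; for it the nonnegative expression in [q] is affine in [t],
   which forces [B f g = 0]. *)
have [g00|gn0] := eqVneq (B g g) 0.
  rewrite g00 mulr0.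
  have [->|b0] := eqVneq (B f g) 0; first by rewrite expr0n.
  have := q (- (B f f + 1) / (B f g *+ 2)).
  rewrite g00 mulr0 addr0.
  have -> : - (B f f + 1) / (B f g *+ 2) * B f g *+ 2 = - (B f f + 1) by field.
  by move=> h; exfalso; lra.
have gp : 0 < B g g by rewrite lt_def gn0.
have := q (- B f g / B g g).
have -> : B f f + - B f g / B g g * B f g *+ 2 + (- B f g / B g g) ^+ 2 * B g g
  = B f f - (B f g ^+ 2) / B g g by field.
by rewrite subr_ge0 ler_pdivrMr.
Qed.

Lemma snormD f g : D f -> D g -> snorm (f + g) <= snorm f + snorm g.
Proof.
move=> Df Dg; rewrite -ler_sqr ?nnegrE ?addr_ge0 ?snorm_ge0//.
have Dfg := siD Df Dg.
rewrite snorm_sqr// siDl// !siDr// (siC Dg Df) sqrrD !snorm_sqr//.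
have := le_trans (ler_norm _) (si_CS Df Dg) => h.
by rewrite mulr2n; lra.
Qed.

Lemma snormZ a f : D f -> snorm (a *: f) = `|a| * snorm f.
Proof.
move=> Df; rewrite /snorm siZl ?siZr//; last exact: siZ.
by rewrite mulrA -expr2 sqrtrM ?sqr_ge0// sqrtr_sqr.
Qed.

Lemma snormN f : D f -> snorm (- f) = snorm f.
Proof. by move=> Df; rewrite -scaleN1r snormZ// normrN1 mul1r. Qed.

Lemma snormB f g : D f -> D g -> snorm (f - g) <= snorm f + snorm g.
Proof. by move=> Df Dg; rewrite -(snormN Dg) snormD//; exact: siN. Qed.

Lemma snorm_distC f g : D f -> D g -> snorm (f - g) = snorm (g - f).
Proof. by move=> Df Dg; rewrite -snormN ?opprB//; exact: siB. Qed.

Lemma snorm0 : snorm 0 = 0.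
Proof. by rewrite /snorm si0l ?sqrtr0//; exact: si0. Qed.

Lemma snorm_triangle f g h : D f -> D g -> D h ->
  snorm (f - h) <= snorm (f - g) + snorm (g - h).
Proof.
move=> Df Dg Dh; have := snormD (siB Df Dg) (siB Dg Dh).
by rewrite addrA subrK.
Qed.

Lemma ler_snorm_dist f g : D f -> D g -> `|snorm f - snorm g| <= snorm (f - g).
Proof.
move=> Df Dg; have h1 : snorm f <= snorm (f - g) + snorm g.
  by have := snormD (siB Df Dg) Dg; rewrite subrK.
have h2 : snorm g <= snorm (f - g) + snorm f.
  by have := snormD (siB Dg Df) Df; rewrite subrK (snorm_distC Dg Df).
by rewrite ler_norml; apply/andP; split; lra.
Qed.

Lemma si_parallelogram f g : D f -> D g ->
  snorm (f + g) ^+ 2 + snorm (f - g) ^+ 2 = 2 * snorm f ^+ 2 + 2 * snorm g ^+ 2.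
Proof.
move=> Df Dg; have Da := siD Df Dg; have Db := siB Df Dg.
rewrite !snorm_sqr// (siDl Df Dg Da) (siBl Df Dg Db) !(siDr Df Dg)// !(siBr Df Dg)//; ring.
Qed.

Lemma cvg_si (T : Type) (F : set_system T) {FF : Filter F} (f g : T -> V) (a b : V) :
  (forall t, D (f t)) -> (forall t, D (g t)) -> D a -> D b ->
  snorm (f t - a) @[t --> F] --> 0 -> snorm (g t - b) @[t --> F] --> 0 ->
  B (f t) (g t) @[t --> F] --> B a b.
Proof.
move=> Df Dg Da Db fa gb.
have key t : `|B (f t) (g t) - B a b| <=
    snorm (f t - a) * snorm (g t - b) + snorm (f t - a) * snorm b + snorm a * snorm (g t - b).
  have Dfa := siB (Df t) Da; have Dgb := siB (Dg t) Db.
  have -> : B (f t) (g t) - B a b = B (f t - a) (g t - b) + B (f t - a) b + B a (g t - b).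
    by rewrite !siBl// !siBr//; ring.
  apply: (le_trans (ler_normD _ _)); apply: lerD; last exact: si_CS.
  by apply: (le_trans (ler_normD _ _)); apply: lerD; exact: si_CS.
have lim0 : (snorm (f t - a) * snorm (g t - b) + snorm (f t - a) * snorm b + snorm a * snorm (g t - b)) @[t --> F] --> (0:R).
  rewrite -[X in _ --> X]addr0 -[X in _ --> X + _]addr0.
  rewrite -[in X in _ --> X + _ + _](mulr0 (0:R)) -[in X in _ --> _ + X + _](mul0r (snorm b)) -[in X in _ --> _ + X](mulr0 (snorm a)).
  apply: cvgD; first apply: cvgD; [exact: cvgM| |]; apply: cvgM => //; exact: cvg_cst.
apply/cvgrPdist_le => e e0; move/cvgrPdist_le : lim0 => /(_ e e0); apply: filterS => t /=.
rewrite sub0r normrN distrC => h; apply: (le_trans (key t)); exact: le_trans (ler_norm _) h.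
Qed.

Lemma cvg_snorm (T : Type) (F : set_system T) {FF : Filter F} (f : T -> V) (a : V) :
  (forall t, D (f t)) -> D a ->
  snorm (f t - a) @[t --> F] --> 0 -> snorm (f t) @[t --> F] --> snorm a.
Proof.
move=> Df Da /cvgrPdist_le h; apply/cvgrPdist_le => e e0; move: (h e e0); apply: filterS => t /=.
rewrite sub0r normrN ger0_norm ?snorm_ge0// distrC => h1.
exact: le_trans (ler_snorm_dist (Df t) Da) h1.
Qed.

End semi_inner.

(** * The space L^2 *)

HB.lock Definition ip {R : realType} {d : nat} (f g : 'rV[R]_d -> R) : R :=
  \int[@lebesgue_rV R d]_x (f x * g x).

Section L2_space.
Context {R : realType} {d : nat}.
Local Notation E := 'rV[R]_d.
Local Notation leb := (@lebesgue_rV R d).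
Implicit Types f g h : E -> R.

Definition integr f := leb.-integrable setT (EFin \o f).
Lemma ipE f g : ip f g = \int[leb]_x (f x * g x).
Proof. by rewrite ip.unlock. Qed.

Lemma integrD f g : integr f -> integr g -> integr (f + g).
Proof. by move=> hf hg; exact: (integrableD measurableT hf hg). Qed.

Lemma integrZ a f : integr f -> integr (a *: f).
Proof. by move=> hf; exact: (integrableZl measurableT a hf). Qed.

Lemma integr_meas f : integr f -> measurable_fun setT f.
Proof. by move=> /integrableP[/measurable_EFinP]. Qed.

Lemma integr_le f g : measurable_fun setT f -> integr g ->
  (forall x, `|f x| <= g x) -> integr f.
Proof.
move=> mf ig h; apply: (le_integrable measurableT _ _ ig).
  exact/measurable_EFinP.
by move=> x _ /=; rewrite lee_fin; apply: le_trans (h x) (ler_norm _).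
Qed.

Lemma integrN f : integr f -> integr (- f).
Proof. by move=> hf; rewrite -scaleN1r; exact: integrZ. Qed.

Lemma integrB f g : integr f -> integr g -> integr (f - g).
Proof. by move=> hf hg; apply: integrD => //; exact: integrN. Qed.

Lemma integr_norm f : integr f -> integr (fun x => `|f x|).
Proof. by move=> hf; exact: integrable_norm. Qed.

Lemma L2_meas f : L2 f -> measurable_fun setT f.
Proof. by rewrite /L2 /= inE => /andP[]; rewrite inE. Qed.

Lemma L2_sqr f : L2 f -> integr (fun x => f x ^+ 2).
Proof. exact: Lfun2_integrable_sqr. Qed.

Lemma L2norm_sqrE f : L2 f -> (((L2norm f) ^+ 2)%:E = \int[leb]_x (f x ^+ 2)%:E)%E.
Proof.
move=> L2f; have fin : ('N[leb]_(2%:E) [EFin \o f] < +oo)%E.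
  by move: L2f; rewrite /L2 /= inE => /andP[_]; rewrite inE.
have := poweR_Lnorm leb (EFin \o f) (r := 2) (ltac:(by [])).
rewrite /L2norm.
have -> : ('N[leb]_(2%:E) [EFin \o f] = (L2norm f)%:E)%E.
  by rewrite /L2norm fineK// ge0_fin_numE// Lnorm_ge0.
rewrite poweR_EFin powR_mulrn; last by rewrite fine_ge0// Lnorm_ge0.
move=> ->; apply: eq_integral => x _.
by rewrite /= powR_mulrn// real_normK// num_real.
Qed.

Lemma L2I f : measurable_fun setT f -> integr (fun x => f x ^+ 2) -> L2 f.
Proof.
move=> mf /integrableP[_ hf]; rewrite /L2 /= inE; apply/andP; split; rewrite inE //=.
rewrite /finite_norm unlock /= ; apply: poweR_lty; apply: le_lt_trans hf.
rewrite le_eqVlt; apply/orP; left; apply/eqP; apply: eq_integral => x _ /=.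
by rewrite powR_mulrn// real_normK ?num_real// ger0_norm ?sqr_ge0.
Qed.

Lemma ip_ff f : L2 f -> ip f f = L2norm f ^+ 2.
Proof.
move=> L2f; rewrite ipE /Rintegral.
under eq_integral do rewrite -expr2.
by rewrite -L2norm_sqrE.
Qed.

Lemma L2M f g : L2 f -> L2 g -> integr (fun x => f x * g x).
Proof. by move=> hf hg; apply/Lfun1_integrable; exact: (Lfun2_mul_Lfun1 hf hg). Qed.

Lemma L2_lin a f g : L2 f -> L2 g -> L2 (a *: f + g).
Proof.
rewrite /L2 /= => hf hg.
have h2 : (1 <= 2%:E :> \bar R)%E by rewrite lee_fin ler1n.
by have [_] := Lfun_submod_closed leb h2; apply.
Qed.

Lemma L2_semi : semi_inner (@L2 R d) ip.
Proof.
split.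
- apply: L2I; first exact: measurable_cst.
  rewrite (_ : (fun x => _) = 0) ?/integr; first exact: integrable0.
  by apply/funext => x /=; rewrite expr0n.
- by move=> a f g; exact: L2_lin.
- by move=> f g _ _; rewrite !ipE; apply: eq_Rintegral => x _; rewrite mulrC.
- move=> a f g h hf hg hh; rewrite !ipE -RintegralZl//; last exact: L2M.
  rewrite -RintegralD//; [| |exact: L2M].
    by apply: eq_Rintegral => x _; rewrite /= mulrDl mulrA.
  exact: (integrZ a (L2M hf hh)).
- by move=> f hf; rewrite ip_ff// sqr_ge0.
Qed.

Lemma L2norm_ge0 f : 0 <= L2norm f.
Proof. by rewrite fine_ge0// Lnorm_ge0. Qed.

Lemma L2normE f : L2 f -> L2norm f = snorm ip f.
Proof. by move=> hf; rewrite /snorm ip_ff// sqrtr_sqr ger0_norm// L2norm_ge0. Qed.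

Lemma L2_le f g : measurable_fun setT f -> L2 g -> (forall x, `|f x| <= `|g x|) -> L2 f.
Proof.
move=> mf hg h; apply: L2I => //; apply: integr_le (L2_sqr hg) _.
  exact: measurable_funX.
by move=> x; rewrite normrX -[leRHS]real_normK ?num_real// lerXn2r ?nnegrE.
Qed.

Lemma ip_le f g f' g' : integr (fun x => f x * g x) -> integr (fun x => f' x * g' x) ->
  (forall x, f x * g x <= f' x * g' x) -> ip f g <= ip f' g'.
Proof. by move=> h1 h2 h; rewrite !ipE; apply: le_Rintegral. Qed.

Lemma snorm_ip_le f g : measurable_fun setT f -> L2 g ->
  (forall x, `|f x| <= `|g x|) -> snorm ip f <= snorm ip g.
Proof.
move=> mf hg h; have hf := L2_le mf hg h.
rewrite ler_sqrt ?(si_ge0 L2_semi)//; apply: ip_le; try exact: L2M.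
by move=> x; rewrite -!expr2 -[leLHS]real_normK ?num_real// -[leRHS]real_normK ?num_real// lerXn2r ?nnegrE.
Qed.

Lemma snorm_ip0_ae f : L2 f -> snorm ip f = 0 -> f = 0 %[ae leb].
Proof.
move=> hf h0.
have : (\int[leb]_x (f x ^+ 2)%:E = 0)%E.
  by rewrite -L2norm_sqrE// L2normE// h0 expr0n.
have mf2 : measurable_fun setT (fun x => (f x ^+ 2)%:E).
  by apply/measurable_EFinP; apply: measurable_funX; exact: L2_meas.
move=> h; have := (ae_eq_integral_abs leb measurableT mf2).1.
under eq_integral do rewrite gee0_abs ?lee_fin ?sqr_ge0//.
move=> /(_ h); apply: filterS => x /= hx _.
by have := hx Logic.I => -[] /eqP; rewrite sqrf_eq0 => /eqP.
Qed.

Lemma ip_ae f g f' g' : L2 f -> L2 g -> L2 f' -> L2 g' -> f = f' %[ae leb] -> g = g' %[ae leb] ->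
  ip f g = ip f' g'.
Proof.
move=> hf hg hf' hg' h1 h2; rewrite !ipE /Rintegral; congr fine.
apply: ae_eq_integral => //.
- by apply/measurable_EFinP; exact: integr_meas (L2M hf hg).
- by apply/measurable_EFinP; exact: integr_meas (L2M hf' hg').
- by apply: filterS2 h1 h2 => x e1 e2 _ /=; rewrite e1// e2.
Qed.

Lemma L2_aff s (a : E) f : s = 1 \/ s = -1 -> L2 f -> L2 (f \o affine s a).
Proof.
move=> hs hf; apply: L2I.
  by apply: measurableT_comp; [exact: L2_meas|exact: measurable_affine].
exact: (integrable_affine a hs (L2_sqr hf)).
Qed.

Lemma Rintegral_aff s (a : E) f : s = 1 \/ s = -1 -> measurable_fun setT f ->
  \int[leb]_x f (affine s a x) = \int[leb]_x f x.
Proof.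
move=> hs mf; rewrite /Rintegral; congr fine.
by apply: (integral_affine a hs (f := EFin \o f)); exact/measurable_EFinP.
Qed.

Lemma ip_aff s (a : E) f g : s = 1 \/ s = -1 -> L2 f -> L2 g ->
  ip (f \o affine s a) (g \o affine s a) = ip f g.
Proof.
move=> hs hf hg; rewrite !ipE; apply: (@Rintegral_aff s a (fun x => f x * g x)) => //.
by apply: measurable_funM; exact: L2_meas.
Qed.

End L2_space.

(** * Limits along ultrafilters, Riesz representation and weak compactness *)

Section ultra.
Context {R : realType}.

Lemma fmap_ultra (T S : Type) (U : set_system T) (f : T -> S) :
  UltraFilter U -> UltraFilter (f @ U).
Proof.
move=> UU; have FU : ProperFilter U by exact: ultra_proper.
split; first exact: fmap_proper_filter.
move=> G PG sG; rewrite predeqE => A; split; last exact: sG.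
move=> GA; have [//|h] := in_ultra_setVsetC (f @^-1` A) UU.
have : G (~` A) by exact: sG.
by move=> GnA; have /filter_ex[x []] : G (A `&` ~` A) by exact: filterI.
Qed.

Lemma ultra_bounded_cvg (T : Type) (U : set_system T) {UU : UltraFilter U} (f : T -> R) (C : R) :
  (forall t, `|f t| <= C) -> exists l : R, f t @[t --> U] --> l.
Proof.
move=> hf; have := @segment_compact R (- C) C; rewrite compact_ultra => /(_ (f @ U)).
have hU : UltraFilter (f @ U) by exact: fmap_ultra.
move=> /(_ hU)[].
  by apply: (@filterE _ U) => t; rewrite /= in_itv /= -ler_norml.
by move=> l [_ hl]; exists l.
Qed.

Context {V : lmodType R}.
Variables (D : set V) (B : V -> V -> R).
Hypothesis hB : semi_inner D B.
Local Notation nm := (snorm B).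
Hypothesis complete : forall u : nat -> V, (forall n, D (u n)) ->
  (forall e, 0 < e -> exists N, forall m n, (N <= m)%N -> (N <= n)%N -> nm (u m - u n) <= e) ->
  exists f, D f /\ nm (u n - f) @[n --> \oo] --> 0.

(** Minimise [J]: the parallelogram identity makes a minimising sequence Cauchy, and the first
    variation at the minimiser is the representation formula. Null vectors are allowed, so [g] is
    unique only modulo them. *)
Lemma riesz (l : V -> R) (C : R) :
  (forall a f g, D f -> D g -> l (a *: f + g) = a * l f + l g) ->
  (forall f, D f -> `|l f| <= C * nm f) ->
  exists g, D g /\ forall f, D f -> l f = B g f.
Proof.
move=> ll lb.
have l0 : l 0 = 0.
  by have := ll 1 _ _ (si0 hB) (si0 hB); rewrite scaler0 addr0 mul1r => h; lra.
have lZ a f : D f -> l (a *: f) = a * l f.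
  by move=> Df; rewrite -[a *: f]addr0 ll// ?l0 ?addr0 //; exact: (si0 hB).
pose J f := nm f ^+ 2 - 2 * l f.
have Jlb f : D f -> - C ^+ 2 <= J f.
  move=> Df; have := lb f Df; rewrite ler_norml => /andP[_ h].
  rewrite /J; have := sqr_ge0 (nm f - C); rewrite sqrrB => h2.
  by rewrite -mulr_natr in h2; nra.
pose S := [set J f | f in D].
have hS : has_inf S.
  split; first by exists (J 0); exists 0 => //; exact: (si0 hB).
  by exists (- C ^+ 2) => _ [f Df <-]; exact: Jlb.
have mJ f : D f -> inf S <= J f.
  by move=> Df; apply: ge_inf; [exact: hS.2|exists f].
have ex n : exists f, D f /\ J f <= inf S + n.+1%:R^-1.
  have [_ [f Df <-] hf] := inf_adherent (ltac:(by rewrite invr_gt0) : 0 < n.+1%:R^-1 :> R) hS.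
  by exists f; split => //; exact: ltW.
have [u hu] := choice ex.
have Du n : D (u n) by have [] := hu n.
have Ju n : J (u n) <= inf S + n.+1%:R^-1 by have [] := hu n.
have key m n : nm (u m - u n) ^+ 2 <= 2 * (m.+1%:R^-1 + n.+1%:R^-1).
  have Ds := siD hB (Du m) (Du n).
  have := si_parallelogram hB (Du m) (Du n).
  have Dh := siZ hB 2^-1 Ds.
  have := mJ _ Dh; rewrite /J lZ// (snormZ hB _ Ds) exprMn -[l (_ + _)]/(l (u m + u n)).
  have -> : l (u m + u n) = l (u m) + l (u n) by rewrite -[u m]scale1r ll// mul1r scale1r.
  rewrite ger0_norm ?invr_ge0// => h1 h2.
  have := Ju n; have := Ju m; rewrite /J.
  rewrite (_ : 2^-1 ^+ 2 = 4^-1 :> R) in h1; last by field.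
  by move: (n.+1%:R^-1) (m.+1%:R^-1) => a b h3 h4; lra.
have [||g [Dg ug]] := complete (u := u) => //.
  move=> e e0.
  have e2 : 0 < e ^+ 2 / 4 by rewrite divr_gt0 ?exprn_gt0.
  have [N _ hN] := near_infty_natSinv_lt (PosNum e2).
  exists N => m n Nm Nn; rewrite -ler_sqr ?nnegrE ?snorm_ge0 ?(ltW e0)//.
  apply: (le_trans (key m n)).
  have := hN m Nm; have := hN n Nn => /= h1 h2.
  by move: (m.+1%:R^-1) (n.+1%:R^-1) h1 h2 => a b h1 h2; lra.
have Jg : J g <= inf S.
  have c1 : nm (u n) @[n --> \oo] --> nm g by exact: (cvg_snorm hB Du Dg ug).
  have c2 : l (u n) @[n --> \oo] --> l g.
    have lB n : l (u n) - l g = l (u n - g).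
      have -> : u n - g = (-1) *: g + u n by rewrite scaleN1r addrC.
      by rewrite ll//; ring.
    apply/cvgrPdist_le => e e0.
    have C1 : 0 < `|C| + 1 by rewrite ltr_wpDl.
    have := ug; move/cvgrPdist_le => /(_ (e / (`|C| + 1)) (divr_gt0 e0 C1)).
    apply: filterS => n; rewrite sub0r normrN ger0_norm ?snorm_ge0// => h.
    rewrite distrC lB; apply: (le_trans (lb _ (siB hB (Du n) Dg))).
    rewrite ler_pdivlMr// mulrC in h; apply: le_trans h.
    apply: ler_wpM2r; first exact: snorm_ge0.
    by apply: le_trans (ler_norm C) _; rewrite lerDl.
  have cJ : J (u n) @[n --> \oo] --> J g.
    apply: cvgB; first by rewrite expr2; under eq_fun do rewrite expr2; exact: cvgM.
    by apply: cvgM => //; exact: cvg_cst.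
  have c3 : (inf S + n.+1%:R^-1) @[n --> \oo] --> inf S + 0.
    by apply: cvgD; [exact: cvg_cst|exact: cvge_harmonic || exact: cvg_harmonic].
  rewrite addr0 in c3.
  exact: (ler_cvg_to cJ c3 (nearW _ Ju)).
exists g; split => // f Df.
apply/eqP; rewrite -subr_eq0; apply/eqP.
set c := l f - B g f.
(* First variation of [J] at the minimiser in the direction [f]. It is used at
   [t = c / (B f f + 1)], where the [+ 1] covers a null [f], and gives [c ^+ 2 <= 0]. *)
have q t : 2 * t * c <= t ^+ 2 * B f f.
  have Dt := siP hB t Df Dg.
  have := le_trans Jg (mJ _ Dt); rewrite /J ll// (snorm_sqr hB Dt) (snorm_sqr hB Dg).
  have Dtf := siZ hB t Df.
  rewrite (siDl hB Dtf Dg Dt) !(siDr hB Dtf Dg)// (siZl hB) // (siZl hB) // !(siZr hB)// (siC hB Df Dg) /c.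
  by move=> h; lra.
have f0 := si_ge0 hB Df.
have := q (c / (B f f + 1)).
have p1 : 0 < B f f + 1 by lra.
have -> : 2 * (c / (B f f + 1)) * c = 2 * (c ^+ 2 / (B f f + 1)) by field; lra.
have -> : (c / (B f f + 1)) ^+ 2 * B f f = (c ^+ 2 / (B f f + 1)) * (B f f / (B f f + 1)) by field; lra.
have h1 : B f f / (B f f + 1) <= 1 by rewrite ler_pdivrMr// mul1r; lra.
have h0 : 0 <= c ^+ 2 / (B f f + 1) by rewrite divr_ge0 ?sqr_ge0// ltW.
move=> h; have : c ^+ 2 / (B f f + 1) <= 0 by nra.
rewrite pmulr_lle0 ?invr_gt0// => h2.
by apply/eqP; rewrite -sqrf_eq0 eq_le h2 sqr_ge0.
Qed.

(** Weak compactness without separability: each pairing is bounded, hence converges along the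
    ultrafilter, and the limits form a bounded linear functional to which [riesz] applies. *)
Lemma weak_ultra_limit (T : Type) (U : set_system T) {UU : UltraFilter U} (u : T -> V) (C : R) :
  (forall t, D (u t)) -> (forall t, nm (u t) <= C) ->
  exists g, D g /\ forall f, D f -> B (u t) f @[t --> U] --> B g f.
Proof.
move=> Du uC.
have FU : ProperFilter U by exact: ultra_proper.
have bd f : D f -> forall t, `|B (u t) f| <= C * nm f.
  move=> Df t; apply: (le_trans (si_CS hB (Du t) Df)).
  by apply: ler_wpM2r; [exact: snorm_ge0|exact: uC].
have cv f : D f -> B (u t) f @[t --> U] --> lim (B (u t) f @[t --> U]).
  move=> Df; have [l hl] := ultra_bounded_cvg (bd f Df).
  by apply/cvg_ex; exists l.
have [||g [Dg hg]] := @riesz (fun f => lim (B (u t) f @[t --> U])) C.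
- move=> a f g Df Dg; apply: cvg_lim => //.
  under eq_fun => t do rewrite (siC hB (Du t) (siP hB a Df Dg)) (siDZl hB)// (siC hB Df (Du t)) (siC hB Dg (Du t)).
  by apply: cvgD; [apply: cvgM; [exact: cvg_cst|exact: cv]|exact: cv].
- move=> f Df; rewrite ler_norml; apply/andP; split.
    by apply: (limr_ge (cv f Df)); apply: nearW => t; have := bd f Df t; rewrite ler_norml => /andP[].
  by apply: (limr_le (cv f Df)); apply: nearW => t; have := bd f Df t; rewrite ler_norml => /andP[].
by exists g; split => // f Df; rewrite -hg//; exact: cv.
Qed.

End ultra.

(** * Completeness of L^2 *)

Section L2_complete.
Context {R : realType} {d : nat}.
Local Notation E := 'rV[R]_d.
Local Notation leb := (@lebesgue_rV R d).

Lemma fatou_ae (g : nat -> E -> R) (h : E -> R) (C : R) :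
  (forall k, measurable_fun setT (g k)) -> (forall k x, 0 <= g k x) ->
  measurable_fun setT h ->
  {ae leb, forall x, g k x @[k --> \oo] --> h x} ->
  (forall k, \int[leb]_x (g k x)%:E <= C%:E)%E ->
  (\int[leb]_x (`|h x|)%:E <= C%:E)%E.
Proof.
move=> mg g0 mh cv hC.
have mg' k : measurable_fun setT (fun x => (g k x)%:E) by exact/measurable_EFinP.
have := fatou leb measurableT mg' (fun k x _ => ltac:(by rewrite lee_fin)).
have -> : (\int[leb]_x limn_einf (fun k => (g k x)%:E) = \int[leb]_x (`|h x|)%:E)%E.
  apply: ae_eq_integral => //.
  - apply: (measurableT_comp (f := -%E)) => //.
    apply: measurable_fun_limn_esup => k; exact: measurableT_comp.
  - by apply/measurable_EFinP; exact: measurableT_comp.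
  - apply: filterS cv => x cx _.
    have hx : 0 <= h x by apply: (ler_cvg_to (cvg_cst 0) cx); exact: nearW.
    rewrite ger0_norm//.
    have cE : (g k x)%:E @[k --> \oo] --> (h x)%:E by apply: cvg_EFin => //; exact: nearW.
    by have := is_cvg_limn_einfE (cvgP _ cE) => ->; apply: cvg_lim.
move=> h1; apply: (le_trans h1).
rewrite limn_einf_lim; apply: lime_le; first exact: is_cvg_einfs.
apply: nearW => n; apply: le_trans (hC n).
by apply: ereal_inf_lbound; exists n => /=.
Qed.

Lemma L2_fatou (u : nat -> E -> R) (f : E -> R) (C : R) :
  (forall k, L2 (u k)) -> measurable_fun setT f ->
  {ae leb, forall x, u k x @[k --> \oo] --> f x} ->
  (forall k, snorm ip (u k) <= C) -> L2 f /\ snorm ip f <= C.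
Proof.
move=> Lu mf cv hC.
have C0 : 0 <= C by apply: le_trans (hC 0%N); exact: snorm_ge0.
have mu k := L2_meas (Lu k).
have h : (\int[leb]_x (`|f x ^+ 2|)%:E <= (C ^+ 2)%:E)%E.
  apply: (@fatou_ae (fun k x => u k x ^+ 2)) => //.
  - by move=> k; exact: measurable_funX.
  - by move=> k x; exact: sqr_ge0.
  - exact: measurable_funX.
  - apply: filterS cv => x cx; rewrite expr2; under eq_fun do rewrite expr2; exact: cvgM.
  - move=> k; rewrite -(L2norm_sqrE (Lu k)) lee_fin L2normE//.
    by rewrite lerXn2r ?nnegrE ?snorm_ge0.
have Lf : L2 f.
  apply: L2I => //; apply/integrableP; split.
    by apply/measurable_EFinP; exact: measurable_funX.
  by apply: le_lt_trans h _; exact: ltry.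
split => //; rewrite -ler_sqr ?nnegrE ?snorm_ge0// -(L2normE Lf) -lee_fin L2norm_sqrE//.
by under eq_integral do rewrite -[X in X%:E]ger0_norm ?sqr_ge0//.
Qed.

(** Riesz-Fischer: along a subsequence with increments of norm at most [2^-k] the sum of the
    absolute increments has L^2 norm at most 2, so it is finite almost everywhere and the
    subsequence converges pointwise; Fatou's lemma then bounds the distance of the whole sequence to
    the limit. *)
Lemma L2_complete (u : nat -> E -> R) : (forall n, L2 (u n)) ->
  (forall e, 0 < e -> exists N, forall m n, (N <= m)%N -> (N <= n)%N -> snorm ip (u m - u n) <= e) ->
  exists f, L2 f /\ snorm ip (u n - f) @[n --> \oo] --> 0.
Proof.
move=> Lu cau.
have S2 := @L2_semi R d.
have hN k : exists N, forall m n, (N <= m)%N -> (N <= n)%N -> snorm ip (u m - u n) <= 2^-1 ^+ k.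
  by apply: cau; rewrite exprn_gt0.
have [N0 hN0] := choice hN.
(* The partial sums give indices that are strictly increasing and still dominate [N0]. *)
pose N k := (\sum_(i < k.+1) (N0 i).+1)%N.
have NN k : (N0 k <= N k)%N.
  by rewrite /N big_ord_recr /=; apply: leq_trans (leqnSn _) (leq_addl _ _).
have Nlt k : (N k < N k.+1)%N by rewrite /N [in X in (_ < X)%N]big_ord_recr /= -[X in (X < _)%N]addn0 ltn_add2l.
have Nmono j k : (j <= k)%N -> (N j <= N k)%N.
  move=> jk; rewrite -(subnKC jk); elim: (k - j)%N => [|i ih]; rewrite ?addn0 ?addnS//.
  exact: leq_trans ih (ltnW (Nlt _)).
have Nid k : (k <= N k)%N by elim: k => // k ih; exact: leq_ltn_trans ih (Nlt k).
pose w k := u (N k).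
have Lw k : L2 (w k) by exact: Lu.
pose D k := fun x => `|w k.+1 x - w k x|.
have LD k : L2 (D k).
  apply: (@L2_le _ _ _ (w k.+1 - w k)); last by move=> x; rewrite normr_id.
    by apply: measurableT_comp => //; apply: measurable_funB; exact: L2_meas.
  by apply: (siB S2).
have nD k : snorm ip (D k) <= 2^-1 ^+ k.
  apply: (@le_trans _ _ (snorm ip (w k.+1 - w k))).
    apply: snorm_ip_le; [exact: L2_meas|exact: (siB S2)|by move=> x; rewrite normr_id].
  by apply: hN0; [apply: leq_trans (NN k) _; exact: Nmono|exact: NN].
pose G n := \sum_(k < n) D k.
have LG n : L2 (G n) by apply: (si_sum S2).
have nG n : snorm ip (G n) <= 2.
  apply: (@le_trans _ _ (2 - 2 * 2^-1 ^+ n)); last by rewrite gerBl mulr_ge0// exprn_ge0.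
  elim: n => [|n ih]; first by rewrite /G big_ord0 (snorm0 S2) expr0 mulr1 subrr.
  rewrite /G big_ord_recr /= (le_trans (snormD S2 (LG n) (LD n)))//.
  by have := nD n; rewrite exprS => h; move: (2^-1 ^+ n) ih h => q; rewrite -/(G n) => *; lra.
have GE n x : G n x = \sum_(k < n) D k x by rewrite /G fct_sumE.
have G0 n x : 0 <= G n x by rewrite GE; apply: sumr_ge0 => k _; exact: normr_ge0.
have Gnd x : nondecreasing_seq (fun n => G n x).
  by apply/nondecreasing_seqP => n; rewrite !GE big_ord_recr /= lerDl /D normr_ge0.
have aeb : {ae leb, forall x, exists M, forall n, G n x <= M}.
  pose H x := limn (fun n => (G n x ^+ 2)%:E).
  have mG n : measurable_fun setT (fun x => (G n x ^+ 2)%:E).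
    by apply/measurable_EFinP; apply: measurable_funX; exact: L2_meas.
  have ndG x : nondecreasing_seq (fun n => (G n x ^+ 2)%:E).
    by move=> m n mn; rewrite lee_fin lerXn2r ?nnegrE// Gnd.
  have cH x : (G n x ^+ 2)%:E @[n --> \oo] --> H x.
    exact: (ereal_nondecreasing_is_cvgn (ndG x)).
  have mH : measurable_fun setT H.
    by apply: (emeasurable_fun_cvg (fun n x => (G n x ^+ 2)%:E)) => // x _; exact: cH.
  have iH : leb.-integrable setT H.
    apply/integrableP; split => //.
    have H0 x : (0 <= H x)%E.
      by apply: lime_ge; [exact: cvgP (cH x)|apply: nearW => n; rewrite lee_fin sqr_ge0].
    under eq_integral do rewrite gee0_abs//.
    apply: (@le_lt_trans _ _ 4%:E); last exact: ltry.
    rewrite (monotone_convergence leb measurableT mG) //; last first.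
      by move=> n x _; rewrite lee_fin sqr_ge0.
    apply: lime_le.
      apply: ereal_nondecreasing_is_cvgn => m n mn.
      apply: ge0_le_integral => //; try by move=> x _; rewrite lee_fin sqr_ge0.
      by move=> x _; exact: ndG.
    apply: nearW => n; rewrite -(L2norm_sqrE (LG n)) lee_fin (L2normE (LG n)).
    have -> : 4 = 2 ^+ 2 :> R by ring.
    by rewrite lerXn2r ?nnegrE ?snorm_ge0.
  have := integrable_ae measurableT iH; apply: filterS => x /(_ Logic.I) fH.
  exists (fine (H x) + 1) => n.
  have : ((G n x ^+ 2)%:E <= H x)%E.
    by apply: lime_ge; [exact: cvgP (cH x)|exists n => // m /= nm; exact: ndG].
  rewrite -(fineK fH) lee_fin => h.
  have := sqr_ge0 (G n x - 1); rewrite sqrrB => h2; nra.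
(* The upper limit is measurable and defined everywhere; where the subsequence converges it is the
   limit, elsewhere the value of [fine] is irrelevant. *)
pose F x := limn_esup (fun k => (w k x)%:E).
pose f x := fine (F x).
have mf : measurable_fun setT f.
  apply: (measurableT_comp (f := fine)) => //.
  by apply: measurable_fun_limn_esup => k; apply/measurable_EFinP; exact: L2_meas.
have cw : {ae leb, forall x, w k x @[k --> \oo] --> f x}.
  apply: filterS aeb => x [M hM].
  have c : cvgn (fun k => w k x).
    have c0 : cvgn [normed series (fun k => w k.+1 x - w k x)].
      apply: nondecreasing_is_cvgn.
        apply/nondecreasing_seqP => n; rewrite /normed_series_of !seriesEord /= big_ord_recr /= lerDl.
        exact: normr_ge0.
      exists M => _ [n _ <-]; rewrite /normed_series_of seriesEord /=; have := hM n; rewrite GE; exact.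
    have /cvg_ex[l hl] := normed_cvg c0.
    apply/cvg_ex; exists (l + w 0%N x).
    apply: cvg_trans (cvgD hl (cvg_cst (w 0%N x))).
    apply: near_eq_cvg; apply: nearW => n /=.
    by rewrite fctE seriesEnat /= telescope_sumr// subrK.
  have [l hl] : exists l : R, w k x @[k --> \oo] --> l by move/cvg_ex: c.
  have hE : (w k x)%:E @[k --> \oo] --> l%:E by apply: cvg_EFin => //; exact: nearW.
  rewrite /f /F; have [_ ->] := cvg_limn_einf_sup hE.
  exact: hl.
have bound n e : 0 < e -> (forall m k, (n <= m)%N -> (n <= k)%N -> snorm ip (u m - u k) <= e) ->
    forall m, (n <= m)%N -> L2 (u m - f) /\ snorm ip (u m - f) <= e.
  move=> e0 he m nm.
  apply: (@L2_fatou (fun k => u m - w (k + n)%N)).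
  - by move=> k; apply: (siB S2).
  - by apply: measurable_funB => //; exact: L2_meas.
  - apply: filterS cw => x cx; apply: cvgB; first exact: cvg_cst.
    by have := cvg_comp _ _ (cvg_addnr n) cx; apply.
  - by move=> k; apply: he => //; apply: leq_trans (Nid n) _; apply: Nmono; exact: leq_addl.
have Lf : L2 f.
  have [n hn] := cau 1 ltr01.
  have [h _] := bound n 1 ltr01 hn n (leqnn n).
  by have := siB S2 (Lu n) h; rewrite opprB addrC subrK.
exists f; split => //.
apply/cvgrPdist_le => e e0; have [n hn] := cau e e0.
exists n => // m /= nm; rewrite sub0r normrN ger0_norm ?snorm_ge0//.
by have [] := bound n e e0 hn m nm.
Qed.

Lemma L2_weak_ultra (T : Type) (U : set_system T) {UU : UltraFilter U} (u : T -> E -> R) (C : R) :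
  (forall t, L2 (u t)) -> (forall t, snorm ip (u t) <= C) ->
  exists g, L2 g /\ forall f, L2 f -> ip (u t) f @[t --> U] --> ip g f.
Proof. exact: (weak_ultra_limit (@L2_semi R d) L2_complete). Qed.

End L2_complete.

(** * Smooth functions *)

Section smooth_functions.
Context {R : realType}.

(** Smoothness quantifies over all finite sequences of directions. It is therefore proved by
    exhibiting a class of continuous derivable functions that is stable under derivation. *)
Lemma smooth_coind (V : normedModType R) (C : (V -> R) -> Prop) :
  (forall f, C f -> [/\ continuous f, forall x v, derivable f x v & forall v, C ('D_v f)]) ->
  forall f, C f -> smooth f.
Proof.
move=> hC f Cf s; have : C (foldr (fun v h => 'D_v h) f s).
  by elim: s => //= v s ih; have [_ _] := hC _ ih; apply.
by move=> /hC[].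
Qed.

Lemma smooth_cont (V : normedModType R) (f : V -> R) : smooth f -> continuous f.
Proof. by move=> /(_ [::])[]. Qed.

Lemma smooth_derivable (V : normedModType R) (f : V -> R) x v : smooth f -> derivable f x v.
Proof. by move=> /(_ [::])[]. Qed.

Lemma smooth_D (V : normedModType R) (f : V -> R) v : smooth f -> smooth ('D_v f).
Proof. by move=> sf s; have := sf (rcons s v); rewrite -cats1 foldr_cat. Qed.

(** The derivative of a product is a sum of products, so no class of single products is stable under
    derivation; the algebra generated by the smooth functions is. *)
Inductive alg (V : normedModType R) : (V -> R) -> Prop :=
| alg_smooth f of smooth f : alg f
| alg_cst (c : R) : alg (cst c)
| alg_add f g of alg f & alg g : alg (f + g)
| alg_mul f g of alg f & alg g : alg (f * g).

Lemma alg_smoothP (V : normedModType R) (f : V -> R) : alg f -> smooth f.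
Proof.
apply: (@smooth_coind _ (@alg V)) => {}f; elim => {f}.
- move=> f sf; split; [exact: smooth_cont|by move=> x v; exact: smooth_derivable|].
  by move=> v; apply: alg_smooth; exact: smooth_D.
- move=> c; split; [by move=> x; exact: cvg_cst|by move=> x v; exact: derivable_cst|].
  move=> v; rewrite (_ : 'D_v _ = cst 0); first exact: alg_cst.
  by apply/funext => x; exact: derive_cst.
- move=> f g _ [cf df Df] _ [cg dg Dg]; split.
  + by move=> x; apply: cvgD; [exact: cf|exact: cg].
  + by move=> x v; exact: derivableD.
  + move=> v; rewrite (_ : 'D_v _ = 'D_v f + 'D_v g); first exact: alg_add.
    by apply/funext => x; exact: deriveD.
- move=> f g af [cf df Df] ag [cg dg Dg]; split.
  + by move=> x; apply: cvgM; [exact: cf|exact: cg].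
  + by move=> x v; exact: derivableM.
  + move=> v; rewrite (_ : 'D_v _ = f * 'D_v g + g * 'D_v f).
      by apply: alg_add; exact: alg_mul.
    by apply/funext => x; exact: deriveM.
Qed.

Lemma smooth_cst (V : normedModType R) (c : R) : smooth (cst c : V -> R).
Proof. by apply: alg_smoothP; exact: alg_cst. Qed.

Lemma smooth_add (V : normedModType R) (f g : V -> R) : smooth f -> smooth g -> smooth (f + g).
Proof. by move=> sf sg; apply: alg_smoothP; apply: alg_add; exact: alg_smooth. Qed.

Lemma smooth_mul (V : normedModType R) (f g : V -> R) : smooth f -> smooth g -> smooth (f * g).
Proof. by move=> sf sg; apply: alg_smoothP; apply: alg_mul; exact: alg_smooth. Qed.

Lemma smooth_prod (V : normedModType R) (I : Type) (r : seq I) (F : I -> V -> R) :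
  (forall i, smooth (F i)) -> smooth (\prod_(i <- r) F i).
Proof.
by move=> h; apply: (big_ind (@smooth R V)); [exact: (smooth_cst 1)|exact: smooth_mul|by move=> i _; exact: h].
Qed.

Lemma derive_affine (V W : normedModType R) (L L' : W -> V) (f : V -> R) :
  (forall h v x, L (h *: v + x) = h *: L' v + L x) ->
  forall x v, 'D_v (f \o L) x = 'D_(L' v) f (L x).
Proof.
move=> hL x v; rewrite /derive.
rewrite (_ : (fun h : R => h^-1 *: ((f \o shift (L x)) (h *: L' v) - f (L x))) =
  (fun h : R => h^-1 *: (((f \o L) \o shift x) (h *: v) - (f \o L) x))) //.
by apply/funext => h /=; rewrite hL.
Qed.

Lemma derivable_affine (V W : normedModType R) (L L' : W -> V) (f : V -> R) :
  (forall h v x, L (h *: v + x) = h *: L' v + L x) ->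
  forall x v, derivable f (L x) (L' v) -> derivable (f \o L) x v.
Proof.
move=> hL x v; rewrite /derivable.
rewrite (_ : (fun h : R => h^-1 *: ((f \o shift (L x)) (h *: L' v) - f (L x))) =
  (fun h : R => h^-1 *: (((f \o L) \o shift x) (h *: v) - (f \o L) x))) //.
by apply/funext => h /=; rewrite hL.
Qed.

Lemma smooth_affine (V W : normedModType R) (L L' : W -> V) (f : V -> R) :
  (forall h v x, L (h *: v + x) = h *: L' v + L x) -> continuous L ->
  smooth f -> smooth (f \o L).
Proof.
move=> hL cL sf.
apply: (@smooth_coind _ (fun g => exists2 f, smooth f & g = f \o L)); last by exists f.
move=> _ [g sg ->]; split.
- by move=> x; apply: continuous_comp; [exact: cL|exact: smooth_cont].
- by move=> x v; apply: (derivable_affine hL); exact: smooth_derivable.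
- move=> v; exists ('D_(L' v) g); first exact: smooth_D.
  by apply/funext => x; exact: derive_affine.
Qed.

End smooth_functions.

(** * A smooth function that is flat at the origin *)

Section flat_function.
Context {R : realType}.

(** The polynomial factor makes the family stable under derivation: [p] is replaced by
    [X^2 (p - p')]. *)
Definition flat (p : {poly R}) (x : R) : R :=
  if 0 < x then p.[x^-1] * expR (- x^-1) else 0.

Lemma poly_exp_bounded (p : {poly R}) :
  exists C, 0 <= C /\ forall y, 0 <= y -> `|p.[y]| * expR (- y) <= C.
Proof.
exists (\sum_(i < size p) `|p`_i| * i`!%:R); split.
  by apply: sumr_ge0 => i _; rewrite mulr_ge0.
move=> y y0; rewrite horner_coef.
apply: (@le_trans _ _ ((\sum_(i < size p) `|p`_i| * y ^+ i) * expR (- y))).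
  rewrite ler_wpM2r ?expR_ge0//; apply: le_trans (ler_norm_sum _ _ _) _.
  by apply: ler_sum => i _; rewrite normrM (ger0_norm (exprn_ge0 _ y0)).
rewrite mulr_suml; apply: ler_sum => i _; rewrite -mulrA ler_wpM2l//.
rewrite expRN ler_pdivrMr ?expR_gt0//.
have f0 : 0 < i`!%:R :> R by rewrite ltr0n fact_gt0.
rewrite mulrC -ler_pdivrMr//.
case: (nat_of_ord i) => [|j]; first by rewrite expr0 fact0 divr1 -[leLHS]expR0 ler_expR.
by have := expR_ge1Dxn j y0; apply: le_trans; rewrite lerDr.
Qed.

Lemma is_derive_flat (p : {poly R}) (x : R) :
  is_derive x 1 (flat p) (flat ('X^2 * (p - p^`())) x).
Proof.
have [x0|x0|->] := ltgtP x 0.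
- have -> : flat ('X^2 * (p - p^`())) x = 0 by rewrite /flat ltNge (ltW x0).
  apply: (near_eq_is_derive _ (f := cst 0)) => //.
  near=> y; rewrite /flat /= ltNge (_ : y <= 0)//.
  by apply: ltW; near: y; exact: lt_nbhsl.
- have xn0 : x != 0 by rewrite gt_eqF.
  have -> : flat ('X^2 * (p - p^`())) x = p.[x^-1] * (expR (- x^-1) * (x ^- 2)) + (p^`().[x^-1] * (- x ^- 2)) * expR (- x^-1).
    by rewrite /flat x0 hornerM hornerXn hornerD hornerN -!exprVn; ring.
  have dV : is_derive x 1 (fun y : R => y^-1) (- x ^- 2).
    by have := is_deriveV (f := id) (x := x) (v := 1) xn0 => h; apply: is_derive_eq; rewrite /GRing.scale /= mulr1.
  have dP : is_derive x 1 (fun y => p.[y^-1]) (p^`().[x^-1] * (- x ^- 2)).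
    exact: (@is_derive1_comp _ (horner p) (fun y => y^-1)).
  have dE : is_derive x 1 (fun y => expR (- y^-1)) (expR (- x^-1) * (x ^- 2)).
    have -> : x ^- 2 = - - x ^- 2 by rewrite opprK.
    exact: (@is_derive1_comp _ expR (fun y => - y^-1)).
  have dM : is_derive x 1 (fun y : R => p.[y^-1] * expR (- y^-1)) (p.[x^-1] * (expR (- x^-1) * (x ^- 2)) + (p^`().[x^-1] * (- x ^- 2)) * expR (- x^-1)).
    by apply: (is_derive_eq (is_deriveM dP dE)); rewrite /GRing.scale /=; ring.
  apply: near_eq_is_derive dM; near=> y; rewrite /flat (_ : 0 < y)//.
  by near: y; exact: lt_nbhsr.
- have -> : flat ('X^2 * (p - p^`())) 0 = 0 by rewrite /flat ltxx.
  (* One factor [X] absorbs the division by [h] in the difference quotient, the other leaves a bound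
     [C |h|] that tends to 0. *)
  have [C [C0 hC]] := poly_exp_bounded ('X^2 * p).
  have key h : `|h^-1 * flat p h| <= C * `|h|.
    rewrite /flat; case: ifPn => [h0|_]; last by rewrite mulr0 normr0 mulr_ge0.
    have hV : 0 <= h^-1 by rewrite invr_ge0 ltW.
    have := hC _ hV; rewrite !hornerE => hh.
    rewrite (ger0_norm (ltW h0)) -ler_pdivrMr// !normrM (ger0_norm hV) (ger0_norm (expR_ge0 _)).
    by apply: le_trans hh; rewrite normrM normrX (ger0_norm hV); rewrite le_eqVlt; apply/orP; left; apply/eqP; ring.
  have cv : (fun h => h^-1 *: ((flat p \o shift 0) (h *: 1) - flat p 0)) @ 0^' --> (0 : R).
    apply/cvgrPdist_le => e e0.
    have C1 : 0 < C + 1 by rewrite ltr_wpDl.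
    near=> h.
    have -> : h^-1 *: ((flat p \o shift 0) (h *: 1) - flat p 0) = h^-1 * flat p h.
      by rewrite {2}/flat ltxx subr0 /= addr0 [h *: 1]mulr1.
    rewrite sub0r normrN; apply: (le_trans (key h)).
    have hh : `|h| < e / (C + 1) by near: h; apply: dnbhs0_lt; rewrite divr_gt0.
    move: hh; rewrite ltr_pdivlMr// => hh; have := normr_ge0 h; nra.
  apply: DeriveDef; first by apply/cvg_ex; exists 0.
  exact: cvg_lim.
Unshelve. all: by end_near. Qed.

Lemma smooth_flat (p : {poly R}) : smooth (flat p : R^o -> R).
Proof.
apply: (@smooth_coind _ _ (fun f => exists c p, f = (fun x => c * flat p x))); last first.
  by exists 1, p; apply/funext => x; rewrite mul1r.
move=> _ [c [q ->]].
have dfl x : differentiable (fun x => c * flat q x) x.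
  by apply/derivable1_diffP; have [] := is_deriveZ c (is_derive_flat q x).
split.
- by move=> x; apply: differentiable_continuous; exact: dfl.
- by move=> x v; apply: diff_derivable; exact: dfl.
- move=> v; exists (v * c), ('X^2 * (q - q^`())); apply/funext => x.
  rewrite deriveE; last exact: dfl.
  rewrite -[v in LHS]mulr1 -[v * 1]/(v *: 1) linearZ /= -deriveE; last exact: dfl.
  have [_ ->] := is_deriveZ c (is_derive_flat q x).
  by rewrite /GRing.scale /= mulrA.
Qed.

End flat_function.

(** * Test functions and their Taylor remainders *)

Section tests.
Context {R : realType}.

Lemma support_sub (V : normedModType R) (f g : V -> R) :
  (forall x, f x = 0 -> g x = 0) -> supp g `<=` supp f.
Proof.
move=> h; apply: closure_subset => x /= gx; apply: contra_neq gx; exact: h.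
Qed.

Lemma support_out (V : normedModType R) (f : V -> R) x : ~ supp f x -> \near x, f x = 0.
Proof.
move=> sx; have oc : open (~` supp f) by apply: closed_openC; exact: closed_closure.
have := open_nbhs_nbhs (conj oc sx); apply: filterS => y hy.
by apply: contrapT => /eqP fy; apply: hy; exact: subset_closure.
Qed.

Lemma support0 (V : normedModType R) (f : V -> R) x : ~ supp f x -> f x = 0.
Proof. by move=> /support_out /nbhs_singleton. Qed.

Lemma support_D (V : normedModType R) (f : V -> R) v : supp ('D_v f) `<=` supp f.
Proof.
rewrite [X in _ `<=` X](closure_id (supp f)).1; last exact: closed_closure.
apply: closure_subset => x /= dx; apply: contrapT => sx.
move/eqP : dx; apply; rewrite (near_eq_derive v (g := cst 0)); first exact: derive_cst.
exact: support_out.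
Qed.

Lemma test_D (V : normedModType R) (U : set V) (f : V -> R) v :
  test_function U f -> test_function U ('D_v f).
Proof.
move=> [sf cf Uf]; split; first exact: smooth_D.
- by apply: subclosed_compact cf (@support_D _ _ _); exact: closed_closure.
- by apply: subset_trans Uf; exact: support_D.
Qed.

Lemma test_mull (V : normedModType R) (U : set V) (f g : V -> R) :
  smooth g -> test_function U f -> test_function U (g * f).
Proof.
move=> sg [sf cf Uf].
have sub : supp (g * f) `<=` supp f by apply: support_sub => x fx; rewrite /= fctE fx mulr0.
split; first exact: smooth_mul.
- by apply: subclosed_compact cf sub; exact: closed_closure.
- exact: subset_trans Uf.
Qed.

Lemma test_add (V : normedModType R) (U : set V) (f g : V -> R) :
  test_function U f -> test_function U g -> test_function U (f + g).
Proof.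
move=> [sf cf Uf] [sg cg Ug].
have sub : supp (f + g) `<=` supp f `|` supp g.
  rewrite /Defs.support -closureU; apply: closure_subset => x /= h.
  have [f0|f0] := eqVneq (f x) 0; [right|left] => //.
  by move: h; rewrite fctE f0 add0r.
split; first exact: smooth_add.
- apply: subclosed_compact sub; first exact: closed_closure.
  exact: compactU.
- by apply: (subset_trans sub) => x [/Uf|/Ug].
Qed.

Lemma test_scale (V : normedModType R) (U : set V) c (f : V -> R) :
  test_function U f -> test_function U (c *: f).
Proof. by move=> tf; have := test_mull (smooth_cst c) tf. Qed.

Lemma is_derive_line (V : normedModType R) (phi : V -> R) (v x : V) (t : R) : smooth phi ->
  is_derive t 1 (fun s : R => phi (s *: v + x)) ('D_v phi (t *: v + x)).
Proof.
move=> sp.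
have hL (h : R) (s t0 : R^o) : (h *: s + t0) *: v + x = h *: (s *: v) + (t0 *: v + x).
  by rewrite scalerDl -addrA -scalerA.
apply: DeriveDef.
  apply: (@derivable_affine R V R^o (fun s : R^o => s *: v + x) (fun s : R^o => s *: v) phi hL t 1).
  exact: smooth_derivable.
have := @derive_affine R V R^o (fun s : R^o => s *: v + x) (fun s : R^o => s *: v) phi hL t 1.
by rewrite scale1r.
Qed.

Lemma MVT_line (V : normedModType R) (phi : V -> R) (v x : V) (t : R) : smooth phi ->
  exists s, `|s| <= `|t| /\ phi (t *: v + x) - phi x = t * 'D_v phi (s *: v + x).
Proof.
move=> sp.
have dl s := is_derive_line v x s sp.
have cl : continuous (fun s : R => phi (s *: v + x)).
  by move=> s; apply: differentiable_continuous; apply/derivable1_diffP; have [] := dl s.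
have [t0|t0|->] := ltgtP t 0.
- have [s] := @MVT R (fun s : R => phi (s *: v + x)) (fun s => 'D_v phi (s *: v + x)) t 0 t0 (fun s _ => dl s) (continuous_subspaceT cl).
  rewrite in_itv /= => /andP[h1 h2]; rewrite scale0r add0r => h.
  exists s; split; first by rewrite !ltr0_norm// lerN2 ltW.
  by rewrite -[LHS]opprB h; ring.
- have [s] := @MVT R (fun s : R => phi (s *: v + x)) (fun s => 'D_v phi (s *: v + x)) 0 t t0 (fun s _ => dl s) (continuous_subspaceT cl).
  rewrite in_itv /= => /andP[h1 h2]; rewrite scale0r add0r => h.
  exists s; split; first by rewrite !gtr0_norm// ltW.
  by rewrite h; ring.
- by exists 0; split => //; rewrite scale0r add0r subrr mul0r.
Qed.

Lemma test_bounded (V : normedModType R) (U : set V) (phi : V -> R) : test_function U phi ->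
  exists2 M, 0 <= M & forall x, `|phi x| <= M.
Proof.
move=> [sp cp _].
have ci : compact (phi @` supp phi).
  by apply: continuous_compact => //; apply: continuous_subspaceT; exact: smooth_cont.
have [M [Mr hM]] := compact_bounded ci.
exists (`|M| + 1) => // x; have [hx|/support0 ->] := pselect (supp phi x); last by rewrite normr0.
by apply: (hM (`|M| + 1)) => //; rewrite (le_lt_trans (ler_norm M))// ltrDl.
Qed.

Lemma test_quad (V : normedModType R) (U : set V) (phi : V -> R) (v : V) : test_function U phi ->
  exists2 M, 0 <= M & forall t x, `|phi (t *: v + x) - phi x - t * 'D_v phi x| <= M * t ^+ 2.
Proof.
move=> tp; have tD := test_D v tp; have [M M0 hM] := test_bounded (test_D v tD).
have [sp _ _] := tp; have [sD _ _] := tD.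
exists M => // t x; have [s [st ->]] := MVT_line v x t sp.
have [s' [ss' h]] := MVT_line v x s sD.
rewrite -mulrBr h !normrM -(real_normK (num_real t)) expr2 mulrCA mulrA mulrC.
by apply: ler_pM; [by []|by rewrite mulr_ge0|exact: hM|by rewrite ler_wpM2r].
Qed.

Context {d : nat}.
Local Notation E := 'rV[R]_d.

Lemma test_ball (f : E -> R) : test_function setT f ->
  exists r, 0 < r /\ forall x, ~ ball (0 : E) r x -> f x = 0.
Proof.
move=> [_ /compact_sub_ball[r [r0 hr]] _]; exists r; split => // x hx.
by apply: support0 => /hr; exact: hx.
Qed.

Lemma ball_test (f : E -> R) r : smooth f -> (forall x, ~ ball (0 : E) r x -> f x = 0) ->
  test_function setT f.
Proof.
move=> sf hf; split => //; apply: bounded_closed_compact; last exact: closed_closure.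
have sub : supp f `<=` [set x : E | `|x| <= r].
  rewrite (closure_id [set x : E | `|x| <= r]).1.
    apply: closure_subset => x /= fx; apply: contrapT => hx.
    move/eqP: fx; apply; apply: hf => bx; apply: hx.
    have r0 : 0 < r by case: bx.
    by apply: norm_rV_le (ltW r0) _ => i; move/(ball_rVP _ _ r0) : bx => /(_ i); rewrite mxE sub0r normrN => /ltW.
  rewrite (_ : [set x | _] = (fun x : E => `|x|) @^-1` [set t | t <= r]) //.
  by apply: closed_comp => [x _|]; [exact: norm_continuous|exact: closed_le].
exists r; split; first exact: num_real.
by move=> M rM x /sub /= h; apply: le_trans h (ltW rM).
Qed.

End tests.

(** * Test functions are dense in L^2 *)

Section boxes.
Context {R : realType} {d : nat}.
Local Notation E := 'rV[R]_d.
Local Notation leb := (@lebesgue_rV R d).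

Definition obox (a b : E) : set E := [set x | forall i, a ord0 i < x ord0 i < b ord0 i].

Lemma flat1_ge0 (t : R) : 0 <= flat 1 t.
Proof. by rewrite /flat; case: ifP => // _; rewrite hornerC mul1r expR_ge0. Qed.

Lemma flat1_le1 (t : R) : flat 1 t <= 1.
Proof.
rewrite /flat; case: ifP => // t0; rewrite hornerC mul1r -expR0 ler_expR.
by rewrite lerNl oppr0 invr_ge0 ltW.
Qed.

Lemma flat1_le0 (t : R) : t <= 0 -> flat 1 t = 0.
Proof. by move=> t0; rewrite /flat ltNge t0. Qed.

Lemma flat1_gt0 (t : R) : 0 < t -> 0 < flat 1 t.
Proof. by move=> t0; rewrite /flat t0 hornerC mul1r expR_gt0. Qed.

Lemma flat1_cvg (t : R) : flat 1 (n.+1%:R * t) @[n --> \oo] --> ((if 0 < t then 1 else 0) : R).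
Proof.
case: ifPn => t0; last first.
  under eq_fun do rewrite flat1_le0 ?pmulr_rle0 ?leNgt//.
  exact: cvg_cst.
have e n : flat 1 (n.+1%:R * t) = expR (- (t^-1 * n.+1%:R^-1)).
  by rewrite /flat mulr_gt0// hornerC mul1r invfM mulrC.
under eq_fun do rewrite e.
have h : (- (t^-1 * n.+1%:R^-1)) @[n --> \oo] --> (0 : R).
  rewrite -oppr0 -(mulr0 t^-1); apply: cvgN; apply: cvgM; [exact: cvg_cst|exact: cvg_harmonic].
have h2 := cvg_comp _ _ h (@continuous_expR R 0); rewrite expR0 in h2; exact: h2.
Qed.

(** Smooth functions with values in [0, 1] that vanish outside the open box and tend pointwise to
    its indicator as [n] grows. *)
Definition boxf (a b : E) (n : nat) : E -> R := \prod_(i < d)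
  ((fun x : E => flat 1 (n.+1%:R * (x ord0 i - a ord0 i))) *
   (fun x : E => flat 1 (n.+1%:R * (b ord0 i - x ord0 i)))).

Lemma boxfE a b n x : boxf a b n x = \prod_(i < d)
  (flat 1 (n.+1%:R * (x ord0 i - a ord0 i)) * flat 1 (n.+1%:R * (b ord0 i - x ord0 i))).
Proof. by rewrite /boxf fct_prodE. Qed.

Lemma smooth_coord (i : 'I_d) (c e : R) (f : R^o -> R) : smooth f ->
  smooth (fun x : E => f (c * x ord0 i + e)).
Proof.
move=> sf; apply: (@smooth_affine R R^o E (fun x : E => c * x ord0 i + e : R^o) (fun x : E => c * x ord0 i : R^o)) => //.
  by move=> h v x; rewrite !mxE /GRing.scale /=; ring.
have h (x : E) : (fun y : E => c * y ord0 i + e : R) @ x --> (c * x ord0 i + e : R).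
  have h1 : (fun y : E => y ord0 i : R) @ x --> (x ord0 i : R) by exact: coord_continuous.
  exact: (cvgD (cvgM (cvg_cst c) h1) (cvg_cst e)).
exact: h.
Qed.

Lemma smooth_boxf a b n : smooth (boxf a b n).
Proof.
apply: smooth_prod => i; apply: smooth_mul.
  rewrite (_ : (fun x : E => _) = (fun x : E => flat 1 (n.+1%:R * x ord0 i + - n.+1%:R * a ord0 i))).
    by apply: smooth_coord; exact: smooth_flat.
  by apply/funext => x; congr flat; ring.
rewrite (_ : (fun x : E => _) = (fun x : E => flat 1 (- n.+1%:R * x ord0 i + n.+1%:R * b ord0 i))).
  by apply: smooth_coord; exact: smooth_flat.
by apply/funext => x; congr flat; ring.
Qed.

Lemma boxf_ge0 a b n x : 0 <= boxf a b n x.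
Proof. by rewrite boxfE; apply: prodr_ge0 => i _; rewrite mulr_ge0 ?flat1_ge0. Qed.

Lemma boxf_le1 a b n x : boxf a b n x <= 1.
Proof.
have /andP[] // : 0 <= boxf a b n x <= 1.
rewrite boxfE; apply: (big_ind (fun z : R => 0 <= z <= 1)); first by rewrite ler01 lexx.
  by move=> u w /andP[u0 u1] /andP[w0 w1]; rewrite mulr_ge0//= mulr_ile1.
by move=> i _; rewrite mulr_ge0 ?flat1_ge0//= mulr_ile1 ?flat1_ge0 ?flat1_le1.
Qed.

Lemma boxf_out a b n x : ~ obox a b x -> boxf a b n x = 0.
Proof.
move=> /existsNP[i hi]; rewrite boxfE (bigD1 i)//=.
have [h1|h1] := ltP (a ord0 i) (x ord0 i); last first.
  by rewrite flat1_le0 ?mul0r// pmulr_rle0// subr_le0.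
have h2 : b ord0 i <= x ord0 i by rewrite leNgt; apply/negP => h2; apply: hi; rewrite h1.
by rewrite [X in _ * X * _]flat1_le0 ?mulr0 ?mul0r// pmulr_rle0// subr_le0.
Qed.

Lemma boxf_gt0 a b n x : obox a b x -> 0 < boxf a b n x.
Proof.
move=> h; rewrite boxfE; apply: prodr_gt0 => i _; have /andP[h1 h2] := h i.
by rewrite mulr_gt0// flat1_gt0// mulr_gt0// subr_gt0.
Qed.

Lemma cvg_prodr (I : Type) (r : seq I) (F : I -> nat -> R) (l : I -> R) :
  (forall i, F i n @[n --> \oo] --> l i) ->
  (\prod_(i <- r) F i n) @[n --> \oo] --> \prod_(i <- r) l i.
Proof.
move=> h; elim: r => [|i r ih].
  by rewrite big_nil; under eq_fun do rewrite big_nil; exact: cvg_cst.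
by rewrite big_cons; under eq_fun do rewrite big_cons; exact: cvgM.
Qed.

Lemma boxf_cvg a b x : boxf a b n x @[n --> \oo] --> (\1_(obox a b) x : R).
Proof.
have [bx|bx] := pselect (obox a b x); last first.
  rewrite indicE memNset//; under eq_fun do rewrite boxf_out//; exact: cvg_cst.
rewrite indicE mem_set//.
under eq_fun do rewrite boxfE.
have -> : (true : nat)%:R = \prod_(i < d) (1 : R) by rewrite big1.
apply: cvg_prodr => i; have /andP[h1 h2] := bx i.
have := @flat1_cvg (x ord0 i - a ord0 i); have := @flat1_cvg (b ord0 i - x ord0 i).
rewrite !subr_gt0 h1 h2 => c1 c2.
by rewrite -[X in _ --> X]mulr1; exact: cvgM.
Qed.

Lemma obox_ball a b : exists r, 0 < r /\ obox a b `<=` ball (0 : E) r.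
Proof.
exists (`|a| + `|b| + 1); split; first by rewrite ltr_wpDl ?addr_ge0.
move=> x bx; apply/ball_rVP; first by rewrite ltr_wpDl ?addr_ge0.
move=> i; have /andP[h1 h2] := bx i.
have := coord_le_norm a i; have := coord_le_norm b i; rewrite mxE sub0r normrN.
rewrite !ler_norml ltr_norml => /andP[? ?] /andP[? ?]; apply/andP; split.
  by have := normr_ge0 b; lra.
by have := normr_ge0 a; lra.
Qed.

Lemma test_boxf a b n : test_function setT (boxf a b n).
Proof.
have [r [r0 hr]] := obox_ball a b; apply: (@ball_test _ _ _ r); first exact: smooth_boxf.
by move=> x hx; apply: boxf_out => /hr.
Qed.

Lemma measurable_obox a b : measurable (obox a b).
Proof.
rewrite (_ : obox a b = \bigcap_(i : 'I_d) ((fun x : E => x ord0 i) @^-1` `]a ord0 i, b ord0 i[%classic)).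
  apply: fin_bigcap_measurable => // i _.
  rewrite -[X in measurable X]setTI; apply: measurable_coord => //.
apply/seteqP; split => x h i; first by move=> _; rewrite /= in_itv /=; exact: h.
by have := h i Logic.I; rewrite /= in_itv.
Qed.

Lemma oboxI a b a' b' : obox a b `&` obox a' b' =
  obox (\row_i Num.max (a ord0 i) (a' ord0 i)) (\row_i Num.min (b ord0 i) (b' ord0 i)).
Proof.
apply/seteqP; split => x /=.
  by move=> [h1 h2] i; rewrite !mxE gt_max lt_min; have /andP[-> ->] := h1 i; have /andP[-> ->] := h2 i.
move=> h; split => i; have := h i; rewrite !mxE gt_max lt_min => /andP[/andP[? ?] /andP[? ?]]; exact/andP.
Qed.

Lemma measurable_rV_boxes :
  @measurable _ E = <<s [set A | exists a b, A = obox a b] >>.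
Proof.
apply/seteqP; split; last first.
  by apply: smallest_sub; [exact: sigma_algebra_measurable|move=> _ [a [b ->]]; exact: measurable_obox].
apply: smallest_sub; first exact: smallest_sigma_algebra.
rewrite -bigcup_seq => A [i _ [B mB <-]] /=; rewrite setTI => {A}.
pose S := <<s [set A | exists a b : E, A = obox a b] >>.
have [S0 SC SU] : sigma_algebra setT S by exact: smallest_sigma_algebra.
suff : <<s @RGenOpens.G R >> `<=` [set Y | S ((fun x : E => x ord0 i) @^-1` Y)].
  have mB' : (@RGenOpens.G R).-sigma.-measurable B by rewrite -RGenOpens.measurableE.
  by move=> h; exact: h B mB'.
apply: smallest_sub.
  split => /=.
  - by rewrite preimage_set0; exact: S0.
  - by move=> Y SY; rewrite setTD preimage_setC -setTD; exact: SC.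
  - by move=> F SF; rewrite preimage_bigcup; exact: SU.
move=> _ [p [q ->]] /=.
rewrite (_ : _ @^-1` _ = \bigcup_n obox (\row_j if j == i then p else - n%:R) (\row_j if j == i then q else n%:R)).
  apply: SU => n; apply: sub_sigma_algebra.
  by eexists; eexists; reflexivity.
apply/seteqP; split => x /=.
  rewrite in_itv /= => hx.
  have [n hn] : exists n : nat, `|x| < n%:R by exists (Num.bound `|x|); rewrite archi_boundP.
  exists n => // j; rewrite !mxE; case: eqP => [->//|_].
  by rewrite -ltr_norml (le_lt_trans (coord_le_norm x j)).
by move=> [n _] /(_ i); rewrite !mxE eqxx in_itv.
Qed.

(** Dynkin's theorem: the boxes are stable under intersection and generate the sigma-algebra, and
    the sets on which [f] has integral 0 are stable under complements because the total integral
    vanishes. The integrals over [[f >= 0]] and over its complement then give [\int |f| = 0]. *)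
Lemma integr_boxes_ae0 (f : E -> R) : integr f -> \int[leb]_x f x = 0 ->
  (forall a b, \int[leb]_(x in obox a b) f x = 0) -> f = 0 %[ae leb].
Proof.
move=> intf f0 hbox.
have intS S : measurable S -> leb.-integrable S (EFin \o f).
  by move=> mS; apply: integrableS intf.
have fin S : measurable S -> (\int[leb]_(x in S) (f x)%:E)%E \is a fin_num.
  by move=> mS; apply: integrable_fin_num => //; exact: intS.
have all0 S : measurable S -> \int[leb]_(x in S) f x = 0.
  move=> mS; have := mS; rewrite measurable_rV_boxes.
  apply: (dynkin_induction (P := fun S => \int[leb]_(x in S) f x = 0) measurable_rV_boxes) => //.
  - by move=> _ _ [a [b ->]] [a' [b' ->]]; rewrite oboxI; eexists; eexists.
  - by move=> _ [a [b ->]]; exact: hbox.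
  - move=> A mA A0; have := @Rintegral_setU _ _ _ leb A (~` A) f mA (measurableC mA).
    rewrite setUv => /(_ intf); rewrite f0 A0 add0r => <- //.
    by apply/disj_setPS; rewrite setICr.
  - move=> F mF tF F0; rewrite /Rintegral integral_bigcup//; last by apply: intS; exact: bigcupT_measurable.
    rewrite eseries0 // => i _ _.
    by rewrite -[LHS]fineK ?fin//; congr EFin; exact: F0.
have mf := integr_meas intf.
pose P := [set x | 0 <= f x].
have mP : measurable P.
  rewrite (_ : P = f @^-1` `[0, +oo[%classic).
    by rewrite -[X in measurable X]setTI; exact: mf.
  by apply/seteqP; split => x /=; rewrite in_itv /= andbT.
have h1 : \int[leb]_x `|f x| = 0.
  have := @Rintegral_setU _ _ _ leb P (~` P) (fun x => `|f x|) mP (measurableC mP).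
  rewrite setUv => /(_ (integr_norm intf)) ->; last by apply/disj_setPS; rewrite setICr.
  rewrite (@eq_Rintegral _ _ _ leb P f); last by move=> x; rewrite inE => Px; rewrite ger0_norm.
  rewrite (@eq_Rintegral _ _ _ leb (~` P) (fun x => -1 * f x)); last first.
    by move=> x; rewrite inE /= => /negP; rewrite -ltNge => fx; rewrite ltr0_norm// mulN1r.
  have mPC := measurableC mP; have iPC := intS _ mPC.
  by rewrite RintegralZl ?all0 ?mulr0 ?addr0.
have h2 : (\int[leb]_x `|(f x)%:E| = 0)%E.
  rewrite -[LHS]fineK; first by congr EFin; exact: h1.
  by apply: integrable_fin_num => //; exact: integr_norm.
have mfE : measurable_fun setT (EFin \o f) by exact/measurable_EFinP.
have := (ae_eq_integral_abs leb measurableT mfE).1 h2.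
by apply: filterS => x /= hx _; have := hx Logic.I => -[].
Qed.

End boxes.

Section density.
Context {R : realType} {d : nat}.
Local Notation E := 'rV[R]_d.
Local Notation leb := (@lebesgue_rV R d).
Local Notation nm := (snorm (@ip R d)).
Local Notation test := (test_function (@setT E)).
Let S2 := @L2_semi R d.

Lemma L2_indic (A : set E) : measurable A -> (leb A < +oo)%E -> L2 (\1_A : E -> R).
Proof.
move=> mA fA; apply: L2I; first exact: measurable_indic.
apply/integrableP; split.
  by apply/measurable_EFinP; apply: measurable_funX; exact: measurable_indic.
rewrite (eq_integral (fun x => (\1_A x)%:E)) ?integral_indic ?setIT// => x _ /=.
by rewrite indicE; case: (_ \in _); rewrite ?expr0n ?expr1n /= ?normr0 ?normr1.
Qed.

Lemma L2_ballindic (r : R) : L2 (\1_(ball (0 : E) r) : E -> R).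
Proof. by apply: L2_indic; [exact: measurable_ball_rV|exact: lebesgue_ball_lty]. Qed.

Lemma L2_bounded (f : E -> R) (r M : R) : measurable_fun setT f ->
  (forall x, `|f x| <= M * \1_(ball (0 : E) r) x) ->
  L2 f /\ nm f <= `|M| * nm (\1_(ball (0 : E) r) : E -> R).
Proof.
move=> mf h; have LB := siZ S2 M (L2_ballindic r).
have h' x : `|f x| <= `|(M *: (\1_(ball (0 : E) r) : E -> R)) x|.
  by apply: le_trans (h x) _; apply: ler_norm.
split; first exact: L2_le LB h'.
by rewrite -(snormZ S2); [exact: snorm_ip_le|exact: L2_ballindic].
Qed.

Lemma test_meas (phi : E -> R) : test phi -> measurable_fun setT phi.
Proof. by move=> [s _ _]; apply: continuous_measurable_rV; exact: smooth_cont. Qed.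

Lemma test_bound (phi : E -> R) : test phi ->
  exists r M, [/\ 0 < r, 0 <= M & forall x, `|phi x| <= M * \1_(ball (0 : E) r) x].
Proof.
move=> tp; have [r [r0 hr]] := test_ball tp; have [M M0 hM] := test_bounded tp.
exists r, M; split => // x; have [bx|bx] := pselect (ball (0 : E) r x).
  by rewrite indicE mem_set// mulr1.
by rewrite hr// normr0 indicE memNset// mulr0.
Qed.

Lemma test_L2 (phi : E -> R) : test phi -> L2 phi.
Proof.
by move=> tp; have [r [M [r0 M0 h]]] := test_bound tp; have [] := L2_bounded (test_meas tp) h.
Qed.

Lemma obox_int0 (f : E -> R) (a b : E) : L2 f ->
  (forall phi, test phi -> ip f phi = 0) -> \int[leb]_(x in obox a b) f x = 0.
Proof.
move=> Lf h0; have mf := L2_meas Lf.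
have [r [r0 hr]] := obox_ball a b.
have Lq : L2 (\1_(obox a b) : E -> R).
  apply: L2_le (L2_ballindic r) _; first exact: measurable_indic (measurable_obox a b).
  move=> x; rewrite !indicE !ger0_norm// ler_nat.
  by case: (boolP (x \in obox a b)) => //; rewrite inE => /hr bx; rewrite mem_set.
have ig : leb.-integrable setT (EFin \o (fun x => `|f x * (\1_(obox a b) : E -> R) x|)).
  by apply: integr_norm; exact: L2M.
have [_ _] := @dominated_convergence _ _ _ leb setT measurableT
  (fun n x => (f x * boxf a b n x)%:E) (fun x => (f x * (\1_(obox a b) : E -> R) x)%:E)
  _ (fun n => ltac:(by apply/measurable_EFinP; apply: measurable_funM => //; exact: (test_meas (test_boxf a b n))))
  (ltac:(by apply/measurable_EFinP; apply: measurable_funM => //; exact: measurable_indic (measurable_obox a b)))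
  (ltac:(apply: nearW => x _; apply: cvg_EFin; [exact: nearW|exact: (cvgM (cvg_cst (f x)) (@boxf_cvg _ _ a b x))]))
  ig
  (ltac:(apply: nearW => x n _ /=; rewrite lee_fin !normrM ler_wpM2l//;
    have [bx|bx] := pselect (obox a b x);
    [by rewrite indicE mem_set// normr1 ger0_norm ?boxf_ge0 ?boxf_le1|by rewrite boxf_out// normr0])).
rewrite (_ : (fun n => _) = cst 0%E); last first.
  apply/funext => n /=; have := h0 _ (test_boxf a b n); rewrite ipE /Rintegral => h.
  rewrite -[LHS]fineK ?h//; apply: integrable_fin_num => //.
  exact: (L2M Lf (test_L2 (test_boxf a b n))).
move=> /cvg_unique => /(_ _ 0%E (cvg_cst _)) h.
rewrite /Rintegral integral_mkcond.
rewrite (_ : (\int[leb]_x _)%E = 0%E) //; rewrite -[RHS]h.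
  apply: eq_integral => x _; rewrite /= /patch indicE; case: ifPn => _; by rewrite ?mulr1 ?mulr0.
exact: ereal_hausdorff.
Qed.

(** A function of L^2 need not be integrable, so the measure-theoretic argument is applied to [f]
    times the indicator of each cube [Q k]; these cubes exhaust the space. *)
Lemma test_separating (f : E -> R) : L2 f -> (forall phi, test phi -> ip f phi = 0) ->
  f = 0 %[ae leb].
Proof.
move=> Lf h0.
pose Q (k : nat) : set E := obox (const_mx (- k%:R)) (const_mx k%:R).
have QI a b k : \int[leb]_(x in obox a b) (f x * (\1_(Q k) : E -> R) x) = 0.
  have := obox_int0 (\row_i Num.max (a ord0 i) ((const_mx (- k%:R) : E) ord0 i)) (\row_i Num.min (b ord0 i) ((const_mx k%:R : E) ord0 i)) Lf h0.
  rewrite -oboxI Rintegral_mkcondr => h; rewrite -[RHS]h; apply: eq_Rintegral => x _.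
  by rewrite patchE indicE; case: ifPn => _; rewrite ?mulr1 ?mulr0.
have LQ k : L2 (\1_(Q k) : E -> R).
  have [r [r0 hr]] := obox_ball (const_mx (- k%:R) : E) (const_mx k%:R : E).
  apply: L2_le (L2_ballindic r) _; first exact: measurable_indic (measurable_obox _ _).
  move=> x; rewrite !indicE !ger0_norm// ler_nat.
  by case: (boolP (x \in Q k)) => //; rewrite inE => /hr bx; rewrite mem_set.
have ae0 k : {ae leb, forall x, f x * (\1_(Q k) : E -> R) x = 0}.
  have := @integr_boxes_ae0 R d (fun x => f x * (\1_(Q k) : E -> R) x) (L2M Lf (LQ k)).
  have -> : \int[leb]_x (f x * (\1_(Q k) : E -> R) x) = 0.
    have := obox_int0 (const_mx (- k%:R)) (const_mx k%:R) Lf h0.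
    rewrite Rintegral_mkcond => h; rewrite -[RHS]h; apply: eq_Rintegral => x _.
    by rewrite patchE indicE; case: ifPn => _; rewrite ?mulr1 ?mulr0.
  move=> /(_ erefl (fun a b => QI a b k)); apply: filterS => x hx; exact: hx.
have : {ae leb, forall x k, f x * (\1_(Q k) : E -> R) x = 0} by exact/ae_foralln.
apply: filterS => x hx _.
have [n hn] : exists n : nat, `|x| < n%:R by exists (Num.bound `|x|); rewrite archi_boundP.
have := hx n; rewrite indicE mem_set ?mulr1// => i; rewrite !mxE.
by rewrite -ltr_norml (le_lt_trans (coord_le_norm x i)).
Qed.

(** Orthogonal projection: the closure [W] of the test functions is complete, so [riesz] on [W]
    provides a [g] in [W] such that [f - g] is orthogonal to every test function, hence vanishes
    almost everywhere. *)
Lemma test_dense (f : E -> R) (e : R) : L2 f -> 0 < e ->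
  exists phi, test phi /\ nm (f - phi) <= e.
Proof.
move=> Lf e0.
pose W := [set f : E -> R | L2 f /\ forall e, 0 < e -> exists phi, test phi /\ nm (f - phi) <= e].
have test0 : test (0 : E -> R).
  apply: (@ball_test _ _ _ 1); first exact: (smooth_cst 0).
  by [].
have WL g : W g -> L2 g by case.
have tW phi : test phi -> W phi.
  by move=> tp; split; [exact: test_L2|move=> e1 e10; exists phi; rewrite subrr (snorm0 S2) ltW].
have SW : semi_inner W (@ip R d).
  split.
  - exact: tW.
  - move=> a g h [Lg hg] [Lh hh]; split; first exact: L2_lin.
    move=> e1 e10; have a1 : 0 < `|a| + 1 by rewrite ltr_wpDl.
    have [p1 [tp1 h1]] := hg (e1 / 2 / (`|a| + 1)) (ltac:(by rewrite !divr_gt0)).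
    have [p2 [tp2 h2]] := hh (e1 / 2) (ltac:(by rewrite divr_gt0)).
    exists (a *: p1 + p2); split; first by apply: test_add => //; exact: test_scale.
    have -> : a *: g + h - (a *: p1 + p2) = a *: (g - p1) + (h - p2).
      by rewrite scalerBr opprD addrACA.
    have L1 := siB S2 Lg (test_L2 tp1); have L2' := siB S2 Lh (test_L2 tp2).
    apply: le_trans (snormD S2 (siZ S2 a L1) L2') _; rewrite (snormZ S2 a L1).
    have : `|a| * nm (g - p1) <= e1 / 2.
      apply: le_trans (_ : (`|a| + 1) * nm (g - p1) <= _).
        by rewrite ler_wpM2r ?snorm_ge0// lerDl.
      by rewrite mulrC -ler_pdivlMr.
    by move=> h3; lra.
  - by move=> g h [Lg _] [Lh _]; exact: (siC S2).
  - by move=> a g h k [Lg _] [Lh _] [Lk _]; exact: (siDZl S2).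
  - by move=> g [Lg _]; exact: (si_ge0 S2).
have [|||g [Wg hg]] := @riesz R _ W (@ip R d) SW _ (fun h => ip f h) (nm f).
- move=> u hu cau; have [g [Lg ug]] := L2_complete (fun n => WL _ (hu n)) cau.
  exists g; split => //; split => // e1 e10.
  have e2 : 0 < e1 / 2 by rewrite divr_gt0.
  move/cvgrPdist_le : ug => /(_ _ e2)[n _ hn].
  have [Lu hun] := hu n; have [p [tp hp]] := hun _ e2.
  exists p; split => //.
  have := snorm_triangle S2 Lg Lu (test_L2 tp).
  have := hn n (leqnn n); rewrite sub0r normrN ger0_norm ?snorm_ge0// (snorm_distC S2 Lu Lg).
  by move=> h1 h2; lra.
- by move=> a g h [Lg _] [Lh _]; rewrite (siC S2 Lf (L2_lin _ Lg Lh)) (siDZl S2) // (siC S2 Lg Lf) (siC S2 Lh Lf).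
- by move=> g [Lg _]; exact: (si_CS S2).
have Lg := WL _ Wg.
have ae0 : f - g = 0 %[ae leb].
  apply: test_separating; first exact: (siB S2).
  by move=> phi tp; rewrite (siBl S2)//; [rewrite (hg _ (tW _ tp)) subrr|exact: test_L2].
have [_ /(_ e e0)[phi [tp hp]]] := Wg; exists phi; split => //.
apply: le_trans hp; rewrite le_eqVlt; apply/orP; left; apply/eqP; congr Num.sqrt.
have Lp := test_L2 tp; have L1 := siB S2 Lf Lp; have L2' := siB S2 Lg Lp.
have h : f - phi = g - phi %[ae leb].
  apply: filterS ae0 => x /= /(_ Logic.I) h _.
  by move: h; rewrite !fctE => /eqP; rewrite subr_eq0 => /eqP ->.
exact: ip_ae.
Qed.

Lemma nm_dual (w : E -> R) (K : R) : L2 w -> 0 <= K ->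
  (forall phi, test phi -> ip w phi <= K * nm phi) -> nm w <= K.
Proof.
move=> Lw K0 h; apply/ler_addgt0Pr => e e0.
have [w0|wn0] := eqVneq (nm w) 0; first by rewrite w0 addr_ge0// ltW.
have wp : 0 < nm w by rewrite lt_def wn0 snorm_ge0.
have p1 : 0 < nm w + K + 1 by lra.
(* With [n = nm w] and [q = nm (w - phi)] the estimate reads [n^2 <= n q + K (n + q)]; this
   tolerance makes [q (n + K) <= e n], whence [n <= K + e]. *)
have [phi [tp hp]] := test_dense Lw (ltac:(by rewrite divr_gt0// mulr_gt0) : 0 < e * nm w / (nm w + K + 1)).
have Lp := test_L2 tp; have Ld := siB S2 Lw Lp.
have h1 : nm w ^+ 2 = ip w (w - phi) + ip w phi by rewrite (snorm_sqr S2)// (siBr S2)//; ring.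
have h2 := le_trans (ler_norm _) (si_CS S2 Lw Ld).
have h3 := h _ tp.
have h4 : nm phi <= nm w + nm (w - phi).
  by have := snormB S2 Lw Ld; rewrite opprB addrC subrK.
rewrite ler_pdivlMr// in hp.
set q := nm (w - phi) in h2 h4 hp; have q0 : 0 <= q by exact: snorm_ge0.
set n := nm w in wp h1 h2 h4 hp p1 *.
have h5 : n ^+ 2 <= n * q + K * (n + q) by nra.
have h6 : n * (n - K - e) <= 0 by rewrite expr2 in h5; nra.
by rewrite pmulr_rle0// in h6; lra.
Qed.

Definition tr (a : E) (f : E -> R) : E -> R := fun x => f (x + a).

Lemma trE a f : tr a f = f \o affine 1 a.
Proof. by apply/funext => x; rewrite /tr /affine /= scale1r. Qed.

Lemma L2_tr a f : L2 f -> L2 (tr a f).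
Proof. by rewrite trE; apply: L2_aff; left. Qed.

Lemma ip_tr a f g : L2 f -> L2 g -> ip (tr a f) (tr a g) = ip f g.
Proof. by move=> Lf Lg; rewrite !trE ip_aff//; left. Qed.

Lemma nm_tr a f : L2 f -> nm (tr a f) = nm f.
Proof. by move=> Lf; rewrite /snorm ip_tr. Qed.

Lemma tr_tr a b f : tr a (tr b f) = tr (a + b) f.
Proof. by apply/funext => x; rewrite /tr addrA. Qed.

Lemma tr0 f : tr 0 f = f.
Proof. by apply/funext => x; rewrite /tr addr0. Qed.

Lemma trB a f g : tr a (f - g) = tr a f - tr a g. Proof. by []. Qed.
Lemma ip_trl a f g : L2 f -> L2 g -> ip (tr a f) g = ip f (tr (- a) g).
Proof.
move=> Lf Lg; rewrite -[in LHS](tr0 g) -(subrr a) -tr_tr ip_tr//; exact: L2_tr.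
Qed.

Lemma smooth_tr a f : smooth f -> smooth (tr a f).
Proof.
move=> sf; apply: (@smooth_affine R E E (fun x => x + a) id) => //.
  by move=> h v x; rewrite addrA.
by move=> x; exact: (@cvgD _ E E (nbhs x) _ id (cst a) x a cvg_id (cvg_cst a)).
Qed.

Lemma test_tr a phi : test phi -> test (tr a phi).
Proof.
move=> tp; have [r [r0 hr]] := test_ball tp; have [sp _ _] := tp.
apply: (@ball_test _ _ _ (r + `|a|)); first exact: smooth_tr.
move=> x hx; apply: hr => hb; apply: hx.
have p : 0 < r + `|a| by rewrite ltr_pwDl.
apply/ball_rVP => // i; move/(ball_rVP _ _ r0) : hb => /(_ i).
rewrite !mxE !sub0r !normrN => h; have := coord_le_norm a i.
have -> : x ord0 i = (x ord0 i + a ord0 i) - a ord0 i by ring.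
move=> h2; apply: le_lt_trans (ler_normB _ _) _; lra.
Qed.

Lemma D_tr a phi v : 'D_v (tr a phi) = tr a ('D_v phi).
Proof.
apply/funext => x; apply: (@derive_affine R E E (fun x => x + a) id) => h w y.
by rewrite addrA.
Qed.

Lemma ball_line (r : R) (v x : E) (s : R) : `|s| <= 1 -> ball (0 : E) r (s *: v + x) ->
  ball (0 : E) (r + `|v|) x.
Proof.
move=> s1 hb; have r0 : 0 < r by case: hb.
have p : 0 < r + `|v| by rewrite ltr_pwDl.
apply/ball_rVP => // i; move/(ball_rVP _ _ r0) : hb => /(_ i).
rewrite !mxE !sub0r !normrN => h; have h2 := coord_le_norm v i.
have -> : x ord0 i = (s * v ord0 i + x ord0 i) - s * v ord0 i by ring.
apply: le_lt_trans (ler_normB _ _) _; rewrite normrM.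
have : `|s| * `|v ord0 i| <= `|v| by rewrite (le_trans _ h2)// ler_piMl.
lra.
Qed.

Lemma test_line_bound (phi : E -> R) (v : E) : test phi -> exists r M, [/\ 0 < r, 0 <= M &
  forall t x, `|t| <= 1 -> `|phi (t *: v + x) - phi x - t * 'D_v phi x| <= M * t ^+ 2 * \1_(ball (0 : E) r) x].
Proof.
move=> tp; have tD := test_D v tp; have tDD := test_D v tD.
have [r1 [M1 [r10 M10 h1]]] := test_bound tDD.
have [sp _ _] := tp; have [sD _ _] := tD.
exists (r1 + `|v|), M1; split => //; first by rewrite ltr_pwDl.
move=> t x t1; have [s [st ->]] := MVT_line v x t sp.
have [s' [ss' h]] := MVT_line v x s sD.
rewrite -mulrBr h !normrM.
have b := h1 (s' *: v + x).
have s'1 : `|s'| <= 1 by apply: le_trans ss' _; apply: le_trans st _.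
have b' : `|('D_v ('D_v phi)) (s' *: v + x)| <= M1 * (\1_(ball (0 : E) (r1 + `|v|)) x : R).
  apply: le_trans b _; rewrite ler_wpM2l// !indicE ler_nat.
  have [hb|hb] := pselect (ball (0 : E) r1 (s' *: v + x)); last by rewrite memNset.
  by rewrite (mem_set (ball_line s'1 hb)) leq_b1.
have -> : t ^+ 2 = `|t| * `|t| by rewrite -expr2 real_normK// num_real.
rewrite [leRHS](_ : _ = `|t| * (`|t| * (M1 * \1_(ball (0 : E) (r1 + `|v|)) x))); last by ring.
rewrite ler_wpM2l//.
by apply: ler_pM.
Qed.

(** By translation invariance the Taylor remainder [phi(x + t v) - phi(x) - t D_v phi(x)] has
    integral [- t \int D_v phi], while it is bounded by a multiple of [t^2] on a fixed ball; let [t]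
    tend to 0. *)
Lemma integral_D0 (phi : E -> R) v : test phi -> \int[leb]_x ('D_v phi x) = 0.
Proof.
move=> tp; have [r [M [r0 M0 hM]]] := test_line_bound v tp.
have [sp _ _] := tp.
have iB : integr (\1_(ball (0 : E) r) : E -> R).
  have := L2M (L2_ballindic r) (L2_ballindic r); congr integr; apply/funext => x.
  by rewrite indicE; case: (_ \in _); rewrite ?mulr0 ?mulr1.
pose K := \int[leb]_x (\1_(ball (0 : E) r) : E -> R) x.
have iphi f : test f -> integr f.
  move=> tf; have [r1 [M1 [r10 M10 h1]]] := test_bound tf.
  have iB1 : integr (\1_(ball (0 : E) r1) : E -> R).
    have := L2M (L2_ballindic r1) (L2_ballindic r1); congr integr; apply/funext => x.
    by rewrite indicE; case: (_ \in _); rewrite ?mulr0 ?mulr1.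
  by apply: integr_le (test_meas tf) (integrZ M1 iB1) _ => x; exact: h1.
have iD := iphi _ (test_D v tp).
have key t : 0 < t -> t <= 1 -> `|\int[leb]_x 'D_v phi x| <= M * K * t.
  move=> t0 t1.
  pose g := fun x => phi (t *: v + x) - phi x - t * 'D_v phi x.
  have it : integr (tr (t *: v) phi) by apply: iphi; exact: test_tr.
  have i1 : integr (tr (t *: v) phi - phi) by apply: integrB => //; exact: iphi.
  have gE : g = (tr (t *: v) phi - phi) - t *: 'D_v phi.
    by apply/funext => x; rewrite /g /tr !fctE addrC [x + _]addrC addrC.
  have ig : integr g by rewrite gE; apply: integrB => //; exact: integrZ.
  have : \int[leb]_x g x = - (t * \int[leb]_x 'D_v phi x).
    rewrite gE.
    have -> : \int[leb]_x ((tr (t *: v) phi - phi) - t *: 'D_v phi) x = \int[leb]_x (tr (t *: v) phi - phi) x - \int[leb]_x (t *: 'D_v phi) x.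
      by apply: RintegralB => //; exact: integrZ.
    have -> : \int[leb]_x (tr (t *: v) phi - phi) x = \int[leb]_x (tr (t *: v) phi) x - \int[leb]_x phi x.
      by apply: RintegralB => //; exact: iphi.
    rewrite trE Rintegral_aff ?subrr ?sub0r; [|by left|exact: test_meas].
    by congr (- _); apply: RintegralZl.
  move=> hg; have : `|\int[leb]_x g x| <= M * t ^+ 2 * K.
    apply: le_trans (le_normr_Rintegral measurableT ig) _.
    rewrite -RintegralZl//; apply: le_Rintegral => //.
    - exact: integr_norm.
    - exact: (integrZ _ iB).
    - by move=> x _; apply: hM; rewrite ger0_norm// ltW.
  rewrite hg normrN normrM (gtr0_norm t0) => h.
  have : t * `|\int[leb]_x 'D_v phi x| <= t * (M * K * t) by apply: le_trans h _; rewrite le_eqVlt; apply/orP; left; apply/eqP; ring.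
  by rewrite ler_pM2l.
have K0 : 0 <= K by apply: Rintegral_ge0 => x _; rewrite indicE.
apply/eqP; rewrite -normr_le0; apply/ler_addgt0Pr => e e0; rewrite add0r.
have p : 0 < M * K + 1 by rewrite ltr_wpDl ?mulr_ge0.
have t0 : 0 < Num.min 1 (e / (M * K + 1)) by rewrite lt_min ltr01 divr_gt0.
apply: le_trans (key _ t0 _) _; first by rewrite ge_min lexx.
apply: le_trans (_ : M * K * (e / (M * K + 1)) <= _).
  by rewrite ler_wpM2l ?mulr_ge0// ge_min lexx orbT.
rewrite mulrA ler_pdivrMr// mulrC ler_wpM2l ?(ltW e0)//.
by rewrite lerDl.
Qed.

Lemma test_IBP (phi psi : E -> R) v : test phi -> smooth psi ->
  \int[leb]_x (psi x * 'D_v phi x) = - \int[leb]_x ('D_v psi x * phi x).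
Proof.
move=> tp sp; have [sphi _ _] := tp.
have t1 := test_mull sp tp.
have E1 : 'D_v (psi * phi) = psi * 'D_v phi + 'D_v psi * phi.
  apply/funext => x; rewrite (deriveM (@smooth_derivable _ _ _ x v sp) (@smooth_derivable _ _ _ x v sphi)).
  by rewrite /GRing.scale /= !fctE [phi x * _]mulrC.
have iphi f : test f -> integr f.
  move=> tf; have [r1 [M1 [r10 M10 h1]]] := test_bound tf.
  have iB1 : integr (\1_(ball (0 : E) r1) : E -> R).
    have := L2M (L2_ballindic r1) (L2_ballindic r1); congr integr; apply/funext => x.
    by rewrite indicE; case: (_ \in _); rewrite ?mulr0 ?mulr1.
  by apply: integr_le (test_meas tf) (integrZ M1 iB1) _ => x; exact: h1.
have := integral_D0 v t1; rewrite E1.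
have -> : \int[leb]_x (psi * 'D_v phi + 'D_v psi * phi) x =
   \int[leb]_x (psi x * 'D_v phi x) + \int[leb]_x ('D_v psi x * phi x).
  apply: (RintegralD measurableT); first exact: (iphi _ (test_mull sp (test_D v tp))).
  exact: (iphi _ (test_mull (smooth_D v sp) tp)).
by move=> /eqP; rewrite addr_eq0 => /eqP.
Qed.

End density.

Lemma cvgR_unique (R : realType) (T : Type) (F : set_system T) {FF : ProperFilter F} (f : T -> R) (a b : R) :
  f t @[t --> F] --> a -> f t @[t --> F] --> b -> a = b.
Proof. by move=> h1 h2; rewrite -(cvg_lim _ h1)// (cvg_lim _ h2). Qed.

(** * The space H^1 *)

HB.lock Definition grad {R : realType} {d : nat} (i : 'I_d) (f : 'rV[R]_d -> R) : 'rV[R]_d -> R :=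
  wpartial i f.

Section sobolev_space.
Context {R : realType} {d : nat}.
Local Notation E := 'rV[R]_d.
Local Notation leb := (@lebesgue_rV R d).
Local Notation nm := (snorm (@ip R d)).
Local Notation test := (test_function (@setT E)).
Let S2 := @L2_semi R d.
Implicit Types (f g : E -> R) (i : 'I_d).

Lemma ip_weakP i f g : weak_partial i f g <->
  forall phi, test phi -> ip f ('D_(dir i) phi) = - ip g phi.
Proof. by split=> h phi tp; have := h phi tp; rewrite !ipE. Qed.

Lemma wp_smooth i (psi : E -> R) : smooth psi -> weak_partial i psi ('D_(dir i) psi).
Proof. by move=> sp phi tp; exact: test_IBP. Qed.

Lemma wp_uniq i f g h : L2 g -> L2 h -> weak_partial i f g -> weak_partial i f h ->
  g = h %[ae leb].
Proof.
move=> Lg Lh hg hh.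
have h0 : g - h = 0 %[ae leb].
  apply: test_separating => [|phi tp]; first exact: (siB S2).
  rewrite (siBl S2)//; last exact: test_L2.
  have := (ip_weakP i f g).1 hg _ tp; rewrite ((ip_weakP i f h).1 hh _ tp) => /oppr_inj hgh.
  by apply/eqP; rewrite subr_eq0; apply/eqP; exact: esym hgh.
apply: filterS h0 => x /= /(_ Logic.I) h0 _.
by move: h0; rewrite fctE => /eqP; rewrite subr_eq0 => /eqP.
Qed.

Lemma wp_lin i a f g f' g' : L2 f -> L2 g -> L2 f' -> L2 g' ->
  weak_partial i f f' -> weak_partial i g g' -> weak_partial i (a *: f + g) (a *: f' + g').
Proof.
move=> Lf Lg Lf' Lg' hf hg; apply/ip_weakP => phi tp.
have Lp := test_L2 tp; have LD := test_L2 (test_D (dir i) tp).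
rewrite (siDZl S2)// (siDZl S2)//.
have -> := (ip_weakP i f f').1 hf _ tp.
have -> := (ip_weakP i g g').1 hg _ tp.
ring.
Qed.

Lemma wp_tr i a f g : L2 f -> L2 g -> weak_partial i f g -> weak_partial i (tr a f) (tr a g).
Proof.
move=> Lf Lg h; apply/ip_weakP => phi tp.
rewrite ip_trl//; last by apply: test_L2; exact: test_D.
rewrite ip_trl//; last exact: test_L2.
rewrite -D_tr; apply: (ip_weakP i f g).1 h _ _; exact: test_tr.
Qed.

Lemma H1_L2 f : H1 f -> L2 f. Proof. by case. Qed.

Lemma gradP i f : H1 f -> L2 (grad i f) /\ weak_partial i f (grad i f).
Proof.
move=> [_ /(_ i)[g hg]]; rewrite grad.unlock /wpartial.
by case: xgetP => [h -> //|/(_ g)].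
Qed.

Lemma L2_grad i f : H1 f -> L2 (grad i f).
Proof. by move=> /(gradP i)[]. Qed.

Lemma grad_wp i f : H1 f -> weak_partial i f (grad i f).
Proof. by move=> /(gradP i)[]. Qed.

Lemma H1I f (g : 'I_d -> E -> R) : L2 f -> (forall i, L2 (g i)) ->
  (forall i, weak_partial i f (g i)) -> H1 f.
Proof. by move=> Lf Lg h; split => // i; exists (g i). Qed.

Lemma grad_ae i f g : H1 f -> L2 g -> weak_partial i f g -> grad i f = g %[ae leb].
Proof.
by move=> Hf Lg h; apply: (wp_uniq _ Lg _ h); [exact: L2_grad|exact: grad_wp].
Qed.

Definition aform f g : R := ip f g + \sum_i ip (grad i f) (grad i g).

Lemma ip_ael f f' g : L2 f -> L2 f' -> L2 g -> f = f' %[ae leb] -> ip f g = ip f' g.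
Proof. by move=> Lf Lf' Lg h; apply: ip_ae => //; exact: nearW. Qed.

Lemma ip_grad_lin i a f g h : H1 f -> H1 g -> L2 h ->
  ip (grad i (a *: f + g)) h = a * ip (grad i f) h + ip (grad i g) h.
Proof.
move=> Hf Hg Lh.
have Lf := L2_grad i Hf; have Lg := L2_grad i Hg.
have h1 : weak_partial i (a *: f + g) (a *: grad i f + grad i g).
  by apply: wp_lin; [exact: H1_L2|exact: H1_L2|by []|by []|exact: grad_wp|exact: grad_wp].
have Hs : H1 (a *: f + g).
  apply: (@H1I _ (fun j => a *: grad j f + grad j g)).
  - by apply: L2_lin; exact: H1_L2.
  - by move=> j; apply: L2_lin; exact: L2_grad.
  - by move=> j; apply: wp_lin; [exact: H1_L2|exact: H1_L2|exact: L2_grad|exact: L2_grad|exact: grad_wp|exact: grad_wp].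
have Ls : L2 (a *: grad i f + grad i g) by exact: L2_lin.
rewrite (ip_ael _ Ls Lh (grad_ae Hs Ls h1)); last exact: L2_grad.
by rewrite (siDZl S2).
Qed.

Lemma H1_lin a f g : H1 f -> H1 g -> H1 (a *: f + g).
Proof.
move=> Hf Hg; apply: (@H1I _ (fun j => a *: grad j f + grad j g)).
- by apply: L2_lin; exact: H1_L2.
- by move=> j; apply: L2_lin; exact: L2_grad.
- by move=> j; apply: wp_lin; [exact: H1_L2|exact: H1_L2|exact: L2_grad|exact: L2_grad|exact: grad_wp|exact: grad_wp].
Qed.

Lemma test_H1 phi : test phi -> H1 phi.
Proof.
move=> tp; apply: (@H1I _ (fun i => 'D_(dir i) phi)); first exact: test_L2.
- by move=> i; apply: test_L2; exact: test_D.
- by move=> i; apply: wp_smooth; case: tp.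
Qed.

Lemma test0 : test (0 : E -> R).
Proof. by apply: (@ball_test _ _ _ 1); first exact: (smooth_cst 0). Qed.

Lemma aform_lin a f g h : H1 f -> H1 g -> H1 h ->
  aform (a *: f + g) h = a * aform f h + aform g h.
Proof.
move=> Hf Hg Hh.
have e0 : ip (a *: f + g) h = a * ip f h + ip g h.
  exact: (siDZl S2 a (H1_L2 Hf) (H1_L2 Hg) (H1_L2 Hh)).
have e1 i : ip (grad i (a *: f + g)) (grad i h) =
    a * ip (grad i f) (grad i h) + ip (grad i g) (grad i h).
  exact: (ip_grad_lin i a Hf Hg (L2_grad i Hh)).
rewrite /aform e0 (eq_bigr _ (fun i _ => e1 i)) big_split /= -mulr_sumr.
by ring.
Qed.

Lemma H1_semi : semi_inner (@H1 R d) aform.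
Proof.
split.
- exact: test_H1 test0.
- exact: H1_lin.
- move=> f g Hf Hg; rewrite /aform; congr (_ + _); first exact: (siC S2 (H1_L2 Hf) (H1_L2 Hg)).
  by apply: eq_bigr => i _; exact: (siC S2 (L2_grad i Hf) (L2_grad i Hg)).
- exact: aform_lin.
- move=> f Hf; apply: addr_ge0; first by apply: (si_ge0 S2); exact: H1_L2.
  by apply: sumr_ge0 => i _; apply: (si_ge0 S2); exact: L2_grad.
Qed.

Local Notation hn := (snorm aform).
Let SH := H1_semi.

Lemma H1normE f : H1 f -> H1norm f = hn f.
Proof.
move=> Hf; rewrite /H1norm /snorm /aform; congr Num.sqrt.
rewrite -ip_ff; last exact: H1_L2.
congr (_ + _); apply: eq_bigr => i _; have := L2_grad i Hf; rewrite grad.unlock => Lg.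
by rewrite -ip_ff.
Qed.

Lemma nm_le_hn f : H1 f -> nm f <= hn f.
Proof.
move=> Hf; rewrite ler_sqrt; last exact: (si_ge0 SH).
rewrite /aform lerDl; apply: sumr_ge0 => i _; apply: (si_ge0 S2); exact: L2_grad.
Qed.

Lemma nm_wp_le_hn i f : H1 f -> nm (grad i f) <= hn f.
Proof.
move=> Hf; rewrite ler_sqrt; last exact: (si_ge0 SH).
rewrite /aform (bigD1 i) //= addrCA lerDl; apply: addr_ge0.
  by apply: (si_ge0 S2); exact: H1_L2.
by apply: sumr_ge0 => j _; apply: (si_ge0 S2); exact: L2_grad.
Qed.

Lemma aformE f g (f' g' : 'I_d -> E -> R) : L2 f -> L2 g -> (forall i, L2 (f' i)) -> (forall i, L2 (g' i)) ->
  (forall i, weak_partial i f (f' i)) -> (forall i, weak_partial i g (g' i)) ->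
  aform f g = ip f g + \sum_i ip (f' i) (g' i).
Proof.
move=> Lf Lg Lf' Lg' hf hg; congr (_ + _); apply: eq_bigr => i _.
have Hf : H1 f by exact: H1I hf.
have Hg : H1 g by exact: H1I hg.
by apply: ip_ae; [exact: L2_grad|exact: L2_grad|by []|by []|exact: grad_ae|exact: grad_ae].
Qed.

Lemma H1_tr a f : H1 f -> H1 (tr a f).
Proof.
move=> Hf; apply: (@H1I _ (fun i => tr a (grad i f))).
- by apply: L2_tr; exact: H1_L2.
- by move=> i; apply: L2_tr; exact: L2_grad.
- by move=> i; apply: wp_tr; [exact: H1_L2|exact: L2_grad|exact: grad_wp].
Qed.

Lemma aform_tr a f g : H1 f -> H1 g -> aform (tr a f) (tr a g) = aform f g.
Proof.
move=> Hf Hg; rewrite (@aformE _ _ (fun i => tr a (grad i f)) (fun i => tr a (grad i g))).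
- rewrite ip_tr; [|exact: H1_L2..]; congr (_ + _); apply: eq_bigr => i _.
  by rewrite ip_tr//; exact: L2_grad.
- by apply: L2_tr; exact: H1_L2.
- by apply: L2_tr; exact: H1_L2.
- by move=> i; apply: L2_tr; exact: L2_grad.
- by move=> i; apply: L2_tr; exact: L2_grad.
- by move=> i; apply: wp_tr; [exact: H1_L2|exact: L2_grad|exact: grad_wp].
- by move=> i; apply: wp_tr; [exact: H1_L2|exact: L2_grad|exact: grad_wp].
Qed.

Lemma hn_tr a f : H1 f -> hn (tr a f) = hn f.
Proof. by move=> Hf; rewrite /snorm aform_tr. Qed.

Lemma aform_trl a f g : H1 f -> H1 g -> aform (tr a f) g = aform f (tr (- a) g).
Proof.
move=> Hf Hg; rewrite -[in LHS](tr0 g) -(subrr a) -tr_tr aform_tr//; exact: H1_tr.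
Qed.

(** By duality the translation falls on a test function. The pairing [m s] then has the derivative
    [ip w (tr ...)] with [w] the weak derivative, bounded by [nm w * nm phi], and the mean value
    theorem concludes. *)
Lemma nm_tr_dir i f (t : R) : H1 f ->
  nm (tr (t *: dir i) f - f) <= `|t| * nm (grad i f).
Proof.
move=> Hf; have Lf := H1_L2 Hf; have Lw := L2_grad i Hf.
apply: nm_dual => [||phi tp]; first by apply: (siB S2) => //; exact: L2_tr.
  by rewrite mulr_ge0// snorm_ge0.
have Lp := test_L2 tp; set w := grad i f in Lw *.
pose m (s : R) := ip f (tr (- (s *: dir i)) phi).
have Lt s : L2 (tr (- (s *: dir i)) phi) by exact: L2_tr.
have tt s : test (tr (- (s *: dir i)) phi) by exact: test_tr.
have dm (s : R) : is_derive s 1 m (ip w (tr (- (s *: dir i)) phi)).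
  have e1 : ip w (tr (- (s *: dir i)) phi) = - ip f ('D_(dir i) (tr (- (s *: dir i)) phi)).
    by have := (ip_weakP i f _).1 (grad_wp i Hf) _ (tt s) => h; apply: oppr_inj; rewrite opprK -h.
  have [r [M [r0 M0 hM]]] := test_line_bound (dir i) (tt s).
  set K := nm f * (M * nm (\1_(ball (0 : E) r) : E -> R)).
  have K0 : 0 <= K by rewrite !mulr_ge0// snorm_ge0.
  have key h : `|h| <= 1 -> `|m (h + s) - m s - h * ip w (tr (- (s *: dir i)) phi)| <= K * h ^+ 2.
    move=> h1; set p := tr (- (s *: dir i)) phi.
    have Lpp : L2 p by exact: Lt.
    have LD : L2 ('D_(dir i) p) by apply: test_L2; apply: test_D; exact: tt.
    have e2 : tr (- ((h + s) *: dir i)) phi = tr ((- h) *: dir i) p.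
      by rewrite tr_tr scalerDl opprD scaleNr.
    have L3 : L2 (tr ((- h) *: dir i) p) by exact: L2_tr.
    have -> : m (h + s) - m s - h * ip w p = ip f (tr ((- h) *: dir i) p - p - (- h) *: 'D_(dir i) p).
      have L4 := siB S2 L3 Lpp; have L5 := siZ S2 (- h) LD.
      rewrite (siBr S2)// (siBr S2)// (siZr S2)// /m e2 e1; ring.
    set q := _ - _ - _.
    have Lq : L2 q by apply: (siB S2); [exact: (siB S2)|exact: (siZ S2)].
    apply: le_trans (si_CS S2 Lf Lq) _; rewrite /K -mulrA ler_wpM2l ?snorm_ge0//.
    have hb x : `|q x| <= M * h ^+ 2 * \1_(ball (0 : E) r) x.
      have := hM (- h) x; rewrite normrN sqrrN => /(_ h1).
      by rewrite (addrC (- h *: dir i) x).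
    have [_ /le_trans] := L2_bounded (L2_meas Lq) hb; apply.
    have p0 : 0 <= M * h ^+ 2 by rewrite mulr_ge0 ?sqr_ge0.
    by rewrite (ger0_norm p0) mulrAC.
  have cv : (fun h => h^-1 *: ((m \o shift s) (h *: 1) - m s)) @ 0^' --> ip w (tr (- (s *: dir i)) phi).
    apply/cvgrPdist_le => e e0; have K1 : 0 < K + 1 by lra.
    near=> h.
    have h0 : h != 0 by near: h; exact: nbhs_dnbhs_neq.
    have h1 : `|h| <= 1 by apply: ltW; near: h; exact: dnbhs0_lt.
    have h2 : `|h| < e / (K + 1) by near: h; apply: dnbhs0_lt; rewrite divr_gt0.
    have hp : 0 < `|h| by rewrite normr_gt0.
    rewrite distrC /= [h *: 1]mulr1.
    have -> : h^-1 *: (m (h + s) - m s) - ip w (tr (- (s *: dir i)) phi) = h^-1 * (m (h + s) - m s - h * ip w (tr (- (s *: dir i)) phi)).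
      by rewrite /GRing.scale /=; field.
    rewrite normrM normfV ler_pdivrMl//; apply: le_trans (key h h1) _.
    rewrite -[h ^+ 2]real_normK ?num_real// expr2 mulrCA ler_wpM2l//.
    by move: h2; rewrite ltr_pdivlMr// => h2; nra.
  by apply: DeriveDef; [apply/cvg_ex; eexists; exact: cv|exact: cvg_lim].
have bd s : `|ip w (tr (- (s *: dir i)) phi)| <= nm w * nm phi.
  by have := si_CS S2 Lw (Lt s); rewrite nm_tr.
have cm : continuous m.
  by move=> s; apply: differentiable_continuous; apply/derivable1_diffP; have [] := dm s.
have e3 : ip (tr (t *: dir i) f - f) phi = m t - m 0.
  by rewrite (siBl S2)//; [rewrite ip_trl// /m scale0r oppr0 tr0|exact: L2_tr].
rewrite e3; apply: le_trans (ler_norm _) _.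
have [t0|t0|->] := ltgtP t 0; last by rewrite subrr !normr0 mul0r mul0r.
- have [s _] := @MVT R m _ t 0 t0 (fun s _ => dm s) (continuous_subspaceT cm).
  rewrite distrC => ->; rewrite normrM sub0r normrN mulrC -mulrA ler_wpM2l//; exact: bd.
- have [s _ ->] := @MVT R m _ 0 t t0 (fun s _ => dm s) (continuous_subspaceT cm).
  rewrite normrM subr0 mulrC -mulrA ler_wpM2l//; exact: bd.
Unshelve. all: by end_near. Qed.

(** The translation is made along one coordinate axis at a time; [s k] keeps the first [k]
    coordinates of [h]. *)
Lemma nm_tr_H1 f (h : E) : H1 f ->
  nm (tr h f - f) <= `|h| * \sum_i nm (grad i f).
Proof.
move=> Hf; have Lf := H1_L2 Hf.
pose s (k : nat) : E := \row_i (if (i < k)%N then h ord0 i else 0).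
have sS k (kd : (k < d)%N) : s k.+1 = h ord0 (Ordinal kd) *: dir (Ordinal kd) + s k.
  apply/rowP => j; rewrite !mxE eqxx /= ltnS leq_eqVlt.
  have -> : (j == Ordinal kd) = (j == k :> nat) by [].
  case: eqP => [jk|_]; rewrite /= ?mulr0 ?add0r// mulr1.
  have -> : j = Ordinal kd by apply: val_inj.
  by rewrite ltnn addr0.
have key k : (k <= d)%N -> nm (tr (s k) f - f) <= \sum_(i < d | (i < k)%N) `|h ord0 i| * nm (grad i f).
  elim: k => [_|k ih kd].
    have -> : s 0%N = 0 by apply/rowP => j; rewrite !mxE.
    by rewrite tr0 subrr (snorm0 S2) big_pred0.
  have h1 := ih (ltnW kd).
  rewrite (bigD1 (Ordinal kd)) //=.
  rewrite (eq_bigl (fun i : 'I_d => (i < k)%N)); last first.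
    move=> i; rewrite ltnS leq_eqVlt -(inj_eq val_inj) /=.
    by case: eqP => [->|_] /=; rewrite ?ltnn ?andbT.
  have L1 : L2 (tr (s k.+1) f) by exact: L2_tr.
  have L2k : L2 (tr (s k) f) by exact: L2_tr.
  apply: le_trans (snorm_triangle S2 L1 L2k Lf) _.
  apply: lerD => //.
  have -> : tr (s k.+1) f - tr (s k) f = tr (s k) (tr (h ord0 (Ordinal kd) *: dir (Ordinal kd)) f - f).
    by rewrite sS (addrC _ (s k)) trB tr_tr.
  rewrite nm_tr; first exact: nm_tr_dir.
  by apply: (siB S2) => //; exact: L2_tr.
have -> : h = s d by apply/rowP => j; rewrite !mxE ltn_ord.
apply: le_trans (key d (leqnn d)) _.
rewrite mulr_sumr [X in _ <= X](eq_bigl (fun i : 'I_d => (i < d)%N)); last by move=> i; rewrite ltn_ord.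
apply: ler_sum => i _; rewrite ler_wpM2r ?snorm_ge0//.
have -> : h ord0 i = s d ord0 i by rewrite !mxE ltn_ord.
exact: coord_le_norm.
Qed.

Lemma nm_tr_cont f (e : R) : L2 f -> 0 < e ->
  exists2 del, 0 < del & forall h : E, `|h| <= del -> nm (tr h f - f) <= e.
Proof.
move=> Lf e0; have e4 : 0 < e / 4 by rewrite divr_gt0.
have [phi [tp hp]] := test_dense Lf e4.
have Hp := test_H1 tp; have Lp := test_L2 tp.
set K := \sum_i nm (grad i phi).
have K0 : 0 <= K by apply: sumr_ge0 => i _; exact: snorm_ge0.
have K1 : 0 < K + 1 by lra.
exists (e / 4 / (K + 1)); first by rewrite divr_gt0.
move=> h hh; have h1 := nm_tr_H1 h Hp; rewrite -/K in h1.
rewrite ler_pdivlMr// in hh.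
have h2 : `|h| * K <= e / 4 by apply: le_trans hh; rewrite ler_wpM2l// lerDl.
have Ld := siB S2 Lf Lp.
have -> : tr h f - f = tr h (f - phi) + (tr h phi - phi) - (f - phi).
  by apply/funext => x; rewrite /tr !fctE; ring.
have La : L2 (tr h (f - phi)) by exact: L2_tr.
have Lb : L2 (tr h phi - phi) by apply: (siB S2) => //; exact: L2_tr.
apply: le_trans (snormB S2 (siD S2 La Lb) Ld) _.
have := snormD S2 La Lb; rewrite nm_tr//.
move=> h3; lra.
Qed.

(** The function and its weak derivatives have weak limits in L^2 separately; testing the definition
    of the weak derivative shows that these limits fit together. *)
Lemma H1_weak_ultra (T : Type) (U : set_system T) {UU : UltraFilter U} (u : T -> E -> R) (C : R) :
  (forall t, H1 (u t)) -> (forall t, hn (u t) <= C) ->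
  exists g, [/\ H1 g, forall f, L2 f -> ip (u t) f @[t --> U] --> ip g f &
    forall i f, L2 f -> ip (grad i (u t)) f @[t --> U] --> ip (grad i g) f].
Proof.
move=> Hu uC.
have FU : ProperFilter U by exact: ultra_proper.
have [g [Lg hg]] := @L2_weak_ultra R d T U UU u C (fun t => H1_L2 (Hu t)) (fun t => le_trans (nm_le_hn (Hu t)) (uC t)).
have hgi i : exists gi, L2 gi /\ forall f, L2 f -> ip (grad i (u t)) f @[t --> U] --> ip gi f.
  exact: (@L2_weak_ultra R d T U UU (fun t => grad i (u t)) C (fun t => L2_grad i (Hu t)) (fun t => le_trans (nm_wp_le_hn i (Hu t)) (uC t))).
have [gi hgi'] := choice hgi.
have wg i : weak_partial i g (gi i).
  apply/ip_weakP => phi tp; have [_ h1] := hgi' i.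
  have c1 := hg _ (test_L2 (test_D (dir i) tp)).
  have c2 : (- ip (grad i (u t)) phi) @[t --> U] --> - ip (gi i) phi.
    by apply: cvgN; exact: (h1 _ (test_L2 tp)).
  have e1 : (fun t => ip (u t) ('D_(dir i) phi)) = (fun t => - ip (grad i (u t)) phi).
    by apply/funext => t; exact: ((ip_weakP i _ _).1 (grad_wp i (Hu t)) _ tp).
  rewrite e1 in c1; exact: (cvgR_unique c1 c2).
have Hg : H1 g by apply: (@H1I _ gi) => // i; have [] := hgi' i.
exists g; split => // i f Lf; have [Li h1] := hgi' i.
by rewrite (ip_ael _ Li Lf (grad_ae Hg Li (wg i)));[exact: h1|exact: L2_grad].
Qed.

End sobolev_space.

(** * Averages over dyadic cubes *)

Section cubes.
Context {R : realType} {d : nat}.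
Local Notation E := 'rV[R]_d.
Local Notation leb := (@lebesgue_rV R d).
Implicit Types (x y : E) (k : nat).

Definition cube k : set E := [set y | forall i, 0 <= y ord0 i < 2 ^- k].

(** The lower corner of the dyadic cube of side [2^-k] that contains [x]. *)
Definition corner k x : E := \row_i ((Num.floor (2 ^+ k * x ord0 i))%:~R * 2 ^- k).

Lemma side_gt0 k : 0 < 2 ^- k :> R.
Proof. by rewrite invr_gt0 exprn_gt0. Qed.

Lemma floor_side k (t : R) (m : int) : m%:~R * 2 ^- k <= t < m%:~R * 2 ^- k + 2 ^- k ->
  Num.floor (2 ^+ k * t) = m.
Proof.
have s0 := side_gt0 k; have p0 : 0 < 2 ^+ k :> R by rewrite exprn_gt0.
move=> /andP[h1 h2]; apply/floor_def.
rewrite -(ler_pM2l s0) mulrA mulVf ?gt_eqF// mul1r mulrC h1/=.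
rewrite -(ltr_pM2l s0) mulrA mulVf ?gt_eqF// mul1r mulrC rmorphD/= mulrDl mul1r.
exact: h2.
Qed.

Lemma corner_itv k x i : 0 <= x ord0 i - corner k x ord0 i < 2 ^- k.
Proof.
have s0 := side_gt0 k; have p0 : 0 < 2 ^+ k :> R by rewrite exprn_gt0.
rewrite mxE; have := floor_itv (2 ^+ k * x ord0 i) => /andP[h1 h2].
rewrite subr_ge0 ltrBlDl.
rewrite -(ler_pM2l p0) mulrCA mulfV ?gt_eqF// mulr1 h1/=.
rewrite -(ltr_pM2l p0) mulrDr mulrCA mulfV ?gt_eqF// mulr1.
by move: h2; rewrite rmorphD.
Qed.

(** Dyadic cubes are nested: the cube of side [2^-(k+1)] around [x] lies in the one of side [2^-k].
    With [n] and [m] the two integer parts this is [2 n <= m] and [m + 1 <= 2 n + 2]. *)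
Lemma corner_corner k x y : cube k.+1 y -> corner k (corner k.+1 x + y) = corner k x.
Proof.
move=> hy; apply/rowP => i; rewrite [LHS]mxE [RHS]mxE; congr (_%:~R * _).
set n := Num.floor (2 ^+ k * x ord0 i); apply: floor_side.
have := corner_itv k x i; rewrite mxE -/n => /andP[h1 h2].
have /andP[h5 h6] := hy i; rewrite !mxE.
have /andP[h3 h4] := floor_itv (2 ^+ k.+1 * x ord0 i).
set m := Num.floor (2 ^+ k.+1 * x ord0 i) in h3 h4 *.
have s0 := side_gt0 k.+1.
have e : 2 ^- k = 2 * 2 ^- k.+1 :> R by rewrite exprS invfM mulrA mulfV// mul1r.
have E2 : 2 ^+ k.+1 * 2 ^- k.+1 = 1 :> R by rewrite mulfV// expf_neq0.
move: h1 h2 h3 h4 h5 h6; rewrite e; move: E2 s0.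
move: (2 ^+ k.+1) (2 ^- k.+1) => P s E2 s0 h1 h2 h3 h4 h5 h6.
have P0 : 0 < P by rewrite -(pmulr_lgt0 _ s0) E2.
have a1 : n * 2 <= m.
  rewrite -ltzD1 -(ltr_int R); apply: le_lt_trans h4; rewrite intrM.
  have := ler_wpM2l (ltW P0) (_ : n%:~R * (2 * s) <= x ord0 i).
  have -> : P * (n%:~R * (2 * s)) = (n%:~R * 2) * (P * s) by ring.
  by rewrite E2 mulr1; apply; lra.
have a2 : m < n * 2 + 2.
  rewrite -(ltr_int R) intrD intrM; apply: le_lt_trans h3 _.
  have := @ltr_pM2l _ P P0 (x ord0 i) (n%:~R * (2 * s) + 2 * s).
  have -> : P * (n%:~R * (2 * s) + 2 * s) = (n%:~R * 2 + 2) * (P * s) by ring.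
  by rewrite E2 mulr1 => ->; lra.
have a1' : n%:~R * 2 <= m%:~R :> R by rewrite -(intrM _ n 2) ler_int.
have a2' : m%:~R + 1 <= n%:~R * 2 + 2 :> R.
  by rewrite -(intrM _ n 2) -(intrD _ _ 2) -(intrD _ m 1) ler_int lezD1.
have := ler_wpM2r (ltW s0) a1'; have := ler_wpM2r (ltW s0) a2'.
by rewrite !mulrDl => b1 b2; apply/andP; split; lra.
Qed.

Lemma box_prod_EFin (c : R) : (\prod_(i < d) c%:E = (c ^+ d)%:E)%E.
Proof. by rewrite prodEFin prodr_const card_ord. Qed.

Lemma measurable_rV_box (A : set R) : measurable A -> measurable [set y : E | forall i, A (y ord0 i)].
Proof.
move=> mA; rewrite (_ : [set y : E | _] = \bigcap_(i : 'I_d) ((fun y : E => y ord0 i) @^-1` A)).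
  apply: fin_bigcap_measurable => // i _.
  by rewrite -[X in measurable X]setTI; apply: measurable_coord.
by apply/seteqP; split => y /=; [move=> h i _; exact: h|move=> h i; exact: h].
Qed.

Lemma cubeE k : cube k = [set y | forall i, `[0, 2 ^- k[%classic (y ord0 i)].
Proof. by apply/seteqP; split => y /= h i; have := h i; rewrite in_itv. Qed.

Lemma measurable_cube k : measurable (cube k).
Proof. by rewrite cubeE; exact: measurable_rV_box. Qed.

Lemma lebesgue_cube k : leb (cube k) = ((2 ^- k) ^+ d)%:E.
Proof.
rewrite cubeE (lebesgue_rV_box (A := fun=> `[0, 2 ^- k[%classic))//.
rewrite -box_prod_EFin; apply: eq_bigr => i _.
by rewrite lebesgue_measure_itv/= lte_fin side_gt0 sube0.
Qed.

Lemma lebesgue_ball0 (r : R) : 0 < r -> leb (ball (0 : E) r) = ((2 * r) ^+ d)%:E.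
Proof.
move=> r0; rewrite (_ : ball (0 : E) r = [set y | forall i, ball (0 : R) r (y ord0 i)]).
  rewrite (lebesgue_rV_box (A := fun i => ball (0 : R) r)) => [|i]; last exact: measurable_ball.
  rewrite -box_prod_EFin; apply: eq_bigr => i _.
  by rewrite lebesgue_measure_ball ?(ltW r0)// mulr_natl.
by apply/seteqP; split => y /=; [move=> /(ball_rVP _ _ r0) h i|move=> h; apply/(ball_rVP _ _ r0) => i];
   have := h i; rewrite /ball/= mxE.
Qed.

Lemma cube_ball k x y : cube k y -> ball (0 : E) (2 ^- k) (y + (corner k x - x)).
Proof.
move=> hy; apply/ball_rVP; first exact: side_gt0.
move=> i; have /andP[h1 h2] := hy i; have := corner_itv k x i; rewrite !mxE => /andP[h3 h4].
by rewrite ltr_norml; apply/andP; split; lra.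
Qed.

End cubes.

(** The mean of [u] over the dyadic cube of side [2^-k] that contains [x]; the prefactor is the
    inverse of its volume. *)
HB.lock Definition avg {R : realType} {d : nat} (k : nat) (u : 'rV[R]_d -> R) (x : 'rV[R]_d) : R :=
  (2 ^+ k) ^+ d * ip (tr (corner k x) u) (\1_(cube k)).

Section averages.
Context {R : realType} {d : nat}.
Local Notation E := 'rV[R]_d.
Local Notation leb := (@lebesgue_rV R d).
Local Notation nm := (snorm (@ip R d)).
Local Notation V k := (((2 : R) ^+ k) ^+ d).
Let S2 := @L2_semi R d.
Implicit Types (u w : E -> R) (x y : E) (k : nat).

Lemma avgE k u x : avg k u x = V k * ip (tr (corner k x) u) (\1_(cube k)).
Proof. by rewrite avg.unlock. Qed.

Lemma vol_gt0 k : 0 < V k.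
Proof. by rewrite !exprn_gt0. Qed.

Lemma L2_cube k : L2 (\1_(cube k) : E -> R).
Proof. by apply: L2_indic; [exact: measurable_cube|rewrite lebesgue_cube ltry]. Qed.

Lemma ip_indic (A : set E) : measurable A -> ip (\1_A : E -> R) \1_A = fine (leb A).
Proof.
move=> mA; rewrite ipE.
rewrite (_ : (fun x => _) = \1_A); last by rewrite -[LHS]/(\1_A \* \1_A) -indicI setIid.
by rewrite /Rintegral integral_indic// setIT.
Qed.

Lemma ip_cube k : ip (\1_(cube k) : E -> R) \1_(cube k) = (V k)^-1.
Proof. by rewrite ip_indic ?lebesgue_cube/= ?exprVn//; exact: measurable_cube. Qed.

Lemma nm_cube k : nm (\1_(cube k) : E -> R) = Num.sqrt (V k)^-1.
Proof. by rewrite /snorm ip_cube. Qed.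

Lemma avg_le k u x : L2 u -> `|avg k u x| <= Num.sqrt (V k) * nm u.
Proof.
move=> Lu; rewrite avgE normrM gtr0_norm ?vol_gt0//.
have h := si_CS S2 (L2_tr (corner k x) Lu) (L2_cube k).
rewrite nm_tr// nm_cube in h.
apply: le_trans (ler_wpM2l (ltW (vol_gt0 k)) h) _.
rewrite sqrtrV ?(ltW (vol_gt0 k))// mulrCA [leRHS]mulrC ler_wpM2l ?snorm_ge0//.
have p : 0 < Num.sqrt (V k) by rewrite sqrtr_gt0 vol_gt0.
by rewrite -{1}(sqr_sqrtr (ltW (vol_gt0 k))) expr2 mulfK// gt_eqF.
Qed.

Lemma avgB k u w x : L2 u -> L2 w -> avg k (u - w) x = avg k u x - avg k w x.
Proof.
move=> Lu Lw; rewrite !avgE trB (siBl S2) ?mulrBr//; [exact: L2_tr..|exact: L2_cube].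
Qed.

Lemma avg_meas k u : measurable_fun setT (avg k u).
Proof.
move=> _ Y mY; rewrite setTI.
pose c (z : 'rV[int]_d) : E := \row_i ((z ord0 i)%:~R * 2 ^- k).
pose B (z : 'rV[int]_d) : set E := if `[< Y (V k * ip (tr (c z) u) (\1_(cube k))) >] then affine 1 (- c z) @^-1` cube k else set0.
rewrite (_ : _ @^-1` _ = \bigcup_z B z).
  apply: countable_bigcupT_measurable => [|z]; first exact/countableP.
  rewrite /B; case: ifP => _ //; rewrite -[X in measurable X]setTI.
  by apply: measurable_affine => //; exact: measurable_cube.
have hc x : corner k x = c (\row_i Num.floor (2 ^+ k * x ord0 i)).
  by apply/rowP => i; rewrite !mxE.
apply/seteqP; split => x /=.
  rewrite avgE => hx; exists (\row_i Num.floor (2 ^+ k * x ord0 i)) => //.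
  rewrite /B -hc; case: asboolP => // _ i; rewrite /affine scale1r.
  by have := corner_itv k x i; rewrite !mxE.
move=> [z _]; rewrite /B; case: asboolP => // hY hx; rewrite avgE.
suff -> : corner k x = c z by [].
apply/rowP => i; rewrite [LHS]mxE [RHS]mxE; congr (_%:~R * _); apply: floor_side.
by have := hx i; rewrite /affine scale1r !mxE => /andP[h1 h2]; apply/andP; split; lra.
Qed.

(** [avg k u] is constant on the smaller cube, so it is its own average at scale [k+1], and the
    difference is the average of [u - avg k u]. *)
Lemma avg_tower k u x : L2 u -> L2 (avg k u) ->
  `|avg k.+1 u x - avg k u x| <= Num.sqrt (V k.+1) * nm (u - avg k u).
Proof.
move=> Lu La; suff -> : avg k u x = avg k.+1 (avg k u) x.
  by rewrite -avgB//; apply: avg_le; exact: (siB S2).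
rewrite [RHS]avgE (_ : ip _ _ = avg k u x * ip (\1_(cube k.+1) : E -> R) \1_(cube k.+1)).
  by rewrite ip_cube mulrCA mulfV ?mulr1// gt_eqF// vol_gt0.
rewrite -(siZl S2); [|exact: L2_cube..]; rewrite !ipE; apply: eq_Rintegral => y _.
rewrite /tr addrC -[(_ *: _) y]/(avg k u x * \1_(cube k.+1) y) /=.
have [hy|hy] := pselect (cube k.+1 y); last by rewrite !indicE memNset// !mulr0.
by rewrite [\1_(cube k.+1) y]indicE mem_set// !mulr1 [LHS]avgE [RHS]avgE corner_corner.
Qed.

(** The dyadic cube of [x] lies in the ball of radius [2^-k] around [x] for the maximum norm. The
    bound in terms of that ball no longer refers to the position of the cube, so that it can be
    integrated in [x]. *)
Lemma avg_pointwise k u x : L2 u ->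
  let w := fun h : E => (u (x + h) - u x) * \1_(ball (0 : E) (2 ^- k)) h in
  L2 w /\ `|u x - avg k u x| <= Num.sqrt (V k) * nm w.
Proof.
move=> Lu w; have LB : L2 (\1_(ball (0 : E) (2 ^- k)) : E -> R) by exact: L2_ballindic.
have Lt a (A : set E) : measurable A -> (leb A < +oo)%E -> L2 (fun h => (u (h + a) - u x) * \1_A h : R).
  move=> mA fA; have LA := L2_indic mA fA.
  rewrite (_ : (fun h => _) = (fun h => tr a u h * \1_A h) - u x *: (\1_A : E -> R)); last first.
    by apply/funext => h; rewrite -[RHS]/(tr a u h * \1_A h - u x * \1_A h) /tr mulrBl.
  apply: (siB S2); last exact: (siZ S2).
  apply: (L2_le _ (L2_tr a Lu)).
    by apply: measurable_funM; [exact: L2_meas (L2_tr a Lu)|exact: measurable_indic].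
  by move=> h; rewrite normrM ler_piMr// indicE; case: (h \in A); rewrite ?normr0 ?normr1.
have ew : w = (fun h => (u (h + x) - u x) * \1_(ball (0 : E) (2 ^- k)) h).
  by apply/funext => h; rewrite /w (addrC x h).
have Lw : L2 w by rewrite ew; apply: Lt; [exact: measurable_ball_rV|exact: lebesgue_ball_lty].
split=> //.
pose c := corner k x.
pose g := (fun h => (u (h + c) - u x) * \1_(cube k) h : R).
have Lg : L2 g by apply: Lt; [exact: measurable_cube|rewrite lebesgue_cube ltry].
have -> : u x - avg k u x = - (V k * ip g \1_(cube k)).
  have -> : ip g (\1_(cube k)) = ip (tr c u - u x *: (\1_(cube k) : E -> R)) \1_(cube k).
    rewrite !ipE; apply: eq_Rintegral => y _; rewrite /g -[(tr c u - _) y]/(u (y + c) - u x * \1_(cube k) y).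
    have [hy|hy] := pselect (cube k y); last by rewrite !indicE memNset// !mulr0.
    by rewrite [\1_(cube k) y]indicE mem_set// !mulr1.
  rewrite (siBl S2) ?(siZl S2) ?ip_cube ?mulrBr; try exact: L2_cube; try exact: L2_tr; last first.
    by apply: (siZ S2); exact: L2_cube.
  by rewrite mulrCA mulfV ?gt_eqF ?vol_gt0// mulr1 -avgE; ring.
rewrite normrN normrM gtr0_norm ?vol_gt0//.
have gw : nm g <= nm w.
  rewrite -(nm_tr (c - x) Lw); apply: snorm_ip_le; [exact: L2_meas|exact: L2_tr|].
  move=> y; rewrite /g /tr /w.
  have [hy|hy] := pselect (cube k y); last by rewrite indicE memNset// mulr0 normr0.
  rewrite !indicE mem_set// mem_set; last exact: cube_ball.
  by rewrite (_ : x + (y + (c - x)) = y + c) // addrC -addrA subrK.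
have h := si_CS S2 Lg (L2_cube k); rewrite nm_cube in h.
apply: le_trans (ler_wpM2l (ltW (vol_gt0 k)) h) _.
rewrite sqrtrV ?(ltW (vol_gt0 k))// mulrCA mulrC ler_pM ?snorm_ge0//.
have p : 0 < Num.sqrt (V k) by rewrite sqrtr_gt0 vol_gt0.
by rewrite -{1}(sqr_sqrtr (ltW (vol_gt0 k))) expr2 mulfK// gt_eqF.
Qed.

Lemma nm_sqr_int w : L2 w -> ((nm w ^+ 2)%:E = \int[leb]_x (w x ^+ 2)%:E)%E.
Proof. by move=> Lw; rewrite -L2normE// L2norm_sqrE. Qed.

Lemma measurable_add_rV : measurable_fun setT (fun z : E * E => z.1 + z.2).
Proof.
apply: measurable_fun_rV => i.
rewrite (_ : (fun t => _) = (fun t : E * E => t.1 ord0 i + t.2 ord0 i)); last by apply/funext => t; rewrite mxE.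
apply: measurable_funD; first exact: (measurableT_comp (measurable_coord i) measurable_fst).
exact: (measurableT_comp (measurable_coord i) measurable_snd).
Qed.

(** Poincare inequality on all dyadic cubes at once. Integrate the square of [avg_pointwise] in [x]
    and exchange the integrals: for fixed [h] there remains the L^2 norm of [u(. + h) - u], bounded
    by [nm_tr_H1]. The constant [2^d] is the volume of the ball divided by that of the cube. *)
Lemma avg_poincare k u : H1 u ->
  L2 (u - avg k u) /\
  nm (u - avg k u) <= Num.sqrt (2 ^+ d) * 2 ^- k * \sum_i nm (grad i u).
Proof.
move=> Hu; have Lu := H1_L2 Hu; have mu := L2_meas Lu.
set S := \sum_i _; have S0 : 0 <= S by apply: sumr_ge0 => i _; exact: snorm_ge0.
pose B : set E := ball (0 : E) (2 ^- k).
have mB : measurable B by exact: measurable_ball_rV.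
pose F (z : E * E) : R := ((u (z.1 + z.2) - u z.1) * \1_B z.2) ^+ 2.
have mF : measurable_fun setT F.
  apply: measurable_funX; apply: measurable_funM.
    apply: measurable_funB; first by apply: measurableT_comp; [exact: mu|exact: measurable_add_rV].
    exact: measurableT_comp.
  by apply: measurableT_comp => //; exact: measurable_indic.
have mEF : measurable_fun setT (fun z => (F z)%:E) by exact/measurable_EFinP.
have F0 z : (0 <= (F z)%:E)%E by rewrite lee_fin sqr_ge0.
have mD : measurable_fun setT (u - avg k u) by apply: measurable_funB => //; exact: avg_meas.
have key : (\int[leb]_x (((u - avg k u) x) ^+ 2)%:E <= (2 ^+ d * (2 ^- k * S) ^+ 2)%:E)%E.
  apply: (@le_trans _ _ (\int[leb]_x ((V k)%:E * \int[leb]_h (F (x, h))%:E))%E).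
    apply: ge0_le_integral => //.
    - by move=> x _; rewrite lee_fin sqr_ge0.
    - by apply/measurable_EFinP; exact: measurable_funX.
    - apply: emeasurable_funM => //; exact: (measurable_fun_fubini_tonelli_F _ mEF F0).
    - move=> x _; have [Lw hw] := avg_pointwise k x Lu.
      rewrite -(nm_sqr_int Lw) -EFinM lee_fin.
      rewrite -[leLHS]real_normK ?num_real// -[V k in leRHS]sqr_sqrtr ?(ltW (vol_gt0 k))// -exprMn.
      by rewrite lerXn2r ?nnegrE// mulr_ge0 ?sqrtr_ge0 ?snorm_ge0.
  rewrite ge0_integralZl//; last 2 first.
  - exact: (measurable_fun_fubini_tonelli_F _ mEF F0).
  - by move=> x _; exact: integral_ge0.
  rewrite (@fubini_tonelli _ _ _ _ _ leb leb _ mEF F0).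
  apply: (@le_trans _ _ ((V k)%:E * \int[leb]_h (((2 ^- k * S) ^+ 2)%:E * (\1_B h)%:E))%E).
    apply: lee_wpmul2l; first by rewrite lee_fin ltW// vol_gt0.
    apply: ge0_le_integral => //.
    - by move=> h _; exact: integral_ge0.
    - exact: (measurable_fun_fubini_tonelli_G _ mEF F0).
    - by apply: emeasurable_funM => //; apply/measurable_EFinP; exact: measurable_indic.
    - move=> h _; have [hB|hB] := pselect (B h); last first.
        rewrite integral0_eq; first by rewrite -EFinM lee_fin mulr_ge0 ?sqr_ge0.
        by move=> x _; rewrite /F /= indicE memNset// mulr0 expr0n.
      rewrite indicE mem_set//= mule1.
      have Lt : L2 (tr h u - u) by apply: (siB S2) => //; exact: L2_tr.
      rewrite (_ : (\int[leb]_x _)%E = (nm (tr h u - u) ^+ 2)%:E); last first.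
        rewrite nm_sqr_int//; apply: eq_integral => x _; rewrite /F /= indicE mem_set//= mulr1.
        by [].
      rewrite lee_fin lerXn2r ?nnegrE ?snorm_ge0//.
        by rewrite mulr_ge0// ltW// side_gt0.
      apply: le_trans (nm_tr_H1 h Hu) _; rewrite ler_wpM2r//.
      by move: hB; rewrite /B -ball_normE /= sub0r normrN => /ltW.
  rewrite ge0_integralZl//; last by rewrite lee_fin sqr_ge0.
  have -> : (\int[leb]_x (\1_B x)%:E = ((2 * 2 ^- k) ^+ d)%:E)%E.
    by rewrite integral_indic// setIT; exact: lebesgue_ball0 (side_gt0 k).
  rewrite -!EFinM lee_fin.
  rewrite [(2 * _) ^+ d]exprMn (_ : V k * _ = 2 ^+ d * (2 ^- k * S) ^+ 2 * (V k * (2 ^- k) ^+ d)); last ring.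
  by rewrite -exprMn mulfV ?expf_neq0// expr1n mulr1.
  by apply/measurable_EFinP; exact: measurable_indic.
have LD : L2 (u - avg k u).
  apply: L2I => //; apply/integrableP; split.
    by apply/measurable_EFinP; exact: measurable_funX.
  apply: le_lt_trans (ltry _); apply: le_trans key.
  rewrite le_eqVlt; apply/orP; left; apply/eqP; apply: eq_integral => x _ /=.
  by rewrite ger0_norm ?sqr_ge0.
split=> //; rewrite -ler_sqr ?nnegrE ?snorm_ge0//; last first.
  by rewrite !mulr_ge0 ?sqrtr_ge0// ltW// side_gt0.
by rewrite -lee_fin nm_sqr_int// -mulrA [in leRHS]exprMn sqr_sqrtr ?exprn_ge0.
Qed.

End averages.

(** * The subcritical nonlinearity *)

Section power_estimates.
Context {R : realType} {d : nat}.
Local Notation E := 'rV[R]_d.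
Local Notation leb := (@lebesgue_rV R d).
Local Notation nm := (snorm (@ip R d)).
Local Notation hn := (snorm (@aform R d)).
Local Notation V k := (((2 : R) ^+ k) ^+ d).
Let S2 := @L2_semi R d.
Let SH := @H1_semi R d.
Implicit Types (u w : E -> R) (x y : E) (k : nat).

Lemma L2_series_bound (f : E -> R) (g : nat -> E -> R) (C : R) :
  measurable_fun setT f -> (forall k, L2 (g k)) ->
  (forall x, exists k, `|f x| <= `|g k x|) ->
  (forall n, \sum_(k < n) nm (g k) ^+ 2 <= C) ->
  L2 f /\ nm f ^+ 2 <= C.
Proof.
move=> mf Lg hfg hC.
have key : (\int[leb]_x ((f x ^+ 2)%:E) <= C%:E)%E.
  apply: (@le_trans _ _ (\int[leb]_x (\sum_(k <oo) (g k x ^+ 2)%:E))%E).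
    apply: ge0_le_integral => //.
    - by move=> x _; rewrite lee_fin sqr_ge0.
    - by apply/measurable_EFinP; exact: measurable_funX.
    - apply: ge0_emeasurable_sum => [k x _ _|k _]; first by rewrite lee_fin sqr_ge0.
      by apply/measurable_EFinP; apply: measurable_funX; exact: L2_meas.
    - move=> x _; have [k hk] := hfg x.
      apply: le_trans (nneseries_lim_ge k.+1 _); last by move=> n _ _; rewrite lee_fin sqr_ge0.
      rewrite big_nat_recr//=; apply: (@le_trans _ _ (g k x ^+ 2)%:E).
        rewrite lee_fin -[leLHS]real_normK ?num_real// -[leRHS]real_normK ?num_real//.
        by rewrite lerXn2r ?nnegrE.
      by rewrite leeDr//; apply: sume_ge0 => i _; rewrite lee_fin sqr_ge0.
  rewrite integral_nneseries//; last 2 first.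
  - by move=> k; apply/measurable_EFinP; apply: measurable_funX; exact: L2_meas.
  - by move=> k x _; rewrite lee_fin sqr_ge0.
  apply: lime_le.
    by apply: is_cvg_nneseries => k _ _; apply: integral_ge0 => x _; rewrite lee_fin sqr_ge0.
  apply: nearW => n; rewrite (eq_bigr (fun k => (nm (g k) ^+ 2)%:E)).
    by rewrite sumEFin lee_fin big_mkord.
  by move=> k _; rewrite nm_sqr_int.
have Lf : L2 f.
  apply: L2I => //; apply/integrableP; split.
    by apply/measurable_EFinP; exact: measurable_funX.
  apply: le_lt_trans (ltry C); apply: le_trans key.
  rewrite le_eqVlt; apply/orP; left; apply/eqP; apply: eq_integral => x _ /=.
  by rewrite ger0_norm ?sqr_ge0.
by split => //; rewrite -lee_fin nm_sqr_int.
Qed.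

Variable p : R.
Hypothesis hp1 : 1 < p.

Definition fnl u : E -> R := fun x => nonlinearity p (u x).

Lemma nlN (a : R) : nonlinearity p (- a) = - nonlinearity p a.
Proof. by rewrite /nonlinearity normrN mulrN. Qed.

Lemma nl_norm (a : R) : `|nonlinearity p a| = `|a| `^ p.
Proof.
rewrite /nonlinearity normrM ger0_norm ?powR_ge0// mulrC mulr_powRB1//.
exact: lt_trans hp1.
Qed.

Lemma nlZ (c a : R) : 0 <= c -> nonlinearity p (c * a) = c `^ p * nonlinearity p a.
Proof.
move=> c0; rewrite /nonlinearity normrM (ger0_norm c0) powRM//.
rewrite -(@mulr_powRB1 _ c p)//; last exact: lt_trans hp1.
by rewrite mulrACA (mulrC (c `^ _)) -mulrA (mulrC c).
Qed.

Lemma fnl_meas u : measurable_fun setT u -> measurable_fun setT (fnl u).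
Proof.
move=> mu; apply: measurable_funM => //.
by apply: (measurableT_comp (f := fun t : R => t `^ (p - 1))); [exact: measurable_powR|exact: measurableT_comp].
Qed.

(** [L] bounds the growth of the averages of an H^1 function from one dyadic scale to the next. [Ld]
    makes the tower estimate give this rate, and [Lp] is the subcriticality that makes the series
    over the scales converge. *)
Variable L : R.
Hypothesis L1 : 1 < L.
Hypothesis Ld : Num.sqrt (2 ^+ d) <= 2 * L.
Hypothesis Lp : L `^ (p - 1) < 2.

Let C0 : R := Num.sqrt (2 ^+ d) * d%:R.
(** Chosen so that [c0 L >= c0 + 2 C0 L], the inductive step of [sup_avg]. *)
Let c0 : R := 1 + 2 * C0 * L / (L - 1).
Let C0_ge0 : 0 <= C0. Proof. by rewrite mulr_ge0// sqrtr_ge0. Qed.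
Let c0_ge1 : 1 <= c0.
Proof. by rewrite /c0 lerDl mulr_ge0// ?invr_ge0 ?mulr_ge0// ?subr_ge0 ltW// (lt_trans _ L1). Qed.

Let poinc k u : H1 u -> hn u <= 1 -> L2 (avg k u) /\ nm (u - avg k u) <= C0 * 2 ^- k.
Proof.
move=> Hu h1; have [LD hD] := avg_poincare k Hu; split.
  by rewrite -(subKr u (avg k u)); apply: (siB S2) => //; exact: H1_L2.
apply: le_trans hD _; rewrite /C0 -!mulrA ler_wpM2l ?sqrtr_ge0// [leRHS]mulrC.
rewrite ler_wpM2l ?(ltW (side_gt0 k))//.
have -> : d%:R = \sum_(i < d) (1 : R) by rewrite sumr_const card_ord.
by apply: ler_sum => i _; apply: le_trans h1; exact: nm_wp_le_hn.
Qed.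

Let sqrtV k : Num.sqrt (V k) = (Num.sqrt (2 ^+ d)) ^+ k.
Proof.
elim: k => [|k ih]; first by rewrite !expr0 expr1n sqrtr1.
by rewrite exprS exprMn sqrtrM ?exprn_ge0// ih exprS.
Qed.

(** By [avg_tower] and the Poincare inequality consecutive averages differ by at most
    [(2 L)^(k+1) C0 2^-k = 2 C0 L^(k+1)]; the telescoping sum is geometric. *)
Let sup_avg k u x : H1 u -> hn u <= 1 -> `|avg k u x| <= c0 * L ^+ k.
Proof.
move=> Hu h1; have Lu := H1_L2 Hu; have L0 : 0 < L by exact: lt_trans L1.
elim: k => [|k ih].
  apply: le_trans (avg_le 0 x Lu) _; rewrite sqrtV !expr0 mul1r mulr1.
  by apply: le_trans c0_ge1; apply: le_trans h1; exact: nm_le_hn.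
have [La hP] := poinc k Hu h1.
have h2 := avg_tower x Lu La.
have h3 : `|avg k.+1 u x - avg k u x| <= 2 * C0 * L ^+ k.+1.
  apply: le_trans h2 _; rewrite sqrtV.
  apply: (@le_trans _ _ ((2 * L) ^+ k.+1 * (C0 * 2 ^- k))).
    by rewrite ler_pM ?exprn_ge0 ?sqrtr_ge0 ?snorm_ge0// lerXn2r ?nnegrE ?sqrtr_ge0// mulr_ge0// ltW.
  rewrite exprMn [2 ^+ k.+1]exprS -[leLHS]/(2 * 2 ^+ k * L ^+ k.+1 * (C0 * 2 ^- k)).
  rewrite (_ : _ * _ = 2 * C0 * L ^+ k.+1 * (2 ^+ k * 2 ^- k)); last ring.
  by rewrite mulfV ?mulr1// expf_neq0.
have h4 : `|avg k.+1 u x| <= `|avg k u x| + `|avg k.+1 u x - avg k u x|.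
  by have := ler_normD (avg k u x) (avg k.+1 u x - avg k u x); rewrite addrC subrK.
apply: le_trans h4 _; apply: le_trans (lerD ih h3) _.
rewrite [L ^+ k.+1]exprS -subr_ge0.
have -> : c0 * (L * L ^+ k) - (c0 * L ^+ k + 2 * C0 * (L * L ^+ k)) = L ^+ k * (L - 1).
  by rewrite /c0; field; rewrite subr_eq0 gt_eqF.
by rewrite mulr_ge0 ?exprn_ge0 ?subr_ge0 ?(ltW L0) ?(ltW L1).
Qed.

(** The piece of [fnl u] that lives at scale [k] has squared norm at most [M rho^k]: [L^(p-1)] comes
    from the size of [u] there, the factor [1/2] from the Poincare inequality. *)
Let rho : R := (L `^ (p - 1) / 2) ^+ 2.
Let M : R := 4 * ((2 * c0) `^ (p - 1) * L `^ (p - 1) * C0) ^+ 2.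

Let rho_itv : 0 < rho < 1.
Proof.
have L0 : 0 < L by exact: lt_trans L1.
have h : 0 < L `^ (p - 1) / 2 by rewrite divr_gt0// powR_gt0.
by rewrite /rho exprn_gt0//= exprn_ilt1 ?ltW// ltr_pdivrMr// mul1r.
Qed.

Let M_ge0 : 0 <= M. Proof. by rewrite mulr_ge0// sqr_ge0. Qed.

(* A substitute for Sobolev's inequality.  The averages over dyadic cubes of side [2^-k] satisfy
   [|avg k u| <= c0 L^k], so if [k >= K] is the first scale with [|u x| <= 2 c0 L^(k+1)], then
   [|u x| <= 2 |u x - avg k u x|]; the Poincare inequality on the cubes makes the sum over the scales
   geometric, with ratio [rho < 1] exactly in the subcritical range. *)
Lemma fnl_master u (e : R) K : H1 u -> hn u <= 1 -> 0 < e -> (forall x, `|avg K u x| <= e) ->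
  L2 (fnl u) /\ nm (fnl u) ^+ 2 <= ((2 * e) `^ (p - 1)) ^+ 2 + M * rho ^+ K / (1 - rho).
Proof.
move=> Hu h1 e0 hK; have Lu := H1_L2 Hu; have L0 : 0 < L by exact: lt_trans L1.
have c00 : 0 < c0 by exact: lt_le_trans c0_ge1.
have q0 : 0 <= p - 1 by rewrite subr_ge0 ltW.
have /andP[rho0 rho1] := rho_itv.
pose lam k := 2 * c0 * L ^+ k.
have lam0 k : 0 < lam k by rewrite mulr_gt0 ?exprn_gt0// mulr_gt0.
(* The index 0 serves the points with [|u x| <= 2 e]; the index [k.+1] serves those whose first
   admissible scale is [K + k]. *)
pose g (n : nat) : E -> R := if n is k.+1 then (2 * lam (K + k).+1 `^ (p - 1)) *: (u - avg (K + k) u)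
  else (2 * e) `^ (p - 1) *: u.
have LD k : L2 (u - avg k u) by have [? _] := avg_poincare k Hu.
have nlb x (b t : R) : `|u x| <= b -> `|u x| <= t -> 0 <= b -> `|fnl u x| <= b `^ (p - 1) * t.
  move=> ub ut b0; rewrite /fnl nl_norm -mulr_powRB1//; last exact: lt_trans hp1.
  by rewrite mulrC ler_pM ?powR_ge0// ge0_ler_powR ?nnegrE.
apply: (@L2_series_bound _ g).
- exact: fnl_meas (L2_meas Lu).
- by case=> [|k]; apply: (siZ S2).
- move=> x; have [hx|hx] := leP `|u x| (2 * e).
    exists 0%N; apply: le_trans (nlb x (2 * e) `|u x| hx (lexx _) _) _; first by rewrite mulr_ge0// ltW.
    by rewrite /g -[X in _ <= `|X|]/((2 * e) `^ (p - 1) * u x) (normrM (_ `^ _)) [`|_ `^ _|]ger0_norm ?powR_ge0.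
  have ex : exists k, `|u x| <= lam (K + k).+1.
    have : L^-1 ^+ k @[k --> \oo] --> 0.
      by apply: cvg_expr; rewrite ger0_norm ?invr_ge0 ?invf_lt1// ltW.
    move=> /cvgrPdist_le /(_ ((1 + `|u x|)^-1)); rewrite invr_gt0 ltr_pwDl// => /(_ isT)[n _ hn].
    exists n; have := hn n (leqnn n); rewrite /= sub0r normrN ger0_norm ?exprn_ge0 ?invr_ge0 ?(ltW L0)//.
    rewrite exprVn lef_pV2 ?posrE ?exprn_gt0 ?ltr_pwDl// => hh.
    have h2 : L ^+ n <= lam (K + n).+1.
      rewrite /lam; apply: (@le_trans _ _ (1 * L ^+ (K + n).+1)).
        by rewrite mul1r ler_weXn2l ?(ltW L1)// (leq_trans (leq_addl K n)).
      by rewrite ler_wpM2r ?exprn_ge0 ?(ltW L0)//; move: c0_ge1; move: (c0) => c hc; lra.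
    by apply: le_trans h2; lra.
  case: (ex_minnP ex) => k hk kmin; exists k.+1.
  rewrite /g -[(_ *: _) x]/(2 * lam (K + k).+1 `^ (p - 1) * (u x - avg (K + k) u x)).
  have ha : `|avg (K + k) u x| <= `|u x| / 2.
    (* At the first scale minimality says nothing; there the hypothesis [|avg K u x| <= e] is used
       together with [2 e < |u x|]. *)
    case: k {hk} kmin => [|k] kmin; first by rewrite addn0; have := hK x; lra.
    have : ~ (`|u x| <= lam (K + k).+1) by move=> /kmin; rewrite ltnn.
    move/negP; rewrite -ltNge => h3; have := sup_avg (K + k.+1) x Hu h1; rewrite addnS.
    by move: h3; rewrite /lam; lra.
  have hb : `|u x| <= 2 * `|u x - avg (K + k) u x|.
    by have := ler_normB (u x - avg (K + k) u x) (- avg (K + k) u x); rewrite opprK subrK normrN; lra.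
  apply: le_trans (nlb x _ _ hk hb (ltW (lam0 _))) _.
  by rewrite (normrM (2 * _)) (ger0_norm (_ : 0 <= 2 * _)) ?mulr_ge0 ?powR_ge0// mulrCA mulrA.
case=> [|n].
  rewrite big_ord0 addr_ge0 ?sqr_ge0// mulr_ge0 ?invr_ge0 ?subr_ge0 ?(ltW rho1)//.
  by rewrite mulr_ge0// exprn_ge0// ltW.
rewrite big_ord_recl lerD//.
  rewrite /g/= (snormZ S2)// exprMn ger0_norm ?powR_ge0// ler_piMr ?sqr_ge0//.
  by rewrite expr_le1 ?snorm_ge0// (le_trans (nm_le_hn Hu)).
apply: (@le_trans _ _ (\sum_(k < n) (M * rho ^+ K) * rho ^+ k)).
  apply: ler_sum => k _; rewrite /g lift0 (snormZ S2)// exprMn.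
  have [_ hP] := poinc (K + k) Hu h1.
  apply: (@le_trans _ _ (`|2 * lam (K + k).+1 `^ (p - 1)| ^+ 2 * (C0 * 2 ^- (K + k)) ^+ 2)).
    by rewrite ler_wpM2l ?sqr_ge0// lerXn2r ?nnegrE ?snorm_ge0// (le_trans (snorm_ge0 _ _) hP).
  rewrite ger0_norm ?mulr_ge0 ?powR_ge0// /lam powRM ?exprn_ge0 ?mulr_ge0 ?(ltW L0) ?(ltW c00)//.
  have -> : (L ^+ (K + k).+1) `^ (p - 1) = (L `^ (p - 1)) ^+ (K + k).+1.
    elim: (K + k).+1 => [|n' ih]; first by rewrite !expr0 powR1.
    by rewrite !exprS powRM ?exprn_ge0 ?(ltW L0)// ih.
  rewrite -mulrA -exprD /M /rho le_eqVlt; apply/orP; left; apply/eqP.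
  rewrite [(_ ^+ 2) ^+ (K + k)]exprAC.
  move: (_ `^ (p - 1)) (L `^ (p - 1)) => a l.
  rewrite [(l / 2) ^+ (K + k)]expr_div_n [l ^+ (K + k).+1]exprS.
  by move: (l ^+ (K + k)) (2 ^- (K + k)) => lm w; ring.
rewrite -mulr_sumr.
have -> : \sum_(i < n) rho ^+ i = series (geometric 1 rho) n.
  by rewrite /series/= big_mkord; apply: eq_bigr => i _; rewrite mul1r.
have MK : 0 <= M * rho ^+ K by apply: (mulr_ge0 M_ge0); rewrite exprn_ge0 ?(ltW rho0).
apply: (ler_wpM2l MK).
apply: le_trans (geometric_le_lim n _ rho0 _) _ => //; first by rewrite ger0_norm ?ltW.
by rewrite mul1r.
Qed.

Lemma hn_scale1 u (s : R) : H1 u -> 0 < s -> hn u <= s -> H1 (s^-1 *: u) /\ hn (s^-1 *: u) <= 1.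
Proof.
move=> Hu s0 hs; split; first exact: (siZ SH).
by rewrite (snormZ SH)// ger0_norm ?invr_ge0 ?(ltW s0)// mulrC ler_pdivrMr// mul1r.
Qed.

Lemma fnl_scale u (s : R) : 0 < s -> fnl u = s `^ p *: fnl (s^-1 *: u).
Proof.
move=> s0; apply/funext => x; rewrite -[RHS]/(s `^ p * nonlinearity p (s^-1 * u x)).
by rewrite -nlZ ?(ltW s0)// mulrA mulfV ?mul1r// gt_eqF.
Qed.

Lemma fnl_L2 u : H1 u -> L2 (fnl u).
Proof.
move=> Hu; have s0 : 0 < 1 + hn u by rewrite ltr_pwDl// snorm_ge0.
have [Hs hs] : H1 ((1 + hn u)^-1 *: u) /\ hn ((1 + hn u)^-1 *: u) <= 1.
  by apply: hn_scale1 => //; rewrite lerDr.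
rewrite (fnl_scale u s0); apply: (siZ S2).
have c00 : 0 < c0 by exact: lt_le_trans c0_ge1.
have [|//] := @fnl_master _ c0 0%N Hs hs c00.
by move=> x; have := sup_avg 0%N x Hs hs; rewrite expr0 mulr1.
Qed.

Lemma fnl_bound : exists C, 0 < C /\ forall u s, H1 u -> 0 < s -> hn u <= s ->
  nm (fnl u) <= C * s `^ p.
Proof.
have c00 : 0 < c0 by exact: lt_le_trans c0_ge1.
have /andP[rho0 rho1] := rho_itv.
pose D := ((2 * c0) `^ (p - 1)) ^+ 2 + M * rho ^+ 0 / (1 - rho).
have D0 : 0 <= D.
  by rewrite addr_ge0 ?sqr_ge0// mulr_ge0 ?invr_ge0 ?subr_ge0 ?(ltW rho1)// mulr_ge0.
exists (1 + Num.sqrt D); split; first by rewrite ltr_pwDl// sqrtr_ge0.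
move=> u s Hu s0 hs; have [Hs h1] := hn_scale1 Hu s0 hs.
have [|Lf hf] := @fnl_master _ c0 0%N Hs h1 c00.
  by move=> x; have := sup_avg 0%N x Hs h1; rewrite expr0 mulr1.
rewrite (fnl_scale u s0) (snormZ S2)// ger0_norm ?powR_ge0// mulrC ler_wpM2r ?powR_ge0//.
apply: (@le_trans _ _ (Num.sqrt D)); last by rewrite lerDr.
have hf' : nm (fnl (s^-1 *: u)) ^+ 2 <= D := hf.
by move: hf'; rewrite -[X in _ <= X -> _](sqr_sqrtr D0) ler_sqr ?nnegrE ?snorm_ge0 ?sqrtr_ge0.
Qed.

(** Smallness of the averages at one single scale is enough: first [K] makes the geometric tail of
    [fnl_master] small, then [e] its leading term. General [B] follows by homogeneity. *)
Lemma fnl_vanish (B eta : R) : 0 < B -> 0 < eta -> exists K e, 0 < e /\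
  forall u, H1 u -> hn u <= B -> (forall x, `|avg K u x| <= e) -> nm (fnl u) <= eta.
Proof.
move=> B0 eta0; have /andP[rho0 rho1] := rho_itv.
pose et := (eta / B `^ p) ^+ 2 / 2.
have et0 : 0 < et by rewrite divr_gt0// exprn_gt0// divr_gt0// powR_gt0.
have [K hK] : exists K, M * rho ^+ K / (1 - rho) <= et.
  have : (M / (1 - rho)) * rho ^+ k @[k --> \oo] --> (M / (1 - rho)) * 0.
    have hc : rho ^+ k @[k --> \oo] --> 0 by apply: cvg_expr; rewrite ger0_norm// ltW.
    exact: (cvgM (cvg_cst _) hc).
  rewrite mulr0 => /cvgrPdist_le /(_ et et0)[n _ hn].
  exists n; have := hn n (leqnn n); rewrite /= sub0r normrN => h.
  by rewrite mulrAC; apply: le_trans (ler_norm _) h.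
have [e e0 he] : exists2 e, 0 < e & (((2 * e) `^ (p - 1)) ^+ 2 <= et).
  exists ((Num.sqrt et) `^ ((p - 1)^-1) / 2); first by rewrite divr_gt0// powR_gt0// sqrtr_gt0.
  rewrite mulrC divfK// -powRrM mulVf ?powRr1 ?sqrtr_ge0// ?sqr_sqrtr ?(ltW et0)//.
  by rewrite subr_eq0 gt_eqF.
exists K, (e * B); split; first by rewrite mulr_gt0.
move=> u Hu hu ha; have [Hs h1] := hn_scale1 Hu B0 hu.
have [|Lf hf] := @fnl_master _ e K Hs h1 e0.
  move=> x; have := ha x; rewrite !avgE.
  have -> : tr (corner K x) (B^-1 *: u) = B^-1 *: tr (corner K x) u by [].
  rewrite (siZl S2); [|exact: L2_tr (H1_L2 Hu)|exact: L2_cube].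
  by move=> h; rewrite mulrCA normrM (gtr0_norm (_ : 0 < B^-1)) ?invr_gt0// ler_pdivrMl// (mulrC B).
rewrite (fnl_scale u B0) (snormZ S2)// ger0_norm ?powR_ge0//.
rewrite mulrC -ler_pdivlMr ?powR_gt0//.
rewrite -ler_sqr ?nnegrE ?snorm_ge0 ?divr_ge0 ?powR_ge0 ?(ltW eta0)//.
by apply: le_trans hf _; apply: le_trans (lerD he hK) _; rewrite /et; lra.
Qed.

Lemma fnl_small (B eta : R) : 0 < B -> 0 < eta -> exists2 e, 0 < e &
  forall u, H1 u -> hn u <= B -> nm u <= e -> nm (fnl u) <= eta.
Proof.
move=> B0 eta0; have [K [e [e0 h]]] := fnl_vanish B0 eta0.
have v0 : 0 < Num.sqrt (V K) by rewrite sqrtr_gt0 vol_gt0.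
exists (e / Num.sqrt (V K)); first by rewrite divr_gt0.
move=> u Hu hu nu; apply: h => // x; apply: le_trans (avg_le K x (H1_L2 Hu)) _.
by rewrite mulrC -ler_pdivlMr.
Qed.

End power_estimates.

(** For [d >= 3] take [L = 2^(d/2 - 1)]: then [2 L] equals the square root of [2^d], and
    [L^(p-1) < 2] says [(d - 2)(p - 1) < 2], that is [p < d/(d-2)]. For [d <= 2] any [L > 1]
    satisfies the second condition, and the exponent below gives [L^(p-1) = 2^(1/2)]. *)
Lemma subcritical_rate (R : realType) (d : nat) (p : R) : 1 < p ->
  ((3 <= d)%N -> p < d%:R / (d - 2)%:R) ->
  exists L : R, [/\ 1 < L, Num.sqrt (2 ^+ d) <= 2 * L & L `^ (p - 1) < 2].
Proof.
move=> hp1 hp2; have q0 : 0 < p - 1 by rewrite subr_gt0.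
have h12 : (1 : R) < 2 by rewrite ltr1n.
have pow2 (t : R) : t < 1 -> 2 `^ t < 2.
  by move=> t1; rewrite -[ltRHS]powRr1// /powR !ifF ?pnatr_eq0// ltr_expR ltr_pM2r// ln_gt0.
have pow1 (t : R) : 0 < t -> 1 < 2 `^ t.
  by move=> t1; rewrite -[ltLHS](powRr0 2) /powR !ifF ?pnatr_eq0// ltr_expR ltr_pM2r// ln_gt0.
have [d3|d3] := leqP 3 d; last first.
  exists (2 `^ (2^-1 / (p - 1))); split.
  - by apply: pow1; rewrite divr_gt0.
  - apply: (@le_trans _ _ 2); last by rewrite ler_peMr// ltW// pow1// divr_gt0.
    rewrite -[leRHS]ger0_norm// -sqrtr_sqr ler_sqrt ?exprn_ge0//.
    by rewrite ler_weXn2l ?(ltW h12).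
  - by rewrite -powRrM divfK ?gt_eqF//; apply: pow2; lra.
have := hp2 d3; rewrite natrB ?(ltnW d3)//.
have d3' : (3 : R) <= d%:R by rewrite ler_nat.
move: d3'; set D := d%:R => d3' hp.
have D2 : 0 < D - 2 by lra.
exists (2 `^ (D / 2 - 1)); split.
- by apply: pow1; lra.
- rewrite -powR12_sqrt ?exprn_ge0// -powR_mulrn// -powRrM -/D.
  rewrite [X in 2 `^ X <= _](_ : _ = 1 + (D / 2 - 1)); last by lra.
  by rewrite powRD ?pnatr_eq0 ?implybT// powRr1.
- rewrite -powRrM; apply: pow2.
  by move: hp; rewrite ltr_pdivlMr// => hp; nra.
Qed.

Lemma cvg_scale0 (R : realType) (T : Type) (F : set_system T) {FF : Filter F} (c : R) (f : T -> R) :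
  f t @[t --> F] --> 0 -> c * f t @[t --> F] --> 0.
Proof. by move=> h; rewrite -[X in _ --> X](mulr0 c); exact: (cvgM (cvg_cst c) h). Qed.

(** * Pointwise inequalities for the power nonlinearity *)

Section nonlinearity_estimates.
Context {R : realType}.
Variable p : R.
Hypothesis hp1 : 1 < p.
Local Notation nl := (nonlinearity p).
Let p0 : 0 < p. Proof. exact: lt_trans hp1. Qed.

Lemma nl_pos (a : R) : 0 <= a -> nl a = a `^ p.
Proof. by move=> a0; rewrite /nonlinearity ger0_norm// mulrC mulr_powRB1. Qed.

Lemma nl_mul (a : R) : nl a * a = `|a| `^ p * `|a|.
Proof.
rewrite /nonlinearity -(@mulr_powRB1 _ `|a| p)// -mulrA -expr2 -(real_normK (num_real a)).
by rewrite expr2 mulrA (mulrC `|a|).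
Qed.

(** A substitute for differentiating the nonlinearity. If [b] is close to [a] relative to [|a|], the
    two powers differ by at most [del |a|^p]; otherwise [|a|] itself is bounded by a multiple of
    [|a - b|]. Symmetry and oddness reduce to [|b| <= a]. *)
Lemma nl_diff (del : R) : 0 < del -> exists2 C, 0 < C &
  forall a b, `|nl a - nl b| <= del * (`|a| `^ p + `|b| `^ p) + C * `|a - b| `^ p.
Proof.
move=> del0; pose d' := Num.min del 2^-1.
have d'0 : 0 < d' by rewrite lt_min del0 invr_gt0 ltr0n.
have d'1 : d' <= 2^-1 by rewrite ge_min lexx orbT.
have d'd : d' <= del by rewrite ge_min lexx.
(* With [s^p = 1 - d'], the condition [s a < b <= a] gives [a^p - b^p <= d' a^p]. *)
pose s := (1 - d') `^ p^-1.
have sp : s `^ p = 1 - d' by rewrite /s -powRrM mulVf ?gt_eqF// powRr1//; lra.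
have s0 : 0 <= s by exact: powR_ge0.
have s1 : s < 1.
  rewrite ltNge; apply/negP => h.
  by have := ge0_ler_powR (ltW p0) (_ : 1 \in Num.nneg) (_ : s \in Num.nneg) h; rewrite powR1 sp !nnegrE ler01 s0 => /(_ isT isT); lra.
pose k := 1 - s; have k0 : 0 < k by rewrite /k; lra.
exists (2 / k `^ p); first by rewrite divr_gt0// powR_gt0.
suff key a b : 0 <= a -> `|b| <= a ->
    `|nl a - nl b| <= del * (`|a| `^ p + `|b| `^ p) + 2 / k `^ p * `|a - b| `^ p.
  have key2 a b : `|b| <= `|a| ->
      `|nl a - nl b| <= del * (`|a| `^ p + `|b| `^ p) + 2 / k `^ p * `|a - b| `^ p.
    move=> h; have [a0|a0] := leP 0 a; first by apply: key => //; rewrite -(ger0_norm a0).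
    have an : `|a| = - a by rewrite ler0_norm// ltW.
    have := @key (- a) (- b); rewrite !nlN !normrN.
    have -> : - nl a - - nl b = - (nl a - nl b) by rewrite opprB opprK addrC.
    have -> : - a - - b = - (a - b) by rewrite opprB opprK addrC.
    by rewrite !normrN; apply; [rewrite oppr_ge0 ltW|rewrite -an].
  move=> a b; have [h|/ltW h] := leP `|b| `|a|; first exact: key2.
  by rewrite distrC (distrC a) (addrC (`|a| `^ p)); exact: key2.
move=> a0 hb; have pa : 0 <= a `^ p by exact: powR_ge0.
have pb : 0 <= `|b| `^ p by exact: powR_ge0.
have pba : `|b| `^ p <= a `^ p by rewrite ge0_ler_powR ?nnegrE// ltW.
rewrite (ger0_norm a0).
have [h|h] := leP (k * a) `|a - b|.
  have h1 : k `^ p * a `^ p <= `|a - b| `^ p.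
    by rewrite -powRM ?(ltW k0)// ge0_ler_powR ?nnegrE ?mulr_ge0 ?(ltW k0) ?(ltW p0).
  have h2 : a `^ p <= `|a - b| `^ p / k `^ p by rewrite ler_pdivlMr ?powR_gt0// mulrC.
  have h3 : `|nl a - nl b| <= 2 * a `^ p.
    apply: le_trans (ler_normB _ _) _; rewrite !nl_norm// (ger0_norm a0); lra.
  apply: le_trans h3 _; rewrite -mulrA (mulrC (k `^ p)^-1).
  have := mulr_ge0 (ltW del0) (addr_ge0 pa pb); lra.
have ak : s * a < b by move: h; rewrite ltr_norml /k => /andP[h1 h2]; nra.
have b0 : 0 <= b by apply: le_trans (ltW ak); exact: mulr_ge0.
have ba : b <= a by rewrite -(ger0_norm b0).
rewrite !nl_pos// ger0_norm ?subr_ge0; last by rewrite -(ger0_norm b0).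
have h2 : s `^ p * a `^ p <= b `^ p.
  by rewrite -powRM// ge0_ler_powR ?nnegrE ?mulr_ge0 ?(ltW p0)// ltW.
have := powR_ge0 `|a - b| p; have : 0 < 2 / k `^ p by rewrite divr_gt0// powR_gt0.
rewrite (ger0_norm b0) in pb *.
move: (2 / k `^ p) (`|a - b| `^ p) => C D C0 D0.
have CD : 0 <= C * D by rewrite mulr_ge0// ltW.
rewrite sp in h2; move: pa pb h2; move: (a `^ p) (b `^ p) => A B A0 B0 h2; nra.
Qed.

(** If [|r| <= k |a|] the first term suffices; otherwise [|a|^p <= k^(-p) |r|^p] and the second one
    does. *)
Lemma nl_young (k a r : R) : 0 < k ->
  `|nl a * r| <= k * (nl a * a) + k `^ (- p) * (nl r * r).
Proof.
move=> k0; rewrite !nl_mul normrM nl_norm//.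
have pa : 0 <= `|a| `^ p by exact: powR_ge0.
have pr : 0 <= `|r| `^ p by exact: powR_ge0.
have pk : 0 <= k `^ (- p) by exact: powR_ge0.
have [h|h] := leP `|r| (k * `|a|).
  apply: (@le_trans _ _ (k * (`|a| `^ p * `|a|))); first by rewrite mulrCA ler_wpM2l.
  by rewrite lerDl !mulr_ge0.
have : `|a| `^ p <= k `^ (- p) * `|r| `^ p.
  rewrite powRN mulrC ler_pdivlMr ?powR_gt0// -powRM// ?(ltW k0)//.
  by rewrite ge0_ler_powR ?nnegrE ?mulr_ge0 ?(ltW p0) ?(ltW k0)// mulrC ltW.
move=> h2; apply: (@le_trans _ _ (k `^ (- p) * (`|r| `^ p * `|r|))).
  by rewrite mulrA ler_wpM2r.
by rewrite lerDr !mulr_ge0// ltW.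
Qed.

(** Three ranges of [|z|^p]: below [eta] and above [1/eta] the first term dominates, and in between
    [z^2] is bounded below. Thus an L^2 bound on [nl z] and local L^2 smallness of [z] make [nl z]
    small locally in L^1. *)
Lemma nl_local (eta : R) : 0 < eta -> exists2 C, 0 < C &
  forall z, `|z| `^ p <= eta * (1 + (nl z) ^+ 2) + C * z ^+ 2.
Proof.
move=> e0; have q0 : 0 < eta `^ p^-1 by rewrite powR_gt0.
exists (eta^-1 / (eta `^ p^-1) ^+ 2); first by rewrite divr_gt0 ?invr_gt0// exprn_gt0.
move=> z; have -> : nl z ^+ 2 = (`|z| `^ p) ^+ 2 by rewrite -nl_norm// real_normK ?num_real.
have t0 : 0 <= `|z| `^ p by exact: powR_ge0.
have Cz : 0 <= eta^-1 / (eta `^ p^-1) ^+ 2 * z ^+ 2.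
  by rewrite mulr_ge0 ?sqr_ge0// divr_ge0 ?sqr_ge0// invr_ge0 ltW.
have [h|h] := leP (`|z| `^ p) eta.
  by have := mulr_ge0 (ltW e0) (sqr_ge0 (`|z| `^ p)); lra.
have [h2|h2] := leP (`|z| `^ p) eta^-1; last first.
  have : 1 <= eta * `|z| `^ p by rewrite -ler_pdivrMl// mulr1 ltW.
  move: t0 Cz; move: (`|z| `^ p) (_ * z ^+ 2) => t c *; nra.
have hz : eta `^ p^-1 <= `|z|.
  rewrite leNgt; apply/negP => h3.
  have := ge0_ler_powR (ltW p0) (_ : `|z| \in Num.nneg) (_ : eta `^ p^-1 \in Num.nneg) (ltW h3).
  rewrite -powRrM mulVf ?gt_eqF// powRr1 ?(ltW e0)// !nnegrE normr_ge0 (ltW q0) => /(_ isT isT); lra.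
apply: (@le_trans _ _ (eta^-1 / (eta `^ p^-1) ^+ 2 * z ^+ 2)).
  apply: (le_trans h2); rewrite -mulrA ler_peMr ?invr_ge0 ?(ltW e0)//.
  by rewrite mulrC ler_pdivlMr ?exprn_gt0// mul1r -(real_normK (num_real z)) lerXn2r ?nnegrE// ltW.
by rewrite lerDr mulr_ge0 ?(ltW e0)// addr_ge0 ?sqr_ge0.
Qed.

(** Convexity of [|z|^(p+1)], from Young's inequality with the exponents [(p+1)/p] and [p+1]. It
    yields the derivative of the potential energy by enclosing its increments. *)
Lemma nl_convex (a b : R) : (p + 1) * (nl a * (b - a)) <= nl b * b - nl a * a.
Proof.
have p10 : 0 < p + 1 by rewrite addr_gt0.
have q0 : 0 < (p + 1) / p by rewrite divr_gt0.
have hc : ((p + 1) / p)^-1 + (p + 1)^-1 = 1.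
  by field; rewrite gt_eqF// gt_eqF.
have := conjugate_powR (powR_ge0 `|a| p) (normr_ge0 b) q0 p10 hc.
rewrite -powRrM mulrCA mulfV ?gt_eqF// mulr1 invf_div => h.
have e c : 0 <= c -> c `^ (p + 1) = c `^ p * c :> R.
  by move=> c0; rewrite -(@mulr_powRB1 _ c (p + 1))// addrK mulrC.
rewrite !e// in h.
have : nl a * b <= `|a| `^ p * `|b| by rewrite -nl_norm// -normrM ler_norm.
rewrite mulrBr !nl_mul => h2.
have : (p + 1) * (`|a| `^ p * `|b|) <= p * (`|a| `^ p * `|a|) + `|b| `^ p * `|b|.
  have := ler_wpM2l (ltW p10) h; rewrite mulrDr.
  have -> : (p + 1) * (`|a| `^ p * `|a| * (p / (p + 1))) = p * (`|a| `^ p * `|a|).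
    by field; rewrite gt_eqF.
  have -> // : (p + 1) * (`|b| `^ p * `|b| / (p + 1)) = `|b| `^ p * `|b|.
  by field; rewrite gt_eqF.
move=> h3; have := ler_wpM2l (ltW p10) h2; lra.
Qed.

End nonlinearity_estimates.

(** * The nonlinearity as a map from H^1 to L^2 *)

Section nonlinear_maps.
Context {R : realType} {d : nat}.
Local Notation E := 'rV[R]_d.
Local Notation leb := (@lebesgue_rV R d).
Local Notation nm := (snorm (@ip R d)).
Local Notation hn := (snorm (@aform R d)).
Let S2 := @L2_semi R d.
Let SH := @H1_semi R d.
Implicit Types (u w z : E -> R).

Definition subcritical (p : R) : Prop := 1 < p /\
  exists L : R, [/\ 1 < L, Num.sqrt (2 ^+ d) <= 2 * L & L `^ (p - 1) < 2].

Variable p : R.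
Hypothesis hp : subcritical p.
Let hp1 : 1 < p. Proof. by case: hp. Qed.
Local Notation f := (fnl p).

Lemma L2_fnl u : H1 u -> L2 (f u).
Proof. by case: hp => h1 [L [h2 h3 h4]]; exact: (fnl_L2 h1 h2 h3 h4). Qed.

Lemma nm_fnl_le : exists C, 0 < C /\ forall u s, H1 u -> 0 < s -> hn u <= s ->
  nm (f u) <= C * s `^ p.
Proof. by case: hp => h1 [L [h2 h3 h4]]; exact: (fnl_bound h1 h2 h3 h4). Qed.

Lemma fnl_vanishing (B eta : R) : 0 < B -> 0 < eta -> exists K e, 0 < e /\
  forall u, H1 u -> hn u <= B -> (forall x, `|avg K u x| <= e) -> nm (f u) <= eta.
Proof. by case: hp => h1 [L [h2 h3 h4]]; exact: (fnl_vanish h1 h2 h3 h4). Qed.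

Lemma nm_fnl_small (B eta : R) : 0 < B -> 0 < eta -> exists2 e, 0 < e &
  forall u, H1 u -> hn u <= B -> nm u <= e -> nm (f u) <= eta.
Proof. by case: hp => h1 [L [h2 h3 h4]]; exact: (fnl_small h1 h2 h3 h4). Qed.

Lemma nm_fnl_bound (B : R) : exists2 M, 0 < M & forall u, H1 u -> hn u <= B -> nm (f u) <= M.
Proof.
have [C [C0 h]] := nm_fnl_le; exists (C * (1 + `|B|) `^ p).
  by rewrite mulr_gt0// powR_gt0// ltr_pwDl.
move=> u Hu hu; apply: h => //.
by apply: (le_trans hu); apply: (le_trans (ler_norm B)); rewrite lerDr.
Qed.

Lemma L2_norm u : L2 u -> L2 (fun x => `|u x|) /\ nm (fun x => `|u x|) = nm u.
Proof.
move=> Lu; have mu : measurable_fun setT (fun x => `|u x|).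
  by apply: measurableT_comp => //; exact: L2_meas.
have La : L2 (fun x => `|u x|) by apply: (L2_le mu Lu) => x; rewrite normr_id.
split=> //; apply/eqP; rewrite eq_le; apply/andP; split.
  by apply: snorm_ip_le => // x; rewrite normr_id.
by apply: snorm_ip_le => //; [exact: L2_meas|move=> x; rewrite normr_id].
Qed.

(** On bounded sets of H^1 smallness in L^2 alone suffices. This is what makes the dissipation
    effective, since it controls the increments of a trajectory in L^2 only. The proof integrates
    [nl_diff] and applies [nm_fnl_small] to [u - w]. *)
Lemma fnl_unif (B eta : R) : 0 < B -> 0 < eta -> exists2 e, 0 < e &
  forall u w, H1 u -> H1 w -> hn u <= B -> hn w <= B -> nm (u - w) <= e ->
  nm (f u - f w) <= eta.
Proof.
move=> B0 eta0; have [M M0 hM] := nm_fnl_bound B.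
have del0 : 0 < eta / (4 * M) by rewrite divr_gt0// mulr_gt0.
have [C C0 hC] := nl_diff hp1 del0.
have B2 : 0 < 2 * B by rewrite mulr_gt0.
have eC : 0 < eta / (2 * C) by rewrite divr_gt0// mulr_gt0.
have [e e0 he] := nm_fnl_small B2 eC.
exists e => // u w Hu Hw hu hw nuw.
have Hd := siB SH Hu Hw.
have hd : hn (u - w) <= 2 * B by have := snormB SH Hu Hw; lra.
have [Lu nu] := L2_norm (L2_fnl Hu); have [Lw nw] := L2_norm (L2_fnl Hw).
have [Ld nd] := L2_norm (L2_fnl Hd).
pose g : E -> R := (eta / (4 * M)) *: ((fun x => `|f u x|) + (fun x => `|f w x|)) + C *: (fun x => `|f (u - w) x|).
have Luw := siD S2 Lu Lw.
have Lg : L2 g by apply: (siD S2); apply: (siZ S2).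
have Lf : L2 (f u - f w) by apply: (siB S2); exact: L2_fnl.
apply: (@le_trans _ _ (nm g)).
  apply: snorm_ip_le => //; first exact: L2_meas.
  move=> x; apply: le_trans (ler_norm _).
  have := hC (u x) (w x); rewrite -!(nl_norm hp1) => h; exact: h.
apply: le_trans (snormD S2 (siZ S2 _ Luw) (siZ S2 C Ld)) _.
rewrite !(snormZ S2)// !gtr0_norm// nd.
have h1 : nm ((fun x => `|f u x|) + (fun x => `|f w x|)) <= 2 * M.
  by apply: le_trans (snormD S2 Lu Lw) _; rewrite nu nw; have := hM u Hu hu; have := hM w Hw hw; lra.
have h2 := he _ Hd hd nuw.
have := ler_wpM2l (ltW del0) h1; have := ler_wpM2l (ltW C0) h2.
have -> : C * (eta / (2 * C)) = eta / 2 by field; rewrite gt_eqF.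
have -> : eta / (4 * M) * (2 * M) = eta / 2 by field; rewrite gt_eqF.
lra.
Qed.

Lemma fnl_young (k : R) u z : 0 < k -> H1 u -> H1 z ->
  `|ip (f u) z| <= k * (nm (f u) * nm u) + k `^ (- p) * (nm (f z) * nm z).
Proof.
move=> k0 Hu Hz; have Lu := H1_L2 Hu; have Lz := H1_L2 Hz.
have Lfu := L2_fnl Hu; have Lfz := L2_fnl Hz.
have key w : H1 w -> ip (f u) w <= k * ip (f u) u + k `^ (- p) * ip (f w) w.
  move=> Hw; have Lw := H1_L2 Hw; have Lfw := L2_fnl Hw.
  have i1 := L2M Lfu Lw; have i2 := L2M Lfu Lu; have i3 := L2M Lfw Lw.
  have i4 := integrZ k i2; have i5 := integrZ (k `^ (- p)) i3.
  rewrite !ipE -!RintegralZl// -RintegralD//; apply: le_Rintegral => //.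
  - exact: (integrD i4 i5).
  - move=> x _; apply: le_trans (nl_young hp1 (u x) (w x) k0); exact: ler_norm.
have fN : f (- z) = - f z by apply/funext => x; exact: nlN.
have h : `|ip (f u) z| <= k * ip (f u) u + k `^ (- p) * ip (f z) z.
  rewrite ler_norml key// andbT lerNl; have := key _ (siN SH Hz).
  by rewrite fN (siNr S2)// (siNl S2)// ?(siNr S2)// ?opprK//; exact: (siN S2).
apply: (le_trans h); apply: lerD; rewrite ler_wpM2l ?(ltW k0) ?powR_ge0//;
  by apply: le_trans (ler_norm _) _; apply: (si_CS S2).
Qed.

Lemma fnl_convex u w : H1 u -> H1 w ->
  (p + 1) * ip (f u) (w - u) <= ip (f w) w - ip (f u) u.
Proof.
move=> Hu Hw; have Lu := H1_L2 Hu; have Lw := H1_L2 Hw.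
have Lfu := L2_fnl Hu; have Lfw := L2_fnl Hw; have Lwu := siB S2 Lw Lu.
have i1 := L2M Lfu Lwu; have i2 := L2M Lfu Lu; have i3 := L2M Lfw Lw.
rewrite !ipE -RintegralZl// -RintegralB//; apply: le_Rintegral => //.
- exact: (integrZ (p + 1) i1).
- exact: (integrB i3 i2).
- by move=> x _; exact: (nl_convex hp1 (u x) (w x)).
Qed.

End nonlinear_maps.

Lemma int_window (z : int) (m : nat) : - m%:Z <= z -> z <= m%:Z ->
  exists j : 'I_(m + m).+1, z = (j : nat)%:Z - m%:Z.
Proof.
move=> h1 h2; have h : (absz (z + m%:Z)%R < (m + m).+1)%N by lia.
by exists (Ordinal h) => /=; lia.
Qed.

(** * Local compactness *)

Section rellich.
Context {R : realType} {d : nat}.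
Local Notation E := 'rV[R]_d.
Local Notation leb := (@lebesgue_rV R d).
Local Notation nm := (snorm (@ip R d)).
Local Notation hn := (snorm (@aform R d)).
Let S2 := @L2_semi R d.
Let SH := @H1_semi R d.

(** At a fine enough scale [u - avg k u] is uniformly small in L^2 by the Poincare inequality, and
    only finitely many dyadic cubes meet the ball, so that weak convergence makes all the averages
    on them small at once. *)
Lemma rellich (T : Type) (U : set_system T) {FU : Filter U} (u : T -> E -> R) (B r : R) :
  (forall t, H1 (u t)) -> (forall t, hn (u t) <= B) ->
  (forall g, L2 g -> ip (u t) g @[t --> U] --> 0) ->
  nm (fun x => u t x * \1_(ball (0 : E) r) x) @[t --> U] --> 0.
Proof.
move=> Hu hB hw; apply/cvgrPdist_le => e e0.
have [k hk] : exists k, Num.sqrt (2 ^+ d) * 2 ^- k * (d%:R * `|B|) <= e / 2.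
  have hc : 2^-1 ^+ k @[k --> \oo] --> (0 : R) by apply: cvg_expr; rewrite ger0_norm ?invr_ge0// invf_lt1// ltr1n.
  have hc2 : Num.sqrt (2 ^+ d) * (d%:R * `|B|) * 2^-1 ^+ k @[k --> \oo] --> 0 by exact: cvg_scale0.
  have e2 : 0 < e / 2 by rewrite divr_gt0.
  move: hc2 => /cvgrPdist_le /(_ _ e2)[n _ hn]; exists n; have := hn n (leqnn n).
  rewrite /= sub0r normrN => h; apply: le_trans (le_trans (ler_norm _) h).
  by rewrite exprVn mulrAC.
have LB := L2_ballindic (d := d) r.
have [m hm] : exists m : nat, 2 ^+ k * `|r| <= m%:R.
  by exists (Num.truncn (2 ^+ k * `|r|)).+1; rewrite ltW// truncnS_gt.
(* The corners of the dyadic cubes that can meet the ball: integer multiples of [2^-k] between [- m]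
   and [m] in each coordinate, with [m >= 2^k |r|]. *)
pose c (j : {ffun 'I_d -> 'I_(m + m).+1}) : E := \row_i (((j i : nat)%:R - m%:R) * 2 ^- k).
pose e' := e / 2 / (1 + nm (\1_(ball (0 : E) r) : E -> R)).
have n0 : 0 < 1 + nm (\1_(ball (0 : E) r) : E -> R) by rewrite ltr_pwDl// snorm_ge0.
have e'0 : 0 < e' by rewrite !divr_gt0.
have near1 : \forall t \near U, forall j, `|(2 ^+ k) ^+ d * ip (tr (c j) (u t)) (\1_(cube k))| <= e'.
  apply: filter_forall => j.
  have := hw (tr (- c j) \1_(cube k)) (L2_tr _ (L2_cube k)) => h.
  have h2 : ((2 : R) ^+ k) ^+ d * ip (u t) (tr (- c j) \1_(cube k)) @[t --> U] --> 0 by exact: cvg_scale0.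
  move: h2 => /cvgrPdist_le /(_ _ e'0); apply: filterS => t /=.
  by rewrite sub0r normrN ip_trl//; [exact: H1_L2|exact: L2_cube].
apply: filterS near1 => t ht; rewrite sub0r normrN ger0_norm ?snorm_ge0//.
have [LD hD] := avg_poincare k (Hu t).
have [La na] := L2_norm LD.
have LuB : L2 (fun x => u t x * \1_(ball (0 : E) r) x).
  apply: (L2_le _ (H1_L2 (Hu t))).
    by apply: measurable_funM; [exact: L2_meas (H1_L2 (Hu t))|exact: measurable_indic (measurable_ball_rV _ _)].
  by move=> x; rewrite normrM ler_piMr// indicE; case: (_ \in _); rewrite ?normr0 ?normr1.
pose g : E -> R := (fun x => `|(u t - avg k (u t)) x|) + e' *: \1_(ball (0 : E) r).
have LeB := siZ S2 e' LB.
apply: (@le_trans _ _ (nm g)).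
  apply: snorm_ip_le; [exact: L2_meas|exact: (siD S2)|move=> x].
  apply: le_trans (ler_norm _); rewrite -[g x]/(`|u t x - avg k (u t) x| + e' * \1_(ball (0 : E) r) x).
  have [hx|hx] := pselect (ball (0 : E) r x); last by rewrite indicE memNset// !mulr0 normr0 addr0.
  rewrite indicE mem_set// !mulr1.
  suff h : `|avg k (u t) x| <= e'.
    by have := ler_normD (u t x - avg k (u t) x) (avg k (u t) x); rewrite subrK; lra.
  have p2 : 0 < 2 ^+ k :> R by rewrite exprn_gt0.
  have hz i : exists j : 'I_(m + m).+1, Num.floor (2 ^+ k * x ord0 i) = (j : nat)%:Z - m%:Z.
    have r0 : 0 < r by case: hx.
    have := (ball_rVP (0 : E) x r0).1 hx i; rewrite mxE sub0r normrN => hxi.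
    have : `|2 ^+ k * x ord0 i| < m%:R.
      rewrite normrM (gtr0_norm p2); apply: lt_le_trans hm.
      by rewrite ltr_pM2l// (lt_le_trans hxi)// ler_norm.
    rewrite ltr_norml => /andP[h1 h2].
    have f1 : - m%:Z <= Num.floor (2 ^+ k * x ord0 i) by rewrite floor_ge_int_tmp rmorphN/= ltW.
    have f2 : Num.floor (2 ^+ k * x ord0 i) <= m%:Z.
      by rewrite -(ler_int R); apply: le_trans (ltW h2); have /andP[] := floor_itv (2 ^+ k * x ord0 i).
    exact: int_window.
  have [j hj] := choice hz.
  have hc : corner k x = c (finfun j) by apply/rowP => i; rewrite !mxE hj ffunE intrB.
  by rewrite avgE hc.
apply: le_trans (snormD S2 La LeB) _; rewrite na (snormZ S2)// (gtr0_norm e'0).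
have h1 : nm (u t - avg k (u t)) <= e / 2.
  apply: (le_trans hD); apply: le_trans hk; rewrite ler_wpM2l ?mulr_ge0 ?sqrtr_ge0 ?(ltW (side_gt0 k))//.
  rewrite (_ : d%:R * `|B| = \sum_(i < d) `|B|); last by rewrite sumr_const card_ord mulr_natl.
  apply: ler_sum => i _; apply: le_trans (nm_wp_le_hn i (Hu t)) _.
  by apply: (le_trans (hB t)); exact: ler_norm.
have h2 : e' * nm (\1_(ball (0 : E) r) : E -> R) <= e / 2.
  rewrite /e' mulrAC ler_pdivrMr// ler_wpM2l ?lerDr//.
  by rewrite divr_ge0// ltW.
lra.
Qed.

End rellich.

(** * Mollification, cutoff, and density of test functions in H^1 *)

Section mollification.
Context {R : realType} {d : nat}.
Local Notation E := 'rV[R]_d.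
Local Notation leb := (@lebesgue_rV R d).
Local Notation nm := (snorm (@ip R d)).
Local Notation hn := (snorm (@aform R d)).
Local Notation test := (test_function (@setT E)).
Let S2 := @L2_semi R d.
Let SH := @H1_semi R d.
Implicit Types (u w : E -> R) (rho kappa theta phi : E -> R).

Lemma cvg_quotient_quad (V : normedModType R) (f : V -> R) (x v : V) (l C : R) :
  (forall h : R, `|h| <= 1 -> `|f (h *: v + x) - f x - h * l| <= C * h ^+ 2) ->
  derivable f x v /\ 'D_v f x = l.
Proof.
move=> hC.
have hc : h^-1 *: (f (h *: v + x) - f x) @[h --> 0^'] --> l.
  apply/cvgrPdist_le => e e0.
  have p : 0 < 1 + `|C| by rewrite ltr_pwDl.
  have d0 : 0 < Num.min 1 (e / (1 + `|C|)) by rewrite lt_min ltr01 divr_gt0.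
  near=> h.
  have hn0 : h != 0 by near: h; exact: nbhs_dnbhs_neq.
  have : `|h| < Num.min 1 (e / (1 + `|C|)) by near: h; exact: dnbhs0_lt.
  rewrite lt_min => /andP[h1 h2].
  rewrite -[_ *: _]/(h^-1 * _).
  have -> : l - h^-1 * (f (h *: v + x) - f x) = - (h^-1 * (f (h *: v + x) - f x - h * l)).
    by field.
  rewrite normrN normrM normfV ler_pdivrMl ?normr_gt0//.
  apply: (le_trans (hC h (ltW h1))).
  rewrite -(real_normK (num_real h)) expr2 mulrA mulrC ler_wpM2l//.
  apply: (@le_trans _ _ ((1 + `|C|) * `|h|)).
    by rewrite ler_wpM2r//; have := ler_norm C; lra.
  by rewrite -ler_pdivlMl// mulrC ltW.
split; first exact: (cvgP _ hc).
exact: cvg_lim hc.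
Unshelve. all: by end_near.
Qed.

(** A correlation, the integral of [u(x + y) rho(y)]; hence the minus sign when a derivative is
    moved to the kernel. *)
Definition conv rho u : E -> R := fun x => ip (tr x u) rho.

Lemma conv_quotient rho u v x : test rho -> L2 u ->
  derivable (conv rho u) x v /\ 'D_v (conv rho u) x = - conv ('D_v rho) u x.
Proof.
move=> tr_ Lu; have [r [M [r0 M0 hM]]] := test_line_bound v tr_.
have tD := test_D v tr_; have Lr := test_L2 tr_; have LD := test_L2 tD.
have LB := L2_ballindic (d := d) r.
apply: (@cvg_quotient_quad _ _ _ _ _ (nm u * (M * nm (\1_(ball (0 : E) r) : E -> R)))) => h h1.
pose g : E -> R := tr (- (h *: v)) rho - rho - (- h) *: 'D_v rho.
have L1 := L2_tr (- (h *: v)) Lr.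
have L3 := siB S2 L1 Lr; have L4 := siZ S2 (- h) LD.
have Lg : L2 g by apply: (siB S2).
have Lux := L2_tr x Lu.
have -> : conv rho u (h *: v + x) - conv rho u x - h * - conv ('D_v rho) u x = ip (tr x u) g.
  rewrite /g (siBr S2)// (siBr S2)// (siZr S2)// /conv.
  have -> : ip (tr x u) (tr (- (h *: v)) rho) = ip (tr (h *: v + x) u) rho.
    by rewrite -tr_tr; rewrite -[in RHS](tr0 rho) -(subrr (h *: v)) -tr_tr ip_tr.
  by ring.
apply: (le_trans (si_CS S2 Lux Lg)); rewrite nm_tr// -[leRHS]mulrA ler_wpM2l ?snorm_ge0//.
have gb y : `|g y| <= M * h ^+ 2 * \1_(ball (0 : E) r) y.
  have := hM (- h) y; rewrite normrN => /(_ h1); rewrite sqrrN.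
  have -> : (- h) *: v + y = y + - (h *: v) by rewrite scaleNr addrC.
  exact.
have [_ hg] := L2_bounded (L2_meas Lg) gb.
apply: (le_trans hg); by rewrite (ger0_norm (mulr_ge0 M0 (sqr_ge0 h))) mulrAC.
Qed.

Lemma smooth_conv rho u : test rho -> L2 u -> smooth (conv rho u).
Proof.
move=> tr_ Lu.
apply: (@smooth_coind _ _ (fun f => exists c rho, test rho /\ f = c *: conv rho u)); last first.
  by exists 1, rho; split => //; rewrite scale1r.
move=> _ [c [r [tr0 ->]]]; have dq x v := conv_quotient v x tr0 Lu.
have Lr := test_L2 tr0.
split.
- move=> x; apply/(@cvgrPdist_le R R E (nbhs x) (nbhs_filter x)) => e e0.
  have p : 0 < 1 + `|c| * nm u by rewrite ltr_pwDl// mulr_ge0// snorm_ge0.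
  have [del del0 hdel] := nm_tr_cont Lr (divr_gt0 e0 p).
  apply: filterS (nbhsx_ballx x del del0) => y xy.
  rewrite -[_ - _]/(c * conv r u x - c * conv r u y) -mulrBr normrM /conv.
  have -> : ip (tr x u) r - ip (tr y u) r = ip (tr y u) (tr (y - x) r - r).
    rewrite (siBr S2)//; try exact: L2_tr.
    by rewrite -[in LHS](ip_tr (y - x) (L2_tr x Lu) Lr) tr_tr subrK.
  have hb := si_CS S2 (L2_tr y Lu) (siB S2 (L2_tr (y - x) Lr) Lr).
  rewrite nm_tr// in hb.
  apply: (@le_trans _ _ (`|c| * (nm u * (e / (1 + `|c| * nm u))))).
    rewrite ler_wpM2l//; apply: (le_trans hb); rewrite ler_wpM2l ?snorm_ge0// hdel//.
    by rewrite distrC ltW//; move: xy; rewrite -ball_normE.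
  rewrite mulrA mulrCA mulrA ler_pdivrMr// ler_wpM2l ?(ltW e0)//.
  by rewrite lerDr.
- move=> x v; apply: derivableZ; exact: (dq x v).1.
- move=> v; exists (- c), ('D_v r); split; first exact: test_D.
  apply/funext => x; rewrite deriveZ; last exact: (dq x v).1.
  by rewrite (dq x v).2 -[RHS]/(- c * conv ('D_v r) u x) -[LHS]/(c * - conv ('D_v r) u x) mulrN mulNr.
Qed.

Lemma D_conv_grad rho u i : test rho -> H1 u ->
  'D_(dir i) (conv rho u) = conv rho (grad i u).
Proof.
move=> t Hu; apply/funext => x; rewrite (conv_quotient (dir i) x t (H1_L2 Hu)).2 /conv.
have := wp_tr x (H1_L2 Hu) (L2_grad i Hu) (grad_wp i Hu).
by move=> /ip_weakP /(_ rho t) ->; rewrite opprK.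
Qed.

(** The kernel is a square [kappa^2] with [nm kappa = 1], so its integral is 1 and the error at [x]
    is a pairing with [kappa]; Cauchy-Schwarz bounds it by an L^2 norm that integrates well in
    [x]. *)
Lemma conv_pointwise kappa u x : test kappa -> nm kappa = 1 -> L2 u ->
  let w := fun h : E => (u (x + h) - u x) * kappa h in
  L2 w /\ `|u x - conv (kappa * kappa) u x| <= nm w.
Proof.
move=> tk nk Lu w; have Lk := test_L2 tk.
have [r [M [r0 M0 hM]]] := test_bound tk.
have mk := test_meas tk.
have ew : w = (fun h => tr x u h * kappa h) - u x *: kappa.
  by apply/funext => h; rewrite /w (addrC x h) mulrBl.
have Lt : L2 (fun h => tr x u h * kappa h).
  apply: (@L2_le _ _ _ (M *: tr x u)); last first.
  - move=> h; rewrite -[(M *: _) h]/(M * tr x u h) !normrM mulrC ler_wpM2r// (le_trans (hM h))//.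
    rewrite (ger0_norm M0) ler_piMr// indicE; by case: (_ \in _).
  - by apply: (siZ S2); exact: L2_tr.
  - by apply: measurable_funM => //; exact: L2_meas (L2_tr x Lu).
have Lw : L2 w by rewrite ew; apply: (siB S2) => //; exact: (siZ S2).
split=> //.
have -> : u x - conv (kappa * kappa) u x = - ip w kappa.
  rewrite ew (siBl S2)//; last exact: (siZ S2).
  rewrite (siZl S2)// -(snorm_sqr S2)// nk expr1n mulr1 opprB; congr (_ - _).
  by rewrite /conv !ipE; apply: eq_Rintegral => y _; rewrite mulrA.
by rewrite normrN; have := si_CS S2 Lw Lk; rewrite nk mulr1.
Qed.

(** Integrate the square of [conv_pointwise] and exchange the integrals: the error is the
    [kappa^2]-average of the squared translation errors. *)
Lemma conv_close kappa u (m : R) : test kappa -> nm kappa = 1 -> L2 u -> 0 <= m ->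
  (forall h, kappa h != 0 -> nm (tr h u - u) <= m) ->
  L2 (u - conv (kappa * kappa) u) /\ nm (u - conv (kappa * kappa) u) <= m.
Proof.
move=> tk nk Lu m0 hm; have mu := L2_meas Lu; have mk := test_meas tk.
have tkk : test (kappa * kappa) by apply: test_mull => //; case: tk.
pose F (z : E * E) : R := ((u (z.1 + z.2) - u z.1) * kappa z.2) ^+ 2.
have mF : measurable_fun setT F.
  apply: measurable_funX; apply: measurable_funM.
    apply: measurable_funB; first by apply: measurableT_comp; [exact: mu|exact: measurable_add_rV].
    exact: measurableT_comp.
  exact: measurableT_comp.
have mEF : measurable_fun setT (fun z => (F z)%:E) by exact/measurable_EFinP.
have F0 z : (0 <= (F z)%:E)%E by rewrite lee_fin sqr_ge0.
set w := u - conv (kappa * kappa) u.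
have mw : measurable_fun setT w.
  apply: measurable_funB => //; apply: continuous_measurable_rV; apply: smooth_cont.
  exact: smooth_conv.
have key : (\int[leb]_x (w x ^+ 2)%:E <= (m ^+ 2)%:E)%E.
  apply: (@le_trans _ _ (\int[leb]_x (\int[leb]_h (F (x, h))%:E))%E).
    apply: ge0_le_integral => //.
    - by move=> x _; rewrite lee_fin sqr_ge0.
    - by apply/measurable_EFinP; exact: measurable_funX.
    - exact: (measurable_fun_fubini_tonelli_F _ mEF F0).
    - move=> x _; have [Lw hw] := conv_pointwise x tk nk Lu.
      rewrite -(nm_sqr_int Lw) lee_fin.
      by rewrite -[leLHS]real_normK ?num_real// lerXn2r ?nnegrE ?snorm_ge0.
  rewrite (@fubini_tonelli _ _ _ _ _ leb leb _ mEF F0).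
  apply: (@le_trans _ _ (\int[leb]_h ((m ^+ 2)%:E * (kappa h ^+ 2)%:E))%E).
    apply: ge0_le_integral => //.
    - by move=> h _; exact: integral_ge0.
    - exact: (measurable_fun_fubini_tonelli_G _ mEF F0).
    - by apply: emeasurable_funM => //; apply/measurable_EFinP; exact: measurable_funX.
    - move=> h _; have [k0|kn0] := eqVneq (kappa h) 0.
        rewrite integral0_eq; first by rewrite k0 expr0n mule0.
        by move=> x _; rewrite /F /= k0 mulr0 expr0n.
      have Lt : L2 (tr h u - u) by apply: (siB S2) => //; exact: L2_tr.
      have -> : (\int[leb]_x (F (x, h))%:E = (nm (kappa h *: (tr h u - u)) ^+ 2)%:E)%E.
        rewrite nm_sqr_int; last exact: (siZ S2).
        apply: eq_integral => x _; rewrite /F /= [in LHS]mulrC.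
        by [].
      rewrite -EFinM lee_fin (snormZ S2)// exprMn real_normK ?num_real// mulrC.
      by rewrite ler_wpM2r ?sqr_ge0// lerXn2r ?nnegrE ?snorm_ge0// hm.
  rewrite ge0_integralZl//; last 3 first.
  - by apply/measurable_EFinP; exact: measurable_funX.
  - by move=> h _; rewrite lee_fin sqr_ge0.
  - by rewrite lee_fin sqr_ge0.
  by rewrite -(nm_sqr_int (test_L2 tk)) nk expr1n mule1.
have LD : L2 w.
  apply: L2I => //; apply/integrableP; split.
    by apply/measurable_EFinP; exact: measurable_funX.
  apply: le_lt_trans (ltry (m ^+ 2)); apply: le_trans key.
  rewrite le_eqVlt; apply/orP; left; apply/eqP; apply: eq_integral => x _ /=.
  by rewrite ger0_norm ?sqr_ge0.
by split=> //; rewrite -ler_sqr ?nnegrE ?snorm_ge0// -lee_fin nm_sqr_int.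
Qed.

Lemma bump_kernel (e : R) : 0 < e -> exists kappa, [/\ test kappa, nm kappa = 1 &
  forall h, kappa h != 0 -> `|h| <= e].
Proof.
move=> e0; pose b : E -> R := boxf (const_mx (- e)) (const_mx e) 0.
have tb : test b by exact: test_boxf.
have Lb := test_L2 tb.
have nb : 0 < nm b.
  rewrite lt_def snorm_ge0 andbT; apply/eqP => n0.
  have := snorm_ip0_ae Lb n0 => -[N [mN N0 hN]].
  have sub : ball (0 : E) e `<=` N.
    move=> x hx; apply: hN => /= /(_ I); apply/eqP; rewrite gt_eqF// boxf_gt0// => i.
    have := (ball_rVP (0 : E) x e0).1 hx i; rewrite !mxE sub0r normrN ltr_norml.
    by move=> /andP[-> ->].
  have := le_measure leb (mem_set (measurable_ball_rV (0 : E) e)) (mem_set mN) sub.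
  by rewrite /= N0 lebesgue_ball0// lee_fin leNgt exprn_gt0// mulr_gt0.
exists ((nm b)^-1 *: b); split; first exact: test_scale.
  by rewrite (snormZ S2)// gtr0_norm ?invr_gt0// mulVf// gt_eqF.
move=> h; have [hb|hb] := pselect (obox (const_mx (- e)) (const_mx e : E) h); last first.
  by rewrite -[(_ *: _) h]/((nm b)^-1 * b h) /b boxf_out// mulr0 eqxx.
move=> _; apply: norm_rV_le; first exact: ltW.
by move=> i; have := hb i; rewrite !mxE => /andP[h1 h2]; rewrite ler_norml !ltW.
Qed.

Lemma smooth_dense_H1 u (e : R) : H1 u -> 0 < e ->
  exists w, [/\ smooth w, H1 w, forall i, L2 ('D_(dir i) w) & hn (u - w) <= e].
Proof.
move=> Hu e0; have Lu := H1_L2 Hu.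
(* The squared H^1 norm has [1 + d] terms, each with the tolerance [e']. *)
pose e' := e / Num.sqrt (1 + d%:R).
have s0 : 0 < Num.sqrt (1 + d%:R) :> R by rewrite sqrtr_gt0 ltr_pwDl.
have e'0 : 0 < e' by rewrite divr_gt0.
have [d0 d00 hd0] := nm_tr_cont Lu e'0.
have hg i : exists t, 0 < t /\ forall h : E, `|h| <= t -> nm (tr h (grad i u) - grad i u) <= e'.
  by have [t t0 ht] := nm_tr_cont (L2_grad i Hu) e'0; exists t.
have [t ht] := choice hg.
pose del := \big[Num.min/d0]_i t i.
have del0 : 0 < del by apply/bigmin_gtP; split => // i _; have [] := ht i.
have [k [tk nk hk]] := bump_kernel del0.
have [L0 n0] : L2 (u - conv (k * k) u) /\ nm (u - conv (k * k) u) <= e'.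
  apply: conv_close => //; first exact: ltW.
  move=> h /hk h1; apply: hd0; apply: (le_trans h1); exact: bigmin_le_id.
have hgi i : L2 (grad i u - conv (k * k) (grad i u)) /\ nm (grad i u - conv (k * k) (grad i u)) <= e'.
  apply: conv_close => //; [exact: L2_grad|exact: ltW|].
  move=> h /hk h1; have [_ h2] := ht i; apply: h2; apply: (le_trans h1).
  exact: (bigmin_le_cond _ t).
have tkk : test (k * k) by apply: test_mull => //; case: tk.
pose w := conv (k * k) u.
have sw : smooth w by exact: smooth_conv.
have Dw i : 'D_(dir i) w = conv (k * k) (grad i u) by exact: D_conv_grad.
have LDw i : L2 ('D_(dir i) w).
  by rewrite Dw -(subKr (grad i u) (conv _ _)); apply: (siB S2); [exact: L2_grad|have [] := hgi i].
have Lw : L2 w by rewrite -(subKr u w); apply: (siB S2).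
have wpw i := wp_smooth i sw.
have Hw : H1 w by apply: (@H1I _ _ _ (fun i => 'D_(dir i) w)).
exists w; split => //.
have Hd := siB SH Hu Hw.
rewrite -ler_sqr ?nnegrE ?snorm_ge0 ?(ltW e0)// (snorm_sqr SH)//.
have wpd i : weak_partial i (u - w) (grad i u - 'D_(dir i) w).
  have := wp_lin (- 1) Lw Lu (LDw i) (L2_grad i Hu) (wpw i) (grad_wp i Hu).
  by rewrite !scaleN1r (addrC _ u) (addrC _ (grad i u)).
have LDd i : L2 (grad i u - 'D_(dir i) w) by rewrite Dw; have [] := hgi i.
rewrite (aformE L0 L0 LDd LDd wpd wpd) -(snorm_sqr S2)//.
have -> : e ^+ 2 = e' ^+ 2 + \sum_(i < d) e' ^+ 2.
  rewrite sumr_const card_ord -mulr_natl /e' expr_div_n sqr_sqrtr ?addr_ge0//.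
  by field; rewrite gt_eqF// ltr_pwDl.
apply: lerD; first by rewrite lerXn2r ?nnegrE ?snorm_ge0// ltW.
apply: ler_sum => i _; rewrite -(snorm_sqr S2)// lerXn2r ?nnegrE ?snorm_ge0 ?(ltW e'0)//.
by rewrite Dw; have [] := hgi i.
Qed.

Lemma derive_scale_dir (f : E -> R) (s : R) (v x : E) : smooth f ->
  'D_(s *: v) f x = s * 'D_v f x.
Proof.
move=> sf.
have h1 := is_derive_line (s *: v) x 0 sf.
have h2 := is_derive_line v x (0 * s) sf.
have h3 : is_derive (0 : R) 1 (fun t : R => t * s) s.
  by apply: is_derive_eq; rewrite /GRing.scale /=; ring.
have h4 := @is_derive1_comp _ (fun s0 : R => f (s0 *: v + x)) (fun t => t * s) 0 _ _ h2 h3.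
have e : (fun t : R => f (t *: (s *: v) + x)) = (fun s0 : R => f (s0 *: v + x)) \o (fun t => t * s).
  by apply/funext => t /=; rewrite scalerA.
have := @derive_val _ _ _ _ _ _ _ h1; rewrite e (@derive_val _ _ _ _ _ _ _ h4).
by rewrite mul0r !scale0r add0r mulrC => <-.
Qed.

(** The multiplication by the dilated cutoff is bounded on L^2 uniformly in [n], so [w] may be
    replaced by a compactly supported [phi], on whose support the cutoff tends uniformly to
    [theta 0 = 1]. *)
Lemma cutoff_L2 theta w (e : R) : test theta -> theta 0 = 1 -> L2 w -> 0 < e ->
  \forall n \near \oo, nm ((fun x => theta (n.+1%:R^-1 *: x)) * w - w) <= e.
Proof.
move=> tt t1 Lw e0; have [rt [M [_ M0 hM]]] := test_bound tt.
have hM' x : `|theta x| <= M.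
  by apply: (le_trans (hM x)); rewrite ler_piMr// indicE; case: (_ \in _).
have p : 0 < M + 2 by rewrite ltr_wpDl.
have [phi [tphi hphi]] := test_dense Lw (divr_gt0 (divr_gt0 e0 (ltr0n _ 2)) p).
have Lp := test_L2 tphi.
have [r [r0 hr]] := test_ball tphi.
have q0 : 0 < e / 2 / (1 + nm phi) by rewrite !divr_gt0// ltr_pwDl// snorm_ge0.
have ct : continuous theta by case: tt => /smooth_cont.
have := ct (0 : E); move=> /cvgrPdist_le /(_ _ q0) /nbhs_ballP[del /= del0 hdel].
near=> n.
have nr : n.+1%:R^-1 * r < del.
  rewrite -ltr_pdivlMr//; near: n; exact: (near_infty_natSinv_lt (PosNum (divr_gt0 del0 r0))).
pose c : E -> R := fun x => theta (n.+1%:R^-1 *: x).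
have cm : measurable_fun setT c.
  apply: continuous_measurable_rV; apply: smooth_cont.
  apply: (@smooth_affine R E E (fun x => n.+1%:R^-1 *: x) (fun x => n.+1%:R^-1 *: x)); last by case: tt.
    by move=> h v x; rewrite scalerDr !scalerA mulrC.
  exact: scaler_continuous.
have Lc z : L2 z -> L2 (c * z) /\ nm (c * z) <= M * nm z.
  move=> Lz; have hb x : `|(c * z) x| <= `|(M *: z) x|.
    by rewrite -[(c * z) x]/(c x * z x) -[(M *: z) x]/(M * z x) !normrM ler_wpM2r// (ger0_norm M0) hM'.
  have mcz : measurable_fun setT (c * z) by apply: measurable_funM => //; exact: L2_meas.
  split; first exact: (L2_le mcz (siZ S2 M Lz) hb).
  by apply: le_trans (snorm_ip_le mcz (siZ S2 M Lz) hb) _; rewrite (snormZ S2)// (ger0_norm M0).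
have Lwp := siB S2 Lw Lp.
have -> : c * w - w = (c * (w - phi) - (w - phi)) + (c * phi - phi).
  by apply/funext => x; rewrite !fctE; ring.
have [La na] := Lc _ Lwp; have [Lb nb] := Lc _ Lp.
have L1 := siB S2 La Lwp; have L3 := siB S2 Lb Lp.
apply: le_trans (snormD S2 L1 L3) _.
have h1 : nm (c * (w - phi) - (w - phi)) <= e / 2.
  apply: le_trans (snormB S2 La Lwp) _.
  apply: (@le_trans _ _ ((M + 2) * nm (w - phi))); first by have := snorm_ge0 (@ip R d) (w - phi); lra.
  by rewrite mulrC -ler_pdivlMr.
have h2 : nm (c * phi - phi) <= e / 2.
  apply: (@le_trans _ _ (nm ((e / 2 / (1 + nm phi)) *: phi))).
    apply: snorm_ip_le; [exact: L2_meas|exact: (siZ S2)|move=> x].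
    rewrite -[(c * phi - phi) x]/(c x * phi x - phi x) -[(_ *: phi) x]/(e / 2 / (1 + nm phi) * phi x).
    have [hx|hx] := pselect (ball (0 : E) r x); last by rewrite hr// !mulr0 subrr.
    rewrite -[X in _ - X]mul1r -mulrBl (normrM (c x - 1)) (normrM (e / 2 / _)) ler_wpM2r// (gtr0_norm q0) distrC -[X in `|X - _|]t1.
    apply: hdel; rewrite -ball_normE /= sub0r normrN normrZ ger0_norm ?invr_ge0//.
    apply: le_lt_trans nr; rewrite ler_wpM2l ?invr_ge0// ltW//.
    by move: hx; rewrite -ball_normE /= sub0r normrN.
  rewrite (snormZ S2)// (gtr0_norm q0) mulrAC ler_pdivrMr ?ltr_pwDl ?snorm_ge0//.
  by rewrite ler_wpM2l ?lerDr// ltW// divr_gt0.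
lra.
Unshelve. all: by end_near.
Qed.

(** Mollify, then cut off. Differentiating the dilated cutoff produces a factor [s = 1/(n+1)], so
    the extra term [w D c] is small in L^2; each of the [1 + d] components is off by at most
    [2 e']. *)
Lemma test_dense_H1 u (e : R) : H1 u -> 0 < e -> exists phi, test phi /\ hn (u - phi) <= e.
Proof.
move=> Hu e0; have e20 : 0 < e / 2 by rewrite divr_gt0.
have [w [sw Hw LDw hw]] := smooth_dense_H1 Hu e20.
have Lw := H1_L2 Hw.
pose b : E -> R := boxf (const_mx (- 1)) (const_mx 1) 0.
have tb : test b by exact: test_boxf.
have b0 : 0 < b 0 by apply: boxf_gt0 => i; rewrite !mxE; lra.
pose theta := (b 0)^-1 *: b.
have tt : test theta by exact: test_scale.
have t1 : theta 0 = 1 by rewrite -[LHS]/((b 0)^-1 * b 0) mulVf// gt_eqF.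
have [st _ _] := tt.
pose e' := e / 4 / Num.sqrt (1 + d%:R).
have s0 : 0 < Num.sqrt (1 + d%:R) :> R by rewrite sqrtr_gt0 ltr_pwDl.
have e'0 : 0 < e' by rewrite divr_gt0// divr_gt0.
have hB i : exists M, 0 <= M /\ forall x, `|'D_(dir i) theta x| <= M.
  have [rt [M [_ M0 hM]]] := test_bound (test_D (dir i) tt); exists M; split => // x.
  by apply: (le_trans (hM x)); rewrite ler_piMr// indicE; case: (_ \in _).
have [M hM] := choice hB.
pose K := 1 + \sum_i M i * nm w.
have K0 : 0 < K by rewrite ltr_pwDl// sumr_ge0// => i _; rewrite mulr_ge0 ?snorm_ge0//; have [] := hM i.
suff [n [n1 n2 n3]] : exists n, [/\ nm ((fun x => theta (n.+1%:R^-1 *: x)) * w - w) <= e',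
    forall i, nm ((fun x => theta (n.+1%:R^-1 *: x)) * 'D_(dir i) w - 'D_(dir i) w) <= e'
    & n.+1%:R^-1 < e' / K].
  pose s : R := n.+1%:R^-1.
  have sp : 0 < s by rewrite invr_gt0.
  pose c : E -> R := fun x => theta (s *: x).
  have sc : smooth c.
    apply: (@smooth_affine R E E (fun x => s *: x) (fun x => s *: x)) => //.
      by move=> h v x; rewrite scalerDr !scalerA mulrC.
    exact: scaler_continuous.
  have Dc i x : 'D_(dir i) c x = s * 'D_(dir i) theta (s *: x).
    rewrite -derive_scale_dir//; apply: (@derive_affine R E E (fun x => s *: x) (fun x => s *: x)).
    by move=> h v y; rewrite scalerDr !scalerA mulrC.
  have tc : test c.
    have [r [r0 hr]] := test_ball tt.
    apply: (@ball_test _ _ _ (r / s)) => // x hx; apply: hr => hb; apply: hx.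
    move: hb; rewrite -!ball_normE /= !sub0r !normrN normrZ (gtr0_norm sp).
    by rewrite ltr_pdivlMr// mulrC.
  exists (c * w); split; first by rewrite mulrC; exact: test_mull.
  have tcw : test (c * w) by rewrite mulrC; exact: test_mull.
  have Hcw := test_H1 tcw.
  have Hd := siB SH Hcw Hw.
  suff h : hn (c * w - w) <= e / 2.
    by have := snorm_triangle SH Hu Hw Hcw; rewrite (snorm_distC SH Hw Hcw); lra.
  have scw : smooth (c * w) by exact: smooth_mul.
  have De i : 'D_(dir i) (c * w) = c * 'D_(dir i) w + w * 'D_(dir i) c.
    by apply/funext => x; rewrite deriveM; [|exact: smooth_derivable..].
  have Lcw := H1_L2 Hcw.
  have LDcw i : L2 ('D_(dir i) (c * w)) by apply: test_L2; exact: test_D.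
  have wpd i : weak_partial i (c * w - w) ('D_(dir i) (c * w) - 'D_(dir i) w).
    have := wp_lin (- 1) Lw Lcw (LDw i) (LDcw i) (wp_smooth i sw) (wp_smooth i scw).
    by rewrite !scaleN1r (addrC _ (c * w)) (addrC _ ('D_(dir i) (c * w))).
  have LDd i := siB S2 (LDcw i) (LDw i).
  have Ld := siB S2 Lcw Lw.
  rewrite -ler_sqr ?nnegrE ?snorm_ge0 ?(ltW e20)// (snorm_sqr SH)//.
  rewrite (aformE Ld Ld LDd LDd wpd wpd) -(snorm_sqr S2)//.
  have -> : (e / 2) ^+ 2 = (2 * e') ^+ 2 + \sum_(i < d) (2 * e') ^+ 2.
    have e'2 : e' ^+ 2 = (e / 4) ^+ 2 / (1 + d%:R) by rewrite expr_div_n sqr_sqrtr ?addr_ge0.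
    rewrite sumr_const card_ord -[_ *+ d]mulr_natl (_ : (2 * e') ^+ 2 = 4 * e' ^+ 2); last by ring.
    rewrite e'2.
    by field; rewrite gt_eqF// ltr_pwDl.
  have n1' : nm (c * w - w) <= 2 * e' by apply: (@le_trans _ _ e' _ _ n1); lra.
  have e'4 : 0 <= 2 * e' by rewrite mulr_ge0 ?(ltW e'0).
  apply: lerD; first by rewrite lerXn2r ?nnegrE ?snorm_ge0.
  apply: ler_sum => i _; rewrite -(snorm_sqr S2)// lerXn2r ?nnegrE ?snorm_ge0//.
  have [Mi0 hMi] := hM i.
  have bd x : `|(w * 'D_(dir i) c) x| <= `|((s * M i) *: w) x|.
    rewrite -[(w * _) x]/(w x * 'D_(dir i) c x) Dc -[(_ *: w) x]/(s * M i * w x).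
    rewrite !normrM mulrC ler_wpM2r// (gtr0_norm sp) (ger0_norm Mi0) ler_wpM2l ?(ltW sp)//.
  have mwc : measurable_fun setT (w * 'D_(dir i) c).
    have mD := continuous_measurable_rV (smooth_cont (smooth_D (dir i) sc)).
    exact: (measurable_funM (continuous_measurable_rV (smooth_cont sw)) mD).
  have LsM := siZ S2 (s * M i) Lw.
  have L1 := L2_le mwc LsM bd.
  have n4 := snorm_ip_le mwc LsM bd; rewrite (snormZ S2)// (ger0_norm (mulr_ge0 (ltW sp) Mi0)) in n4.
  have e1 : 'D_(dir i) (c * w) - 'D_(dir i) w = (c * 'D_(dir i) w - 'D_(dir i) w) + w * 'D_(dir i) c.
    by rewrite De addrAC.
  have L5 : L2 (c * 'D_(dir i) w - 'D_(dir i) w).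
    rewrite (_ : _ - _ = 'D_(dir i) (c * w) - 'D_(dir i) w - w * 'D_(dir i) c); last by rewrite e1 addrK.
    exact: (siB S2).
  rewrite e1; apply: le_trans (snormD S2 L5 L1) _.
  have h5 : s * M i * nm w <= e'.
    apply: (@le_trans _ _ (s * K)).
      rewrite -mulrA ler_wpM2l ?(ltW sp)// /K (bigD1 i)//= addrCA lerDl addr_ge0// sumr_ge0// => j _.
      by rewrite mulr_ge0 ?snorm_ge0//; have [] := hM j.
    by rewrite -ler_pdivlMr// ltW.
  by have := n2 i; rewrite -/s -/c; lra.
near \oo => n; exists n; split.
- by near: n; exact: cutoff_L2.
- by near: n; apply: filter_forall => i; exact: cutoff_L2.
- by near: n; exact: (near_infty_natSinv_lt (PosNum (divr_gt0 e'0 K0))).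
Unshelve. all: by end_near.
Qed.

End mollification.

(** * Derivatives of curves and the energy identity *)

Section scalar_derivatives.
Context {R : realType}.
Implicit Types (F G : R -> R) (t s c e : R).

Lemma is_derive_epsP F t c : is_derive t 1 F c <->
  forall e, 0 < e -> exists2 del, 0 < del &
    forall s, `|s - t| < del -> `|F s - F t - (s - t) * c| <= e * `|s - t|.
Proof.
split=> [dF e e0|h].
  have [dv cF] := dF.
  have : h^-1 *: (F (h *: 1 + t) - F t) @[h --> 0^'] --> c by rewrite -cF; exact: dv.
  move=> /cvgrPdist_le /(_ e e0) [del /= del0 hdel]; exists del => // s st.
  have [->|sn] := eqVneq s t; first by rewrite !subrr mul0r subrr normr0 mulr0.
  have h0 : s - t != 0 by rewrite subr_eq0.
  have := hdel (s - t); rewrite /ball_ /= sub0r normrN => /(_ st h0).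
  rewrite -[_ *: 1]/((s - t) * 1) mulr1 subrK -[_ *: _]/((s - t)^-1 * (F s - F t)) => h1.
  have -> : F s - F t - (s - t) * c = - ((s - t) * (c - (s - t)^-1 * (F s - F t))) by field.
  by rewrite normrN normrM mulrC ler_wpM2r.
have hc : h^-1 *: (F (h *: 1 + t) - F t) @[h --> 0^'] --> c.
  apply/cvgrPdist_le => e e0; have [del del0 hdel] := h e e0.
  near=> x.
  have x0 : x != 0 by near: x; exact: nbhs_dnbhs_neq.
  have xd : `|x| < del by near: x; exact: dnbhs0_lt.
  rewrite -[_ *: 1]/(x * 1) mulr1 -[_ *: _]/(x^-1 * (F (x + t) - F t)).
  have := hdel (x + t); rewrite addrK => /(_ xd) h1.
  have -> : c - x^-1 * (F (x + t) - F t) = - (x^-1 * (F (x + t) - F t - x * c)) by field.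
  by rewrite normrN normrM normfV ler_pdivrMl ?normr_gt0// (mulrC `|x|).
apply: DeriveDef; [exact: (cvgP _ hc)|exact: cvg_lim hc].
Unshelve. all: by end_near.
Qed.

Lemma MVT_const F (g : R -> R) t c e del s :
  (forall r, `|r - t| < del -> is_derive r 1 F (g r) /\ `|g r - c| <= e) ->
  `|s - t| < del -> `|F s - F t - (s - t) * c| <= e * `|s - t|.
Proof.
move=> h st.
have cont a b : `|a - t| < del -> `|b - t| < del -> {within `[a, b], continuous F}.
  move=> ha hb; apply: derivable_within_continuous => r; rewrite in_itv /= => /andP[r1 r2].
  have : `|r - t| < del by move: ha hb; rewrite !ltr_distl => /andP[? ?] /andP[? ?]; apply/andP; split; lra.
  by move=> /h[[]].
have tt : `|t - t| < del by rewrite subrr normr0; apply: le_lt_trans st.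
have [ts|ts|->] := ltgtP t s; last by rewrite !subrr mul0r subrr normr0 mulr0.
- have [|r] := @MVT R F g t s ts _ (cont _ _ tt st).
    move=> r; rewrite in_itv /= => /andP[r1 r2]; apply: (proj1 (h r _)).
    by move: st; rewrite !ltr_distl => /andP[? ?]; apply/andP; split; lra.
  rewrite in_itv /= => /andP[r1 r2] ->.
  rewrite mulrC -mulrBr normrM mulrC ler_wpM2r//; apply: (proj2 (h r _)).
  by move: st; rewrite !ltr_distl => /andP[? ?]; apply/andP; split; lra.
- have [|r] := @MVT R F g s t ts _ (cont _ _ st tt).
    move=> r; rewrite in_itv /= => /andP[r1 r2]; apply: (proj1 (h r _)).
    by move: st; rewrite !ltr_distl => /andP[? ?]; apply/andP; split; lra.
  rewrite in_itv /= => /andP[r1 r2] hr.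
  have -> : F s - F t - (s - t) * c = (s - t) * (g r - c) by rewrite -[F s - F t]opprB hr; ring.
  rewrite normrM mulrC ler_wpM2r//; apply: (proj2 (h r _)).
  by move: st; rewrite !ltr_distl => /andP[? ?]; apply/andP; split; lra.
Qed.

(** The approximant may depend on the point [s] and on the precision [eta]: the mean value estimate
    needs its derivative near [c] on the interval, and closeness to [F] only at [t] and [s]. *)
Lemma derive_limit F t c :
  (forall e, 0 < e -> exists2 del, 0 < del & forall s, `|s - t| < del -> forall eta, 0 < eta ->
    exists F1 g1, [/\ forall r, `|r - t| < del -> is_derive r 1 F1 (g1 r) /\ `|g1 r - c| <= e,
      `|F1 t - F t| <= eta & `|F1 s - F s| <= eta]) ->
  is_derive t 1 F c.
Proof.
move=> h; apply/is_derive_epsP => e e0; have [del del0 hdel] := h e e0.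
exists del => // s st; apply/ler_addgt0Pr => eta eta0.
have [F1 [g1 [hF h1 h2]]] := hdel s st (eta / 2) (divr_gt0 eta0 (ltr0n _ 2)).
have := MVT_const hF st.
have -> : F s - F t - (s - t) * c = (F1 s - F1 t - (s - t) * c) + (F1 t - F t) - (F1 s - F s) by ring.
move=> h3; have := ler_normB (F1 s - F1 t - (s - t) * c + (F1 t - F t)) (F1 s - F s).
have := ler_normD (F1 s - F1 t - (s - t) * c) (F1 t - F t); lra.
Qed.

End scalar_derivatives.

Section strong_derivatives.
Context {R : realType} {V : lmodType R}.
Variables (D : set V) (B : V -> V -> R).
Hypothesis hB : semi_inner D B.
Local Notation nm := (snorm B).
Implicit Types (x y : R -> V) (t s e : R) (l : V).

Definition scont x t := forall e, 0 < e -> exists2 del, 0 < del &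
  forall s, `|s - t| < del -> nm (x s - x t) <= e.

Definition sderiv x t l := forall e, 0 < e -> exists2 del, 0 < del &
  forall s, `|s - t| < del -> nm (x s - x t - (s - t) *: l) <= e * `|s - t|.

(** The weak derivative relation is tested with the error [psi] itself. It depends on [s] but is
    frozen when the scalar mean value estimate is applied, and one factor [nm psi] then cancels. *)
Lemma weak_strong_derive x y t del0 : (forall s, D (x s)) -> (forall s, D (y s)) -> 0 < del0 ->
  (forall s, `|s - t| < del0 -> forall psi, D psi ->
    is_derive s 1 (fun r => B (x r) psi) (B (y s) psi)) ->
  scont y t -> sderiv x t (y t).
Proof.
move=> Dx Dy d0 hw cy e e0; have [d1 d10 hd1] := cy e e0.
exists (Num.min del0 d1); first by rewrite lt_min d0.
move=> s st; set psi := x s - x t - (s - t) *: y t.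
have Dst : D (x s - x t) by exact: (siB hB).
have Dzt : D ((s - t) *: y t) by exact: (siZ hB).
have Dpsi : D psi by exact: (siB hB).
have n0 : 0 <= nm psi by exact: snorm_ge0.
have : `|B (x s) psi - B (x t) psi - (s - t) * B (y t) psi| <= e * nm psi * `|s - t|.
  apply: (@MVT_const _ (fun r => B (x r) psi) (fun r => B (y r) psi) _ _ _ _ _ _ st) => r.
  rewrite lt_min => /andP[r0 r1]; split; first exact: hw.
  rewrite -(siBl hB)//; apply: le_trans (si_CS hB (siB hB (Dy r) (Dy t)) Dpsi) _.
  by rewrite ler_wpM2r// hd1.
rewrite -(siBl hB)// -(siZl hB)// -(siBl hB)// -/psi -(snorm_sqr hB)// ger0_norm ?sqr_ge0//.
rewrite expr2 mulrAC; have [->|pn] := eqVneq (nm psi) 0.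
  by rewrite mulr_ge0// ltW.
by rewrite ler_pM2r// lt_def pn.
Qed.

Lemma sderiv_scont x t l : (forall s, D (x s)) -> D l -> sderiv x t l -> scont x t.
Proof.
move=> Dx Dl h e e0; have [d1 d10 hd1] := h 1 ltr01.
have p : 0 < 1 + nm l by rewrite ltr_pwDl// snorm_ge0.
exists (Num.min d1 (e / (1 + nm l))); first by rewrite lt_min d10 divr_gt0.
move=> s; rewrite lt_min => /andP[/hd1 h1 h2].
have Dz := siZ hB (s - t) Dl; have Dxx := siB hB (Dx s) (Dx t).
have := snormD hB (siB hB Dxx Dz) Dz; rewrite subrK (snormZ hB)//.
move=> h3; apply: (le_trans h3); apply: (@le_trans _ _ ((1 + nm l) * `|s - t|)).
  by rewrite mul1r in h1; move: h1; lra.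
by rewrite mulrC -ler_pdivlMr// ltW.
Qed.

Lemma scont_bound y t : (forall s, D (y s)) -> scont y t ->
  exists2 del, 0 < del & forall s, `|s - t| < del -> nm (y s) <= nm (y t) + 1.
Proof.
move=> Dy cy; have [del d0 hd] := cy 1 ltr01; exists del => // s /hd h.
by have := snormD hB (siB hB (Dy s) (Dy t)) (Dy t); rewrite subrK; lra.
Qed.

Lemma is_derive_si_weak x y t l c : (forall s, D (x s)) -> (forall s, D (y s)) -> D l ->
  sderiv x t l -> scont y t -> is_derive t 1 (fun r => B (x t) (y r)) c ->
  is_derive t 1 (fun r => B (x r) (y r)) (B l (y t) + c).
Proof.
move=> Dx Dy Dl hx cy /is_derive_epsP hc; apply/is_derive_epsP => e e0.
have [d0 d00 hd0] := scont_bound Dy cy.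
have q0 : 0 < nm (y t) + 1 by rewrite ltr_wpDl ?snorm_ge0.
have q1 : 0 < nm l + 1 by rewrite ltr_wpDl ?snorm_ge0.
have e3 : 0 < e / 3 by rewrite divr_gt0.
have [d1 d10 hd1] := hx _ (divr_gt0 e3 q0).
have [d2 d20 hd2] := cy _ (divr_gt0 e3 q1).
have [d3 d30 hd3] := hc _ e3.
exists (Num.min (Num.min d0 d1) (Num.min d2 d3)); first by rewrite !lt_min d00 d10 d20.
move=> s; rewrite !lt_min => /andP[/andP[s0 s1] /andP[s2 s3]].
have Dz := siZ hB (s - t) Dl; have Dxx := siB hB (Dx s) (Dx t).
have Dr := siB hB Dxx Dz; have Dyy := siB hB (Dy s) (Dy t).
have -> : B (x s) (y s) - B (x t) (y t) - (s - t) * (B l (y t) + c) =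
   B (x s - x t - (s - t) *: l) (y s) + (s - t) * B l (y s - y t) +
   (B (x t) (y s) - B (x t) (y t) - (s - t) * c).
  by rewrite (siBl hB)// (siBl hB)// (siZl hB)// (siBr hB)//; ring.
have h1 : `|B (x s - x t - (s - t) *: l) (y s)| <= e / 3 * `|s - t|.
  apply: le_trans (si_CS hB Dr (Dy s)) _.
  apply: le_trans (ler_pM (snorm_ge0 _ _) (snorm_ge0 _ _) (hd1 s s1) (hd0 s s0)) _.
  by rewrite mulrAC divfK// gt_eqF.
have h2 : `|(s - t) * B l (y s - y t)| <= e / 3 * `|s - t|.
  rewrite normrM mulrC ler_wpM2r//; apply: le_trans (si_CS hB Dl Dyy) _.
  apply: (@le_trans _ _ ((nm l + 1) * (e / 3 / (nm l + 1)))); last by rewrite mulrC divfK// gt_eqF.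
  by rewrite ler_pM ?snorm_ge0 ?hd2// lerDl.
have h3 := hd3 s s3.
apply: le_trans (ler_normD _ _) _; have := ler_normD (B (x s - x t - (s - t) *: l) (y s)) ((s - t) * B l (y s - y t)).
lra.
Qed.

Lemma is_derive_si_cst x t l psi : (forall s, D (x s)) -> D l -> D psi -> sderiv x t l ->
  is_derive t 1 (fun r => B psi (x r)) (B psi l).
Proof.
move=> Dx Dl Dp hx; apply/is_derive_epsP => e e0.
have q : 0 < 1 + nm psi by rewrite ltr_pwDl// snorm_ge0.
have [del d0 hd] := hx _ (divr_gt0 e0 q); exists del => // s st.
have Dz := siZ hB (s - t) Dl; have Dxx := siB hB (Dx s) (Dx t).
rewrite -(siBr hB)// -(siZr hB)// -(siBr hB)//.
apply: le_trans (si_CS hB Dp (siB hB Dxx Dz)) _.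
apply: (@le_trans _ _ (nm psi * (e / (1 + nm psi) * `|s - t|))).
  by rewrite ler_wpM2l ?snorm_ge0// hd.
rewrite mulrA ler_wpM2r// mulrA ler_pdivrMr// mulrC ler_wpM2l ?(ltW e0)//.
by rewrite lerDr.
Qed.

Lemma is_derive_si x y t l k : (forall s, D (x s)) -> (forall s, D (y s)) -> D l -> D k ->
  sderiv x t l -> sderiv y t k ->
  is_derive t 1 (fun r => B (x r) (y r)) (B l (y t) + B (x t) k).
Proof.
move=> Dx Dy Dl Dk hx hy; apply: is_derive_si_weak => //; first exact: sderiv_scont hy.
exact: is_derive_si_cst.
Qed.

End strong_derivatives.

Lemma cvg_sumr {R : realType} (I : Type) (r : seq I) (F : I -> nat -> R) (l : I -> R) :
  (forall i, F i n @[n --> \oo] --> l i) ->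
  (\sum_(i <- r) F i n) @[n --> \oo] --> \sum_(i <- r) l i.
Proof.
move=> h; elim: r => [|i r ih].
  by rewrite big_nil; under eq_fun do rewrite big_nil; exact: cvg_cst.
by rewrite big_cons; under eq_fun do rewrite big_cons; exact: (cvgD (h i) ih).
Qed.

(** * The resolvent of the energy form *)

Section resolvent.
Context {R : realType} {d : nat}.
Local Notation E := 'rV[R]_d.
Local Notation nm := (snorm (@ip R d)).
Local Notation hn := (snorm (@aform R d)).
Let S2 := @L2_semi R d.
Let SH := @H1_semi R d.
Implicit Types (f g w : E -> R).

Lemma hn_sqr_wp f (f' : 'I_d -> E -> R) : L2 f -> (forall i, L2 (f' i)) ->
  (forall i, weak_partial i f (f' i)) -> hn f ^+ 2 = nm f ^+ 2 + \sum_i nm (f' i) ^+ 2.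
Proof.
move=> Lf Lf' wf; have Hf : H1 f by exact: (H1I Lf Lf' wf).
rewrite (snorm_sqr SH)// (aformE Lf Lf Lf' Lf' wf wf) (snorm_sqr S2)//.
by congr (_ + _); apply: eq_bigr => i _; rewrite (snorm_sqr S2).
Qed.

Lemma H1_complete (u : nat -> E -> R) : (forall n, H1 (u n)) ->
  (forall e, 0 < e -> exists N, forall m n, (N <= m)%N -> (N <= n)%N -> hn (u m - u n) <= e) ->
  exists f, H1 f /\ hn (u n - f) @[n --> \oo] --> 0.
Proof.
move=> Hu cau.
have [f [Lf cf]] : exists f, L2 f /\ nm (u n - f) @[n --> \oo] --> 0.
  apply: L2_complete => [n|e e0]; first exact: H1_L2.
  have [N hN] := cau e e0; exists N => m n hm hn_; apply: le_trans (hN m n hm hn_).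
  by apply: nm_le_hn; exact: (siB SH).
have gB i m n : nm (grad i (u m) - grad i (u n)) <= hn (u m - u n).
  have Hd := siB SH (Hu m) (Hu n).
  rewrite -ler_sqr ?nnegrE ?snorm_ge0//.
  rewrite (@hn_sqr_wp _ (fun i => grad i (u m) - grad i (u n))).
  - rewrite (bigD1 i)//= addrCA lerDl addr_ge0 ?sqr_ge0// sumr_ge0// => j _; exact: sqr_ge0.
  - exact: H1_L2.
  - by move=> j; apply: (siB S2); exact: L2_grad.
  - move=> j; have := wp_lin (- 1) (H1_L2 (Hu n)) (H1_L2 (Hu m)) (L2_grad j (Hu n)) (L2_grad j (Hu m)) (grad_wp j (Hu n)) (grad_wp j (Hu m)).
    by rewrite !scaleN1r (addrC _ (u m)) (addrC _ (grad j (u m))).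
have hg i : exists g, L2 g /\ nm (grad i (u n) - g) @[n --> \oo] --> 0.
  apply: L2_complete => [n|e e0]; first exact: L2_grad.
  have [N hN] := cau e e0; exists N => m n hm hn_; apply: le_trans (hN m n hm hn_); exact: gB.
have [g hg'] := choice hg.
have Lg i : L2 (g i) by have [] := hg' i.
have wg i : weak_partial i f (g i).
  apply/ip_weakP => phi tp.
  have LD := test_L2 (test_D (dir i) tp); have Lp := test_L2 tp.
  have c0 h : L2 h -> nm (h - h) @[_ --> \oo] --> 0.
    by move=> Lh; rewrite subrr (snorm0 S2); exact: cvg_cst.
  have c1 : ip (u n) ('D_(dir i) phi) @[n --> \oo] --> ip f ('D_(dir i) phi).
    exact: (@cvg_si _ _ _ _ S2 _ \oo _ u (fun=> 'D_(dir i) phi) f ('D_(dir i) phi) (fun n => H1_L2 (Hu n)) (fun=> LD) Lf LD cf (c0 _ LD)).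
  have c2 : ip (grad i (u n)) phi @[n --> \oo] --> ip (g i) phi.
    exact: (@cvg_si _ _ _ _ S2 _ \oo _ (fun n => grad i (u n)) (fun=> phi) (g i) phi (fun n => L2_grad i (Hu n)) (fun=> Lp) (Lg i) Lp (hg' i).2 (c0 _ Lp)).
  have c3 : (- ip (grad i (u n)) phi) @[n --> \oo] --> - ip (g i) phi by apply: cvgN; exact: c2.
  have e1 : (fun t => ip (u t) ('D_(dir i) phi)) = (fun t => - ip (grad i (u t)) phi).
    by apply/funext => t; exact: ((ip_weakP i _ _).1 (grad_wp i (Hu t)) _ tp).
  by rewrite e1 in c1; exact: (cvgR_unique c1 c3).
have Hf : H1 f by exact: (H1I Lf Lg wg).
exists f; split=> //.
have sq : hn (u n - f) ^+ 2 @[n --> \oo] --> 0.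
  have -> : (fun n => hn (u n - f) ^+ 2) = (fun n => nm (u n - f) * nm (u n - f) + \sum_i nm (grad i (u n) - g i) * nm (grad i (u n) - g i)).
    apply/funext => n; rewrite (@hn_sqr_wp _ (fun i => grad i (u n) - g i)).
    - by rewrite expr2; congr (_ + _); apply: eq_bigr => i _; rewrite expr2.
    - by apply: (siB S2) => //; exact: H1_L2.
    - by move=> i; apply: (siB S2) => //; exact: L2_grad.
    - move=> j; have := wp_lin (- 1) Lf (H1_L2 (Hu n)) (Lg j) (L2_grad j (Hu n)) (wg j) (grad_wp j (Hu n)).
      by rewrite !scaleN1r (addrC _ (u n)) (addrC _ (grad j (u n))).
  have h1 : \sum_i nm (grad i (u n) - g i) * nm (grad i (u n) - g i) @[n --> \oo] --> \sum_(i < d) ((0 : R) * 0).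
    by apply: cvg_sumr => i; exact: (cvgM (hg' i).2 (hg' i).2).
  rewrite [X in _ --> X](_ : 0 = 0 * 0 + \sum_(i < d) ((0 : R) * 0)); last by rewrite mulr0 big1// addr0.
  exact: (cvgD (cvgM cf cf) h1).
apply/cvgrPdist_le => e e0; move: sq => /cvgrPdist_le /(_ _ (exprn_gt0 2 e0)); apply: filterS => n.
by rewrite !sub0r !normrN !ger0_norm ?sqr_ge0 ?snorm_ge0// ler_sqr ?nnegrE ?snorm_ge0// ltW.
Qed.

Variable eps : R.
Hypothesis eps0 : 0 < eps.

Let Be f g := ip f g + eps * aform f g.

Let Be_semi : semi_inner (@H1 R d) Be.
Proof.
split.
- exact: si0 SH.
- by move=> a f g Hf Hg; exact: H1_lin.
- by move=> f g Hf Hg; rewrite /Be (siC S2 (H1_L2 Hf) (H1_L2 Hg)) (siC SH Hf Hg).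
- move=> a f g h Hf Hg Hh; rewrite /Be (siDZl S2)//; [|exact: H1_L2..].
  by rewrite (siDZl SH)//; ring.
- move=> f Hf; rewrite addr_ge0 ?mulr_ge0 ?(ltW eps0) ?(si_ge0 S2) ?(si_ge0 SH)//; exact: H1_L2.
Qed.

Let Be_sqr f : H1 f -> snorm Be f ^+ 2 = nm f ^+ 2 + eps * hn f ^+ 2.
Proof. by move=> Hf; rewrite (snorm_sqr Be_semi)// (snorm_sqr S2) ?(snorm_sqr SH)//; exact: H1_L2. Qed.

Let Be_hn f : H1 f -> Num.sqrt eps * hn f <= snorm Be f.
Proof.
move=> Hf; rewrite -ler_sqr ?nnegrE ?mulr_ge0 ?sqrtr_ge0 ?snorm_ge0//.
by rewrite exprMn sqr_sqrtr ?(ltW eps0)// Be_sqr// lerDr sqr_ge0.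
Qed.

Let Be_le f : H1 f -> snorm Be f <= Num.sqrt (1 + eps) * hn f.
Proof.
move=> Hf; rewrite -ler_sqr ?nnegrE ?mulr_ge0 ?sqrtr_ge0 ?snorm_ge0//.
rewrite exprMn [Num.sqrt (1 + eps) ^+ 2]sqr_sqrtr ?addr_ge0 ?(ltW eps0)// Be_sqr// mulrDl mul1r lerD2r.
by rewrite ler_sqr ?nnegrE ?snorm_ge0// nm_le_hn.
Qed.

(** Riesz representation for the form [Be], whose norm is equivalent to that of H^1. *)
Lemma resolvent_ex f : L2 f ->
  exists g, H1 g /\ forall psi, H1 psi -> ip g psi + eps * aform g psi = ip f psi.
Proof.
move=> Lf.
have se : 0 < Num.sqrt eps by rewrite sqrtr_gt0.
have complete (u : nat -> E -> R) : (forall n, H1 (u n)) ->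
  (forall e, 0 < e -> exists N, forall m n, (N <= m)%N -> (N <= n)%N -> snorm Be (u m - u n) <= e) ->
  exists f, H1 f /\ snorm Be (u n - f) @[n --> \oo] --> 0.
  move=> Hu cau; have [|g [Hg cg]] := H1_complete Hu.
    move=> e e0; have [N hN] := cau _ (mulr_gt0 se e0); exists N => m n hm hn_.
    rewrite -(ler_pM2l se); apply: le_trans (hN m n hm hn_); apply: Be_hn; exact: (siB SH).
  exists g; split => //.
  have p : 0 < Num.sqrt (1 + eps) by rewrite sqrtr_gt0 addr_gt0.
  apply/cvgrPdist_le => e e0; move: cg => /cvgrPdist_le /(_ _ (divr_gt0 e0 p)); apply: filterS => n.
  rewrite !sub0r !normrN !ger0_norm ?snorm_ge0// ler_pdivlMr// mulrC => h.
  by apply: le_trans (Be_le _) h; exact: (siB SH).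
have [|psi Hp|g [Hg hg]] := @riesz _ _ _ _ Be_semi complete (fun psi => ip f psi) (nm f).
- by move=> a u w Hu Hw; rewrite (siDr S2) ?(siZr S2)//; try exact: H1_L2; apply: (siZ S2); exact: H1_L2.
- apply: le_trans (si_CS S2 Lf (H1_L2 Hp)) _; rewrite ler_wpM2l ?snorm_ge0//.
  by rewrite -ler_sqr ?nnegrE ?snorm_ge0// Be_sqr// lerDl mulr_ge0 ?sqr_ge0// ltW.
by exists g; split => // psi Hp; rewrite hg.
Qed.

End resolvent.

Section resolvent_bounds.
Context {R : realType} {d : nat}.
Local Notation E := 'rV[R]_d.
Local Notation nm := (snorm (@ip R d)).
Local Notation hn := (snorm (@aform R d)).
Let S2 := @L2_semi R d.
Let SH := @H1_semi R d.
Implicit Types (f g w r : E -> R) (eps : R).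

(* [r = (1 + eps (1 - Laplacian))^-1 f]. *)
Definition res eps r f : Prop := [/\ L2 f, H1 r &
  forall psi, H1 psi -> ip r psi + eps * aform r psi = ip f psi].

Lemma res_lin eps a r r' f f' : res eps r f -> res eps r' f' ->
  res eps (a *: r + r') (a *: f + f').
Proof.
move=> [Lf Hr h] [Lf' Hr' h']; split; [exact: (siP S2)|exact: (siP SH)|move=> psi Hp].
have Lp := H1_L2 Hp.
rewrite (siDZl S2 a (H1_L2 Hr) (H1_L2 Hr') Lp) (siDZl SH)// (siDZl S2 a Lf Lf' Lp) -h// -h'//; ring.
Qed.

Lemma resB eps r r' f f' : res eps r f -> res eps r' f' -> res eps (r - r') (f - f').
Proof. by move=> h h'; have := res_lin (- 1) h' h; rewrite !scaleN1r !(addrC (- _)). Qed.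

Lemma res_exists eps f : 0 < eps -> L2 f -> exists r, res eps r f.
Proof. by move=> e0 Lf; have [g [Hg hg]] := resolvent_ex e0 Lf; exists g; split. Qed.

Lemma res_bound eps r f : 0 < eps -> res eps r f -> nm r <= nm f /\ eps * hn r ^+ 2 <= nm f ^+ 2.
Proof.
move=> e0 [Lf Hr h]; have Lr := H1_L2 Hr.
have := h r Hr; rewrite -(snorm_sqr S2)// -(snorm_sqr SH)// => e.
have cs : nm r ^+ 2 + eps * hn r ^+ 2 <= nm f * nm r.
  by rewrite e; apply: le_trans (ler_norm _) _; exact: (si_CS S2).
have p : 0 <= eps * hn r ^+ 2 by rewrite mulr_ge0 ?sqr_ge0// ltW.
have nr := snorm_ge0 (@ip R d) r; have nf := snorm_ge0 (@ip R d) f.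
have le1 : nm r <= nm f.
  have [->//|rn] := eqVneq (nm r) 0.
  by rewrite -(ler_pM2r (_ : 0 < nm r)) ?lt_def ?rn//; move: cs; rewrite expr2; lra.
split=> //; apply: (@le_trans _ _ (nm f * nm r)); first by have := sqr_ge0 (nm r); lra.
by rewrite expr2 ler_wpM2l.
Qed.

Lemma res_sym eps r r' f f' : res eps r f -> res eps r' f' -> ip r f' = ip f r'.
Proof.
move=> [Lf Hr h] [Lf' Hr' h']; rewrite -h// (siC S2 (H1_L2 Hr) Lf') -h'//.
by rewrite (siC S2 (H1_L2 Hr) (H1_L2 Hr')) (siC SH Hr Hr').
Qed.

(** The Yosida approximation: [1 - Laplacian] composed with the resolvent is a bounded operator on
    L^2, so the energy form against a resolvent is an L^2 pairing. *)
Lemma res_aform eps r w q psi : 0 < eps -> H1 w -> res eps r w -> res eps q psi ->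
  aform w q = eps^-1 * ip (w - r) psi.
Proof.
move=> e0 Hw hr hq; have s := res_sym hr hq; case: hr => _ Hr _; case: hq => Lp Hq h.
have Lw := H1_L2 Hw; have Lr := H1_L2 Hr; have Lq := H1_L2 Hq.
have := h w Hw; rewrite (siC S2 Lq Lw) -s (siC SH Hq Hw) (siC S2 Lp Lw) => e.
rewrite (siBl S2)// -e; field; exact: lt0r_neq0.
Qed.

Lemma res_H1 eps r f : 0 < eps -> H1 f -> res eps r f ->
  [/\ H1 (f - r), hn (f - r) <= hn f, nm (f - r) ^+ 2 <= eps * hn f ^+ 2 &
    hn (f - r) ^+ 2 <= aform f (f - r)].
Proof.
move=> e0 Hf [Lf Hr h]; have Hq := siB SH Hf Hr; have Lq := H1_L2 Hq; have Lr := H1_L2 Hr.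
have e : nm (f - r) ^+ 2 + eps * hn (f - r) ^+ 2 = eps * aform f (f - r).
  rewrite (snorm_sqr S2)// (snorm_sqr SH)// [in LHS](siBl S2)// -(h _ Hq) (siBl SH)//; ring.
have n2 := sqr_ge0 (nm (f - r)); have hq := snorm_ge0 (@aform R d) (f - r).
have h2 : hn (f - r) ^+ 2 <= aform f (f - r) by rewrite -(ler_pM2l e0); lra.
have cs : aform f (f - r) <= hn f * hn (f - r) by apply: le_trans (ler_norm _) _; exact: (si_CS SH).
have le1 : hn (f - r) <= hn f.
  have [->|rn] := eqVneq (hn (f - r)) 0; first exact: snorm_ge0.
  by rewrite -(ler_pM2r (_ : 0 < hn (f - r))) ?lt_def ?rn//; move: h2; rewrite expr2; lra.
split=> //; apply: (@le_trans _ _ (eps * aform f (f - r))).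
  by rewrite -e lerDl mulr_ge0 ?sqr_ge0// ltW.
rewrite ler_wpM2l ?(ltW e0)//; apply: (le_trans cs); rewrite expr2 ler_wpM2l ?snorm_ge0//.
Qed.

Lemma near_res_L2 f e : L2 f -> 0 < e ->
  \forall eps \near 0^'+, forall r, res eps r f -> nm (r - f) <= e.
Proof.
move=> Lf e0; have e3 : 0 < e / 3 by rewrite divr_gt0.
have [phi [tp hp]] := test_dense Lf e3.
have Hp := test_H1 tp; have Lp := test_L2 tp.
have q : 0 < 1 + hn phi by rewrite ltr_pwDl// snorm_ge0.
have q0 : 0 < (e / 3 / (1 + hn phi)) ^+ 2 by rewrite exprn_gt0// divr_gt0.
near=> eps => r hr.
have ep : 0 < eps by near: eps; exact: nbhs_right_gt.
have eq : eps <= (e / 3 / (1 + hn phi)) ^+ 2 by near: eps; exact: nbhs_right_le.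
have [r1 hr1] := res_exists ep Lp.
have [nb _] := res_bound ep (resB hr hr1).
have [_ _ h3 _] := res_H1 ep Hp hr1.
case: hr => _ Hr _; case: hr1 => _ Hr1 _; have Lr := H1_L2 Hr; have Lr1 := H1_L2 Hr1.
have h4 : nm (phi - r1) <= e / 3.
  rewrite -ler_sqr ?nnegrE ?snorm_ge0 ?(ltW e3)//; apply: (le_trans h3).
  apply: (@le_trans _ _ ((e / 3 / (1 + hn phi)) ^+ 2 * (1 + hn phi) ^+ 2)).
    by rewrite ler_pM ?sqr_ge0 ?(ltW ep)// lerXn2r ?nnegrE ?snorm_ge0 ?(ltW q)// lerDr.
  by rewrite -exprMn divfK// gt_eqF.
have t1 := snorm_triangle S2 Lr Lr1 Lf; have t2 := snorm_triangle S2 Lr1 Lp Lf.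
rewrite (snorm_distC S2 Lr1 Lp) (snorm_distC S2 Lp Lf) in t2; lra.
Unshelve. all: by end_near.
Qed.

Lemma aform_test_bound phi : test_function setT phi ->
  exists2 K, 0 < K & forall q, H1 q -> `|aform phi q| <= K * nm q.
Proof.
move=> tp; exists (1 + (nm phi + \sum_i nm ('D_(dir i) ('D_(dir i) phi)))).
  by rewrite ltr_pwDl// addr_ge0 ?snorm_ge0// sumr_ge0// => i _; exact: snorm_ge0.
move=> q Hq; have Lq := H1_L2 Hq; have Lp := test_L2 tp.
have tD i := test_D (dir i) tp; have tDD i := test_D (dir i) (tD i).
have sp : smooth phi by case: tp.
rewrite (@aformE _ _ _ _ (fun i => 'D_(dir i) phi) (fun i => grad i q)) //; last 4 first.
- by move=> i; exact: test_L2.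
- by move=> i; exact: L2_grad.
- by move=> i; exact: wp_smooth.
- by move=> i; exact: grad_wp.
have h i : `|ip ('D_(dir i) phi) (grad i q)| <= nm ('D_(dir i) ('D_(dir i) phi)) * nm q.
  rewrite (siC S2 (test_L2 (tD i)) (L2_grad i Hq)).
  have := (ip_weakP i _ _).1 (grad_wp i Hq) _ (tD i) => e.
  rewrite -[ip _ _]opprK -e normrN mulrC; apply: (si_CS S2) => //; exact: test_L2.
apply: le_trans (ler_normD _ _) _.
apply: (@le_trans _ _ (nm phi * nm q + \sum_i nm ('D_(dir i) ('D_(dir i) phi)) * nm q)).
  apply: lerD; first exact: (si_CS S2).
  by apply: le_trans (ler_norm_sum _ _ _) _; apply: ler_sum => i _; exact: h.
by rewrite -mulr_suml -mulrDl ler_wpM2r ?snorm_ge0// lerDr.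
Qed.

(** Split [f] in [aform f (f - r)] as [(f - phi) + phi]: the first part is small by density, and
    against a test function the form is bounded by the L^2 norm of [f - r], which is of order
    [eps^(1/2)]. *)
Lemma near_res_H1 f e : H1 f -> 0 < e ->
  \forall eps \near 0^'+, forall r, res eps r f -> hn (r - f) <= e.
Proof.
move=> Hf e0; have p : 0 < 1 + hn f by rewrite ltr_pwDl// snorm_ge0.
have e1 : 0 < e ^+ 2 / 2 / (1 + hn f) by rewrite !divr_gt0// exprn_gt0.
have [phi [tp hp]] := test_dense_H1 Hf e1.
have [K K0 hK] := aform_test_bound tp.
have Hp := test_H1 tp.
have q0 : 0 < (e ^+ 2 / 2 / K / (1 + hn f)) ^+ 2 by rewrite exprn_gt0// !divr_gt0// exprn_gt0.
near=> eps => r hr.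
have ep : 0 < eps by near: eps; exact: nbhs_right_gt.
have eq : eps <= (e ^+ 2 / 2 / K / (1 + hn f)) ^+ 2 by near: eps; exact: nbhs_right_le.
have [Hq h1 h2 h3] := res_H1 ep Hf hr.
case: hr => _ Hr _; rewrite (snorm_distC SH Hr Hf).
rewrite -ler_sqr ?nnegrE ?snorm_ge0 ?(ltW e0)//; apply: (le_trans h3).
have -> : aform f (f - r) = aform (f - phi) (f - r) + aform phi (f - r).
  by rewrite (siBl SH)// subrK.
have a1 : aform (f - phi) (f - r) <= e ^+ 2 / 2.
  apply: le_trans (ler_norm _) _; apply: le_trans (si_CS SH (siB SH Hf Hp) Hq) _.
  apply: (@le_trans _ _ (e ^+ 2 / 2 / (1 + hn f) * (1 + hn f))); last by rewrite divfK// gt_eqF.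
  by rewrite ler_pM ?snorm_ge0// (le_trans h1)// lerDr.
have n1 : nm (f - r) <= e ^+ 2 / 2 / K.
  have x0 : 0 <= e ^+ 2 / 2 / K by rewrite !divr_ge0 ?sqr_ge0// ltW.
  rewrite -ler_sqr ?nnegrE ?snorm_ge0//; apply: (le_trans h2).
  apply: (@le_trans _ _ ((e ^+ 2 / 2 / K / (1 + hn f)) ^+ 2 * (1 + hn f) ^+ 2)).
    by rewrite ler_pM ?sqr_ge0 ?(ltW ep)// lerXn2r ?nnegrE ?snorm_ge0 ?(ltW p)// lerDr.
  by rewrite -exprMn divfK// gt_eqF.
have a2 : aform phi (f - r) <= e ^+ 2 / 2.
  apply: le_trans (ler_norm _) _; apply: (le_trans (hK _ Hq)).
  by rewrite mulrC -ler_pdivlMr.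
lra.
Unshelve. all: by end_near.
Qed.

End resolvent_bounds.

(** * Mass, virial and energy identities for evolution curves *)

Section evolution.
Context {R : realType} {d : nat}.
Local Notation E := 'rV[R]_d.
Local Notation nm := (snorm (@ip R d)).
Local Notation hn := (snorm (@aform R d)).
Let S2 := @L2_semi R d.
Let SH := @H1_semi R d.

Implicit Types (t s : R).

(* [w' = om] and [om' = Laplacian w - w + g]; the times [t <= 0] carry a continuous extension only. *)
Record evol (w om g : R -> E -> R) : Prop := Evol {
  evol_H1 : forall t, H1 (w t);
  evol_L2 : forall t, L2 (om t);
  evol_force : forall t, L2 (g t);
  evol_scontw : forall t, scont (@aform R d) w t;
  evol_sconto : forall t, scont (@ip R d) om t;
  evol_scontg : forall t, scont (@ip R d) g t;
  evol_dw : forall (t : R) (psi : E -> R), 0 < t -> L2 psi ->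
    is_derive t 1 (fun s => ip (w s) psi) (ip (om t) psi);
  evol_dom : forall (t : R) (psi : E -> R), 0 < t -> H1 psi ->
    is_derive t 1 (fun s => ip (om s) psi) (ip (g t) psi - aform (w t) psi) }.

Variables (w om g : R -> E -> R).
Hypothesis ev : evol w om g.
Let Hw := evol_H1 ev.
Let Lom := evol_L2 ev.
Let Lg := evol_force ev.
Let Lw t : L2 (w t) := H1_L2 (Hw t).

Lemma evol_sderiv t : 0 < t -> sderiv (@ip R d) w t (om t).
Proof.
move=> t0; apply: (@weak_strong_derive _ _ _ _ S2 w om t t) => //; last exact: evol_sconto ev t.
move=> s st psi Lp; apply: (evol_dw ev) => //.
by move: st; rewrite ltr_distl => /andP[]; rewrite subrr.
Qed.

Lemma scont_nmw t : scont (@ip R d) w t.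
Proof.
move=> e e0; have [del d0 hd] := evol_scontw ev t e0; exists del => // s /hd h.
by apply: le_trans h; apply: nm_le_hn; exact: (siB SH).
Qed.

Lemma evol_mass t : 0 < t -> is_derive t 1 (fun s => ip (w s) (w s)) (2 * ip (w t) (om t)).
Proof.
move=> t0; have dw := evol_sderiv t0.
have := @is_derive_si _ _ _ _ S2 w w t (om t) (om t) Lw Lw (Lom t) (Lom t) dw dw.
by rewrite (siC S2 (Lom t) (Lw t)) => h; apply: is_derive_eq; ring.
Qed.

Lemma evol_virial t : 0 < t -> is_derive t 1 (fun s => ip (w s) (om s))
  (ip (om t) (om t) - aform (w t) (w t) + ip (g t) (w t)).
Proof.
move=> t0; have dw := evol_sderiv t0.
have h : is_derive t 1 (fun r => ip (w t) (om r)) (ip (g t) (w t) - aform (w t) (w t)).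
  have := evol_dom ev t0 (Hw t); rewrite (_ : (fun s => ip (om s) (w t)) = (fun r => ip (w t) (om r)))//.
  by apply/funext => r; rewrite (siC S2).
have := @is_derive_si_weak _ _ _ _ S2 w om t (om t) _ Lw Lom (Lom t) dw (evol_sconto ev t) h.
by move=> h2; apply: is_derive_eq; ring.
Qed.

Lemma is_derive_half (F : R -> R) t (c : R) : is_derive t 1 F c ->
  is_derive t 1 (fun s => F s / 2) (c / 2).
Proof.
move=> /is_derive_epsP h; apply/is_derive_epsP => e e0.
have [del d0 hd] := h e e0; exists del => // s /hd h2.
have -> : F s / 2 - F t / 2 - (s - t) * (c / 2) = (F s - F t - (s - t) * c) / 2 by ring.
rewrite normrM (gtr0_norm (_ : 0 < 2^-1)) ?invr_gt0// ler_pdivrMr//.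
by apply: (le_trans h2); have := normr_ge0 (s - t); nra.
Qed.

(* [w] is not strongly differentiable in H^1, but its resolvent [S w] is: the energy identity is derived
   for [S w] and passes to the limit [eps -> 0]. *)
Section regularized.
Variables (eps : R) (S : (E -> R) -> (E -> R)).
Hypothesis eps0 : 0 < eps.
Hypothesis hS : forall f, L2 f -> res eps (S f) f.

Let SHS f : L2 f -> H1 (S f). Proof. by move=> /hS[]. Qed.
Let SLS f : L2 f -> L2 (S f). Proof. by move=> Lf; apply: H1_L2; exact: SHS. Qed.

(** The resolvent maps L^2 to H^1 with norm at most [eps^(-1/2)], so it turns the L^2 derivative of
    [w] into an H^1 derivative. *)
Let Sw_deriv t : 0 < t -> sderiv (@aform R d) (fun s => S (w s)) t (S (om t)).
Proof.
move=> t0 e e0; have se : 0 < Num.sqrt eps by rewrite sqrtr_gt0.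
have [del d0 hd] := evol_sderiv t0 (mulr_gt0 e0 se); exists del => // s /hd h.
have hr : res eps (S (w s) - S (w t) - (s - t) *: S (om t)) (w s - w t - (s - t) *: om t).
  have h1 := resB (hS (Lw s)) (hS (Lw t)).
  have := res_lin (- (s - t)) (hS (Lom t)) h1.
  by rewrite !scaleNr !(addrC (- _)).
have [_ h2] := res_bound eps0 hr.
rewrite -(ler_pM2l se); apply: (@le_trans _ _ (nm (w s - w t - (s - t) *: om t))).
  rewrite -ler_sqr ?nnegrE ?mulr_ge0 ?snorm_ge0 ?(ltW se)//.
  by rewrite exprMn [Num.sqrt eps ^+ 2]sqr_sqrtr ?(ltW eps0).
by apply: (le_trans h); rewrite mulrAC mulrC.
Qed.

(** The derivative of [S (om s)]: since [S (1 - Laplacian) w = (w - S w) / eps], this is [S] applied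
    to the right-hand side of the equation. *)
Let zeta s := eps^-1 *: (S (w s) - w s) + S (g s).

Let Lzeta s : L2 (zeta s).
Proof. by apply: (siP S2); [apply: (siB S2)|]; try exact: SLS. Qed.

Let scontS x t : (forall s, L2 (x s)) -> scont (@ip R d) x t -> scont (@ip R d) (fun s => S (x s)) t.
Proof.
move=> Lx hx e e0; have [del d0 hd] := hx e e0; exists del => // s /hd.
by apply: le_trans; have [] := res_bound eps0 (resB (hS (Lx s)) (hS (Lx t))).
Qed.

Let scont_zeta t : scont (@ip R d) zeta t.
Proof.
move=> e e0; have e3 : 0 < e / 3 by rewrite divr_gt0.
have [d1 d10 h1] := scont_nmw t (mulr_gt0 e3 eps0).
have [d2 d20 h2] := scontS Lw (scont_nmw t) (mulr_gt0 e3 eps0).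
have [d3 d30 h3] := scontS Lg (evol_scontg ev t) e3.
exists (Num.min d1 (Num.min d2 d3)); first by rewrite !lt_min d10 d20.
move=> s; rewrite !lt_min => /and3P[/h1 n1 /h2 n2 /h3 n3].
have -> : zeta s - zeta t = (eps^-1 *: ((S (w s) - S (w t)) - (w s - w t))) + (S (g s) - S (g t)).
  by apply/funext => x; rewrite /zeta !fctE; ring.
have L1 := siB S2 (SLS (Lw s)) (SLS (Lw t)); have L3 := siB S2 (Lw s) (Lw t).
have L4 := siB S2 (SLS (Lg s)) (SLS (Lg t)); have L5 := siB S2 L1 L3.
apply: le_trans (snormD S2 (siZ S2 _ L5) L4) _.
rewrite (snormZ S2)// gtr0_norm ?invr_gt0//.
have := snormB S2 L1 L3 => n4.
have : eps^-1 * nm (S (w s) - S (w t) - (w s - w t)) <= 2 * (e / 3).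
  by rewrite ler_pdivrMl//; apply: (le_trans n4); lra.
lra.
Qed.

Let Som_deriv t : 0 < t -> sderiv (@ip R d) (fun s => S (om s)) t (zeta t).
Proof.
move=> t0; apply: (@weak_strong_derive _ _ _ _ S2 (fun s => S (om s)) zeta t t) => //.
- by move=> s; exact: SLS.
- move=> s st psi Lp.
  have s0 : 0 < s by move: st; rewrite ltr_distl => /andP[]; rewrite subrr.
  have := evol_dom ev s0 (SHS Lp).
  rewrite (_ : (fun s0 => ip (om s0) (S psi)) = (fun r => ip (S (om r)) psi)); last first.
    by apply/funext => r; rewrite (res_sym (hS (Lom r)) (hS Lp)).
  rewrite -(res_sym (hS (Lg s)) (hS Lp)) (res_aform eps0 (Hw s) (hS (Lw s)) (hS Lp)).
  rewrite /zeta (siDZl S2)//; [|by apply: (siB S2) => //; exact: SLS|exact: SLS].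
  rewrite (siBl S2)//; last exact: SLS.
  rewrite [in X in _ -> X](siBl S2)//; last exact: SLS.
  by move=> h; apply: is_derive_eq; ring.
Qed.

(** Both terms are now strongly differentiable, and the resolvent equation cancels
    [aform (S w) (S om)] against the pairing of [(S w - w) / eps] with [S om]. *)
Lemma regularized_energy t : 0 < t ->
  is_derive t 1 (fun s => (ip (S (om s)) (S (om s)) + aform (S (w s)) (S (w s))) / 2)
    (ip (S (g t)) (S (om t))).
Proof.
move=> t0; have LS s := SLS (Lom s); have HSw s := SHS (Lw s).
have h1 := @is_derive_si _ _ _ _ S2 _ _ t _ _ LS LS (Lzeta t) (Lzeta t) (Som_deriv t0) (Som_deriv t0).
have h2 := @is_derive_si _ _ _ _ SH _ _ t _ _ HSw HSw (SHS (Lom t)) (SHS (Lom t)) (Sw_deriv t0) (Sw_deriv t0).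
have h3 := is_derive_half (is_deriveD h1 h2).
apply: (@is_derive_eq _ _ _ _ _ _ _ _ h3).
rewrite (siC S2 (LS t) (Lzeta t)) (siC SH (SHS (Lom t)) (HSw t)).
have [_ HSo hSo] := hS (Lom t); have [_ HSwt hSw] := hS (Lw t).
have := hSw _ HSo => e1.
rewrite /zeta (siDZl S2)//; [|by apply: (siB S2) => //; exact: SLS|exact: SLS].
rewrite (siBl S2)//; last exact: SLS.
rewrite -e1; field; exact: lt0r_neq0.
Qed.

End regularized.

Lemma si_sqr_close (V : lmodType R) (D : set V) (B : V -> V -> R) (a b : V) (e : R) :
  semi_inner D B -> D a -> D b -> snorm B (a - b) <= e ->
  `|B a a - B b b| <= e * (2 * snorm B b + e).
Proof.
move=> hB Da Db h; have Dab := siB hB Da Db.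
have -> : B a a - B b b = B (a - b) (a - b) + 2 * B (a - b) b.
  by rewrite (siBl hB Da Db Dab) (siBl hB Da Db Db) !(siBr hB)// (siC hB Da Db); ring.
have n0 := snorm_ge0 B (a - b); have nb := snorm_ge0 B b.
have h1 := si_CS hB Dab Dab; have h2 := si_CS hB Dab Db.
apply: le_trans (ler_normD _ _) _; rewrite normrM (ger0_norm (ler0n _ 2)).
have := ler_pM n0 n0 h h; have := ler_wpM2r nb h; lra.
Qed.

Lemma evol_energy t : 0 < t ->
  is_derive t 1 (fun s => (ip (om s) (om s) + aform (w s) (w s)) / 2) (ip (g t) (om t)).
Proof.
move=> t0; apply: derive_limit => e e0.
pose K := 2 * (nm (om t) + nm (g t) + 1).
have K0 : 0 < K by rewrite mulr_gt0// ltr_wpDl// addr_ge0 ?snorm_ge0.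
pose a := Num.min 2^-1 (e / K).
have a0 : 0 < a by rewrite lt_min invr_gt0 ltr0n divr_gt0.
have a1 : a <= 2^-1 by rewrite ge_min lexx.
have a2 : a * K <= e by rewrite -ler_pdivlMr// ge_min lexx orbT.
have [d1 d10 h1] := evol_sconto ev t a0; have [d2 d20 h2] := evol_scontg ev t a0.
exists (Num.min t (Num.min d1 d2)); first by rewrite !lt_min t0 d10.
move=> s hs eta eta0.
pose M r := 2 * nm (om r) + 2 * hn (w r) + 2.
have M0 r : 0 < M r by rewrite ltr_wpDl// addr_ge0// mulr_ge0// snorm_ge0.
pose b := Num.min 1 (Num.min (eta / M t) (eta / M s)).
have b0 : 0 < b by rewrite !lt_min ltr01 !divr_gt0.
(* [eps] is fixed after [s] and [eta], as [derive_limit] permits: the resolvents need to be close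
   only at the times [t] and [s]. In between, their uniform L^2 bound and the continuity of [g] and
   [om] suffice. *)
have hnear : \forall eps \near (0 : R)^'+, [/\ 0 < eps,
  forall r, res eps r (g t) -> nm (r - g t) <= a,
  forall r, res eps r (om t) -> nm (r - om t) <= Num.min a b,
  forall r, res eps r (om s) -> nm (r - om s) <= b &
  (forall r, res eps r (w t) -> hn (r - w t) <= b) /\
  (forall r, res eps r (w s) -> hn (r - w s) <= b)].
  have ab : 0 < Num.min a b by rewrite lt_min a0.
  near=> eps; split; [|near: eps; exact: near_res_L2|near: eps; exact: near_res_L2|near: eps; exact: near_res_L2|split].
  - by near: eps; exact: nbhs_right_gt.
  - by near: eps; exact: near_res_H1.
  - by near: eps; exact: near_res_H1.
have [eps [ep c1 c2 c3 [c4 c5]]] := filter_ex hnear.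
have hSex (f : E -> R) : exists r, L2 f -> res eps r f.
  have [Lf|nLf] := pselect (L2 f); last by exists f.
  by have [r hr] := res_exists ep Lf; exists r.
have [S hS] := choice hSex.
exists (fun s => (ip (S (om s)) (S (om s)) + aform (S (w s)) (S (w s))) / 2).
exists (fun t => ip (S (g t)) (S (om t))).
have LS (f : E -> R) (Lf : L2 f) : L2 (S f) by case: (hS f Lf) => _ /H1_L2.
have HS (f : E -> R) (Lf : L2 f) : H1 (S f) by case: (hS f Lf).
have close r : nm (S (om r) - om r) <= b -> hn (S (w r) - w r) <= b -> b <= eta / M r ->
  `|(ip (S (om r)) (S (om r)) + aform (S (w r)) (S (w r))) / 2 - (ip (om r) (om r) + aform (w r) (w r)) / 2| <= eta.
  move=> n1 n2 n3.
  have q1 := si_sqr_close S2 (LS _ (Lom r)) (Lom r) n1.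
  have q2 := si_sqr_close SH (HS _ (Lw r)) (Hw r) n2.
  have b1 : b <= 1 by rewrite ge_min lexx.
  have bM : b * M r <= eta by rewrite -ler_pdivlMr.
  rewrite -mulrBl normrM (gtr0_norm (_ : 0 < 2^-1)) ?invr_gt0// ler_pdivrMr//.
  have -> : ip (S (om r)) (S (om r)) + aform (S (w r)) (S (w r)) - (ip (om r) (om r) + aform (w r) (w r)) =
    (ip (S (om r)) (S (om r)) - ip (om r) (om r)) + (aform (S (w r)) (S (w r)) - aform (w r) (w r)) by ring.
  apply: le_trans (ler_normD _ _) _; apply: (@le_trans _ _ (b * M r)); last by lra.
  apply: (le_trans (lerD q1 q2)); rewrite -mulrDr ler_wpM2l ?(ltW b0)// /M; lra.
split.
- move=> r; rewrite !lt_min => /and3P[rt r1 r2].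
  have r0 : 0 < r by move: rt; rewrite ltr_distl => /andP[]; rewrite subrr.
  split; first exact: (regularized_energy ep hS r0).
  have n1 : nm (S (g r) - g t) <= 2 * a.
    have := (res_bound ep (resB (hS _ (Lg r)) (hS _ (Lg t)))).1.
    have := snorm_triangle S2 (LS _ (Lg r)) (LS _ (Lg t)) (Lg t).
    have := c1 _ (hS _ (Lg t)); have := h2 r r2; lra.
  have n2 : nm (S (om r) - om t) <= 2 * a.
    have := (res_bound ep (resB (hS _ (Lom r)) (hS _ (Lom t)))).1.
    have := snorm_triangle S2 (LS _ (Lom r)) (LS _ (Lom t)) (Lom t).
    have := c2 _ (hS _ (Lom t)); rewrite le_min => /andP[? _]; have := h1 r r1; lra.
  have L1 := siB S2 (LS _ (Lg r)) (Lg t); have L2' := siB S2 (LS _ (Lom r)) (Lom t).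
  have -> : ip (S (g r)) (S (om r)) - ip (g t) (om t) =
    ip (S (g r) - g t) (S (om r)) + ip (g t) (S (om r) - om t).
    rewrite (siBl S2 (LS _ (Lg r)) (Lg t) (LS _ (Lom r))) (siBr S2 (LS _ (Lom r)) (Lom t) (Lg t)); ring.
  have n3 : nm (S (om r)) <= nm (om t) + 1.
    by have := snormD S2 L2' (Lom t); rewrite subrK; lra.
  apply: le_trans (ler_normD _ _) _.
  have q1 := le_trans (si_CS S2 L1 (LS _ (Lom r))) (ler_pM (snorm_ge0 _ _) (snorm_ge0 _ _) n1 n3).
  have q2 := le_trans (si_CS S2 (Lg t) L2') (ler_wpM2l (snorm_ge0 _ _) n2).
  apply: le_trans (lerD q1 q2) _; apply: le_trans a2; rewrite /K; lra.
- apply: close; [|exact: c4 (hS _ (Lw t))|by rewrite !ge_min lexx !orbT].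
  by have := c2 _ (hS _ (Lom t)); rewrite le_min => /andP[].
- by apply: close; [exact: c3 (hS _ (Lom s))|exact: c5 (hS _ (Lw s))|rewrite !ge_min lexx !orbT].
Unshelve. all: by end_near.
Qed.

End evolution.

(** * Distributional solutions as curves in H^1 x L^2 *)

Section time_distributions.
Context {R : realType}.
Local Notation mu := (@lebesgue_measure R).
Implicit Types (m n f rho theta : R -> R) (t s e : R).

Definition postime : set R^o := [set s : R | 0 < s].

Definition time_bump (e : R) : R^o -> R := fun s => flat 1 (s + e) * flat 1 (e - s).

Lemma time_bump_smooth e : smooth (time_bump e).
Proof.
apply: smooth_mul.
  apply: (@smooth_affine R R^o R^o (fun s => s + e) id); last exact: smooth_flat.
    by move=> h v x; rewrite addrA.
  by move=> x; exact: (cvgD cvg_id (cvg_cst e)).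
apply: (@smooth_affine R R^o R^o (fun s => e - s) -%R); last exact: smooth_flat.
  by move=> h v x; rewrite /GRing.scale/=; ring.
by move=> x; exact: (cvgB (cvg_cst e) cvg_id).
Qed.

Lemma time_bump_ge0 e s : 0 <= time_bump e s.
Proof. by rewrite mulr_ge0 ?flat1_ge0. Qed.

Lemma time_bump_out e s : ~ (`|s| < e) -> time_bump e s = 0.
Proof.
move=> h; rewrite /time_bump; have [h1|h1] := leP (s + e) 0; first by rewrite flat1_le0// mul0r.
have [h2|h2] := leP (e - s) 0; first by rewrite (flat1_le0 h2) mulr0.
by exfalso; apply: h; rewrite ltr_norml; apply/andP; split; lra.
Qed.

Lemma flat1_mono (a b : R) : 0 < a -> a <= b -> flat 1 a <= flat 1 b.
Proof.
move=> a0 ab; have b0 := lt_le_trans a0 ab.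
by rewrite /flat a0 b0 !hornerC !mul1r ler_expR lerN2 lef_pV2.
Qed.

Lemma Rintegral_support f (K : set R) : (forall s, ~ K s -> f s = 0) ->
  \int[mu]_s f s = \int[mu]_(s in K) f s.
Proof.
move=> h; rewrite [RHS]Rintegral_mkcond; apply: eq_Rintegral => s _.
by rewrite patchE; case: ifPn => // /negP hs; apply: h => /mem_set.
Qed.

Lemma integrable_itv f (a b : R) : continuous f -> mu.-integrable `[a, b] (EFin \o f).
Proof.
move=> cf; apply: continuous_compact_integrable; first exact: segment_compact.
exact: continuous_subspaceT.
Qed.

Lemma ge0_integral_shift t (f : R -> \bar R) : measurable_fun setT f -> (forall s, 0 <= f s)%E ->
  (\int[mu]_s f (s - t)%R = \int[mu]_s f s)%E.
Proof.
move=> mf f0.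
pose phi : measurableTypeR R -> measurableTypeR R := fun x : R => (1 * x + - t)%R.
have mg : measurable_fun setT phi := measurable_scale_add 1 (- t).
transitivity (\int[mu]_(x in phi @^-1` setT) (f \o phi) x)%E.
  by rewrite preimage_setT; apply: eq_integral => s _; rewrite /= /phi mul1r.
rewrite -(ge0_integral_pushforward mg)//.
apply: eq_measure_integral => A mA _; first
  [exact: (lebesgue_affine1 (- t) (or_introl erefl) mA) | exact: esym (lebesgue_affine1 (- t) (or_introl erefl) mA)].
Qed.

Lemma test_itv (a b : R) (f : R^o -> R) : smooth f -> (forall s, ~ (a <= s <= b) -> f s = 0) -> 0 < a ->
  test_function postime f.
Proof.
move=> sf hf a0.
have sub : supp f `<=` `[a, b].
  rewrite (closure_id `[a, b]).1; last exact: itv_closed.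
  apply: closure_subset => s /= fs; apply: contrapT => hs; move/eqP : fs; apply; apply: hf.
  by move=> h; apply: hs; rewrite in_itv.
split => //.
  by apply: subclosed_compact sub; [exact: closed_closure|exact: segment_compact].
by move=> s /sub /=; rewrite in_itv /= => /andP[h _]; exact: lt_le_trans h.
Qed.

(** The averages of [m] against the bump translated to [r] are differentiable in [r], with the
    corresponding averages of [n] as derivative; divided by the mass [c] of the bump they
    approximate [m] and stay near [n t], as [derive_limit] requires. *)
Lemma du_bois_reymond m n : continuous m -> continuous n ->
  (forall theta : R^o -> R, test_function postime theta ->
    \int[mu]_s (m s * 'D_1 theta s) = - \int[mu]_s (n s * theta s)) ->
  forall t, 0 < t -> is_derive t 1 m (n t).
Proof.
move=> cm cn hw t t0; apply: derive_limit => e e0.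
have := cn t => /cvgrPdist_le /(_ e e0) /nbhs_ballP[d1 /= d10 hd1].
(* For [|r - t| < del] and a bump of width at most [del] the support stays in
   [[t - 2 del, t + 2 del]], hence at positive times and where [n] is within [e] of [n t]. *)
pose del := Num.min (d1 / 2) (t / 4).
have del0 : 0 < del by rewrite lt_min !divr_gt0.
have deld : 2 * del <= d1 by rewrite mulrC -ler_pdivlMr// ge_min lexx.
have delt : 4 * del <= t by rewrite mulrC -ler_pdivlMr// ge_min lexx orbT.
exists del => // s0 hs0 eta eta0.
have := cm t => /cvgrPdist_le /(_ eta eta0) /nbhs_ballP[e1 /= e10 he1].
have := cm s0 => /cvgrPdist_le /(_ eta eta0) /nbhs_ballP[e2 /= e20 he2].
pose ep := Num.min del (Num.min e1 e2).
have ep0 : 0 < ep by rewrite lt_min del0 lt_min e10.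
have epd : ep <= del by rewrite ge_min lexx.
pose a := t - 2 * del; pose b := t + 2 * del.
have a0 : 0 < a by rewrite /a; lra.
pose rho := time_bump ep.
have sr : smooth rho := time_bump_smooth ep.
have crho : continuous rho := smooth_cont sr.
have cdrho : continuous ('D_1 rho) := smooth_cont (smooth_D (1 : R^o) sr).
have csh (f : R -> R) r : continuous f -> continuous (fun s => f (s - r)).
  by move=> cf s; apply: (@continuous_comp _ _ _ (fun s => s - r) f); [exact: (cvgB cvg_id (cvg_cst r))|exact: cf].
have tth r : `|r - t| < del -> test_function postime (fun s : R^o => rho (s - r)).
  rewrite ltr_distl => /andP[r1 r2].
  have srs : smooth (fun s : R^o => rho (s - r)).
    have hL (h : R) (v x : R^o) : (h *: v + x) - r = h *: v + (x - r) by rewrite addrA.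
    apply: (@smooth_affine R R^o R^o (fun s => s - r) id rho hL _ sr).
    by move=> x; exact: (cvgB cvg_id (cvg_cst r)).
  apply: (@test_itv a b _ srs _ a0) => s hs; apply: time_bump_out; rewrite ltr_norml => /andP[h1 h2].
  by apply: hs; rewrite /a /b; apply/andP; split; lra.
have D_shift r s : 'D_1 (fun s : R^o => rho (s - r)) s = 'D_1 rho (s - r).
  by apply: (@derive_affine R R^o R^o (fun s => s - r) id) => h v x; rewrite addrA.
pose K : set R := [set` `[a, b]].
have out r s : `|r - t| < del -> ~ K s -> rho (s - r) = 0.
  rewrite ltr_distl => /andP[r1 r2] hs; apply: time_bump_out; rewrite ltr_norml => /andP[h1 h2].
  by apply: hs; rewrite /K /= in_itv /= /a /b; apply/andP; split; lra.
have outD r s : `|r - t| < del -> ~ K s -> 'D_1 rho (s - r) = 0.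
  move=> hr hs; pose g : R^o -> R := fun s => rho (s - r); rewrite -D_shift.
  have sub : supp g `<=` K.
    rewrite (closure_id K).1; last exact: itv_closed.
    by apply: closure_subset => x /= fs; apply: contrapT => /(out r x hr) h; rewrite /g h eqxx in fs.
  have sD := @support_D R R^o g (1 : R^o).
  by apply: (@support0 R R^o ('D_(1 : R^o) g) s) => hsup; exact: hs (sub _ (sD _ hsup)).
pose I (f : R -> R) := \int[mu]_(s in `[a, b]) f s.
have ci (f : R -> R) : continuous f -> mu.-integrable `[a, b] (EFin \o f) by exact: integrable_itv.
have cM (f g : R -> R) : continuous f -> continuous g -> continuous (fun s => f s * g s).
  by move=> cf cg s; exact: (cvgM (cf s) (cg s)).
have IB (f g : R -> R) : continuous f -> continuous g -> I (fun s => f s - g s) = I f - I g.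
  by move=> cf cg; apply: RintegralB => //; exact: ci.
have IZ k (f : R -> R) : continuous f -> I (fun s => k * f s) = k * I f.
  by move=> cf; apply: RintegralZl => //; exact: ci.
have Ile (f g : R -> R) : continuous f -> continuous g -> (forall s, f s <= g s) -> I f <= I g.
  by move=> cf cg h; apply: le_Rintegral => //; exact: ci.
have Inorm (f : R -> R) : continuous f -> `|I f| <= I (fun s => `|f s|).
  by move=> cf; apply: le_normr_Rintegral => //; exact: ci.
have cnorm (f : R -> R) : continuous f -> continuous (fun s => `|f s|).
  by move=> cf s; exact: (cvg_norm (cf s)).
have IK (f : R -> R) : (forall s, ~ K s -> f s = 0) -> \int[mu]_s f s = I f.
  exact: Rintegral_support.
pose c := \int[mu]_s rho s.
have cE r : `|r - t| < del -> I (fun s => rho (s - r)) = c.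
  move=> hr; rewrite -(IK (fun s => rho (s - r))); last by move=> s; exact: out.
  rewrite /c /Rintegral; congr fine; apply: (@ge0_integral_shift r (EFin \o rho)).
    by apply/measurable_EFinP; exact: continuous_measurable_fun.
  by move=> s; rewrite lee_fin time_bump_ge0.
have tt : `|t - t| < del by rewrite subrr normr0.
have c0 : 0 < c.
  have ep2 : 0 < ep / 2 by rewrite divr_gt0.
  rewrite -(cE t tt); pose k := flat 1 (ep / 2) : R.
  have k0 : 0 < k by exact: flat1_gt0.
  pose J : set R := [set` `[t - ep / 2, t + ep / 2]].
  have JK : J `<=` K.
    move=> s; rewrite /J /K /=; rewrite !in_itv /= => /andP[h1 h2].
    by rewrite /a /b; apply/andP; split; move: epd; lra.
  have h1 : ((k * k * ep)%:E <= \int[mu]_(s in J) (rho (s - t))%:E)%E.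
    apply: (@le_trans _ _ (\int[mu]_(s in J) (k * k)%:E)%E).
      rewrite integral_cst /J//= lebesgue_measure_itv/= lte_fin ifT; last by lra.
      by rewrite -EFinD -EFinM lee_fin (_ : t + ep / 2 - (t - ep / 2) = ep)//; lra.
    apply: ge0_le_integral => //.
    - exact: measurable_itv.
    - by move=> s _; rewrite lee_fin mulr_ge0// ltW.
    - apply/measurable_EFinP; apply: measurable_funTS; apply: continuous_measurable_fun; exact: csh.
    - move=> s; rewrite /J /= in_itv/= => /andP[s1 s2]; rewrite lee_fin /rho /time_bump.
      by rewrite ler_pM ?(ltW k0)// flat1_mono//; lra.
  have h2 : (\int[mu]_(s in J) (rho (s - t))%:E <= \int[mu]_(s in K) (rho (s - t))%:E)%E.
    apply: ge0_subset_integral => //; [exact: measurable_itv|exact: measurable_itv| |].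
      apply/measurable_EFinP; apply: measurable_funTS; apply: continuous_measurable_fun; exact: csh.
    by move=> s _; rewrite lee_fin time_bump_ge0.
  have fin : (\int[mu]_(s in K) (rho (s - t))%:E \is a fin_num)%E.
    have i1 := ci (fun s => rho (s - t)) (csh _ t crho).
    by apply: integrable_fin_num; [exact: measurable_itv|exact: i1].
  rewrite /I /Rintegral -lte_fin fineK//; apply: lt_le_trans (le_trans h1 h2).
  by rewrite lte_fin !mulr_gt0.
clearbody I c.
pose G r := I (fun s => rho (s - r) * m s).
pose H r := I (fun s => rho (s - r) * n s).
have dG r : `|r - t| < del -> is_derive r 1 G (H r).
  move=> hr; have [M M0 hM] := @test_quad _ _ _ _ (1 : R^o) (tth t tt).
  pose l := - I (fun s => 'D_1 rho (s - r) * m s).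
  have hl : l = H r.
    have := hw _ (tth r hr).
    rewrite (IK (fun s => m s * 'D_1 (fun s : R^o => rho (s - r)) s)); last first.
      by move=> s hs; rewrite D_shift outD// mulr0.
    rewrite (IK (fun s => n s * rho (s - r))); last first.
      by move=> s hs; rewrite out// mulr0.
    move=> h; rewrite /l (_ : I _ = - H r) ?opprK//.
    rewrite /H (_ : (fun s => rho (s - r) * n s) = (fun s => n s * rho (s - r))); last by apply/funext => s; rewrite mulrC.
    by rewrite -h; congr (I _); apply/funext => s; rewrite D_shift mulrC.
  have hM' h x : `|rho (x - h) - rho x + h * 'D_1 rho x| <= M * h ^+ 2.
    have := hM (- h) (x + t); rewrite D_shift -[(- h) *: 1]/((- h) * 1) mulr1 addrK sqrrN.
    by rewrite mulNr opprK (_ : - h + (x + t) - t = x - h) //; ring.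
  have bound (h : R) : `|h| <= 1 -> `|G (h *: (1 : R^o) + r) - G r - h * l| <= M * I (fun s => `|m s|) * h ^+ 2.
    move=> _.
    rewrite -[h *: 1]/(h * 1) mulr1.
    have c1 := cM _ _ (csh _ (h + r) crho) cm; have c2 := cM _ _ (csh _ r crho) cm.
    have c3 := cM _ _ (csh _ r cdrho) cm.
    have c4 : continuous (fun s => rho (s - (h + r)) * m s - rho (s - r) * m s) by move=> s; exact: (cvgB (c1 s) (c2 s)).
    have c5 : continuous (fun s => - h * ('D_1 rho (s - r) * m s)) by move=> s; exact: (cvgM (cvg_cst (- h)) (c3 s)).
    have c6 : continuous (fun s => rho (s - (h + r)) * m s - rho (s - r) * m s - (- h * ('D_1 rho (s - r) * m s))).
      by move=> s; exact: (cvgB (c4 s) (c5 s)).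
    have -> : G (h + r) - G r - h * l =
        I (fun s => rho (s - (h + r)) * m s - rho (s - r) * m s - (- h * ('D_1 rho (s - r) * m s))).
      by rewrite (IB _ _ c4 c5) (IB _ _ c1 c2) (IZ _ _ c3) /l mulNr mulrN !opprK.
    apply: le_trans (Inorm _ c6) _; rewrite mulrAC -(IZ _ _ (cnorm _ cm)).
    apply: Ile => [||s]; [exact: cnorm c6|by move=> s; exact: (cvgM (cvg_cst _) (cnorm _ cm s))|].
    have -> : rho (s - (h + r)) * m s - rho (s - r) * m s - (- h * ('D_1 rho (s - r) * m s)) =
       (rho (s - r - h) - rho (s - r) + h * 'D_1 rho (s - r)) * m s.
      by rewrite opprD addrA (addrAC s); ring.
    by rewrite normrM ler_wpM2r.
  have [dv Dv] := @cvg_quotient_quad R R^o G r (1 : R^o) l _ bound.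
  by rewrite -hl; exact: DeriveDef.
have near_avg (f : R -> R) r k x : continuous f -> `|r - t| < del ->
    (forall s, `|s - r| < ep -> `|f s - x| <= k) -> `|I (fun s => rho (s - r) * f s) / c - x| <= k.
  move=> cf hr hk; have c1 := csh _ r crho; have c2 := cM _ _ c1 cf.
  have c3 : continuous (fun s => x * rho (s - r)) by move=> s; exact: (cvgM (cvg_cst x) (c1 s)).
  have c4 : continuous (fun s => rho (s - r) * f s - x * rho (s - r)) by move=> s; exact: (cvgB (c2 s) (c3 s)).
  have -> : I (fun s => rho (s - r) * f s) / c - x = I (fun s => rho (s - r) * f s - x * rho (s - r)) / c.
    by rewrite (IB _ _ c2 c3) (IZ _ _ c1) cE//; field; exact: lt0r_neq0.
  rewrite normrM normfV (gtr0_norm c0) ler_pdivrMr// -(cE r hr) -(IZ _ _ c1).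
  apply: le_trans (Inorm _ c4) _; apply: Ile => [||s]; [exact: cnorm c4|by move=> s; exact: (cvgM (cvg_cst _) (c1 s))|].
  rewrite mulrC -mulrBl normrM [`|rho _|]ger0_norm ?time_bump_ge0//.
  have [h|h] := pselect (`|s - r| < ep); first by rewrite ler_wpM2r ?time_bump_ge0// hk.
  by rewrite /rho time_bump_out// !mulr0.
exists (fun r => G r / c), (fun r => H r / c); split.
- move=> r hr; split.
    have /is_derive_epsP h := dG r hr; apply/is_derive_epsP => k k0.
    have [z z0 hz] := h _ (mulr_gt0 k0 c0); exists z => // s /hz h2.
    have -> : G s / c - G r / c - (s - r) * (H r / c) = (G s - G r - (s - r) * H r) / c by ring.
    by rewrite normrM normfV (gtr0_norm c0) ler_pdivrMr// mulrAC.
  apply: near_avg => // s hs; rewrite distrC; apply: hd1; rewrite /ball/=.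
  have := ler_distD r t s; rewrite (distrC t r) (distrC r s); move: hr hs epd deld; lra.
- apply: near_avg => // s hs; rewrite distrC; apply: he1; rewrite /ball/= distrC.
  by apply: (lt_le_trans hs); rewrite !ge_min lexx orbT.
- apply: near_avg => // s hs; rewrite distrC; apply: he2; rewrite /ball/= distrC.
  by apply: (lt_le_trans hs); rewrite !ge_min lexx !orbT.
Qed.

End time_distributions.

(** * Solutions satisfy the evolution equation in the sense of scalar pairings *)

Section solution_curves.
Context {R : realType} {d : nat}.
Local Notation E := 'rV[R]_d.
Local Notation leb := (@lebesgue_rV R d).
Local Notation mu := (@lebesgue_measure R).
Local Notation nm := (snorm (@ip R d)).
Local Notation hn := (snorm (@aform R d)).
Local Notation test := (test_function (@setT E)).
Let S2 := @L2_semi R d.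
Let SH := @H1_semi R d.
Implicit Types (t s : R).

(** Freezing the curve at its initial value for negative times gives curves on the whole line, so
    that the later continuity statements need no one-sided version. *)
Lemma continuous_in_scont (D : set (E -> R)) (N : (E -> R) -> R) (B : (E -> R) -> (E -> R) -> R)
    (F : R -> E -> R) : semi_inner D B -> (forall f, D f -> N f = snorm B f) ->
  continuous_in D N +oo%E F ->
  (forall t, D (F (Num.max t 0))) /\ forall t, scont B (fun t => F (Num.max t 0)) t.
Proof.
move=> hB hN hF.
have bf t : before +oo%E (Num.max t 0 : R) by split; [rewrite le_max lexx orbT|rewrite ltry].
have DF t : D (F (Num.max t 0)) by have [] := hF _ (bf t).
split=> // t e e0; have [_] := hF _ (bf t).
move=> /cvgrPdist_le /(_ e e0) /nbhs_ballP[del /= del0 hdel]; exists del => // s st.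
have h1 : ball (Num.max t 0) del (Num.max s 0).
  rewrite /ball /= distrC; apply: le_lt_trans st.
  have [s0|s0] := leP s 0; have [t0|t0] := leP t 0; rewrite ?subrr ?normr0 ?sub0r ?subr0 ?normrN//.
  - by rewrite gtr0_norm// ler0_norm; lra.
  - by rewrite gtr0_norm// ger0_norm; lra.
have := hdel _ h1 (bf s); rewrite sub0r normrN -hN; last exact: (siB hB).
exact: le_trans (ler_norm _).
Qed.

(** The relation [l' = k] extends from the dense set [T]: near [t] both pairings are Lipschitz in
    the test vector with one constant [C], so the pairings with nearby [phi] are approximants for
    [derive_limit]. *)
Lemma is_derive_dense (V : lmodType R) (D T : set V) (B : V -> V -> R) (l k : R -> V -> R)
    (t del0 C : R) (psi : V) :
  D psi -> (forall e, 0 < e -> exists phi, T phi /\ snorm B (psi - phi) <= e) -> 0 < del0 -> 0 < C ->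
  (forall r phi, `|r - t| < del0 -> T phi ->
    [/\ `|l r psi - l r phi| <= C * snorm B (psi - phi),
        `|k r psi - k r phi| <= C * snorm B (psi - phi) & is_derive r 1 (l ^~ phi) (k r phi)]) ->
  (forall e, 0 < e -> exists2 del, 0 < del & forall r, `|r - t| < del -> `|k r psi - k t psi| <= e) ->
  is_derive t 1 (l ^~ psi) (k t psi).
Proof.
move=> Dp dens d0 C0 h ck; apply: derive_limit => e e0.
have e2 : 0 < e / 2 by rewrite divr_gt0.
have [del del1 hdel] := ck _ e2.
exists (Num.min del0 del); first by rewrite lt_min d0.
move=> s; rewrite lt_min => /andP[s1 s2] eta eta0.
have m0 : 0 < Num.min (e / 2) eta by rewrite lt_min e2.
have [phi [Tp hp]] := dens _ (divr_gt0 m0 C0).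
have hp' : C * snorm B (psi - phi) <= Num.min (e / 2) eta by rewrite mulrC -ler_pdivlMr.
have hp1 : C * snorm B (psi - phi) <= e / 2 by apply: (le_trans hp'); rewrite ge_min lexx.
have hp2 : C * snorm B (psi - phi) <= eta by apply: (le_trans hp'); rewrite ge_min lexx orbT.
have tt : `|t - t| < del0 by rewrite subrr normr0.
exists (l ^~ phi), (fun r => k r phi); split.
- move=> r; rewrite lt_min => /andP[r1 r2]; have [_ h2 h3] := h r phi r1 Tp; split => //.
  have := hdel r r2; have := ler_distD (k r psi) (k r phi) (k t psi).
  by rewrite (distrC (k r phi) (k r psi)); lra.
- by have [h1 _ _] := h t phi tt Tp; rewrite distrC; apply: le_trans h1 hp2.
- by have [h1 _ _] := h s phi s1 Tp; rewrite distrC; apply: le_trans h1 hp2.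
Qed.

Lemma test_tensor (theta : R^o -> R) (psi : E -> R) : test_function postime theta -> test psi ->
  test_function (slab +oo%E) (fun z : R^o * E => theta z.1 * psi z.2).
Proof.
move=> [st ct Tt] [sp cp _].
have s1 : smooth (theta \o fst : R^o * E -> R).
  by apply: (@smooth_affine R R^o _ fst fst) => // x; exact: cvg_fst.
have s2 : smooth (psi \o snd : R^o * E -> R).
  by apply: (@smooth_affine R E _ snd snd) => // x; exact: cvg_snd.
have sub : supp (fun z : R^o * E => theta z.1 * psi z.2) `<=` supp theta `*` supp psi.
  have cl : closed (supp theta `*` supp psi).
    by apply: compact_closed; [exact: norm_hausdorff|exact: compact_setX].
  rewrite (closure_id (supp theta `*` supp psi)).1//; apply: closure_subset => -[s x] /= h; split => /=; apply: subset_closure => /=;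
    by apply: contra_neq h => ->; rewrite ?mul0r ?mulr0.
split; first exact: (smooth_mul s1 s2).
- apply: subclosed_compact sub; first exact: closed_closure.
  exact: compact_setX.
- by move=> [s x] /sub[/= /Tt hs _]; split => //=; rewrite ltry.
Qed.

Lemma dt_tensor (theta : R^o -> R) (psi : E -> R) : smooth theta -> smooth psi ->
  dt (fun z : R^o * E => theta z.1 * psi z.2) = (fun z => 'D_1 theta z.1 * psi z.2).
Proof.
move=> st sp; apply/funext => z; rewrite /dt.
have s1 : smooth (theta \o fst : R^o * E -> R).
  by apply: (@smooth_affine R R^o _ fst fst) => // x; exact: cvg_fst.
have s2 : smooth (psi \o snd : R^o * E -> R).
  by apply: (@smooth_affine R E _ snd snd) => // x; exact: cvg_snd.
have e1 := @derive_affine R R^o _ fst fst theta (fun _ _ _ => erefl) z (1, 0).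
have e2 := @derive_affine R E _ snd snd psi (fun _ _ _ => erefl) z (1, 0).
have -> : (fun z : R^o * E => theta z.1 * psi z.2) = (theta \o fst) * (psi \o snd) by [].
rewrite deriveM; [|exact: smooth_derivable s1|exact: smooth_derivable s2].
rewrite e1 e2 /= -(scale0r (0 : E)) derive_scale_dir// mul0r scaler0 add0r.
by rewrite -[_ *: _]/(psi z.2 * _) mulrC.
Qed.

Lemma laplacian_scale (c : R) (psi : E -> R) x : smooth psi ->
  laplacian (fun y => c * psi y) x = c * laplacian psi x.
Proof.
move=> sp; rewrite /laplacian mulr_sumr; apply: eq_bigr => i _.
have e (f : E -> R) : smooth f -> 'D_(dir i) (c *: f) = c *: 'D_(dir i) f.
  by move=> sf; apply/funext => y; rewrite deriveZ//; exact: smooth_derivable.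
have -> : (fun y => c * psi y) = c *: psi by [].
rewrite (e _ sp).
exact: (congr1 (fun g : E -> R => g x) (e _ (smooth_D (dir i) sp))).
Qed.

Lemma laplacian_test (psi : E -> R) : test psi -> L2 (laplacian psi) /\
  forall f, H1 f -> aform f psi = ip f psi - ip f (laplacian psi).
Proof.
move=> tp; have sp : smooth psi by case: tp.
have tD i := test_D (dir i) tp; have tDD i := test_D (dir i) (tD i).
have e : laplacian psi = \sum_i 'D_(dir i) ('D_(dir i) psi).
  by apply/funext => x; rewrite /laplacian fct_sumE.
have LDD i := test_L2 (tDD i).
have Ll : L2 (laplacian psi) by rewrite e; apply: (si_sum S2).
split=> // f Hf; have Lf := H1_L2 Hf.
rewrite (@aformE _ _ f psi (fun i => grad i f) (fun i => 'D_(dir i) psi))//; last 5 first.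
- exact: test_L2.
- by move=> i; exact: L2_grad.
- by move=> i; exact: test_L2.
- by move=> i; exact: grad_wp.
- by move=> i; exact: wp_smooth.
congr (_ + _); rewrite e (siC S2 Lf) -?e// e (si_suml S2)// -sumrN; apply: eq_bigr => i _.
rewrite (siC S2 (LDD i) Lf) ((ip_weakP i _ _).1 (grad_wp i Hf) _ (tD i)) opprK//.
Qed.

Variables (alpha p : R) (u v : R -> E -> R).
Hypothesis hp : @subcritical R d p.
Hypothesis sol : solution alpha p +oo%E u v.

Let ut t := u (Num.max t 0).
Let vt t := v (Num.max t 0).
Let gt t := fnl p (ut t) - (2 * alpha) *: vt t.

Let Hu : (forall t, H1 (ut t)) /\ forall t, scont (@aform R d) ut t.
Proof. by have [[h _] _ _ _] := sol; exact: (continuous_in_scont SH (@H1normE R d) h). Qed.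

Let Hv : (forall t, L2 (vt t)) /\ forall t, scont (@ip R d) vt t.
Proof. by have [[_ h] _ _ _] := sol; exact: (continuous_in_scont S2 (@L2normE R d) h). Qed.

Let Lu t : L2 (ut t) := H1_L2 (Hu.1 t).
Let Lf t : L2 (fnl p (ut t)) := L2_fnl hp (Hu.1 t).

Let scont_u t : scont (@ip R d) ut t.
Proof.
move=> e e0; have [del d0 hd] := Hu.2 t e e0; exists del => // s /hd.
by apply: le_trans; apply: nm_le_hn; apply: (siB SH); exact: Hu.1.
Qed.

Let scont_f t : scont (@ip R d) (fun t => fnl p (ut t)) t.
Proof.
move=> e e0; have [d1 d10 hd1] := scont_bound SH Hu.1 (Hu.2 t).
have B0 : 0 < hn (ut t) + 1 by rewrite ltr_wpDl// snorm_ge0.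
have [k k0 hk] := fnl_unif hp B0 e0.
have [d2 d20 hd2] := scont_u t k0.
exists (Num.min d1 d2); first by rewrite lt_min d10.
move=> s; rewrite lt_min => /andP[/hd1 h1 /hd2 h2]; apply: hk => //; [exact: Hu.1..|].
by rewrite lerDl.
Qed.

Let Lg t : L2 (gt t).
Proof. by apply: (siB S2) => //; apply: (siZ S2); exact: Hv.1. Qed.

Let scont_g t : scont (@ip R d) gt t.
Proof.
move=> e e0; have e2 : 0 < e / 2 by rewrite divr_gt0.
have q : 0 < 1 + `|2 * alpha| by rewrite ltr_pwDl.
have [d1 d10 h1] := scont_f t e2; have [d2 d20 h2] := Hv.2 t _ (divr_gt0 e2 q).
exists (Num.min d1 d2); first by rewrite lt_min d10.
move=> s; rewrite lt_min => /andP[/h1 n1 /h2 n2].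
have -> : gt s - gt t = (fnl p (ut s) - fnl p (ut t)) - (2 * alpha) *: (vt s - vt t).
  by apply/funext => x; rewrite /gt !fctE; ring.
have L1 := siB S2 (Lf s) (Lf t); have L3 := siB S2 (Hv.1 s) (Hv.1 t).
apply: le_trans (snormB S2 L1 (siZ S2 _ L3)) _; rewrite (snormZ S2)//.
have : `|2 * alpha| * nm (vt s - vt t) <= e / 2.
  apply: (@le_trans _ _ ((1 + `|2 * alpha|) * (e / 2 / (1 + `|2 * alpha|)))).
    by rewrite ler_pM ?snorm_ge0// lerDr.
  by rewrite mulrC divfK// gt_eqF.
lra.
Qed.

Let cont_si (V : lmodType R) (D : set V) (B : V -> V -> R) (x : R -> V) psi : semi_inner D B ->
  (forall t, D (x t)) -> (forall t, scont B x t) -> D psi -> continuous (fun t => B (x t) psi).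
Proof.
move=> hB Dx cx Dp t; apply/cvgrPdist_le => e e0.
have q : 0 < 1 + snorm B psi by rewrite ltr_pwDl// snorm_ge0.
have [del d0 hd] := cx t _ (divr_gt0 e0 q).
apply/nbhs_ballP; exists del => // s; rewrite /ball /= distrC => /hd h.
have Dd := siB hB (Dx s) (Dx t).
rewrite distrC -(siBl hB)//; apply: le_trans (si_CS hB Dd Dp) _.
apply: (@le_trans _ _ (e / (1 + snorm B psi) * (1 + snorm B psi))); last by rewrite divfK// gt_eqF.
by rewrite ler_pM ?snorm_ge0// lerDr.
Qed.

Section fixed_test.
Variable psi : E -> R.
Hypothesis tp : test psi.
Let sp : smooth psi. Proof. by case: tp. Qed.
Let Lp : L2 psi := test_L2 tp.
Let Hp : H1 psi := test_H1 tp.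

Let theta_neg (theta : R^o -> R) t : test_function postime theta -> t < 0 -> theta t = 0.
Proof.
move=> [_ _ h] t0; apply: (@support0 R R^o) => /h; rewrite /postime /= => t1; lra.
Qed.

Let Rint0 : \int[leb]_x (0 : R) = 0.
Proof. by rewrite /Rintegral integral0. Qed.

Let inner (f g : R -> E -> R) (theta : R^o -> R) t :
  test_function postime theta -> (0 <= t -> f t = g t) -> L2 (g t) ->
  \int[leb]_x (f t x * (theta t * psi x)) = ip (g t) psi * theta t.
Proof.
move=> tt fg Lgt; have [t0|t0] := leP 0 t; last first.
  rewrite (theta_neg tt t0) mulr0 -[RHS]Rint0; apply: eq_Rintegral => x _; ring.
rewrite fg// mulrC ipE -RintegralZl//; last exact: L2M.
by apply: eq_Rintegral => x _; rewrite mulrCA.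
Qed.

Let maxt (w : R -> E -> R) t : 0 <= t -> w t = w (Num.max t 0).
Proof. by move=> t0; rewrite (max_idPl _). Qed.

Let weak1 (theta : R^o -> R) : test_function postime theta ->
  \int[mu]_t (ip (ut t) psi * 'D_1 theta t) = - \int[mu]_t (ip (vt t) psi * theta t).
Proof.
move=> tt; have [_ _ h _] := sol; have st : smooth theta by case: tt.
have := h _ (test_tensor tt tp); rewrite (dt_tensor st sp) /= => e.
have tD := test_D (1 : R^o) tt.
transitivity (\int[mu]_t (\int[leb]_x (u t x * ('D_1 theta t * psi x)))).
  by apply: eq_Rintegral => t _; rewrite (inner (g := ut) tD)//; exact: maxt.
rewrite e; congr (- _); apply: eq_Rintegral => t _.
by rewrite (inner (g := vt) tt)//; [exact: maxt|exact: Hv.1].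
Qed.

Let weak2 (theta : R^o -> R) : test_function postime theta ->
  \int[mu]_t (ip (ut t) psi * 'D_1 ('D_1 theta) t + aform (ut t) psi * theta t
    - 2 * alpha * (ip (ut t) psi * 'D_1 theta t) - ip (fnl p (ut t)) psi * theta t) = 0.
Proof.
move=> tt; have [_ _ _ h] := sol; have st : smooth theta by case: tt.
have tD := test_D (1 : R^o) tt; have tDD := test_D (1 : R^o) tD.
have sD : smooth ('D_1 theta) by case: tD.
have [Ll hl] := laplacian_test tp.
have := h _ (test_tensor tt tp); rewrite (dt_tensor st sp) (dt_tensor sD sp) /= => <-.
apply: eq_Rintegral => t _; have [t0|t0] := leP 0 t; last first.
  rewrite (theta_neg tt t0) (theta_neg tD t0) (theta_neg tDD t0) -[LHS](_ : 0 = _); last by ring.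
  rewrite -[LHS]Rint0; apply: eq_Rintegral => x _; rewrite laplacian_scale//; ring.
rewrite (hl _ (Hu.1 t)).
have eu := maxt u t0; rewrite -/(ut t) in eu; rewrite eu.
move: ('D_1 ('D_1 theta) t) ('D_1 theta t) (theta t) => c2 c1 c0.
have i1 := L2M (Lu t) Lp; have i2 := L2M (Lu t) Ll; have i3 := L2M (Lf t) Lp.
transitivity (\int[leb]_x (((c2 + c0 - 2 * alpha * c1) * (ut t x * psi x)
   - c0 * (ut t x * laplacian psi x)) - c0 * (fnl p (ut t) x * psi x))).
  have j1 := integrZ (c2 + c0 - 2 * alpha * c1) i1; have j2 := integrZ c0 i2; have j3 := integrZ c0 i3.
  rewrite RintegralB//; last exact: (integrB j1 j2).
  rewrite RintegralB// !RintegralZl// -!ipE; ring.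
by apply: eq_Rintegral => x _; rewrite laplacian_scale// /fnl; ring.
Qed.

(** The weak equation contains [u] tested with [theta''] and with [theta']; [weak1], applied to the
    derivative of [theta] and to [theta], turns these into [v] tested with [theta'] and with
    [theta]. All integrals are first restricted to one compact interval, where continuity gives
    integrability. *)
Let weak3 (theta : R^o -> R) : test_function postime theta ->
  \int[mu]_t (ip (vt t) psi * 'D_1 theta t) = - \int[mu]_t ((ip (gt t) psi - aform (ut t) psi) * theta t).
Proof.
move=> tt; have tD := test_D (1 : R^o) tt; have tDD := test_D (1 : R^o) tD.
have [st cpt _] := tt.
have [M [Mr hM]] := compact_bounded cpt.
pose b := `|M| + 1.
have sup s : supp theta s -> (s \in `[- b, b]).
  move=> hs; rewrite in_itv /= -ler_norml; apply: (hM b) => //.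
  by rewrite /b (le_lt_trans (ler_norm M))// ltrDl.
pose K : set R := [set` `[- b, b]].
have o0 s : ~ K s -> theta s = 0 by move=> hs; apply: (@support0 R R^o) => /sup.
have sD1 := @support_D R R^o theta (1 : R^o).
have o1 s : ~ K s -> 'D_1 theta s = 0.
  by move=> hs; apply: (@support0 R R^o ('D_(1 : R^o) theta) s) => hh; exact: hs (sup _ (sD1 _ hh)).
have sD2 := @support_D R R^o ('D_(1 : R^o) theta) (1 : R^o).
have o2 s : ~ K s -> 'D_1 ('D_1 theta) s = 0.
  by move=> hs; apply: (@support0 R R^o ('D_(1 : R^o) ('D_(1 : R^o) theta)) s) => hh; exact: hs (sup _ (sD1 _ (sD2 _ hh))).
have c0 : continuous theta := smooth_cont st.
have c1 : continuous ('D_1 theta) := smooth_cont (smooth_D (1 : R^o) st).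
have c2 : continuous ('D_1 ('D_1 theta)) := smooth_cont (smooth_D (1 : R^o) (smooth_D (1 : R^o) st)).
pose I (f : R -> R) := \int[mu]_(s in `[- b, b]) f s.
have cM (f g : R -> R) : continuous f -> continuous g -> continuous (fun s => f s * g s).
  by move=> cf cg s; exact: (cvgM (cf s) (cg s)).
have IB (f g : R -> R) : continuous f -> continuous g -> I (fun s => f s - g s) = I f - I g.
  by move=> cf cg; apply: RintegralB => //; exact: integrable_itv.
have ID (f g : R -> R) : continuous f -> continuous g -> I (fun s => f s + g s) = I f + I g.
  by move=> cf cg; apply: RintegralD => //; exact: integrable_itv.
have IZ k (f : R -> R) : continuous f -> I (fun s => k * f s) = k * I f.
  by move=> cf; apply: RintegralZl => //; exact: integrable_itv.
have IK (f : R -> R) : (forall s, ~ K s -> f s = 0) -> \int[mu]_s f s = I f.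
  exact: Rintegral_support.
clearbody I.
have cu := cont_si S2 Lu scont_u Lp; have cv := cont_si S2 Hv.1 Hv.2 Lp.
have ca := cont_si SH Hu.1 Hu.2 Hp; have cf := cont_si S2 Lf scont_f Lp.
have := weak2 tt; have := weak1 tt; have := weak1 tD.
rewrite !IK; try (by move=> s hs; rewrite ?(o0 s hs) ?(o1 s hs) ?(o2 s hs) ?mulr0 ?addr0 ?subr0).
have k1 := cM _ _ cu c2; have k2 := cM _ _ ca c0; have k3 := cM _ _ cu c1; have k4 := cM _ _ cf c0.
have k5 := cM _ _ cv c0.
have k6 : continuous (fun s => 2 * alpha * (ip (ut s) psi * 'D_1 theta s)) by move=> s; exact: (cvgM (cvg_cst _) (k3 s)).
have k7 : continuous (fun s => ip (ut s) psi * 'D_1 ('D_1 theta) s + aform (ut s) psi * theta s) by move=> s; exact: (cvgD (k1 s) (k2 s)).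
have k8 : continuous (fun s => ip (ut s) psi * 'D_1 ('D_1 theta) s + aform (ut s) psi * theta s - 2 * alpha * (ip (ut s) psi * 'D_1 theta s)).
  by move=> s; exact: (cvgB (k7 s) (k6 s)).
have k9 : continuous (fun s => 2 * alpha * (ip (vt s) psi * theta s)) by move=> s; exact: (cvgM (cvg_cst _) (k5 s)).
have k10 : continuous (fun s => ip (fnl p (ut s)) psi * theta s - 2 * alpha * (ip (vt s) psi * theta s)) by move=> s; exact: (cvgB (k4 s) (k9 s)).
have -> : (fun s => (ip (gt s) psi - aform (ut s) psi) * theta s) =
  (fun s => ip (fnl p (ut s)) psi * theta s - 2 * alpha * (ip (vt s) psi * theta s) - aform (ut s) psi * theta s).
  apply/funext => s; rewrite /gt (siBl S2)// ?(siZl S2)//; [ring|exact: Hv.1|by apply: (siZ S2); exact: Hv.1].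
rewrite (IB _ _ k8 k4) (IB _ _ k7 k6) (ID _ _ k1 k2) (IZ _ _ k3) (IB _ _ k10 k2) (IB _ _ k4 k9) (IZ _ _ k5).
move=> -> e1; rewrite e1; lra.
Qed.

Lemma solution_dw_test t : 0 < t -> is_derive t 1 (fun s => ip (ut s) psi) (ip (vt t) psi).
Proof.
move=> t0; apply: (@du_bois_reymond _ (fun s => ip (ut s) psi) (fun s => ip (vt s) psi)) => //.
- exact: cont_si S2 Lu scont_u Lp.
- exact: cont_si S2 Hv.1 Hv.2 Lp.
Qed.

Lemma solution_dom_test t : 0 < t ->
  is_derive t 1 (fun s => ip (vt s) psi) (ip (gt t) psi - aform (ut t) psi).
Proof.
move=> t0.
apply: (@du_bois_reymond _ (fun s => ip (vt s) psi) (fun s => ip (gt s) psi - aform (ut s) psi)) => //.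
- exact: cont_si S2 Hv.1 Hv.2 Lp.
- have c1 := cont_si S2 Lg scont_g Lp; have c2 := cont_si SH Hu.1 Hu.2 Hp.
  by move=> s; exact: (cvgB (c1 s) (c2 s)).
Qed.

End fixed_test.

Lemma solution_evol : evol ut vt gt.
Proof.
split; [exact: Hu.1|exact: Hv.1|exact: Lg|exact: Hu.2|exact: Hv.2|exact: scont_g| |].
- move=> t psi t0 Lp.
  have [d1 d10 h1] := scont_bound S2 Lu (scont_u t).
  have [d2 d20 h2] := scont_bound S2 Hv.1 (Hv.2 t).
  pose C := nm (ut t) + nm (vt t) + 1.
  have C0 : 0 < C by rewrite ltr_wpDl// addr_ge0// snorm_ge0.
  apply: (@is_derive_dense _ (@L2 R d) test (@ip R d) (fun r psi => ip (ut r) psi) (fun r psi => ip (vt r) psi) t (Num.min t (Num.min d1 d2)) C) => //.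
  + by move=> e e0; exact: test_dense.
  + by rewrite !lt_min t0 d10.
  + move=> r phi; rewrite !lt_min => /and3P[r0 /h1 n1 /h2 n2] tp; have Lphi := test_L2 tp.
    have Ld := siB S2 Lp Lphi.
    rewrite -(siBr S2 Lp Lphi (Lu r)) -(siBr S2 Lp Lphi (Hv.1 r)); split.
    * apply: le_trans (si_CS S2 (Lu r) Ld) _; rewrite ler_wpM2r ?snorm_ge0// /C.
      by have := snorm_ge0 (@ip R d) (vt t); lra.
    * apply: le_trans (si_CS S2 (Hv.1 r) Ld) _; rewrite ler_wpM2r ?snorm_ge0// /C.
      by have := snorm_ge0 (@ip R d) (ut t); lra.
    * by apply: solution_dw_test => //; move: r0; rewrite ltr_distl subrr => /andP[].
  + move=> e e0; have cc : continuous (fun s => ip (vt s) psi) := cont_si S2 Hv.1 Hv.2 Lp.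
    have := cc t => /cvgrPdist_le /(_ e e0) /nbhs_ballP[del /= del0 hd].
    by exists del => // r rt; rewrite distrC; apply: hd; rewrite /ball /= distrC.
- move=> t psi t0 Hp.
  have [d1 d10 h1] := scont_bound SH Hu.1 (Hu.2 t).
  have [d2 d20 h2] := scont_bound S2 Hv.1 (Hv.2 t).
  have [d3 d30 h3] := scont_bound S2 Lg (scont_g t).
  pose C := hn (ut t) + nm (vt t) + nm (gt t) + 3.
  have C0 : 0 < C by rewrite ltr_wpDl// !addr_ge0// snorm_ge0.
  have Lp := H1_L2 Hp.
  apply: (@is_derive_dense _ (@H1 R d) test (@aform R d) (fun r psi => ip (vt r) psi) (fun r psi => ip (gt r) psi - aform (ut r) psi) t (Num.min t (Num.min d1 (Num.min d2 d3))) C) => //.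
  + by move=> e e0; exact: test_dense_H1.
  + by rewrite !lt_min t0 d10 d20.
  + move=> r phi; rewrite !lt_min => /and4P[r0 /h1 n1 /h2 n2 /h3 n3] tp.
    have Hphi := test_H1 tp; have Lphi := test_L2 tp.
    have Hd := siB SH Hp Hphi; have Ld := H1_L2 Hd; have nd := nm_le_hn Hd.
    have n0 := snorm_ge0 (@aform R d) (psi - phi).
    have a1 := snorm_ge0 (@ip R d) (vt t); have a2 := snorm_ge0 (@aform R d) (ut t).
    have a3 := snorm_ge0 (@ip R d) (gt t).
    split.
    * rewrite -(siBr S2 Lp Lphi (Hv.1 r)).
      apply: le_trans (si_CS S2 (Hv.1 r) Ld) _; apply: ler_pM => //; rewrite ?snorm_ge0// /C; lra.
    * have -> : ip (gt r) psi - aform (ut r) psi - (ip (gt r) phi - aform (ut r) phi) =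
         ip (gt r) (psi - phi) - aform (ut r) (psi - phi).
        rewrite (siBr S2 Lp Lphi (Lg r)) (siBr SH Hp Hphi (Hu.1 r)); ring.
      apply: le_trans (ler_normB _ _) _.
      have q1 : `|ip (gt r) (psi - phi)| <= (nm (gt t) + 1) * hn (psi - phi).
        apply: le_trans (si_CS S2 (Lg r) Ld) _; apply: ler_pM => //; rewrite ?snorm_ge0//.
      have q2 : `|aform (ut r) (psi - phi)| <= (hn (ut t) + 1) * hn (psi - phi).
        by apply: le_trans (si_CS SH (Hu.1 r) Hd) _; rewrite ler_wpM2r.
      apply: le_trans (lerD q1 q2) _; rewrite -mulrDl ler_wpM2r// /C; lra.
    * by apply: solution_dom_test => //; move: r0; rewrite ltr_distl subrr => /andP[].
  + move=> e e0.
    have cc : continuous (fun s => ip (gt s) psi - aform (ut s) psi).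
      have c1 := cont_si S2 Lg scont_g Lp; have c2 := cont_si SH Hu.1 Hu.2 Hp.
      by move=> s; exact: (cvgB (c1 s) (c2 s)).
    have := cc t => /cvgrPdist_le /(_ e e0) /nbhs_ballP[del /= del0 hd].
    by exists del => // r rt; rewrite distrC; apply: hd; rewrite /ball /= distrC.
Qed.

End solution_curves.

(** * Boundedness and Palais-Smale property of global solutions *)

Section scalar_dynamics.
Context {R : realType}.
Local Notation mu := (@lebesgue_measure R).
Implicit Types (F G H : R -> R) (t s a b c : R).

Lemma is_derive_lin t F G c e a b : is_derive t 1 F c -> is_derive t 1 G e ->
  is_derive t 1 (fun s => a * F s + b * G s) (a * c + b * e).
Proof.
move=> /is_derive_epsP hF /is_derive_epsP hG; apply/is_derive_epsP => k k0.
have qa : 0 < 1 + `|a| by rewrite ltr_pwDl.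
have qb : 0 < 1 + `|b| by rewrite ltr_pwDl.
have k2 : 0 < k / 2 by rewrite divr_gt0.
have [d1 d10 h1] := hF _ (divr_gt0 k2 qa); have [d2 d20 h2] := hG _ (divr_gt0 k2 qb).
exists (Num.min d1 d2); first by rewrite lt_min d10.
move=> s; rewrite lt_min => /andP[/h1 n1 /h2 n2].
have -> : a * F s + b * G s - (a * F t + b * G t) - (s - t) * (a * c + b * e) =
  a * (F s - F t - (s - t) * c) + b * (G s - G t - (s - t) * e) by ring.
have aux x X q : 0 < 1 + `|x| -> `|X| <= k / 2 / (1 + `|x|) * q -> 0 <= q -> `|x * X| <= k / 2 * q.
  move=> x0 hX q0; rewrite normrM; apply: (@le_trans _ _ ((1 + `|x|) * (k / 2 / (1 + `|x|) * q))).
    by apply: ler_pM => //; rewrite lerDr.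
  by rewrite mulrA mulrCA divff ?mulr1// gt_eqF.
apply: le_trans (ler_normD _ _) _.
have := aux _ _ _ qa n1 (normr_ge0 _); have := aux _ _ _ qb n2 (normr_ge0 _); lra.
Qed.

Lemma nondecr_of_derive F (F1 : R -> R) a b : (forall r, a <= r <= b -> is_derive r 1 F (F1 r) /\ 0 <= F1 r) ->
  a <= b -> F a <= F b.
Proof.
move=> h; rewrite le_eqVlt => /orP[/eqP->//|ab].
have [||c] := @MVT R F F1 a b ab.
- by move=> r; rewrite in_itv /= => /andP[r1 r2]; apply: (proj1 (h r _)); rewrite !ltW.
- by apply: derivable_within_continuous => r; rewrite in_itv /= => /h[[]].
rewrite in_itv /= => /andP[r1 r2] hr; rewrite -subr_ge0 hr mulr_ge0 ?subr_ge0 ?(ltW ab)//.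
by apply: (proj2 (h c _)); rewrite !ltW.
Qed.

Lemma derive_compare F (F1 : R -> R) G (G1 : R -> R) a b :
  (forall r, a <= r <= b -> [/\ is_derive r 1 F (F1 r), is_derive r 1 G (G1 r) & F1 r <= G1 r]) ->
  a <= b -> F b - F a <= G b - G a.
Proof.
move=> h ab.
have := @nondecr_of_derive (fun s => 1 * G s + (- 1) * F s) (fun s => 1 * G1 s + (- 1) * F1 s) a b.
have hr r : a <= r <= b -> is_derive r 1 (fun s => 1 * G s + (- 1) * F s) (1 * G1 r + (- 1) * F1 r) /\
    0 <= 1 * G1 r + (- 1) * F1 r.
  by move=> /h[h1 h2 h3]; split; [exact: is_derive_lin|lra].
move=> /(_ hr ab); lra.
Qed.

Lemma is_derive_aff t a b : is_derive t 1 (fun s => a * s + b) a.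
Proof.
apply/is_derive_epsP => e e0; exists 1 => // s _.
rewrite (_ : _ - _ - _ = 0); last by ring.
by rewrite normr0 mulr_ge0// ltW.
Qed.

Lemma is_derive_to t F G c c' : is_derive t 1 F c -> (forall s, G s = F s) -> c' = c ->
  is_derive t 1 G c'.
Proof. by move=> h /funext -> ->. Qed.

Lemma antiderivative F a : continuous F -> exists S, forall t, a < t -> is_derive t 1 S (F t).
Proof.
move=> cF; exists (fun x => \int[mu]_(t in `[a, x]) F t) => t at_.
have tt : t < t + 1 by rewrite ltrDl.
have [d1 d2] := continuous_FTC1_closed tt (integrable_itv a (t + 1) cF) at_ (cF t).
apply: (DeriveDef d1); rewrite -derive1E; exact: d2.
Qed.

Lemma quad_discr (x y z : R) : (forall l, 0 <= l ^+ 2 * x + 2 * l * y + z) -> y ^+ 2 <= x * z.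
Proof.
move=> h; have [x0|x0] := eqVneq x 0.
  rewrite x0 mul0r; have z0 : 0 <= z by have := h 0; lra.
  have [->|y0] := eqVneq y 0; first by rewrite expr0n.
  exfalso; have := h (- (z + 1) / y); rewrite x0 mulr0 add0r.
  have -> : 2 * (- (z + 1) / y) * y = - 2 * (z + 1) by field.
  lra.
have xp : 0 < x.
  rewrite lt_def x0 /= leNgt; apply/negP => xn.
  pose l := (1 + `|z| + `|y|) / - x + 1.
  have nx : 0 < - x by rewrite oppr_gt0.
  have k0 : 0 < (1 + `|z| + `|y|) / - x by rewrite divr_gt0// !ltr_pwDl.
  have := h (Num.sg y * - l); have := h (- (Num.sg y * - l)).
  have l1 : 1 <= l by rewrite /l; lra.
  have hl : l * - x >= 1 + `|z| + `|y|.
    by rewrite /l mulrDl mul1r divfK ?gt_eqF//; lra.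
  have := h l; have := h (- l); rewrite sqrrN => h1 h2 _ _.
  have := ler_norm z; have := normr_ge0 y; have := normr_ge0 z.
  have : l ^+ 2 * - x >= 1 + `|z| + `|y|.
    rewrite expr2 -mulrA; apply: le_trans hl _; rewrite -[leLHS]mul1r ler_wpM2r//.
    by rewrite mulr_ge0 ?ltW//; lra.
  lra.
have := h (- y / x).
have -> : (- y / x) ^+ 2 * x + 2 * (- y / x) * y + z = z - y ^+ 2 / x by field.
by rewrite subr_ge0 ler_pdivrMr// mulrC.
Qed.

Lemma is_derive_quot t F G c e : is_derive t 1 F c -> is_derive t 1 G e -> G t != 0 ->
  is_derive t 1 (fun s => F s / G s) ((c * G t - F t * e) / G t ^+ 2).
Proof.
move=> hF hG G0; have hV := is_deriveV G0 hG.
have := is_deriveM hF hV => h.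
apply: (@is_derive_eq _ _ _ _ _ _ _ _ h).
by rewrite /GRing.scale /=; field.
Qed.

(* Levine's concavity argument.  With [X = M + 2 alpha \int M], [Y = I + 2 alpha \int I]
   and [Z = V + 2 alpha \int V] one has [Y^2 <= X Z] and [Y' >= 2 (1 + eps) Z + 1], so the positive
   quantity [X / Y] eventually decreases at a linear rate. *)
Lemma concavity_contradiction (al p t1 : R) (M I V A En : R -> R) :
  0 < al -> 1 < p -> continuous M ->
  (forall t, t1 <= t -> is_derive t 1 M (2 * I t)) ->
  (forall t, t1 <= t -> is_derive t 1 I
     ((p + 3) / 2 * V t + (p - 1) / 2 * A t - (p + 1) * En t - 2 * al * I t)) ->
  (forall t, t1 <= t -> is_derive t 1 En (- 2 * al * V t)) ->
  (forall l t, 0 <= l ^+ 2 * M t + 2 * l * I t + V t) -> (forall t, 0 <= M t) ->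
  (forall t, 0 <= V t) -> (forall t, 0 <= A t) ->
  (forall t, t1 <= t -> 1 <= (p - 1) / 4 * (V t + A t) - (p + 1) * En t1) -> False.
Proof.
move=> al0 p1 cM dM dI dE qf M0 V0 A0 big.
have [S dS0] := @antiderivative M (t1 - 1) cM.
have dS t : t1 <= t -> is_derive t 1 S (M t) by move=> h; apply: dS0; lra.
(* From [M' = 2 I] the integral [2 al \int I] is [al M t - m1], and from [En' = - 2 al V] the
   integral [2 al \int V] is the energy drop; only [M] needs an antiderivative. *)
pose m1 := al * M t1.
pose X t := M t + 2 * al * (S t - S t1).
pose Y t := I t + al * M t - m1.
pose Z t := V t + (En t1 - En t).
have dX t : t1 <= t -> is_derive t 1 X (2 * I t + 2 * al * M t).
  move=> h; have := is_derive_lin 1 (2 * al) (dM t h) (dS t h) => h1.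
  have := is_derive_lin 1 1 h1 (is_derive_aff t 0 (- 2 * al * S t1)) => h2.
  by apply: (is_derive_to h2) => [s|]; rewrite /X; ring.
have dY t : t1 <= t -> is_derive t 1 Y ((p + 3) / 2 * V t + (p - 1) / 2 * A t - (p + 1) * En t).
  move=> h; have := is_derive_lin 1 al (dI t h) (dM t h) => h1.
  have := is_derive_lin 1 1 h1 (is_derive_aff t 0 (- m1)) => h2.
  by apply: (is_derive_to h2) => [s|]; rewrite /Y; ring.
have D0 t : t1 <= t -> 0 <= En t1 - En t.
  move=> h; have := @derive_compare En (fun r => - 2 * al * V r) (fun s => 0 * s + 0) (fun=> 0) t1 t _ h.
  have hh r : t1 <= r <= t -> [/\ is_derive r 1 En (- 2 * al * V r), is_derive r 1 (fun s => 0 * s + 0) 0 & - 2 * al * V r <= 0].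
    move=> /andP[r1 _]; split; [exact: dE|exact: is_derive_aff|].
    by rewrite -mulrA mulNr oppr_le0 !mulr_ge0// ltW.
  by move=> /(_ hh); lra.
(* [l^2 M + 2 l I + V] is nonnegative for every [l], and [Q] is its integral times [2 al]; hence
   [l^2 X + 2 l Y + Z] is nonnegative and its discriminant has a sign. *)
have XYZ t : t1 <= t -> Y t ^+ 2 <= X t * Z t.
  move=> h; apply: quad_discr => l.
  pose Q r := l ^+ 2 * (2 * al * (S r - S t1)) + 2 * l * (al * M r - m1) + (En t1 - En r).
  have dQ r : t1 <= r <= t -> is_derive r 1 Q (2 * al * (l ^+ 2 * M r + 2 * l * I r + V r)) /\
      0 <= 2 * al * (l ^+ 2 * M r + 2 * l * I r + V r).
    move=> /andP[r1 _]; split; last by rewrite mulr_ge0// mulr_ge0// ltW.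
    have h1 := is_derive_lin (l ^+ 2 * 2 * al) (2 * l * al) (dS r r1) (dM r r1).
    have h2 := is_derive_lin 1 (-1) h1 (dE r r1).
    have h3 := is_derive_lin 1 1 h2 (is_derive_aff r 0 (En t1 - 2 * l * m1 - l ^+ 2 * 2 * al * S t1)).
    by apply: (is_derive_to h3) => [s|]; rewrite /Q; ring.
  have := nondecr_of_derive dQ h; have -> : Q t1 = 0 by rewrite /Q /m1; ring.
  have := qf l t; rewrite /X /Y /Z /Q.
  move: (l ^+ 2) => l2; move: (M t) (I t) (V t) (S t) (S t1) (En t) (En t1) => m i v s s1 e e1; nra.
(* With [eps = (p - 1)/8] there remain [(p - 1)/4 V], [(p - 1)/2 A] and a positive multiple of the
   energy drop, and the lower bound assumed in [big] provides the constant 1. *)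
have Yp t : t1 <= t -> 2 * (1 + (p - 1) / 8) * Z t + 1 <=
    (p + 3) / 2 * V t + (p - 1) / 2 * A t - (p + 1) * En t.
  move=> h; have h1 := big t h; have h2 := D0 t h; have h3 := V0 t; have h4 := A0 t.
  have q : 0 < p - 1 by lra.
  have h5 := mulr_ge0 (ltW q) h2; have h6 := mulr_ge0 (ltW q) h4; have h7 := mulr_ge0 (ltW q) h3.
  rewrite /Z; lra.
have Z0 t : t1 <= t -> 0 <= Z t by move=> h; rewrite /Z addr_ge0// D0.
have q0 : 0 < (p - 1) / 8 by rewrite divr_gt0//; lra.
have Ylin t : t1 <= t -> Y t1 + (t - t1) <= Y t.
  move=> h; have := @derive_compare (fun s => 1 * s + 0) (fun=> 1) Y
    (fun t => (p + 3) / 2 * V t + (p - 1) / 2 * A t - (p + 1) * En t) t1 t _ h.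
  have hh r : t1 <= r <= t -> [/\ is_derive r 1 (fun s => 1 * s + 0) 1, is_derive r 1 Y
      ((p + 3) / 2 * V r + (p - 1) / 2 * A r - (p + 1) * En r) &
      1 <= (p + 3) / 2 * V r + (p - 1) / 2 * A r - (p + 1) * En r].
    move=> /andP[r1 _]; split; [exact: is_derive_aff|exact: dY|].
    apply: le_trans (Yp r r1); rewrite lerDr mulr_ge0 ?Z0//; lra.
  by move=> /(_ hh); lra.
have m10 : 0 <= m1 by rewrite mulr_ge0// ltW.
pose eps := (p - 1) / 8.
(* [X'] is [2 Y + 2 m1] and not [2 Y]. As [Y] grows at least at unit rate, from [t2] on
   [2 m1 <= eps Y] and the error is absorbed by half of the gain [2 eps]. *)
pose t2 := t1 + `|Y t1| + 1 + 2 * m1 / eps.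
have me0 : 0 <= 2 * m1 / eps by rewrite (divr_ge0 (mulr_ge0 _ m10) (ltW q0)).
have t12 : t1 <= t2 by rewrite /t2; have := normr_ge0 (Y t1); lra.
have Ybig t : t2 <= t -> 1 + 2 * m1 / eps <= Y t.
  move=> h; apply: le_trans (Ylin t (le_trans t12 h)).
  have := ler_norm (- Y t1); rewrite normrN; move: h; rewrite /t2; lra.
have Ypos t : t2 <= t -> 0 < Y t by move=> h; have := Ybig t h; lra.
have Xpos t : t2 <= t -> 0 < X t.
  move=> h; have h1 := XYZ t (le_trans t12 h); have h2 := Z0 t (le_trans t12 h).
  have h3 : 0 < Y t ^+ 2 by rewrite exprn_gt0// Ypos.
  rewrite ltNge; apply/negP => h4; have : X t * Z t <= 0 by rewrite mulr_le0_ge0.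
  lra.
pose q t := X t / Y t.
have dq r : t2 <= r -> is_derive r 1 q (((2 * I r + 2 * al * M r) * Y r - X r *
    ((p + 3) / 2 * V r + (p - 1) / 2 * A r - (p + 1) * En r)) / Y r ^+ 2).
  move=> h; have h1 := le_trans t12 h.
  by apply: is_derive_quot; [exact: dX|exact: dY|rewrite gt_eqF// Ypos].
have qdec t : t2 <= t -> q t <= q t2 - eps * (t - t2).
  move=> h; have := @derive_compare q (fun r => ((2 * I r + 2 * al * M r) * Y r - X r *
    ((p + 3) / 2 * V r + (p - 1) / 2 * A r - (p + 1) * En r)) / Y r ^+ 2) (fun s => - eps * s + 0) (fun=> - eps) t2 t _ h.
  have hh r : t2 <= r <= t -> [/\ is_derive r 1 q (((2 * I r + 2 * al * M r) * Y r - X r *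
    ((p + 3) / 2 * V r + (p - 1) / 2 * A r - (p + 1) * En r)) / Y r ^+ 2),
    is_derive r 1 (fun s => - eps * s + 0) (- eps) &
    ((2 * I r + 2 * al * M r) * Y r - X r *
    ((p + 3) / 2 * V r + (p - 1) / 2 * A r - (p + 1) * En r)) / Y r ^+ 2 <= - eps].
    move=> /andP[r2 _]; split; [exact: dq|exact: is_derive_aff|].
    have r1 := le_trans t12 r2; have y0 := Ypos r r2; have x0 := Xpos r r2.
    rewrite ler_pdivrMr ?exprn_gt0//.
    have e1 : 2 * I r + 2 * al * M r = 2 * Y r + 2 * m1 by rewrite /Y; ring.
    have h1 := ler_wpM2l (ltW x0) (Yp r r1).
    have h2 := XYZ r r1.
    have h3 : 2 * m1 <= eps * Y r.
      have := Ybig r r2; rewrite -(ler_pM2l q0) -/eps mulrDr mulr1 mulrCA divff ?gt_eqF// mulr1; move: q0; rewrite -/eps; lra.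
    have h4 : 2 * m1 * Y r <= eps * Y r * Y r by rewrite ler_wpM2r// ltW.
    have h5 : 2 * (1 + eps) * Y r ^+ 2 <= 2 * (1 + eps) * (X r * Z r).
      by rewrite ler_wpM2l// mulr_ge0// addr_ge0// ltW.
    rewrite e1; move: h1 h4 h5; rewrite -/eps.
    move: ((p + 3) / 2 * V r + (p - 1) / 2 * A r - (p + 1) * En r) => K h1 h4 h5.
    rewrite mulrDl; rewrite mulrDr mulr1 in h1.
    have -> : 2 * Y r * Y r = 2 * Y r ^+ 2 by ring.
    have e3 : X r * (2 * (1 + eps) * Z r) = 2 * (1 + eps) * (X r * Z r) by ring.
    have e4 : eps * Y r * Y r = eps * Y r ^+ 2 by ring.
    rewrite e3 in h1; rewrite e4 in h4.
    have e5 : 2 * (1 + eps) * Y r ^+ 2 = 2 * Y r ^+ 2 + 2 * (eps * Y r ^+ 2) by ring.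
    rewrite e5 in h5; rewrite mulNr; lra.
  by move=> /(_ hh); lra.
have q20 : 0 <= q t2 by rewrite /q divr_ge0// ltW ?Xpos ?Ypos.
have t23 : t2 <= t2 + q t2 / eps by rewrite lerDl divr_ge0// ltW.
have := qdec _ t23; have : 0 < q (t2 + q t2 / eps) by rewrite /q divr_gt0 ?Xpos ?Ypos.
rewrite (addrC t2) addrK mulrCA mulfV ?mulr1 ?gt_eqF//; lra.
Qed.

(* The derivative of [(1 + N)^-(k+1)] is at least [- (k+1) K]. *)
Lemma growth_window (N N1 : R -> R) (K a b : R) (k : nat) :
  (forall r, a <= r <= b -> [/\ is_derive r 1 N (N1 r), 0 <= N r & N1 r <= K * (1 + N r) ^+ k.+2]) ->
  (forall r, a <= r <= b -> (1 + N r) ^- k.+1 >= (1 + N a) ^- k.+1 - k.+1%:R * K * (r - a)).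
Proof.
move=> h r /andP[ar rb].
have hd s : a <= s <= r -> is_derive s 1 (fun x => (1 + N x) ^- k.+1) (- (k.+1%:R * (1 + N s) ^+ k * N1 s) / ((1 + N s) ^+ k.+1) ^+ 2)
    /\ - (k.+1%:R * K) <= - (k.+1%:R * (1 + N s) ^+ k * N1 s) / ((1 + N s) ^+ k.+1) ^+ 2.
  move=> /andP[as_ sr]; have [hN N0 hN1] := h s (introT andP (conj as_ (le_trans sr rb))).
  have p1 : 0 < 1 + N s by rewrite ltr_pwDl.
  have h1 : is_derive s 1 (fun x => 1 + N x) (N1 s).
    have := is_derive_lin 1 1 hN (is_derive_aff s 0 1) => h2.
    by apply: (is_derive_to h2) => [x|]; ring.
  have h2 : is_derive s 1 (fun x => (1 + N x) ^+ k.+1) (k.+1%:R * (1 + N s) ^+ k * N1 s).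
    have := @is_deriveX _ _ (fun x => 1 + N x) k.+1 s 1 _ h1 => h3.
    by apply: (is_derive_to h3) => [x|]; rewrite ?exprfctE.
  have n0 : (1 + N s) ^+ k.+1 != 0 by rewrite expf_neq0// gt_eqF.
  split.
    have h3 := is_derive_quot (is_derive_aff s 0 1) h2 n0.
    by apply: (is_derive_to h3) => [x|]; rewrite ?(mul0r, add0r, mul1r, sub0r).
  rewrite mulNr lerN2 ler_pdivrMr ?exprn_gt0// -!mulrA ler_wpM2l//.
  apply: (@le_trans _ _ ((1 + N s) ^+ k * (K * (1 + N s) ^+ k.+2))).
    by rewrite ler_wpM2l// exprn_ge0// ltW.
  by rewrite mulrCA -exprD -exprM muln2 -addnn addSn addnS -!addSnnS.
have hc s : a <= s <= r -> [/\ is_derive s 1 (fun s => - (k.+1%:R * K) * s + 0) (- (k.+1%:R * K)),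
   is_derive s 1 (fun x => (1 + N x) ^- k.+1) (- (k.+1%:R * (1 + N s) ^+ k * N1 s) / ((1 + N s) ^+ k.+1) ^+ 2) &
   - (k.+1%:R * K) <= - (k.+1%:R * (1 + N s) ^+ k * N1 s) / ((1 + N s) ^+ k.+1) ^+ 2].
  by move=> /hd[h1 h2]; split => //; exact: is_derive_aff.
have := derive_compare hc ar; lra.
Qed.

End scalar_dynamics.

(** * Energy identities, recurrence and local growth *)

Section energy_estimates.
Context {R : realType} {d : nat}.
Local Notation E := 'rV[R]_d.
Local Notation nm := (snorm (@ip R d)).
Local Notation hn := (snorm (@aform R d)).
Let S2 := @L2_semi R d.
Let SH := @H1_semi R d.
Implicit Types (t s : R).

Variables (al p : R) (w om : R -> E -> R).
Hypothesis al0 : 0 < al.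
Hypothesis hp : @subcritical R d p.
Local Notation f := (fnl p).
Hypothesis ev : evol w om (fun t => f (w t) - (2 * al) *: om t).

Let hp1 : 1 < p. Proof. by case: hp. Qed.
Let Hw := evol_H1 ev.
Let Lom := evol_L2 ev.
Let Lw t : L2 (w t) := H1_L2 (Hw t).
Let Lf t : L2 (f (w t)) := L2_fnl hp (Hw t).

Definition total (w om : R -> E -> R) t := ip (om t) (om t) + aform (w t) (w t).
Definition energy p (w om : R -> E -> R) t := total w om t / 2 - ip (fnl p (w t)) (w t) / (p + 1).
Local Notation N := (total w om).
Local Notation En := (energy p w om).

Lemma scont_fnl t : scont (@ip R d) (fun s => f (w s)) t.
Proof.
move=> e e0; have b0 : 0 < hn (w t) + 1 by rewrite ltr_wpDl ?snorm_ge0.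
have [k k0 hk] := fnl_unif hp b0 e0; have k1 : 0 < Num.min k 1 by rewrite lt_min k0/=.
have [del d0 hd] := evol_scontw ev t k1; exists del => // s /hd h.
have Hd := siB SH (Hw s) (Hw t); have h2 := ler_snorm_dist SH (Hw s) (Hw t).
move: h; rewrite le_min => /andP[h h'].
apply: hk => //; [|by rewrite lerDl|exact: le_trans (nm_le_hn Hd) h].
by move: h2; rewrite ler_norml => /andP[_]; lra.
Qed.

(** Convexity used at both [t] and [s] encloses the increment of the potential between [p + 1] times
    the pairings of [w s - w t] with [f (w t)] and with [f (w s)]; these differ by [o(s - t)]
    because [f (w s)] is continuous in L^2. *)
Lemma is_derive_potential t : 0 < t ->
  is_derive t 1 (fun s => ip (f (w s)) (w s)) ((p + 1) * ip (f (w t)) (om t)).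
Proof.
have hq : 1 < p := hp1.
move=> t0; apply/is_derive_epsP => e e0.
have nf := snorm_ge0 (@ip R d) (f (w t)); have no := snorm_ge0 (@ip R d) (om t).
pose q := (p + 1) * (nm (f (w t)) + 1 + nm (om t)).
have q0 : 0 < q by rewrite mulr_gt0//; lra.
pose k := Num.min 1 (e / q).
have k0 : 0 < k by rewrite lt_min ltr01 divr_gt0.
have [d1 d10 h1] := evol_sderiv ev t0 k0; have [d2 d20 h2] := scont_fnl t k0.
exists (Num.min d1 d2); first by rewrite lt_min d10.
move=> s; rewrite lt_min => /andP[/h1 n1 /h2 n2].
have c1 := fnl_convex hp (Hw t) (Hw s); have c2 := fnl_convex hp (Hw s) (Hw t).
have k1 : k <= 1 by rewrite ge_min lexx.
have kq : k * q <= e by rewrite -ler_pdivlMr// ge_min lexx orbT.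
pose rho := w s - w t - (s - t) *: om t.
have Lws := siB S2 (Lw s) (Lw t); have Lso := siZ S2 (s - t) (Lom t); have Lrho : L2 rho := siB S2 Lws Lso.
have e1 : ip (f (w t)) rho = ip (f (w t)) (w s - w t) - (s - t) * ip (f (w t)) (om t).
  by rewrite (siBr S2 Lws Lso (Lf t)) (siZr S2 _ (Lom t) (Lf t)).
have Lff := siB S2 (Lf s) (Lf t).
have e2 : ip (f (w s) - f (w t)) (w s - w t) = - ip (f (w s)) (w t - w s) - ip (f (w t)) (w s - w t).
  rewrite (siBl S2 (Lf s) (Lf t) Lws) (siBr S2 (Lw s) (Lw t) (Lf s)) (siBr S2 (Lw t) (Lw s) (Lf s)); ring.
have a1 : `|ip (f (w t)) rho| <= nm (f (w t)) * (k * `|s - t|).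
  by apply: le_trans (si_CS S2 (Lf t) Lrho) _; rewrite ler_wpM2l.
have a2 : `|ip (f (w s) - f (w t)) (w s - w t)| <= k * ((1 + nm (om t)) * `|s - t|).
  apply: le_trans (si_CS S2 Lff Lws) _; apply: ler_pM => //; try exact: snorm_ge0.
  have -> : w s - w t = rho + (s - t) *: om t by rewrite subrK.
  apply: le_trans (snormD S2 Lrho Lso) _; rewrite (snormZ S2 _ (Lom t)).
  have : k * `|s - t| <= 1 * `|s - t| by rewrite ler_wpM2r.
  move: n1; rewrite -/rho; lra.
have a3 : k * q * `|s - t| <= e * `|s - t| by rewrite ler_wpM2r.
have pp : 0 <= p + 1 by lra.
move: a1 a2; rewrite !ler_norml => /andP[a1 a1'] /andP[a2 a2'].
have b1 := ler_wpM2l pp a1; have b1' := ler_wpM2l pp a1'; have b2' := ler_wpM2l pp a2'; have b2 := ler_wpM2l pp a2.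
have x0 : 0 <= (p + 1) * (k * ((1 + nm (om t)) * `|s - t|)) by rewrite !mulr_ge0// ?(ltW k0)//; lra.
move: a3; rewrite /q => a3.
apply/andP; split; nra.
Qed.

Lemma energy_derive t : 0 < t -> is_derive t 1 En (- 2 * al * ip (om t) (om t)).
Proof.
have hq : 1 < p := hp1.
move=> t0; have h := is_derive_lin 1 (- (p + 1)^-1) (evol_energy ev t0) (is_derive_potential t0).
apply: (is_derive_to h) => [s|]; first by rewrite /energy /total; field; lra.
rewrite (siBl S2 (Lf t) (siZ S2 _ (Lom t)) (Lom t)) (siZl S2 _ (Lom t) (Lom t)); field; lra.
Qed.

Lemma total_derive t : 0 < t ->
  is_derive t 1 N (2 * ip (f (w t)) (om t) - 4 * al * ip (om t) (om t)).
Proof.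
move=> t0; have h := is_derive_lin 2 0 (evol_energy ev t0) (evol_energy ev t0).
apply: (is_derive_to h) => [s|]; first by rewrite /total; field.
rewrite (siBl S2 (Lf t) (siZ S2 _ (Lom t)) (Lom t)) (siZl S2 _ (Lom t) (Lom t)); ring.
Qed.

(** The potential term of the virial identity is eliminated through the energy, which leaves
    positive coefficients in front of the kinetic and the H^1 term. *)
Lemma virial_derive t : 0 < t -> is_derive t 1 (fun s => ip (w s) (om s))
  ((p + 3) / 2 * ip (om t) (om t) + (p - 1) / 2 * aform (w t) (w t) - (p + 1) * En t
    - 2 * al * ip (w t) (om t)).
Proof.
have hq : 1 < p := hp1.
move=> t0; apply: (is_derive_to (evol_virial ev t0)) => // .
rewrite (siBl S2 (Lf t) (siZ S2 _ (Lom t)) (Lw t)) (siZl S2 _ (Lom t) (Lw t)).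
rewrite (siC S2 (Lom t) (Lw t)) /energy /total; field; lra.
Qed.

Lemma kinetic_ge0 t : 0 <= ip (om t) (om t). Proof. exact: (si_ge0 S2). Qed.
Lemma form_ge0 t : 0 <= aform (w t) (w t). Proof. exact: (si_ge0 SH). Qed.

Lemma energy_mono s t : 0 < s -> s <= t -> En t <= En s.
Proof.
move=> s0 st; have := @derive_compare _ En (fun r => - 2 * al * ip (om r) (om r)) (fun s => 0 * s + 0) (fun=> 0) s t _ st.
have hh r : s <= r <= t -> [/\ is_derive r 1 En (- 2 * al * ip (om r) (om r)),
    is_derive r 1 (fun s => 0 * s + 0) 0 & - 2 * al * ip (om r) (om r) <= 0].
  move=> /andP[r1 _]; split; [exact/energy_derive/(lt_le_trans s0)|exact: is_derive_aff|].
  have := mulr_ge0 (ltW al0) (kinetic_ge0 r); lra.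
by move=> /(_ hh); lra.
Qed.

Lemma nm_le_total t B : 0 <= B -> N t <= B -> nm (om t) <= Num.sqrt B /\ hn (w t) <= Num.sqrt B.
Proof.
move=> B0; rewrite /total => h; have k1 := kinetic_ge0 t; have k2 := form_ge0 t.
by split; rewrite /snorm ler_sqrt//; lra.
Qed.

(** Otherwise the total exceeds [A0] from some time on. Multiplied by [(p - 1)/4], this is the lower
    bound [big] of [concavity_contradiction], because the energy at [t1 >= 1] is at most [En 1]. *)
Lemma total_recurrent : exists2 A0, 0 < A0 & forall T, exists t, [/\ T <= t, 0 < t & N t <= A0].
Proof.
have hq : 1 < p := hp1.
have p10 : 0 < p - 1 by lra.
pose A0 := 4 / (p - 1) * (1 + (p + 1) * `|En 1|).
have z0 : 0 <= (p + 1) * `|En 1| by rewrite mulr_ge0//; lra.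
have A00 : 0 < A0 by rewrite mulr_gt0 ?divr_gt0//; lra.
exists A0 => // T; apply: contrapT => hN.
have h t : T <= t -> 0 < t -> A0 < N t.
  by move=> Tt t0; rewrite ltNge; apply/negP => nt; apply: hN; exists t.
pose t1 := Num.max T 1.
have t11 : 1 <= t1 by rewrite le_max lexx orbT.
have t1T : T <= t1 by rewrite le_max lexx.
have pos t : t1 <= t -> 0 < t by move=> ht; lra.
apply: (@concavity_contradiction R al p t1 (fun s => ip (w s) (w s)) (fun s => ip (w s) (om s))
  (fun s => ip (om s) (om s)) (fun s => aform (w s) (w s)) En) => //.
- have e : (fun s => ip (w s) (w s)) = (fun s => nm (w s) * nm (w s)).
    by apply/funext => s; rewrite -expr2 (snorm_sqr S2).
  have c : continuous (fun s => nm (w s)).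
    move=> t; apply/cvgrPdist_le => e0 e00.
    have [del d0 hd] := scont_nmw ev t e00; near=> s.
    have ts : `|s - t| < del.
      by rewrite distrC; near: s; apply: cvgr_dist_lt.
    rewrite distrC; apply: le_trans (ler_snorm_dist S2 (Lw s) (Lw t)) _; exact: hd.
  by rewrite e => t; apply: cvgM; exact: c.
- by move=> t /pos; exact: (evol_mass ev).
- by move=> t /pos; exact: virial_derive.
- by move=> t /pos; exact: energy_derive.
- move=> l t; have := si_ge0 S2 (siP S2 l (Lw t) (Lom t)).
  rewrite (siDZl S2 l (Lw t) (Lom t) (siP S2 l (Lw t) (Lom t))).
  rewrite (siDr S2 (siZ S2 l (Lw t)) (Lom t) (Lw t)) (siDr S2 (siZ S2 l (Lw t)) (Lom t) (Lom t)).
  rewrite (siZr S2 l (Lw t) (Lw t)) (siZr S2 l (Lw t) (Lom t)) (siC S2 (Lom t) (Lw t)).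
  by move=> h'; apply: le_trans h' _; rewrite le_eqVlt; apply/orP; left; apply/eqP; ring.
- by move=> t; exact: (si_ge0 S2).
- exact: kinetic_ge0.
- exact: form_ge0.
- move=> t ht; have := h t (le_trans t1T ht) (pos t ht).
  have eA : (p - 1) * A0 = 4 * (1 + (p + 1) * `|En 1|) by rewrite /A0; field; rewrite gt_eqF.
  rewrite -(ltr_pM2l p10) eA.
  have := energy_mono ltr01 t11; have := ler_norm (En 1) => n1 n2.
  have p10' : 0 <= p + 1 by lra.
  have := ler_wpM2l p10' (le_trans n2 n1); rewrite /total; lra.
Unshelve. all: by end_near.
Qed.

(** The energy is nonincreasing, and at the recurrent times its potential part is bounded in terms
    of [A0]; so it is bounded below and its drops on late intervals are small. *)
Lemma energy_cauchy e : 0 < e -> exists2 T, 0 < T & forall s t, T <= s -> s <= t -> En s - En t <= e.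
Proof.
have hq : 1 < p := hp1.
move=> e0; have [A0 A00 hA] := total_recurrent.
have [M M0 hM] := nm_fnl_bound hp (Num.sqrt A0).
have p10 : 0 < p + 1 by lra.
pose C := M * Num.sqrt A0 / (p + 1).
have lb t : 0 < t -> - C <= En t.
  move=> t0; have [r [tr _ Nr]] := hA t.
  apply: le_trans (energy_mono t0 tr).
  have [_ n2] := nm_le_total (ltW A00) Nr.
  have c : ip (f (w r)) (w r) <= M * Num.sqrt A0.
    apply: le_trans (ler_norm _) _; apply: le_trans (si_CS S2 (Lf r) (Lw r)) _.
    apply: ler_pM; try exact: snorm_ge0; first exact: hM.
    exact: le_trans (nm_le_hn (Hw r)) n2.
  have k1 := kinetic_ge0 r; have k2 := form_ge0 r.
  have c2 : ip (f (w r)) (w r) / (p + 1) <= C by rewrite /C ler_pM2r// invr_gt0.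
  rewrite /energy /total; lra.
pose S := [set x | exists2 t, 0 < t & x = En t].
have hS : has_inf S.
  split; first by exists (En 1), 1.
  by exists (- C) => x [t t0 ->]; exact: lb.
have [x [t0 t00 ->] ht0] := inf_adherent e0 hS.
exists t0 => // s t st st'.
have := energy_mono t00 st; have : inf S <= En t.
  by apply: (ge_inf (proj2 hS)); exists t => //; lra.
lra.
Qed.

(** The total satisfies [N' <= 2 C (1 + N)^(k+2)], so [growth_window] bounds it for a time that
    depends only on the starting level [A]. *)
Lemma total_window A : 0 < A -> exists tau B, [/\ 0 < tau, 0 < B & forall s, 0 < s -> N s <= A ->
  forall r, s <= r <= s + 3 * tau -> N r <= B].
Proof.
have hq : 1 < p := hp1.
move=> A0; have [C [C0 hC]] := nm_fnl_le hp.
(* A natural number above [p]: the growth estimate works with natural exponents, and the square root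
   of [1 + N] is at least 1. *)
pose k := Num.bound p.
have pk : p <= k%:R by apply: ltW; apply: archi_boundP; lra.
have N0 t : 0 <= N t by rewrite addr_ge0 ?kinetic_ge0 ?form_ge0.
have hN1 t : 2 * ip (f (w t)) (om t) - 4 * al * ip (om t) (om t) <= 2 * C * (1 + N t) ^+ k.+2.
  have k0 := mulr_ge0 (ltW al0) (kinetic_ge0 t).
  have q1 : 1 <= Num.sqrt (1 + N t) by rewrite -[leLHS]sqrtr1; apply: ler_wsqrtr; rewrite lerDl.
  have q0 : 0 < Num.sqrt (1 + N t) by lra.
  have qq : 0 <= 1 + N t by rewrite addr_ge0.
  have [n1 n2] := @nm_le_total t (1 + N t) qq (ler_wpDl ler01 (lexx _)).
  have c : ip (f (w t)) (om t) <= C * Num.sqrt (1 + N t) `^ p * Num.sqrt (1 + N t).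
    apply: le_trans (ler_norm _) _; apply: le_trans (si_CS S2 (Lf t) (Lom t)) _.
    by apply: ler_pM => //; [exact: snorm_ge0|exact: snorm_ge0|exact: hC].
  have c2 : Num.sqrt (1 + N t) `^ p * Num.sqrt (1 + N t) <= (1 + N t) ^+ k.+2.
    have -> : (1 + N t) ^+ k.+2 = Num.sqrt (1 + N t) ^+ (2 * k.+2) by rewrite exprM sqr_sqrtr.
    move: (Num.sqrt _) q1 q0 => q q1 q0.
    apply: (@le_trans _ _ (q ^+ k * q)); first by rewrite ler_wpM2r ?(ltW q0)// -powR_mulrn ?(ltW q0)// ler_powR.
    by rewrite -exprSr ler_weXn2l// (@leq_trans k.+2)// leq_pmull.
  have c3 := ler_wpM2l (ltW C0) c2; rewrite mulrA in c3; lra.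
pose K := 2 * C; have K0 : 0 < K by rewrite mulr_gt0.
have a1 : 0 < 1 + A by lra.
have v0 : 0 < (1 + A) ^- k.+1 by rewrite invr_gt0 exprn_gt0.
(* Over the length [3 tau] the quantity [(1 + N)^-(k+1)] loses at most half of its initial lower
   bound; hence the factor 2 in [B]. *)
pose tau := (1 + A) ^- k.+1 / (6 * (k.+1%:R * K)).
have kk : 0 < k.+1%:R * K by rewrite mulr_gt0.
exists tau, (2 * (1 + A) ^+ k.+1); split.
- by rewrite divr_gt0 // mulr_gt0.
- by rewrite mulr_gt0// exprn_gt0.
move=> s s0 Ns r hr.
have hh x : s <= x <= s + 3 * tau -> [/\ is_derive x 1 N (2 * ip (f (w x)) (om x) - 4 * al * ip (om x) (om x)),
    0 <= N x & 2 * ip (f (w x)) (om x) - 4 * al * ip (om x) (om x) <= K * (1 + N x) ^+ k.+2].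
  by move=> /andP[sx _]; split; [apply: total_derive; lra|exact: N0|exact: hN1].
have := growth_window hh hr.
have hA : (1 + A) ^- k.+1 <= (1 + N s) ^- k.+1.
  rewrite lef_pV2 ?posrE ?exprn_gt0 ?ltr_pwDl ?(ltW A0)//.
  have x0 : 0 <= 1 + N s by exact: addr_ge0 ler01 (N0 s).
  have x1 : 1 + N s <= 1 + A by rewrite lerD2l.
  exact: (lerXn2r k.+1 x0 (ltW a1) x1).
have hr2 : k.+1%:R * K * (r - s) <= (1 + A) ^- k.+1 / 2.
  have -> : (1 + A) ^- k.+1 / 2 = k.+1%:R * K * (3 * tau).
    by rewrite /tau; field; rewrite expf_neq0 ?gt_eqF.
  by rewrite ler_pM2l//; lra.
move=> h1; have h2 : ((2 * (1 + A) ^+ k.+1))^-1 <= (1 + N r) ^- k.+1.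
  by rewrite invfM; lra.
have h3 : (1 + N r) ^+ k.+1 <= 2 * (1 + A) ^+ k.+1.
  have p1 : 0 < 2 * (1 + A) ^+ k.+1 by rewrite mulr_gt0// exprn_gt0.
  have p2 : 0 < (1 + N r) ^+ k.+1 by apply: exprn_gt0; exact: ltr_pwDl.
  by move: h2; rewrite lef_pV2.
apply: le_trans h3; apply: (@le_trans _ _ (1 + N r)); first by rewrite lerDr.
by rewrite -[leLHS]expr1 ler_weXn2l ?lerDl.
Qed.

End energy_estimates.

(** * Calm windows: increments, velocity and almost critical profiles *)

Section compactness_in_time.
Context {R : realType} {d : nat}.
Local Notation E := 'rV[R]_d.
Local Notation nm := (snorm (@ip R d)).
Local Notation hn := (snorm (@aform R d)).
Let S2 := @L2_semi R d.
Let SH := @H1_semi R d.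
Implicit Types (t s r h : R).

Lemma is_derive_shift (F : R -> R) t h (c : R) : is_derive (t + h) 1 F c -> is_derive t 1 (fun s => F (s + h)) c.
Proof.
move=> /is_derive_epsP hF; apply/is_derive_epsP => e e0.
have [del d0 hd] := hF e e0; exists del => // s st.
have e1 : s + h - (t + h) = s - t by ring.
by have := hd (s + h); rewrite e1; exact.
Qed.

Lemma scont_shiftB (V : lmodType R) (D : set V) (B : V -> V -> R) (x : R -> V) h t :
  semi_inner D B -> (forall s, D (x s)) -> (forall s, scont B x s) ->
  scont B (fun s => x (s + h) - x s) t.
Proof.
move=> hB Dx cx e e0; have e2 : 0 < e / 2 by rewrite divr_gt0.
have [d1 d10 h1] := cx (t + h) _ e2; have [d2 d20 h2] := cx t _ e2.
exists (Num.min d1 d2); first by rewrite lt_min d10.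
move=> s; rewrite lt_min => /andP[s1 /h2 n2].
have n1 : snorm B (x (s + h) - x (t + h)) <= e / 2.
  by apply: h1; have -> : s + h - (t + h) = s - t by ring.
have -> : x (s + h) - x s - (x (t + h) - x t) = (x (s + h) - x (t + h)) - (x s - x t).
  by rewrite !opprB !addrA [LHS]addrAC [RHS]addrAC; congr (_ + _); rewrite addrAC.
apply: le_trans (snormB hB (siB hB (Dx _) (Dx _)) (siB hB (Dx _) (Dx _))) _; lra.
Qed.

Lemma evol_shiftB (w om g : R -> E -> R) h : 0 <= h -> evol w om g ->
  evol (fun t => w (t + h) - w t) (fun t => om (t + h) - om t) (fun t => g (t + h) - g t).
Proof.
move=> h0 ev; have Hw := evol_H1 ev; have Lo := evol_L2 ev; have Lg := evol_force ev.
split.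
- by move=> t; exact: (siB SH).
- by move=> t; exact: (siB S2).
- by move=> t; exact: (siB S2).
- by move=> t; apply: (@scont_shiftB _ _ _ w h t SH) => //; exact: evol_scontw ev.
- by move=> t; apply: (@scont_shiftB _ _ _ om h t S2) => //; exact: evol_sconto ev.
- by move=> t; apply: (@scont_shiftB _ _ _ g h t S2) => //; exact: evol_scontg ev.
- move=> t psi t0 Lp; have th : 0 < t + h by lra.
  have := is_derive_lin 1 (-1) (is_derive_shift (evol_dw ev th Lp)) (evol_dw ev t0 Lp) => h1.
  apply: (is_derive_to h1) => [s|].
    by rewrite (siBl S2 (H1_L2 (Hw _)) (H1_L2 (Hw _)) Lp); ring.
  by rewrite (siBl S2 (Lo _) (Lo _) Lp); ring.
- move=> t psi t0 Hp; have th : 0 < t + h by lra.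
  have := is_derive_lin 1 (-1) (is_derive_shift (evol_dom ev th Hp)) (evol_dom ev t0 Hp) => h1.
  apply: (is_derive_to h1) => [s|].
    by rewrite (siBl S2 (Lo _) (Lo _) (H1_L2 Hp)); ring.
  rewrite (siBl S2 (Lg _) (Lg _) (H1_L2 Hp)) (siBl SH (Hw _) (Hw _) Hp); ring.
Qed.

Variables (al p : R) (w om : R -> E -> R).
Hypothesis al0 : 0 < al.
Hypothesis hp : @subcritical R d p.
Local Notation f := (fnl p).
Hypothesis ev : evol w om (fun t => f (w t) - (2 * al) *: om t).

Let Hw := evol_H1 ev.
Let Lom := evol_L2 ev.
Let Lw t : L2 (w t) := H1_L2 (Hw t).
Let Lf t : L2 (f (w t)) := L2_fnl hp (Hw t).
Local Notation N := (total w om).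
Local Notation En := (energy p w om).

(* Duality against [psi = w (t + h) - w t], with [2 h ab <= h^2 a^2 + b^2]. *)
Lemma shift_bound t h : 0 < t -> 0 < h ->
  nm (w (t + h) - w t) ^+ 2 <= h * (En t - En (t + h)) / (2 * al).
Proof.
move=> t0 h0; set psi := w (t + h) - w t.
have Lp : L2 psi by exact: (siB S2).
set X := nm psi ^+ 2.
have tth : t <= t + h by lra.
have := @derive_compare _ (fun r => ip (w r) psi) (fun r => ip (om r) psi)
  (fun r => - (h / (4 * al)) * En r + 1 * (X / (2 * h) * r + 0))
  (fun r => - (h / (4 * al)) * (- 2 * al * ip (om r) (om r)) + 1 * (X / (2 * h))) t (t + h) _ tth.
have hh r : t <= r <= t + h -> [/\ is_derive r 1 (fun r => ip (w r) psi) (ip (om r) psi),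
  is_derive r 1 (fun r => - (h / (4 * al)) * En r + 1 * (X / (2 * h) * r + 0))
   (- (h / (4 * al)) * (- 2 * al * ip (om r) (om r)) + 1 * (X / (2 * h))) &
  ip (om r) psi <= - (h / (4 * al)) * (- 2 * al * ip (om r) (om r)) + 1 * (X / (2 * h))].
  move=> /andP[r1 _]; have r0 : 0 < r by lra.
  split; [exact: (evol_dw ev)|exact: is_derive_lin (energy_derive hp ev r0) (is_derive_aff _ _ _)|].
  apply: le_trans (ler_norm _) _; apply: le_trans (si_CS S2 (Lom r) Lp) _.
  have -> : - (h / (4 * al)) * (- 2 * al * ip (om r) (om r)) = h / 2 * nm (om r) ^+ 2.
    by rewrite (snorm_sqr S2 (Lom r)); field; rewrite gt_eqF.
  rewrite mul1r /X -(ler_pM2l (_ : 0 < 2 * h)) ?mulr_gt0// mulrDr.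
  have -> : 2 * h * (nm psi ^+ 2 / (2 * h)) = nm psi ^+ 2 by field; rewrite gt_eqF.
  have := sqr_ge0 (h * nm (om r) - nm psi).
  rewrite -subr_ge0 => h1; rewrite -subr_ge0; apply: le_trans h1 _.
  by rewrite le_eqVlt; apply/orP; left; apply/eqP; field.
move=> /(_ hh); rewrite -(siBl S2 (Lw _) (Lw _) Lp) -/psi -(snorm_sqr S2 Lp) -/X.
have e1 : - (h / (4 * al)) * En (t + h) + 1 * (X / (2 * h) * (t + h) + 0) -
  (- (h / (4 * al)) * En t + 1 * (X / (2 * h) * t + 0)) =
  h * (En t - En (t + h)) / (2 * al) / 2 + X / 2 by field; rewrite !gt_eqF.
rewrite e1; lra.
Qed.

Section window.
Variables (B tau : R).
Hypothesis B0 : 0 < B.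
Hypothesis tau0 : 0 < tau.

(** The length [3 tau] leaves room for a base time in [[s, s + 2 tau]] and an increment of length at
    most [tau]. *)
Definition calm s e := (forall r, s <= r <= s + 3 * tau -> N r <= B) /\ En s - En (s + 3 * tau) <= e.

Lemma calm_le s e e' : e <= e' -> calm s e -> calm s e'.
Proof. by move=> ee [h1 h2]; split=> //; exact: le_trans ee. Qed.

Lemma calm_drop s e a b : 0 < s -> calm s e -> s <= a -> a <= b -> b <= s + 3 * tau -> En a - En b <= e.
Proof.
move=> s0 [_ h] sa ab bs; have a0 : 0 < a by lra. have b0 : 0 < b by lra.
have := energy_mono al0 hp ev s0 sa; have := energy_mono al0 hp ev b0 bs; lra.
Qed.

Let b := Num.sqrt B.
Let b0 : 0 < b. Proof. by rewrite sqrtr_gt0. Qed.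

Lemma calm_bound s e r : calm s e -> s <= r <= s + 3 * tau -> nm (om r) <= b /\ hn (w r) <= b.
Proof. by move=> [h _] /h; apply: (nm_le_total ev); exact: ltW. Qed.

(** [shift_bound] turns the small energy drop into a small L^2 increment of [w], and [fnl_unif]
    passes this on to the nonlinearity. *)
Lemma calm_shift k : 0 < k -> exists2 e, 0 < e & forall s t h, 0 < s -> calm s e ->
  s <= t <= s + 2 * tau -> 0 <= h <= tau ->
  nm (w (t + h) - w t) <= k /\ nm (f (w (t + h)) - f (w t)) <= k.
Proof.
move=> k0; have [k' k'0 hk'] := fnl_unif hp b0 k0.
pose m := Num.min k k'; have m0 : 0 < m by rewrite lt_min k0.
exists (2 * al * m ^+ 2 / tau); first by rewrite divr_gt0// mulr_gt0 ?exprn_gt0// mulr_gt0.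
move=> s t h s0 hc /andP[st ts] /andP[h0 ht].
have n1 : nm (w (t + h) - w t) <= m.
  have [->|hn0] := eqVneq h 0; first by rewrite addr0 subrr (snorm0 S2) ltW.
  have h1 : 0 < h by rewrite lt_def hn0.
  have t0 : 0 < t by lra.
  have tth : t <= t + h by lra. have ths : t + h <= s + 3 * tau by lra.
  have dr := calm_drop s0 hc st tth ths.
  have dr0 : 0 <= En t - En (t + h) by rewrite subr_ge0; exact: (energy_mono al0 hp ev t0 tth).
  rewrite -ler_sqr ?nnegrE ?snorm_ge0 ?(ltW m0)//; apply: le_trans (shift_bound t0 h1) _.
  rewrite ler_pdivrMr ?mulr_gt0//; apply: le_trans (ler_pM h0 dr0 ht dr) _.
  by rewrite le_eqVlt; apply/orP; left; apply/eqP; field; rewrite gt_eqF.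
have i1 : s <= t <= s + 3 * tau by lra.
have i2 : s <= t + h <= s + 3 * tau by lra.
have [_ b1] := calm_bound hc i1; have [_ b2] := calm_bound hc i2.
move: n1; rewrite le_min => /andP[n1 n2]; split => //.
by apply: hk'.
Qed.

Let V r := ip (om r) (om r).

(* [lra] is slow on the large contexts below. *)
Local Ltac scalar_lra := clear -S2 SH al0 hp ev Hw Lom Lw Lf B0 tau0 b0 V; lra.

Lemma kinetic_shift t h : ip (om (t + h) - om t) (om (t + h) - om t) <= 2 * V (t + h) + 2 * V t.
Proof.
have := si_parallelogram S2 (Lom (t + h)) (Lom t).
have Ld := siB S2 (Lom (t + h)) (Lom t).
rewrite -(snorm_sqr S2 Ld) /V -!(snorm_sqr S2 (Lom _)) => <-.
by rewrite lerDr sqr_ge0.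
Qed.

(* The energy of the increment [z = w(.+h) - w] hardly varies on the window, and the virial identity
   shows that its mean is small. *)
Lemma calm_energy k : 0 < k -> exists2 e, 0 < e & forall s t h, 0 < s -> calm s e ->
  s <= t <= s + 2 * tau -> 0 <= h <= tau ->
  nm (om (t + h) - om t) <= k /\ hn (w (t + h) - w t) <= k.
Proof.
move=> k0.
(* [c1] and [c2] collect the coefficients of the final bound [m <= de * c1 + e * c2] on the energy
   [m] of the increment; [de] and [e] make each term at most [k^2 / 4]. *)
pose c1 := 4 * b * tau + b / tau + (1 + 4 * al * b) / 2.
pose c2 := 4 + 1 / (al * tau).
have bt : 0 < b * tau by exact: mulr_gt0. have bt' : 0 < b / tau by exact: divr_gt0.
have alb : 0 < al * b by exact: mulr_gt0.
have alt : 0 < 1 / (al * tau) by rewrite divr_gt0// mulr_gt0.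
have c10 : 0 < c1 by rewrite /c1; lra.
have c20 : 0 < c2 by rewrite /c2; lra.
have kk : 0 < k ^+ 2 by rewrite exprn_gt0.
pose de := Num.min 1 (k ^+ 2 / (4 * c1)).
have de0 : 0 < de by rewrite lt_min ltr01 divr_gt0 ?mulr_gt0.
have de1 : de <= 1 by rewrite ge_min lexx.
have dek : de * (4 * c1) <= k ^+ 2 by rewrite -ler_pdivlMr ?mulr_gt0// ge_min lexx orbT.
have [e1 e10 he1] := calm_shift de0.
pose e := Num.min e1 (k ^+ 2 / (4 * c2)).
have e0 : 0 < e by rewrite lt_min e10 divr_gt0 ?mulr_gt0.
have ee1 : e <= e1 by rewrite ge_min lexx.
have ek : e * (4 * c2) <= k ^+ 2 by rewrite -ler_pdivlMr ?mulr_gt0// ge_min lexx orbT.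
exists e => // s t h s0 hc /andP[st ts] hh; have /andP[h0 ht] := hh.
have hc1 := calm_le ee1 hc.
pose z r := w (r + h) - w r; pose ze r := om (r + h) - om r.
pose G r := f (w (r + h)) - (2 * al) *: om (r + h) - (f (w r) - (2 * al) *: om r).
have evz : evol z ze G by exact: evol_shiftB.
have Hz r : H1 (z r) := evol_H1 evz r. have Lze r : L2 (ze r) := evol_L2 evz r.
have Lz r : L2 (z r) := H1_L2 (Hz r).
have Lff r : L2 (f (w (r + h)) - f (w r)) := siB S2 (Lf _) (Lf _).
have GE r : G r = (f (w (r + h)) - f (w r)) - (2 * al) *: ze r.
  rewrite /G /ze scalerBr !opprB !addrA [LHS]addrAC [RHS]addrAC; congr (_ + _).
  by rewrite addrAC.
have GP r psi : L2 psi -> ip (G r) psi = ip (f (w (r + h)) - f (w r)) psi - 2 * al * ip (ze r) psi.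
  by move=> Lp; rewrite GE (siBl S2 (Lff r) (siZ S2 _ (Lze r)) Lp) (siZl S2 _ (Lze r) Lp).
have facts r : s <= r <= s + 2 * tau ->
    [/\ 0 < r, nm (z r) <= de, nm (f (w (r + h)) - f (w r)) <= de & nm (ze r) <= 2 * b].
  move=> hr; have /andP[r1 r2] := hr.
  have [a1 a2] := he1 s r h s0 hc1 hr hh; split => //; first by lra.
  have i1 : s <= r <= s + 3 * tau by lra.
  have i2 : s <= r + h <= s + 3 * tau by lra.
  have [a3 _] := calm_bound hc i1; have [a4 _] := calm_bound hc i2.
  apply: le_trans (snormB S2 (Lom (r + h)) (Lom r)) _; lra.
pose eh r := (ip (ze r) (ze r) + aform (z r) (z r)) / 2.
have V0 r : 0 <= V r by exact: (si_ge0 S2).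
have zze r : 0 <= ip (ze r) (ze r) by exact: (si_ge0 S2).
have zf r : s <= r <= s + 2 * tau -> `|ip (f (w (r + h)) - f (w r)) (ze r)| <= de * (2 * b).
  move=> /facts[_ _ a2 a3]; apply: le_trans (si_CS S2 (Lff r) (Lze r)) _.
  by apply: ler_pM => //; exact: snorm_ge0.
have alV r : 2 * al * ip (ze r) (ze r) <= 4 * al * (V (r + h) + V r).
  have := ler_wpM2l (ltW al0) (kinetic_shift r h); rewrite -/(ze r); lra.
have dEh r : 0 < r -> is_derive r 1 (fun r => En (r + h)) (- 2 * al * V (r + h)).
  by move=> r0; apply: is_derive_shift; apply: (energy_derive hp ev); lra.
have dEn r : 0 < r -> is_derive r 1 (fun r => En (r + h) + En r) (- 2 * al * (V (r + h) + V r)).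
  move=> r0; have h1 := is_derive_lin 1 1 (dEh r r0) (energy_derive hp ev r0).
  by apply: (is_derive_to h1) => [x|]; rewrite /V; ring.
have drop r1 r2 : s <= r1 -> r1 <= r2 -> r2 <= s + 2 * tau ->
    0 <= (En (r1 + h) + En r1) - (En (r2 + h) + En r2) <= 2 * e.
  move=> r1s r12 r2s; have r10 : 0 < r1 by lra. have r1h0 : 0 < r1 + h by lra.
  have r12h : r1 + h <= r2 + h by lra.
  have m1 := energy_mono al0 hp ev r10 r12; have m2 := energy_mono al0 hp ev r1h0 r12h.
  have sr1 : s <= r1 + h by lra. have r2h : r2 + h <= s + 3 * tau by lra. have r23 : r2 <= s + 3 * tau by lra.
  by have := calm_drop s0 hc r1s r12 r23; have := calm_drop s0 hc sr1 r12h r2h; lra.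
(* Oscillation of the increment's energy on the window: the difference of the nonlinear terms
   contributes at most [2 b de] per unit time, and the damping is bounded by the drops of the
   original energy at [r] and at [r + h]. *)
pose osc := 4 * b * de * tau + 4 * e.
have hosc r1 r2 : s <= r1 -> r1 <= r2 -> r2 <= s + 2 * tau -> `|eh r2 - eh r1| <= osc.
  move=> r1s r12 r2s.
  have dG c r : 0 < r -> is_derive r 1 (fun r => 1 * (c * (2 * b * de) * r + 0) + (- 2 * c) * (En (r + h) + En r))
     (1 * (c * (2 * b * de)) + (- 2 * c) * (- 2 * al * (V (r + h) + V r))).
    move=> r0; have h1 := is_derive_lin 1 (- 2 * c) (is_derive_aff r (c * (2 * b * de)) 0) (dEn r r0).
    by apply: (is_derive_to h1) => [x|]; ring.
  have inr r : r1 <= r <= r2 -> s <= r <= s + 2 * tau.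
    by move=> /andP[x1 x2]; rewrite (le_trans r1s x1) (le_trans x2 r2s).
  have bd r : r1 <= r <= r2 -> `|ip (G r) (ze r)| <= 2 * b * de + 4 * al * (V (r + h) + V r).
    move=> /inr /zf; rewrite GP// => x1; have x2 := alV r.
    have x3 := mulr_ge0 (ltW al0) (zze r).
    move: x1; rewrite !ler_norml => /andP[x1 x1'].
    by apply/andP; split; move: x1 x1' x2 x3; scalar_lra.
  have up := @derive_compare _ eh (fun r => ip (G r) (ze r))
    (fun r => 1 * (1 * (2 * b * de) * r + 0) + (- 2 * 1) * (En (r + h) + En r))
    (fun r => 1 * (1 * (2 * b * de)) + (- 2 * 1) * (- 2 * al * (V (r + h) + V r))) r1 r2 _ r12.
  have lo := @derive_compare _
    (fun r => 1 * ((-1) * (2 * b * de) * r + 0) + (- 2 * -1) * (En (r + h) + En r))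
    (fun r => 1 * ((-1) * (2 * b * de)) + (- 2 * -1) * (- 2 * al * (V (r + h) + V r)))
    eh (fun r => ip (G r) (ze r)) r1 r2 _ r12.
  have hup : eh r2 - eh r1 <= 2 * b * de * (r2 - r1) + 2 * ((En (r1 + h) + En r1) - (En (r2 + h) + En r2)).
    apply: le_trans (up _) _ => [r hr|]; last by scalar_lra.
    have /inr /facts[r0 _ _ _] := hr; split; [exact: (evol_energy evz)|exact: dG|].
    by have := bd r hr; rewrite ler_norml => /andP[_]; scalar_lra.
  have hlo : - (2 * b * de * (r2 - r1) + 2 * ((En (r1 + h) + En r1) - (En (r2 + h) + En r2))) <= eh r2 - eh r1.
    apply: le_trans _ (lo _) => [|r hr]; first by scalar_lra.
    have /inr /facts[r0 _ _ _] := hr; split; [exact: dG|exact: (evol_energy evz)|].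
    by have := bd r hr; rewrite ler_norml => /andP[+ _]; scalar_lra.
  have /andP[_ dd] := drop r1 r2 r1s r12 r2s.
  have bde : 0 <= 2 * b * de by rewrite !mulr_ge0// ltW.
  have r21 : r2 - r1 <= 2 * tau by move: r1s r2s; scalar_lra.
  have bdr := ler_wpM2l bde r21.
  by rewrite ler_norml /osc; move: hup hlo dd bdr; scalar_lra.
pose m := eh t.
have hm r : s <= r <= s + 2 * tau -> m - osc <= eh r.
  move=> /andP[sr rs]; have [tr|rt] := leP t r.
    by have := hosc t r st tr rs; rewrite ler_norml /m => /andP[+ _]; scalar_lra.
  by have := hosc r t sr (ltW rt) ts; rewrite ler_norml /m => /andP[_]; scalar_lra.
have ss : s <= s + 2 * tau by lra.
(* In the virial identity [|ze|^2 - |z|^2] is [2 |ze|^2] minus twice the energy, which is at least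
   [m - osc]. The kinetic term is again paid for by the energy drop, and the boundary values are at
   most [2 b de]. *)
pose Q := de * (de + 4 * al * b) - 2 * (m - osc).
have vir := @derive_compare _ (fun r => ip (z r) (ze r))
  (fun r => ip (ze r) (ze r) - aform (z r) (z r) + ip (G r) (z r))
  (fun r => 1 * (Q * r + 0) + (- 2 / al) * (En (r + h) + En r))
  (fun r => 1 * Q + (- 2 / al) * (- 2 * al * (V (r + h) + V r))) s (s + 2 * tau) _ ss.
have Fb r : s <= r <= s + 2 * tau -> `|ip (z r) (ze r)| <= de * (2 * b).
  move=> /facts[_ a1 _ a3]; apply: le_trans (si_CS S2 (Lz r) (Lze r)) _.
  by apply: ler_pM => //; exact: snorm_ge0.
have i1 : s <= s <= s + 2 * tau by lra. have i2 : s <= s + 2 * tau <= s + 2 * tau by lra.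
have hv : ip (z (s + 2 * tau)) (ze (s + 2 * tau)) - ip (z s) (ze s) <=
    2 * tau * Q + 2 / al * (2 * e).
  apply: le_trans (vir _) _ => [r hr|]; last first.
    have /andP[_ dd] := drop s (s + 2 * tau) (lexx _) ss (lexx _).
    have al2 : 0 <= 2 / al by rewrite divr_ge0// ltW.
    by have := ler_wpM2l al2 dd; rewrite !mulNr; scalar_lra.
  have [r0 a1 a2 a3] := facts r hr; split.
  - exact: (evol_virial evz).
  - exact: is_derive_lin (is_derive_aff _ _ _) (dEn r r0).
  have -> : -2 / al * (-2 * al * (V (r + h) + V r)) = 4 * (V (r + h) + V r) by field; rewrite gt_eqF.
  have ks := kinetic_shift r h; rewrite -/(ze r) in ks.
  have := hm r hr; rewrite /eh => em.
  have gz : ip (G r) (z r) <= de * (de + 4 * al * b).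
    rewrite GP//; have := Fb r hr; rewrite (siC S2 (Lz r) (Lze r)) ler_norml => /andP[x1 _].
    have x2 := ler_wpM2l (ltW al0) x1.
    have x3 : ip (f (w (r + h)) - f (w r)) (z r) <= de * de.
      apply: le_trans (ler_norm _) _; apply: le_trans (si_CS S2 (Lff r) (Lz r)) _.
      by apply: ler_pM => //; exact: snorm_ge0.
    by move: x2 x3; scalar_lra.
  by rewrite /Q; move: gz em ks; scalar_lra.
have hmm : m <= de * c1 + e * c2.
  have := Fb _ i1; have := Fb _ i2; rewrite !ler_norml => /andP[x1 _] /andP[_ x2].
  have x3 : 4 * tau * m <= 4 * tau * osc + 4 * b * de + 4 * e / al + 2 * tau * (de * (de + 4 * al * b)).
    by move: hv x1 x2; rewrite /Q; scalar_lra.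
  have dd : de * de <= de by rewrite -[leRHS]mulr1 ler_wpM2l// ltW.
  have x4 : 2 * tau * (de * de) <= 2 * tau * de by rewrite ler_wpM2l// mulr_ge0// ltW.
  rewrite -(ler_pM2l (_ : 0 < 4 * tau)) ?mulr_gt0//.
  have -> : 4 * tau * (de * c1 + e * c2) = 4 * tau * osc + 4 * b * de + 4 * e / al + 2 * tau * de + 2 * tau * (de * (4 * al * b)).
    by rewrite /c1 /c2 /osc; field; rewrite !gt_eqF.
  have x5 : 2 * tau * (de * (de + 4 * al * b)) = 2 * tau * (de * de) + 2 * tau * (de * (4 * al * b)) by ring.
  by rewrite x5 in x3; move: x3 x4; scalar_lra.
have m2 : 2 * m <= k ^+ 2 by move: hmm dek ek; scalar_lra.
have z1 : 0 <= aform (z t) (z t) by exact: (si_ge0 SH).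
have z2 := zze t.
by split; rewrite -ler_sqr ?nnegrE ?snorm_ge0 ?(ltW k0)// ?(snorm_sqr S2 (Lze t)) ?(snorm_sqr SH (Hz t));
  move: m2 z1 z2; rewrite /m /eh; scalar_lra.
Qed.

(** If [nm (om t) > k], small increments keep the velocity above [k/2] during a time [tau], and the
    dissipation would exceed the energy drop allowed on the window. *)
Lemma calm_velocity k : 0 < k -> exists2 e, 0 < e & forall s t, 0 < s -> calm s e ->
  s <= t <= s + 2 * tau -> nm (om t) <= k.
Proof.
move=> k0; have k2 : 0 < k / 2 by rewrite divr_gt0.
have [e1 e10 he1] := calm_energy k2.
pose e := Num.min e1 (al * (k / 2) ^+ 2 * tau).
have kk : 0 < al * (k / 2) ^+ 2 * tau by rewrite !mulr_gt0 ?exprn_gt0.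
exists e; first by rewrite lt_min e10.
move=> s t s0 hc /andP[st ts].
have ee1 : e <= e1 by rewrite ge_min lexx. have ek : e <= al * (k / 2) ^+ 2 * tau by rewrite ge_min lexx orbT.
rewrite leNgt; apply/negP => kt.
have ttau : t <= t + tau by lra.
have := @derive_compare _ (fun r => 2 * al * (k / 2) ^+ 2 * r + 0) (fun=> 2 * al * (k / 2) ^+ 2)
  (fun r => (-1) * En r + 0 * En r) (fun r => (-1) * (- 2 * al * V r) + 0 * (- 2 * al * V r)) t (t + tau) _ ttau.
have hh r : t <= r <= t + tau -> [/\ is_derive r 1 (fun r => 2 * al * (k / 2) ^+ 2 * r + 0) (2 * al * (k / 2) ^+ 2),
   is_derive r 1 (fun r => (-1) * En r + 0 * En r) ((-1) * (- 2 * al * V r) + 0 * (- 2 * al * V r)) &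
   2 * al * (k / 2) ^+ 2 <= (-1) * (- 2 * al * V r) + 0 * (- 2 * al * V r)].
  move=> /andP[r1 r2]; have r0 : 0 < r by lra.
  split; [exact: is_derive_aff|exact: is_derive_lin (energy_derive hp ev r0) (energy_derive hp ev r0)|].
  have i1 : s <= t <= s + 2 * tau by lra. have i2 : 0 <= r - t <= tau by lra.
  have [n1 _] := he1 s t (r - t) s0 (calm_le ee1 hc) i1 i2.
  have x1 := ler_snorm_dist S2 (Lom (t + (r - t))) (Lom t).
  have er : t + (r - t) = r by ring.
  rewrite er in n1 x1.
  have x2 : k / 2 <= nm (om r) by move: x1; rewrite ler_norml => /andP[+ _]; lra.
  have x3 : (k / 2) ^+ 2 <= V r.
    by rewrite /V -(snorm_sqr S2 (Lom r)) ler_sqr ?nnegrE ?snorm_ge0 ?(ltW k2).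
  have := ler_wpM2l (ltW al0) x3; lra.
move=> /(_ hh).
have ts' : t + tau <= s + 3 * tau by lra.
have := calm_drop s0 hc st ttau ts'; lra.
Qed.

(** Integrate the equation, paired with [psi], over [[t, t + tau]]: the velocity is small at both
    ends, and the right-hand side stays close to its undamped value [c0'] at [t], which must
    therefore be small. *)
Lemma calm_palais_smale k : 0 < k -> exists2 e, 0 < e & forall s t psi, 0 < s -> calm s e ->
  s <= t <= s + tau -> H1 psi -> `|aform (w t) psi - ip (f (w t)) psi| <= k * hn psi.
Proof.
(* The 2 stands for the velocities at the two ends, the other term for the oscillation of the
   right-hand side over the length [tau]. *)
move=> k0; pose c := 2 + (2 + 2 * al) * tau.
have c0 : 0 < c by rewrite /c addr_gt0// mulr_gt0// addr_gt0// mulr_gt0.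
pose q := k * tau / c.
have q0 : 0 < q by rewrite divr_gt0// mulr_gt0.
have [e1 e10 he1] := calm_shift q0; have [e2 e20 he2] := calm_energy q0.
have [e3 e30 he3] := calm_velocity q0.
exists (Num.min e1 (Num.min e2 e3)); first by rewrite !lt_min e10 e20.
move=> s t psi s0 hc /andP[st ts] Hp.
have hc1 : calm s e1 by apply: calm_le hc; rewrite ge_min lexx.
have hc2 : calm s e2 by apply: calm_le hc; rewrite !ge_min lexx orbT.
have hc3 : calm s e3 by apply: calm_le hc; rewrite !ge_min lexx !orbT.
have Lp := H1_L2 Hp; have n0 := snorm_ge0 (@aform R d) psi; have nh := nm_le_hn Hp.
pose c0' := ip (f (w t)) psi - aform (w t) psi.
pose D r := ip (f (w r) - (2 * al) *: om r) psi - aform (w r) psi.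
pose K := (2 + 2 * al) * q * hn psi.
have hD r : t <= r <= t + tau -> `|D r - c0'| <= K.
  move=> /andP[r1 r2].
  have i1 : s <= t <= s + 2 * tau by lra. have i2 : 0 <= r - t <= tau by lra.
  have i3 : s <= r <= s + 2 * tau by lra.
  have [_ a1] := he1 s t (r - t) s0 hc1 i1 i2; have [_ a2] := he2 s t (r - t) s0 hc2 i1 i2.
  have a3 := he3 s r s0 hc3 i3.
  have er : t + (r - t) = r by ring.
  rewrite er in a1 a2.
  have -> : D r - c0' = ip (f (w r) - f (w t)) psi - 2 * al * ip (om r) psi - aform (w r - w t) psi.
    rewrite /D /c0' (siBl S2 (Lf r) (siZ S2 _ (Lom r)) Lp) (siZl S2 _ (Lom r) Lp).
    rewrite (siBl S2 (Lf r) (Lf t) Lp) (siBl SH (Hw r) (Hw t) Hp); ring.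
  have b1 : `|ip (f (w r) - f (w t)) psi| <= q * hn psi.
    by apply: le_trans (si_CS S2 (siB S2 (Lf r) (Lf t)) Lp) _; apply: ler_pM => //; exact: snorm_ge0.
  have b2 : `|ip (om r) psi| <= q * hn psi.
    by apply: le_trans (si_CS S2 (Lom r) Lp) _; apply: ler_pM => //; exact: snorm_ge0.
  have b3 : `|aform (w r - w t) psi| <= q * hn psi.
    by apply: le_trans (si_CS SH (siB SH (Hw r) (Hw t)) Hp) _; apply: ler_pM => //; exact: snorm_ge0.
  move: b1 b2 b3; rewrite !ler_norml /K => /andP[b1 b1'] /andP[b2 b2'] /andP[b3 b3'].
  have x1 := ler_wpM2l (ltW al0) b2; have x2 := ler_wpM2l (ltW al0) b2'.
  apply/andP; split; lra.
have ttau : t <= t + tau by lra.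
have dX r : t <= r <= t + tau -> is_derive r 1 (fun r => ip (om r) psi) (D r).
  by move=> /andP[r1 _]; apply: (evol_dom ev) => //; lra.
have up := @derive_compare _ (fun r => ip (om r) psi) D (fun r => (c0' + K) * r + 0) (fun=> c0' + K) t (t + tau) _ ttau.
have lo := @derive_compare _ (fun r => (c0' - K) * r + 0) (fun=> c0' - K) (fun r => ip (om r) psi) D t (t + tau) _ ttau.
have {}up : ip (om (t + tau)) psi - ip (om t) psi <= tau * (c0' + K).
  apply: le_trans (up _) _ => [r hr|]; last by lra.
  split; [exact: dX|exact: is_derive_aff|].
  by have := hD r hr; rewrite ler_norml => /andP[_]; lra.
have {}lo : tau * (c0' - K) <= ip (om (t + tau)) psi - ip (om t) psi.
  apply: le_trans _ (lo _) => [|r hr]; first by lra.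
  split; [exact: is_derive_aff|exact: dX|].
  by have := hD r hr; rewrite ler_norml => /andP[+ _]; lra.
have ob r : s <= r <= s + 2 * tau -> `|ip (om r) psi| <= q * hn psi.
  move=> hr; apply: le_trans (si_CS S2 (Lom r) Lp) _; apply: ler_pM => //; try exact: snorm_ge0.
  exact: (he3 s).
have i1 : s <= t <= s + 2 * tau by lra. have i2 : s <= t + tau <= s + 2 * tau by lra.
have := ob _ i1; have := ob _ i2; rewrite !ler_norml => /andP[x1 x2] /andP[x3 x4].
have e : tau * (k * hn psi) = 2 * q * hn psi + tau * K.
  by rewrite /K /q /c; field; rewrite gt_eqF.
rewrite -[aform _ _ - _]opprB -/c0'.
have l1 : tau * c0' <= tau * (k * hn psi) by rewrite e; lra.
have l2 : tau * - c0' <= tau * (k * hn psi) by rewrite e; lra.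
rewrite !ler_pM2l// in l1 l2; apply/andP; split; lra.
Qed.

End window.

(* Once the energy drops slowly enough, a calm window ends at a total energy bounded by the fixed level
   dictated by the Palais-Smale property, so calm windows repeat forever. *)
Lemma total_eventually_bounded : exists B T, [/\ 0 < B, 0 < T & forall t, T <= t -> N t <= B].
Proof.
have hq : 1 < p by case: hp.
have [A0 A00 hA0] := total_recurrent al0 hp ev.
(* [A0] admits the starting time; the rest is the level reached at the end of a calm window, 1 for
   the kinetic part and the last term for the H^1 part. *)
pose A1 := A0 + 1 + 2 * (p + 1) / (p - 1) * (`|En 1| + 1).
have p10 : 0 < p - 1 by lra. have p11 : 0 < p + 1 by lra.
have pq : 0 < 2 * (p + 1) / (p - 1) by rewrite !divr_gt0// mulr_gt0.
have en1 := normr_ge0 (En 1).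
have pe : 0 < 2 * (p + 1) / (p - 1) * (`|En 1| + 1) by rewrite mulr_gt0// ltr_wpDl.
have A10 : 0 < A1 by rewrite /A1; lra.
have [tau [B [tau0 B0 hW]]] := total_window al0 hp ev A10.
have sB : 0 < Num.sqrt B by rewrite sqrtr_gt0.
(* [B] is known on the window only and may be large; this [k] makes the Palais-Smale error against
   [w] itself at most 1, so that the resulting bound does not involve [B]. *)
pose k := Num.min 1 (Num.sqrt B)^-1.
have k0 : 0 < k by rewrite lt_min ltr01 invr_gt0.
have k1 : k <= 1 by rewrite ge_min lexx.
have kB : k * Num.sqrt B <= 1 by rewrite -ler_pdivlMr// mul1r ge_min lexx orbT.
have [e1 e10 he1] := calm_velocity B0 tau0 k0; have [e2 e20 he2] := calm_palais_smale B0 tau0 k0.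
have e0 : 0 < Num.min e1 e2 by rewrite lt_min e10.
have [T T0 hT] := energy_cauchy al0 hp ev e0.
have [s0 [Ts s00 hs0]] := hA0 (Num.max T 1).
move: Ts; rewrite ge_max => /andP[Ts s01].
have step s : s0 <= s -> N s <= A1 -> N (s + tau) <= A1.
  move=> ss Ns; have sp : 0 < s by lra.
  have hc : calm B tau s (Num.min e1 e2).
    split; first exact: hW. apply: hT; lra.
  have hc1 : calm B tau s e1 by apply: calm_le hc; rewrite ge_min lexx.
  have hc2 : calm B tau s e2 by apply: calm_le hc; rewrite ge_min lexx orbT.
  have i1 : s <= s + tau <= s + 2 * tau by lra. have i2 : s <= s + tau <= s + tau by lra.
  have i3 : s <= s + tau <= s + 3 * tau by lra.
  have n1 := he1 s _ sp hc1 i1; have n2 := he2 s _ (w (s + tau)) sp hc2 i2 (Hw _).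
  have [_ n3] := calm_bound B0 hc i3.
  have n4 : k * hn (w (s + tau)) <= 1 by apply: le_trans kB; rewrite ler_wpM2l// ltW.
  have v1 : ip (om (s + tau)) (om (s + tau)) <= 1.
    rewrite -(snorm_sqr S2 (Lom _)); apply: exprn_ile1; first exact: snorm_ge0.
    exact: le_trans n1 k1.
  have v0 : 0 <= ip (om (s + tau)) (om (s + tau)) by exact: (si_ge0 S2).
  have em : En (s + tau) <= `|En 1|.
    by apply: le_trans (ler_norm _); apply: (energy_mono al0 hp ev) => //; lra.
  move: n2; rewrite ler_norml => /andP[n2 _].
  (* The almost critical equation tested with [w] replaces the potential in the energy by the H^1
     form, and [(p + 1)/2 - 1 = (p - 1)/2] remains. *)
  have a1 : (p - 1) / 2 * aform (w (s + tau)) (w (s + tau)) <= (p + 1) * (`|En 1| + 1).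
    have y1 : (p + 1) * En (s + tau) <= (p + 1) * `|En 1| by rewrite ler_pM2l.
    have y2 : (p + 1) * En (s + tau) = (p + 1) / 2 * (ip (om (s + tau)) (om (s + tau)) + aform (w (s + tau)) (w (s + tau)))
       - ip (f (w (s + tau))) (w (s + tau)) by rewrite /energy /total; field; rewrite gt_eqF.
    rewrite y2 in y1; have y3 := mulr_ge0 (ltW p11) v0; lra.
  have a2 : aform (w (s + tau)) (w (s + tau)) <= 2 * (p + 1) / (p - 1) * (`|En 1| + 1).
    have -> : 2 * (p + 1) / (p - 1) * (`|En 1| + 1) = ((p + 1) * (`|En 1| + 1)) / ((p - 1) / 2).
      by field; rewrite gt_eqF.
    by rewrite ler_pdivlMr ?divr_gt0// mulrC.
  rewrite /total /A1; lra.
have hn n : s0 <= s0 + n%:R * tau /\ N (s0 + n%:R * tau) <= A1.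
  elim: n => [|n [ih1 ih2]].
    by rewrite mul0r addr0; split => //; apply: (le_trans hs0); rewrite /A1; lra.
  have -> : s0 + n.+1%:R * tau = s0 + n%:R * tau + tau by rewrite -natr1; ring.
  by split; [lra|exact: step].
exists B, s0; split => // t s0t.
have q0 : 0 <= (t - s0) / tau by rewrite divr_ge0 ?(ltW tau0)// subr_ge0.
have /andP[f1 f2] := truncn_itv q0.
set n := Num.truncn _ in f1 f2.
have [h1 h2] := hn n.
have g1 : n%:R * tau <= t - s0 by rewrite -ler_pdivlMr.
have g2 : t - s0 < (n%:R + 1) * tau by rewrite natr1 -ltr_pdivrMr.
apply: (hW (s0 + n%:R * tau)) => //; lra.
Qed.

(** Once the trajectory is bounded, every sufficiently late time starts a calm window, here with
    [tau = 1]. *)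
Lemma palais_smale : exists B T0, [/\ 0 < B, 0 < T0, forall t, T0 <= t -> hn (w t) <= B &
  forall k, 0 < k -> exists T, forall t, T <= t -> nm (om t) <= k /\
    forall psi, H1 psi -> `|aform (w t) psi - ip (f (w t)) psi| <= k * hn psi].
Proof.
have [B [T0 [B0 T00 hB]]] := total_eventually_bounded.
exists (Num.sqrt B), T0; split => //; first by rewrite sqrtr_gt0.
  by move=> t /hB; case/(nm_le_total ev (ltW B0)).
move=> k k0; have [e1 e10 he1] := calm_velocity B0 ltr01 k0; have [e2 e20 he2] := calm_palais_smale B0 ltr01 k0.
have e0 : 0 < Num.min e1 e2 by rewrite lt_min e10.
have [T Tp hT] := energy_cauchy al0 hp ev e0.
exists (Num.max T T0) => t; rewrite ge_max => /andP[Tt T0t].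
have tp : 0 < t by lra.
have hc : calm B 1 t (Num.min e1 e2).
  split; first by move=> r /andP[tr _]; apply: hB; lra.
  by apply: hT => //; lra.
have i1 : t <= t <= t + 2 * 1 by lra. have i2 : t <= t <= t + 1 by lra.
split.
  by apply: (he1 t) => //; apply: calm_le hc; rewrite ge_min lexx.
move=> psi Hp; apply: (he2 t) => //; apply: calm_le hc; rewrite ge_min lexx orbT//.
Qed.

End compactness_in_time.

(** * Profile decomposition *)

Section weak_limits.
Context {R : realType} {d : nat}.
Local Notation E := 'rV[R]_d.
Local Notation nm := (snorm (@ip R d)).
Local Notation hn := (snorm (@aform R d)).
Local Notation test := (test_function (@setT E)).
Let S2 := @L2_semi R d.
Let SH := @H1_semi R d.
Variable U : set_system nat.
Context {FU : Filter U}.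
Implicit Types (g : nat -> E -> R) (G phi psi : E -> R) (y : nat -> E).

Definition wk g G := forall phi, L2 phi -> ip (g n) phi @[n --> U] --> ip G phi.

Lemma cvg_sum_filter (F : nat -> nat -> R) (l : nat -> R) J :
  (forall j, (j < J)%N -> F j n @[n --> U] --> l j) ->
  (\sum_(j < J) F j n) @[n --> U] --> \sum_(j < J) l j.
Proof.
elim: J => [|J ih] h.
  by rewrite big_ord0; under eq_fun do rewrite big_ord0; exact: cvg_cst.
rewrite big_ord_recr /=; under eq_fun do rewrite big_ord_recr /=.
by apply: cvgD; [apply: ih => j jJ; apply: h; exact: ltnW|exact: h].
Qed.

Lemma wkB g g' G G' : (forall n, L2 (g n)) -> (forall n, L2 (g' n)) -> L2 G -> L2 G' ->
  wk g G -> wk g' G' -> wk (fun n => g n - g' n) (G - G').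
Proof.
move=> Lg Lg' LG LG' h h' phi Lp; rewrite (siBl S2)//.
under eq_fun do rewrite (siBl S2)//.
by apply: cvgB; [exact: h|exact: h'].
Qed.

Lemma wk_sum (g : nat -> nat -> E -> R) (G : nat -> E -> R) J :
  (forall j n, (j < J)%N -> L2 (g j n)) -> (forall j, (j < J)%N -> L2 (G j)) ->
  (forall j, (j < J)%N -> wk (g j) (G j)) ->
  wk (fun n => \sum_(j < J) g j n) (\sum_(j < J) G j).
Proof.
move=> Lg LG h phi Lp; rewrite (si_suml S2)//; last by move=> i _; exact: LG.
rewrite (_ : (fun n => _) = (fun n => \sum_(j < J) ip (g j n) phi)).
  by apply: (@cvg_sum_filter (fun j n => ip (g j n) phi) (fun j => ip (G j) phi)) => j jJ; exact: h.
by apply/funext => n; rewrite (si_suml S2)// => i _; exact: Lg.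
Qed.

(** Weak L^2 convergence with an H^1 bound is weak H^1 convergence: against a test function [phi]
    the form is the L^2 pairing with [phi - laplacian phi], and the bound allows density. *)
Lemma wk_aform g G (C : R) psi : (forall n, H1 (g n)) -> (forall n, hn (g n) <= C) -> H1 G -> wk g G ->
  H1 psi -> aform (g n) psi @[n --> U] --> aform G psi.
Proof.
move=> Hg bg HG h Hp; apply/cvgrPdist_le => e e0.
have q0 : 0 < 1 + `|C| + hn G by rewrite ltr_pwDl ?snorm_ge0// ltr_pwDl.
have q' : 0 < e / 2 / (1 + `|C| + hn G) by rewrite !divr_gt0.
have [phi [tp hphi]] := test_dense_H1 Hp q'.
have Hphi := test_H1 tp; have Lphi := test_L2 tp; have [Ll hl] := laplacian_test tp.
have Lk := siB S2 Lphi Ll.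
have e2 : 0 < e / 2 by rewrite divr_gt0.
have /cvgrPdist_le /(_ _ e2) := h _ Lk; apply: filterS => n.
have af f : H1 f -> ip f (phi - laplacian phi) = aform f phi.
  by move=> Hf; rewrite hl// (siBr S2)//; exact: H1_L2.
rewrite !af// => h1; have Hd := siB SH Hp Hphi.
have -> : aform G psi - aform (g n) psi = (aform G phi - aform (g n) phi) + aform (G - g n) (psi - phi).
  rewrite (siBl SH)// !(siBr SH)//; ring.
have h2 : `|aform (G - g n) (psi - phi)| <= (1 + `|C| + hn G) * (e / 2 / (1 + `|C| + hn G)).
  apply: le_trans (si_CS SH (siB SH HG (Hg n)) Hd) _; apply: ler_pM => //; try exact: snorm_ge0.
  apply: le_trans (snormB SH HG (Hg n)) _; have := bg n; have := ler_norm C; lra.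
apply: le_trans (ler_normD _ _) _.
rewrite mulrC divfK ?gt_eqF// in h2; lra.
Qed.

(** After approximation by test functions supported in balls of radii [r1] and [r2] the pairing
    vanishes as soon as [|y n| >= r1 + r2]. *)
Lemma ip_tr_far y (q k : E -> R) : L2 q -> L2 k -> `|y n| @[n --> U] --> +oo ->
  ip (tr (y n) q) k @[n --> U] --> 0.
Proof.
move=> Lq Lk yoo; apply/cvgrPdist_le => e e0.
have q0 : 0 < 1 + nm k by rewrite ltr_pwDl ?snorm_ge0.
have [q1 [t1 h1]] := test_dense Lq (divr_gt0 (divr_gt0 e0 (ltr0n R 2)) q0).
have L1 := test_L2 t1; have q10 : 0 < 1 + nm q1 by rewrite ltr_pwDl ?snorm_ge0.
have [k1 [t2 h2]] := test_dense Lk (divr_gt0 (divr_gt0 e0 (ltr0n R 2)) q10).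
have L2' := test_L2 t2.
have [r1 [M1 [r10 M10 b1]]] := test_bound t1; have [r2 [M2 [r20 M20 b2]]] := test_bound t2.
have /cvgryPge /(_ (r1 + r2)) := yoo; apply: filterS => n hn'.
have z0 : ip (tr (y n) q1) k1 = 0.
  rewrite ipE; transitivity (\int[@lebesgue_rV R d]_x (cst 0 x : R)).
    congr (Rintegral _ _ _); apply/funext => x; apply/eqP.
    rewrite /= mulf_eq0 -!normr_le0 /tr; apply/orP.
    have [xb|xb] := asboolP (ball (0 : E) r2 x); last first.
      by right; apply: le_trans (b2 x) _; rewrite indicE memNset// mulr0.
    left; apply: le_trans (b1 _) _; rewrite indicE memNset ?mulr0//.
    move: xb; rewrite -!ball_normE /= !sub0r !normrN => xb hb.
    have := ler_normB (x + y n) x; rewrite [x + y n]addrC addrK => h; rewrite addrC in hb; lra.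
  by rewrite Rintegral_cst// mul0r.
have Ld := siB S2 Lq L1; have Ldk := siB S2 Lk L2'.
have e1 : ip (tr (y n) q) k = ip (tr (y n) (q - q1)) k + ip (tr (y n) q1) (k - k1).
  rewrite trB (siBl S2 (L2_tr _ Lq) (L2_tr _ L1) Lk) (siBr S2 Lk L2' (L2_tr _ L1)) z0; ring.
rewrite sub0r normrN e1; apply: le_trans (ler_normD _ _) _.
have a1 : `|ip (tr (y n) (q - q1)) k| <= e / 2 / (1 + nm k) * (1 + nm k).
  apply: le_trans (si_CS S2 (L2_tr _ Ld) Lk) _; rewrite nm_tr//.
  by apply: ler_pM => //; rewrite ?snorm_ge0// lerDr.
have a2 : `|ip (tr (y n) q1) (k - k1)| <= (1 + nm q1) * (e / 2 / (1 + nm q1)).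
  apply: le_trans (si_CS S2 (L2_tr _ L1) Ldk) _; rewrite nm_tr//.
  by apply: ler_pM => //; rewrite ?snorm_ge0// lerDr.
rewrite divfK ?gt_eqF// in a1; rewrite mulrC divfK ?gt_eqF// in a2; lra.
Qed.

Lemma wk_far y (q : E -> R) : L2 q -> `|y n| @[n --> U] --> +oo -> wk (fun n => tr (y n) q) 0.
Proof. by move=> Lq yoo phi Lp; rewrite (si0l S2)//; exact: ip_tr_far. Qed.

(** The translation is moved to the test side, where it converges strongly. *)
Lemma wk_shift y (a : E) g G (C : R) : (forall n, L2 (g n)) -> (forall n, nm (g n) <= C) -> L2 G ->
  wk g G -> `|y n - a| @[n --> U] --> 0 -> wk (fun n => tr (y n) (g n)) (tr a G).
Proof.
move=> Lg bg LG h ya phi Lp; rewrite ip_trl//.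
have La := L2_tr (- a) Lp.
under eq_fun do rewrite ip_trl//.
apply/cvgrPdist_le => e e0; have e2 : 0 < e / 2 by rewrite divr_gt0.
have c0 : 0 < 1 + `|C| by rewrite ltr_pwDl.
have [del d0 hd] := nm_tr_cont La (divr_gt0 e2 c0).
have /cvgrPdist_le /(_ _ e2) h1 := h _ La.
move: ya => /cvgrPdist_le /(_ _ d0) ya.
near=> n.
have h2 : `|ip G (tr (- a) phi) - ip (g n) (tr (- a) phi)| <= e / 2 by near: n.
have h3 : `|y n - a| <= del.
  by have : `|0 - `|y n - a| | <= del by [near: n]; rewrite sub0r normrN normr_id.
have Lyn := L2_tr (- y n) Lp.
have h4 : nm (tr (- y n) phi - tr (- a) phi) <= e / 2 / (1 + `|C|).
  have -> : tr (- y n) phi = tr (a - y n) (tr (- a) phi) by rewrite tr_tr addrAC subrr add0r.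
  by apply: hd; rewrite distrC.
have -> : ip G (tr (- a) phi) - ip (g n) (tr (- y n) phi) =
    (ip G (tr (- a) phi) - ip (g n) (tr (- a) phi)) - ip (g n) (tr (- y n) phi - tr (- a) phi).
  rewrite (siBr S2 Lyn La (Lg n)); ring.
apply: le_trans (ler_normB _ _) _.
have h5 : `|ip (g n) (tr (- y n) phi - tr (- a) phi)| <= (1 + `|C|) * (e / 2 / (1 + `|C|)).
  apply: le_trans (si_CS S2 (Lg n) (siB S2 Lyn La)) _; apply: ler_pM => //; try exact: snorm_ge0.
  by have := bg n; have := ler_norm C; lra.
rewrite mulrC divfK ?gt_eqF// in h5; lra.
Unshelve. all: by end_near.
Qed.

End weak_limits.

(** * Weak limits of Palais-Smale sequences *)

Section palais_smale_limits.
Context {R : realType} {d : nat}.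
Local Notation E := 'rV[R]_d.
Local Notation nm := (snorm (@ip R d)).
Local Notation hn := (snorm (@aform R d)).
Local Notation test := (test_function (@setT E)).
Let S2 := @L2_semi R d.
Let SH := @H1_semi R d.
Variable U : set_system nat.
Context {FU : ProperFilter U}.
Variable p : R.
Hypothesis hp : @subcritical R d p.
Local Notation f := (fnl p).
Implicit Types (g : nat -> E -> R) (G phi psi : E -> R).

Lemma ip_abs_fnl (eta : R) : 0 < eta -> exists2 C, 0 < C & forall r z, H1 z -> forall Ib : E -> R, Ib = \1_(ball (0 : E) r) ->
  ip (fun x => `|f z x|) Ib <= eta * (ip Ib Ib + ip (f z) (f z)) + C * nm (fun x => z x * Ib x) ^+ 2.
Proof.
have [hp1 _] := hp; move=> e0; have [C C0 hC] := nl_local hp1 e0; exists C; first exact: C0.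
move=> r z Hz Ib eI.
have Lz := H1_L2 Hz; have Lf := L2_fnl hp Hz; have LI : L2 Ib by rewrite eI; exact: L2_ballindic.
have [La _] := L2_norm Lf.
have LzI : L2 (fun x => z x * Ib x).
  apply: (L2_le _ Lz) => [|x]; first by apply: measurable_funM; exact: L2_meas.
  by rewrite normrM eI indicE; case: (_ \in _); rewrite ?normr1 ?mulr1// normr0 mulr0.
rewrite (snorm_sqr S2 LzI).
have i1 := L2M LI LI; have i2 := L2M Lf Lf; have i3 := L2M LzI LzI; have i0 := L2M La LI.
have i4 := integrD i1 i2; have i5 := integrZ eta i4; have i6 := integrZ C i3.
rewrite !ipE -RintegralD// -!RintegralZl// -RintegralD//; apply: le_Rintegral => //.
  exact: (integrD i5 i6).
move=> x _ /=; rewrite eI indicE; case: (_ \in _); last first.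
  rewrite !(mulr0, add0r, addr0) mulr_ge0 ?(ltW e0)// -expr2 sqr_ge0//.
have -> : (true%:R : R) = 1 by [].
by have := hC (z x); rewrite -nl_norm /fnl; lra.
Qed.

Let le_scale (a e : R) : 0 <= a -> 0 <= e -> a * (e / (1 + a)) <= e.
Proof.
move=> a0 e0; have q : 0 < 1 + a by rewrite ltr_pwDl.
by rewrite mulrA ler_pdivrMr// mulrDr mulr1 mulrC lerDr.
Qed.

(** By [nl_diff] the difference [f (g n) - f G] is bounded by a small multiple of L^2-bounded terms
    plus a multiple of [f (g n - G)]. On a ball around the support of [psi] the latter is small in
    L^1 by [nl_local], because [g n - G] tends to 0 there in L^2 by [rellich]. *)
Lemma fnl_weak g G (C : R) psi : (forall n, H1 (g n)) -> (forall n, hn (g n) <= C) -> H1 G -> wk U g G ->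
  test psi -> ip (f (g n)) psi @[n --> U] --> ip (f G) psi.
Proof.
have hp1 : 1 < p by case: hp.
move=> Hg bg HG h tp; apply/cvgrPdist_le => e e0.
have Lg n := H1_L2 (Hg n); have LG := H1_L2 HG; have Lp := test_L2 tp.
have [r [M [r0 M0 bp]]] := test_bound tp.
set I := (\1_(ball (0 : E) r) : E -> R) in bp; have LI : L2 I := L2_ballindic r.
have Hz n : H1 (g n - G) := siB SH (Hg n) HG.
pose B := `|C| + hn G.
have hG0 := snorm_ge0 (@aform R d) G.
have bz n : hn (g n - G) <= B.
  by apply: le_trans (snormB SH (Hg n) HG) _; have := bg n; have := ler_norm C; rewrite /B; lra.
have bg' n : hn (g n) <= B by have := bg n; have := ler_norm C; rewrite /B; lra.
have bG : hn G <= B by rewrite /B lerDr.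
have [M1 M10 hM] := nm_fnl_bound hp B.
have rel : nm (fun x => (g n - G) x * I x) @[n --> U] --> 0.
  apply: (rellich (B := B)) => // k Lk; under eq_fun do rewrite (siBl S2)//.
  by rewrite -(subrr (ip G k)); apply: cvgB; [exact: h|exact: cvg_cst].
have e3 : 0 < e / 3 by rewrite divr_gt0.
have np := snorm_ge0 (@ip R d) psi.
have a10 : 0 <= 2 * M1 * nm psi by rewrite !mulr_ge0// ltW.
(* Three errors of size [e / 3], fixed in this order: the coefficient in [nl_diff], the one in
   [nl_local], and the tolerance [k] for the local L^2 norm; each depends on the constants produced
   before it. *)
have d0 : 0 < e / 3 / (1 + 2 * M1 * nm psi) by rewrite divr_gt0// ltr_pwDl.
have [C1 C10 hC1] := nl_diff hp1 d0.
have II0 : 0 <= ip I I by exact: (si_ge0 S2).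
have a20 : 0 <= C1 * M * (ip I I + M1 ^+ 2) by rewrite !mulr_ge0 ?addr_ge0 ?sqr_ge0// ltW.
have eta0 : 0 < e / 3 / (1 + C1 * M * (ip I I + M1 ^+ 2)) by rewrite divr_gt0// ltr_pwDl.
have [C2 C20 hC2] := ip_abs_fnl eta0.
have a30 : 0 <= C1 * M * C2 by rewrite !mulr_ge0// ltW.
pose k := Num.min 1 (e / 3 / (1 + C1 * M * C2)).
have k0 : 0 < k by rewrite lt_min ltr01 divr_gt0// ltr_pwDl.
move: rel => /cvgrPdist_le /(_ _ k0); apply: filterS => n.
rewrite sub0r normrN ger0_norm ?snorm_ge0// => nk.
have Lfg := L2_fnl hp (Hg n); have LfG := L2_fnl hp HG; have Lfz := L2_fnl hp (Hz n).
have [Lag nag] := L2_norm Lfg; have [LaG naG] := L2_norm LfG; have [Laz naz] := L2_norm Lfz.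
have [Lap nap] := L2_norm Lp.
pose de := e / 3 / (1 + 2 * M1 * nm psi).
pose W : E -> R := de *: ((fun x => `|f (g n) x|) + (fun x => `|f G x|)) + C1 *: (fun x => `|f (g n - G) x|).
have LgG := siD S2 Lag LaG.
have LW : L2 W by exact: (siD S2 (siZ S2 de LgG) (siZ S2 C1 Laz)).
have WX x : `|f (g n) x - f G x| <= W x.
  by apply: le_trans (hC1 _ _) _; rewrite -!nl_norm.
have key X : L2 X -> (forall x, `|X x| <= W x) -> ip X psi <= ip W (fun x => `|psi x|).
  move=> LX hX; apply: ip_le; [exact: L2M|exact: L2M|move=> x].
  by apply: le_trans (ler_norm _) _; rewrite normrM ler_wpM2r.
have Wle : ip W (fun x => `|psi x|) <= e.
  rewrite (siDl S2 (siZ S2 de LgG) (siZ S2 C1 Laz) Lap) (siZl S2 _ LgG Lap) (siZl S2 _ Laz Lap) (siDl S2 Lag LaG Lap).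
  have t1 : ip (fun x => `|f (g n) x|) (fun x => `|psi x|) <= M1 * nm psi.
    apply: le_trans (ler_norm _) _; apply: le_trans (si_CS S2 Lag Lap) _; rewrite nag nap.
    by rewrite ler_wpM2r// hM.
  have t2 : ip (fun x => `|f G x|) (fun x => `|psi x|) <= M1 * nm psi.
    apply: le_trans (ler_norm _) _; apply: le_trans (si_CS S2 LaG Lap) _; rewrite naG nap.
    by rewrite ler_wpM2r// hM.
  have t3 : ip (fun x => `|f (g n - G) x|) (fun x => `|psi x|) <= M * ip (fun x => `|f (g n - G) x|) I.
    rewrite -(siZr S2 _ LI Laz); apply: ip_le; [exact: L2M|exact: (L2M Laz (siZ S2 M LI))|move=> x].
    by rewrite ler_wpM2l//; exact: bp.
  have t4 := hC2 r _ (Hz n) I erefl.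
  have t5 : ip (f (g n - G)) (f (g n - G)) <= M1 ^+ 2.
    by rewrite -(snorm_sqr S2 Lfz) ler_sqr ?nnegrE ?snorm_ge0 ?(ltW M10)// hM.
  have t6 : nm (fun x => (g n - G) x * I x) ^+ 2 <= e / 3 / (1 + C1 * M * C2).
    have kk : nm (fun x => (g n - G) x * I x) ^+ 2 <= k * 1.
      rewrite expr2; apply: ler_pM => //; try exact: snorm_ge0.
      by apply: le_trans nk _; rewrite ge_min lexx.
    by apply: le_trans kk _; rewrite mulr1 ge_min lexx orbT.
  have u1 : de * (ip (fun x => `|f (g n) x|) (fun x => `|psi x|) + ip (fun x => `|f G x|) (fun x => `|psi x|)) <= e / 3.
    apply: le_trans (le_scale a10 (ltW e3)); rewrite mulrC ler_wpM2r ?(ltW d0)//; lra.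
  have u2 := le_scale a20 (ltW e3); have u3 := le_scale a30 (ltW e3).
  have CM : 0 <= C1 * M by rewrite mulr_ge0// ltW.
  have u4 := ler_wpM2l (ltW C10) t3.
  have u5 := ler_wpM2l CM t4.
  have u6 : e / 3 / (1 + C1 * M * (ip I I + M1 ^+ 2)) * (ip I I + ip (f (g n - G)) (f (g n - G))) <=
     e / 3 / (1 + C1 * M * (ip I I + M1 ^+ 2)) * (ip I I + M1 ^+ 2) by rewrite ler_wpM2l ?(ltW eta0)// lerD2l.
  have u7 := ler_wpM2l (ltW C20) t6.
  have u8 := ler_wpM2l CM (lerD u6 u7).
  rewrite mulrDr in u8; lra.
rewrite -(siBl S2 LfG Lfg Lp) ler_norml; apply/andP; split.
  rewrite -opprB (siNl S2 (siB S2 Lfg LfG) Lp) lerN2.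
  by apply: le_trans Wle; apply: key => //; exact: (siB S2).
apply: le_trans Wle; apply: key => [|x]; first exact: (siB S2).
by rewrite -[X in `|X|]opprB normrN; exact: WX.
Qed.

Definition ps g := forall k, 0 < k -> \forall n \near U, forall psi, H1 psi ->
  `|aform (g n) psi - ip (f (g n)) psi| <= k * hn psi.

Lemma ps_tr g (y : nat -> E) : (forall n, H1 (g n)) -> ps g -> ps (fun n => tr (y n) (g n)).
Proof.
move=> Hg h k k0; apply: filterS (h k k0) => n hn' psi Hp.
have := hn' _ (H1_tr (- y n) Hp).
rewrite hn_tr// -aform_trl// -ip_trl//; [exact: L2_fnl|exact: H1_L2].
Qed.

Definition critical Q := H1 Q /\ forall psi, H1 psi -> aform Q psi = ip (f Q) psi.

(** Both terms pass to the limit on test functions; density in H^1 gives the remaining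
    directions. *)
Lemma ps_limit g G (C : R) : (forall n, H1 (g n)) -> (forall n, hn (g n) <= C) -> ps g ->
  H1 G -> wk U g G -> critical G.
Proof.
move=> Hg bg hps HG h; have Lf := L2_fnl hp HG.
have ht phi : test phi -> aform G phi = ip (f G) phi.
  move=> tp; have Hp := test_H1 tp; apply/eqP; rewrite -subr_eq0; apply/eqP.
  have c1 : aform (g n) phi - ip (f (g n)) phi @[n --> U] --> aform G phi - ip (f G) phi.
    by apply: cvgB; [exact: (wk_aform Hg bg)|exact: (fnl_weak Hg bg)].
  apply: (cvgR_unique c1); apply/cvgrPdist_le => e e0.
  have q0 : 0 < 1 + hn phi by rewrite ltr_pwDl ?snorm_ge0.
  apply: filterS (hps _ (divr_gt0 e0 q0)) => n /(_ _ Hp).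
  rewrite sub0r normrN => hh; apply: le_trans hh _.
  by rewrite mulrAC ler_pdivrMr// ler_wpM2l ?(ltW e0)// lerDr.
split => // psi Hp; apply/eqP; rewrite -subr_eq0 -normr_le0 leNgt; apply/negP => m0.
set m := `|_| in m0; have K0 : 0 < 1 + (hn G + nm (f G)) by rewrite ltr_pwDl// addr_ge0 ?snorm_ge0.
have [phi [tp hphi]] := test_dense_H1 Hp (divr_gt0 (divr_gt0 m0 (ltr0n R 2)) K0).
have Hphi := test_H1 tp; have Hd := siB SH Hp Hphi.
have e1 : aform G psi - ip (f G) psi = aform G (psi - phi) - ip (f G) (psi - phi).
  rewrite (siBr SH Hp Hphi HG) (siBr S2 (H1_L2 Hp) (H1_L2 Hphi) Lf) (ht _ tp); ring.
have : m <= m / 2.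
  rewrite {1}/m e1; apply: le_trans (ler_normB _ _) _.
  have x1 := si_CS SH HG Hd; have x2 := si_CS S2 Lf (H1_L2 Hd).
  have x3 : nm (f G) * nm (psi - phi) <= nm (f G) * hn (psi - phi).
    by rewrite ler_wpM2l ?snorm_ge0// nm_le_hn.
  have x4 : (1 + (hn G + nm (f G))) * hn (psi - phi) <= m / 2 by rewrite mulrC -ler_pdivlMr.
  have := snorm_ge0 (@aform R d) (psi - phi); lra.
lra.
Qed.

Lemma critical_equilibrium G : critical G -> equilibrium p G.
Proof.
move=> [HG h]; split => // phi tp.
have [Ll hl] := laplacian_test tp; have LG := H1_L2 HG; have Lp := test_L2 tp.
have Lf := L2_fnl hp HG.
have i1 := L2M LG Ll; have i2 := L2M LG Lp; have i3 := L2M Lf Lp.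
have := h _ (test_H1 tp); rewrite hl// => e.
transitivity (ip G phi - ip G (laplacian phi) - ip (f G) phi); last by rewrite e subrr.
rewrite !ipE -RintegralB// -RintegralB//; last exact: (integrB i2 i1).
by congr (Rintegral _ _ _); apply/funext => x; rewrite [- _ + _]addrC.
Qed.

(** Testing the equation with [G] itself gives [|G|^2 <= C |G|^(p+1)] in H^1, so a nonzero norm is
    at least [C^(-1/(p-1))]. *)
Lemma critical_lower : exists2 c, 0 < c & forall G, critical G -> hn G != 0 -> c <= hn G.
Proof.
have hp1 : 1 < p by case: hp.
have [C [C0 hC]] := nm_fnl_le hp; exists (C^-1 `^ (p - 1)^-1); first by rewrite powR_gt0 ?invr_gt0.
move=> G [HG h] n0; have h0 : 0 < hn G by rewrite lt_def n0 snorm_ge0.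
rewrite leNgt; apply/negP => hc.
have p10 : 0 < p - 1 by rewrite subr_gt0.
have h1 : hn G `^ (p - 1) < C^-1.
  have := gt0_ltr_powR p10 (_ : hn G \in Num.nneg) (_ : C^-1 `^ (p - 1)^-1 \in Num.nneg) hc.
  rewrite -powRrM mulVf ?gt_eqF// powRr1 ?invr_ge0 ?(ltW C0)// !nnegrE powR_ge0 (ltW h0).
  exact.
have h2 : hn G ^+ 2 <= C * hn G `^ p * hn G.
  rewrite (snorm_sqr SH HG) h//; apply: le_trans (ler_norm _) _.
  apply: le_trans (si_CS S2 (L2_fnl hp HG) (H1_L2 HG)) _.
  by apply: ler_pM; rewrite ?snorm_ge0 ?hC ?nm_le_hn.
have e1 : hn G `^ p = hn G `^ (p - 1) * hn G.
  by rewrite -[X in _ = _ * X]powRr1 ?(ltW h0)// -powRD ?subrK// (gt_eqF h0) implybT.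
move: h2; rewrite expr2 ler_pM2r// e1 mulrA -[leLHS]mul1r ler_pM2r//.
by apply/negP; rewrite -ltNge -ltr_pdivlMl// mulr1.
Qed.

End palais_smale_limits.

(** * Extraction of the profiles along an ultrafilter *)

Section profile_decomposition.
Context {R : realType} {d : nat}.
Local Notation E := 'rV[R]_d.
Local Notation nm := (snorm (@ip R d)).
Local Notation hn := (snorm (@aform R d)).
Let S2 := @L2_semi R d.
Let SH := @H1_semi R d.
Variable U : set_system nat.
Context {UU : UltraFilter U}.
Let FU : ProperFilter U. Proof. exact: ultra_proper. Qed.
Variable p : R.
Hypothesis hp : @subcritical R d p.
Local Notation f := (fnl p).
Variables (u : nat -> E -> R) (B : R).
Hypothesis Hu : forall n, H1 (u n).
Hypothesis bu : forall n, hn (u n) <= B.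
Hypothesis psu : ps U p u.
Implicit Types (Q : nat -> E -> R) (x : nat -> nat -> E) (y : nat -> E).

Lemma ultra_dichotomy (a : nat -> R) :
  a n @[n --> U] --> +oo \/ exists C, \forall n \near U, a n <= C.
Proof.
have [h|/existsNP[C hC]] := pselect (forall C, \forall n \near U, C <= a n).
  by left; apply/cvgryPge => C; exact: h.
right; exists C; have [h|h] := in_ultra_setVsetC [set n | C <= a n] UU; first by [].
by apply: filterS h => n /= /negP; rewrite -ltNge => /ltW.
Qed.

Lemma ultra_rV_cvg (z : nat -> E) (C : R) : (\forall n \near U, `|z n| <= C) ->
  exists a, `|z n - a| @[n --> U] --> 0.
Proof.
move=> hC.
have hc i : exists l : R, z n ord0 i @[n --> U] --> l.
  (* The bound holds only for most [n]; truncation makes it hold for all of them, as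
     [ultra_bounded_cvg] requires. *)
  pose t n := if `|z n| <= C then z n ord0 i else 0.
  have [|l hl] := @ultra_bounded_cvg R _ U _ t `|C|.
    move=> n; rewrite /t; case: ifP => [h|_]; last by rewrite normr0.
    apply: le_trans (coord_le_norm _ _) _; apply: (le_trans h); exact: ler_norm.
  exists l; apply: cvg_trans hl; apply: near_eq_cvg; apply: filterS hC => n h.
  by rewrite /t h.
have [l hl] := choice hc; exists (\row_i l i); apply/cvgrPdist_le => e e0.
have hf : \forall n \near U, forall i, `|l i - z n ord0 i| <= e.
  by apply: filter_forall => i; have /cvgrPdist_le /(_ _ e0) := hl i.
apply: filterS hf => n h; rewrite sub0r normrN normr_id; apply: norm_rV_le; first exact: ltW.
by move=> i; rewrite !mxE distrC.
Qed.

Definition bubbles J Q x n : E -> R := \sum_(j < J) tr (- x j n) (Q j).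

(** Families are indexed by all of [nat] and only the indices below [J] count, so that appending a
    profile means changing the value at the index [J]. The condition [hn (Q j) != 0] gives each
    profile a fixed cost in H^1. *)
Definition profiles J Q x :=
  [/\ forall j, (j < J)%N -> critical p (Q j) /\ hn (Q j) != 0,
      forall i j, (i < J)%N -> (j < J)%N -> i != j -> `|x j n - x i n| @[n --> U] --> +oo &
      forall j, (j < J)%N -> wk U (fun n => tr (x j n) (u n)) (Q j)].

Section fixed_profiles.
Variables (J : nat) (Q : nat -> E -> R) (x : nat -> nat -> E).
Hypothesis hprof : profiles J Q x.

Let HQ j : (j < J)%N -> H1 (Q j).
Proof. by case: hprof => h _ _ /h[[]]. Qed.

Let far i j : (i < J)%N -> (j < J)%N -> i != j -> `|x j n - x i n| @[n --> U] --> +oo.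
Proof. by case: hprof => _ h _; exact: h. Qed.

Let lim j : (j < J)%N -> wk U (fun n => tr (x j n) (u n)) (Q j).
Proof. by case: hprof => _ _; exact. Qed.

Let HS n : H1 (bubbles J Q x n).
Proof. by apply: (si_sum SH) => j _; apply: H1_tr; exact: HQ. Qed.

Let C := \sum_(j < J) hn (Q j).

Let bS n : hn (bubbles J Q x n) <= C.
Proof.
rewrite /bubbles /C; have hQ := HQ; elim: J hQ => [|k ih] hQ.
  by rewrite !big_ord0 (snorm0 SH).
rewrite !big_ord_recr /=; have hk : forall j, (j < k)%N -> H1 (Q j) by move=> j jk; apply: hQ; exact: ltnW.
have Hs : H1 (\sum_(i < k) tr (- x i n) (Q i)) by apply: (si_sum SH) => j _; apply: H1_tr; exact: hk.
have Ht := H1_tr (- x k n) (hQ k (ltnSn k)).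
apply: le_trans (snormD SH Hs Ht) _; rewrite hn_tr ?lerD2r ?ih//; exact: hQ.
Qed.

Lemma tr_bubbles y n : tr (y n) (bubbles J Q x n) = \sum_(j < J) tr (y n - x j n) (Q j).
Proof.
rewrite /bubbles; apply/funext => z; rewrite /tr !fct_sumE; apply: eq_bigr => j _.
by rewrite addrA.
Qed.

Lemma bubbles_far y : (forall j, (j < J)%N -> `|y n - x j n| @[n --> U] --> +oo) ->
  wk U (fun n => tr (y n) (bubbles J Q x n)) 0.
Proof.
move=> h; rewrite (_ : (fun n => _) = (fun n => \sum_(j < J) tr (y n - x j n) (Q j))); last first.
  by apply/funext => n; exact: tr_bubbles.
have e0 : 0 = \sum_(j < J) (fun=> 0 : E -> R) j :> (E -> R) by rewrite big1.
rewrite [X in wk _ _ X]e0.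
apply: (@wk_sum R d U _ (fun j n => tr (y n - x j n) (Q j)) (fun=> 0) J).
- by move=> j n jJ; apply/L2_tr/H1_L2/HQ.
- by move=> j jJ; exact: (si0 S2).
- by move=> j jJ; apply: wk_far; [exact/H1_L2/HQ|exact: h].
Qed.

Lemma bubbles_near i : (i < J)%N -> wk U (fun n => tr (x i n) (bubbles J Q x n)) (Q i).
Proof.
move=> iJ; rewrite (_ : (fun n => _) = (fun n => \sum_(j < J) tr (x i n - x j n) (Q j))); last first.
  by apply/funext => n; exact: tr_bubbles.
have e0 : Q i = \sum_(j < J) (fun j => if j == i then Q i else 0) (j : nat).
  rewrite (bigD1 (Ordinal iJ))//= eqxx big1 ?addr0// => j ji.
  by rewrite ifN// (_ : (j : nat) = _).
rewrite [X in wk _ _ X]e0.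
apply: (@wk_sum R d U _ (fun j n => tr (x i n - x j n) (Q j)) (fun j => if j == i then Q i else 0) J).
- by move=> j n jJ; apply/L2_tr/H1_L2/HQ.
- by move=> j jJ; case: ifP => _; [exact/H1_L2/HQ|exact: (si0 S2)].
- move=> j jJ; case: ifP => [/eqP->|/negbT ji].
    by move=> phi Lp; under eq_fun do rewrite subrr tr0; exact: cvg_cst.
  by apply: wk_far; [exact/H1_L2/HQ|exact: far].
Qed.

Lemma bubbles_aform (g : nat -> E -> R) (D : R) (G : nat -> E -> R) : (forall n, H1 (g n)) -> (forall n, hn (g n) <= D) ->
  (forall j, (j < J)%N -> H1 (G j)) ->
  (forall j, (j < J)%N -> wk U (fun n => tr (x j n) (g n)) (G j)) ->
  aform (g n) (bubbles J Q x n) @[n --> U] --> \sum_(j < J) aform (G j) (Q j).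
Proof.
move=> Hg bg HG h.
rewrite (_ : (fun n => _) = (fun n => \sum_(j < J) aform (tr (x j n) (g n)) (Q j))); last first.
  apply/funext => n; rewrite (siC SH (Hg n) (HS n)) /bubbles (si_suml SH) //; last first.
    by move=> j _; apply: H1_tr; exact: HQ.
  apply: eq_bigr => j _; have Hj := HQ (ltn_ord j).
  by rewrite aform_trl// opprK (siC SH Hj (H1_tr _ (Hg n))).
apply: (@cvg_sum_filter R U _ (fun j n => aform (tr (x j n) (g n)) (Q j)) (fun j => aform (G j) (Q j))).
move=> j jJ; apply: (@wk_aform R d U _ _ _ D) => //.
- by move=> n; exact: H1_tr.
- by move=> n; rewrite hn_tr.
- exact: HG.
- exact: h.
- exact: HQ.
Qed.

(** Bessel's inequality in the limit: the squared norm of [u n - bubbles] is nonnegative, and both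
    the pairing of [u n] with the bubbles and the squared norm of the bubbles tend to the sum of the
    squared norms. *)
Lemma profiles_energy : \sum_(j < J) hn (Q j) ^+ 2 <= B ^+ 2.
Proof.
have c1 := bubbles_aform Hu bu HQ lim.
have c2 := bubbles_aform HS bS HQ bubbles_near.
have e : \sum_(j < J) aform (Q j) (Q j) = \sum_(j < J) hn (Q j) ^+ 2.
  by apply: eq_bigr => j _; rewrite (snorm_sqr SH)//; exact: HQ.
have c3 : 2 * aform (u n) (bubbles J Q x n) - aform (bubbles J Q x n) (bubbles J Q x n) @[n --> U] -->
    2 * (\sum_(j < J) aform (Q j) (Q j)) - \sum_(j < J) aform (Q j) (Q j).
  by apply: cvgB => //; apply: cvgM => //; exact: cvg_cst.
rewrite -e; have -> : \sum_(j < J) aform (Q j) (Q j) = 2 * (\sum_(j < J) aform (Q j) (Q j)) - \sum_(j < J) aform (Q j) (Q j) by ring.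
apply/ler_addgt0Pr => e' e0; move: c3 => /cvgrPdist_le /(_ _ e0) /filter_ex[n].
rewrite ler_norml => /andP[_ h].
have h1 := si_ge0 SH (siB SH (Hu n) (HS n)).
rewrite (siBl SH (Hu n) (HS n) (siB SH (Hu n) (HS n))) !(siBr SH (Hu n) (HS n)) // in h1.
rewrite (siC SH (HS n) (Hu n)) in h1.
have h2 : aform (u n) (u n) <= B ^+ 2.
  rewrite -(snorm_sqr SH (Hu n)) ler_sqr ?nnegrE ?snorm_ge0//; exact: le_trans (snorm_ge0 _ _) (bu n).
lra.
Qed.

Definition remainder n : E -> R := u n - bubbles J Q x n.

Lemma H1_remainder n : H1 (remainder n). Proof. exact: (siB SH). Qed.

Lemma remainder_bound n : hn (remainder n) <= B + C.
Proof. by apply: le_trans (snormB SH (Hu n) (HS n)) _; rewrite lerD. Qed.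

Lemma remainder_near j : (j < J)%N -> wk U (fun n => tr (x j n) (remainder n)) 0.
Proof.
move=> jJ; have LQ := H1_L2 (HQ jJ); rewrite -(subrr (Q j)).
apply: (wkB _ _ _ _ (lim jJ) (bubbles_near jJ)) => // n; apply: L2_tr; exact: H1_L2.
Qed.

(* A nonzero weak limit of translates of the remainder would be one more profile. *)
Lemma remainder_wk : (forall Q' x', ~ profiles J.+1 Q' x') ->
  forall y, wk U (fun n => tr (y n) (remainder n)) 0.
Proof.
move=> hmax y.
(* If [y] stays at bounded distance from some centre, a convergent shift reduces to
   [remainder_near]; otherwise it diverges from all the centres and the bubbles disappear in the
   limit. *)
have [[j [jJ [D hD]]]|hfar] := pselect (exists j, (j < J)%N /\ exists D, \forall n \near U, `|y n - x j n| <= D).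
  have [a ha] := ultra_rV_cvg hD.
  have := @wk_shift R d U _ (fun n => y n - x j n) a (fun n => tr (x j n) (remainder n)) 0 (B + C).
  have -> : tr a (0 : E -> R) = 0 by [].
  rewrite (_ : (fun n => tr (y n - x j n) _) = (fun n => tr (y n) (remainder n))); last first.
    by apply/funext => n; rewrite tr_tr subrK.
  apply => //.
  - by move=> n; apply/L2_tr/H1_L2/H1_remainder.
  - move=> n; apply: le_trans (nm_le_hn (H1_tr _ (H1_remainder n))) _; rewrite hn_tr ?remainder_bound//; exact: H1_remainder.
  - exact: (si0 S2).
  - exact: remainder_near.
have far' j : (j < J)%N -> `|y n - x j n| @[n --> U] --> +oo.
  move=> jJ; have [//|h] := ultra_dichotomy (fun n => `|y n - x j n|).
  by exfalso; apply: hfar; exists j.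
have Hty n : H1 (tr (y n) (u n)) := H1_tr _ (Hu n).
have bty n : hn (tr (y n) (u n)) <= B by rewrite hn_tr.
have [G [HG hG _]] := H1_weak_ultra Hty bty.
have wG : wk U (fun n => tr (y n) (u n)) G by exact: hG.
have cG : critical p G by apply: (ps_limit hp Hty bty _ HG wG); exact: (ps_tr hp y Hu psu).
have LG := H1_L2 HG.
have nG : nm G = 0.
  apply/eqP/negPn/negP => nG0; have hG0 : hn G != 0.
    by rewrite gt_eqF// (lt_le_trans _ (nm_le_hn HG))// lt_def nG0 snorm_ge0.
  apply: (hmax (fun j => if j == J then G else Q j) (fun j n => if j == J then y n else x j n)).
  have [h1 h2 h3] := hprof; split.
  - by move=> j; rewrite ltnS leq_eqVlt; case: (eqVneq j J) => [_ _|_ /= jJ] /=; [by []|exact: h1].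
  - have cas l : (l < J.+1)%N -> l = J \/ (l < J)%N.
      by rewrite ltnS leq_eqVlt => /orP[/eqP|]; [left|right].
    move=> i j /cas ci /cas cj ij; case: ci cj => [ei|iJ] [ej|jJ].
    + by rewrite ei ej eqxx in ij.
    + rewrite (ltn_eqF jJ) (introT eqP ei); under eq_fun do rewrite distrC; exact: far'.
    + rewrite (ltn_eqF iJ) (introT eqP ej); exact: far'.
    + rewrite (ltn_eqF iJ) (ltn_eqF jJ); exact: h2.
  - by move=> j; rewrite ltnS leq_eqVlt; case: (eqVneq j J) => [_ _|_ /= jJ] /=; [exact: wG|exact: h3].
have w0 : wk U (fun n => tr (y n) (remainder n)) (G - 0).
  apply: (wkB _ _ _ _ wG (bubbles_far far')) => //; last exact: (si0 S2).
  - by move=> n; apply/L2_tr/H1_L2.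
  - by move=> n; apply/L2_tr/H1_L2.
move=> phi Lp; have := w0 _ Lp; rewrite subr0 (si0l S2)//.
suff -> : ip G phi = 0 by [].
by apply/eqP; rewrite -normr_le0; apply: le_trans (si_CS S2 LG Lp) _; rewrite nG mul0r.
Qed.

(** Uniformity in [z] by contradiction: choose a bad point [z n] for each [n] and translate by the
    corner of its cube; the weak convergence of these translates excludes a large average. *)
Lemma remainder_avg K (e : R) : (forall y, wk U (fun n => tr (y n) (remainder n)) 0) -> 0 < e ->
  \forall n \near U, forall z, `|avg K (remainder n) z| <= e.
Proof.
move=> hw e0.
have [//|h] := in_ultra_setVsetC [set n | forall z, `|avg K (remainder n) z| <= e] UU.
have hz0 n : exists z, (~ forall z', `|avg K (remainder n) z'| <= e) -> e < `|avg K (remainder n) z|.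
  have [/existsNP[z hz]|h'] := pselect (~ forall z, `|avg K (remainder n) z| <= e).
    by exists z => _; rewrite ltNge; apply/negP.
  by exists 0.
have [z hz] := choice hz0.
have V0 := @vol_gt0 R d K.
have /cvgrPdist_lt := hw (fun n => corner K (z n)) _ (L2_cube K).
have q0 : 0 < e / (2 ^+ K) ^+ d by rewrite divr_gt0.
move=> /(_ _ q0) h1.
have [n [/= /hz h2]] := filter_ex (filterI h h1).
rewrite (si0l S2 (L2_cube K)) sub0r normrN ltr_pdivlMr// mulrC.
move: h2; rewrite avgE normrM (gtr0_norm V0) => h2 h3.
by have := lt_trans h2 h3; rewrite ltxx.
Qed.

(** The squared norm is [aform (u n) r - aform (bubbles) r] with [r] the remainder. The second term
    tends to 0; the first is almost the pairing of [f (u n)] with [r], which [fnl_young] bounds by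
    [k] times a bounded term plus [k^(-p)] times a term containing [nm (f r)], and the latter
    vanishes with the averages. *)
Lemma remainder_cvg : (forall y, wk U (fun n => tr (y n) (remainder n)) 0) ->
  hn (remainder n) @[n --> U] --> 0.
Proof.
move=> hw; pose D := B + C + 1.
have BC : 0 <= B + C := le_trans (snorm_ge0 _ _) (remainder_bound 0).
have D0 : 0 < D by rewrite ltr_wpDl.
have bD n : hn (remainder n) <= D by apply: le_trans (remainder_bound n) _; rewrite lerDl.
have [M M0 hM] := nm_fnl_bound hp B.
have B0 : 0 <= B := le_trans (snorm_ge0 _ _) (bu 0).
have caf : aform (bubbles J Q x n) (remainder n) @[n --> U] --> 0.
  have := @bubbles_aform remainder (B + C) (fun=> 0) H1_remainder remainder_bound (fun _ _ => si0 SH) remainder_near.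
  rewrite big1 => [|j _]; last by rewrite (si0l SH)//; exact: HQ.
  by under eq_fun do rewrite (siC SH (H1_remainder _) (HS _)).
apply/cvgrPdist_le => e e0.
have e2 : 0 < e ^+ 2 / 4 by rewrite divr_gt0// exprn_gt0.
(* [k] is fixed before the smallness [m0] of the nonlinearity, whose size compensates [k^(-p)]; four
   errors of size [e^2 / 4] add up. *)
have k0 : 0 < e ^+ 2 / 4 / (1 + M * B) by rewrite divr_gt0// ltr_pwDl// mulr_ge0// ltW.
set k := _ / _ in k0.
have kp : 0 <= k `^ (- p) * D by rewrite mulr_ge0 ?powR_ge0// ltW.
have m0 : 0 < e ^+ 2 / 4 / (1 + k `^ (- p) * D) by rewrite divr_gt0// ltr_pwDl.
have [K [e1 [e10 hv]]] := fnl_vanishing hp D0 m0.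
have q0 : 0 < e ^+ 2 / 4 / D by rewrite divr_gt0.
have hps := psu q0; have hav := remainder_avg K hw e10.
move: caf => /cvgrPdist_le /(_ _ e2) haf.
near=> n.
have a1 : `|0 - aform (bubbles J Q x n) (remainder n)| <= e ^+ 2 / 4 by near: n.
have a2 : forall psi, H1 psi -> `|aform (u n) psi - ip (f (u n)) psi| <= e ^+ 2 / 4 / D * hn psi by near: n.
have a3 : forall z, `|avg K (remainder n) z| <= e1 by near: n.
have Hr := H1_remainder n.
have a4 := hv _ Hr (bD n) a3.
have a5 : `|aform (u n) (remainder n) - ip (f (u n)) (remainder n)| <= e ^+ 2 / 4.
  by apply: le_trans (a2 _ Hr) _; rewrite mulrAC ler_pdivrMr// ler_wpM2l ?(ltW e2).
have a6 := fnl_young hp k0 (Hu n) Hr.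
have a7 : k * (nm (f (u n)) * nm (u n)) <= e ^+ 2 / 4.
  apply: (@le_trans _ _ (k * (1 + M * B))); last by rewrite /k divfK// gt_eqF// ltr_pwDl// mulr_ge0// ltW.
  rewrite ler_wpM2l ?(ltW k0)//; apply: (@le_trans _ _ (M * B)); last by rewrite lerDr.
  by apply: ler_pM; rewrite ?snorm_ge0 ?hM//; apply: le_trans (nm_le_hn (Hu n)) _.
have a8 : k `^ (- p) * (nm (f (remainder n)) * nm (remainder n)) <= e ^+ 2 / 4.
  have h1 : nm (f (remainder n)) * nm (remainder n) <= e ^+ 2 / 4 / (1 + k `^ (- p) * D) * D.
    by apply: ler_pM; rewrite ?snorm_ge0// (le_trans (nm_le_hn Hr)).
  have h2 := ler_wpM2l (powR_ge0 k (- p)) h1; apply: le_trans h2 _.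
  move: (k `^ (- p)) (e ^+ 2 / 4) kp e2 => t A kp e2.
  have -> : t * (A / (1 + t * D) * D) = t * D * A / (1 + t * D) by rewrite [A / _ * D]mulrAC !mulrA [t * A * D]mulrAC.
  have q1 : 0 < 1 + t * D by rewrite ltr_pwDl.
  by rewrite ler_pdivrMr// [A * _]mulrC mulrDl mul1r lerDr ltW.
have e3 : hn (remainder n) ^+ 2 = aform (u n) (remainder n) - aform (bubbles J Q x n) (remainder n).
  by rewrite (snorm_sqr SH Hr) -(siBl SH (Hu n) (HS n) Hr).
rewrite sub0r normrN ger0_norm ?snorm_ge0//.
rewrite -ler_sqr ?nnegrE ?snorm_ge0 ?(ltW e0)// e3.
move: a1 a5 a6; rewrite sub0r normrN !ler_norml => /andP[a1 a1'] /andP[_ a5] /andP[_ a6]; lra.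
Unshelve. all: by end_near.
Qed.

End fixed_profiles.

(** If no family were maximal, there would be families of every length. By [critical_lower] each
    profile costs at least [c^2], so a length above [B^2 / c^2] contradicts [profiles_energy]. *)
Lemma profile_decomposition : exists J Q x,
  [/\ forall j, (j < J)%N -> critical p (Q j),
      forall i j, (i < J)%N -> (j < J)%N -> i != j -> `|x j n - x i n| @[n --> U] --> +oo &
      hn (u n - \sum_(j < J) tr (- x j n) (Q j)) @[n --> U] --> 0].
Proof.
have [c c0 hc] := critical_lower hp.
suff [J [[Q [x hQ]] hmax]] : exists J, (exists Q x, profiles J Q x) /\ forall Q x, ~ profiles J.+1 Q x.
  exists J, Q, x; have [h1 h2 h3] := hQ; split=> //; first by move=> j /h1[].
  exact: (remainder_cvg hQ (remainder_wk hQ hmax)).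
apply: contrapT => hJ.
have all J : exists Q x, profiles J Q x.
  elim: J => [|J ih]; first by exists (fun=> 0), (fun _ _ => 0); split.
  apply: contrapT => hn'; apply: hJ; exists J; split => // Q x hQ; apply: hn'.
  by exists Q, x.
pose J := (Num.truncn (B ^+ 2 / c ^+ 2)).+1.
have [Q [x hQ]] := all J; have := profiles_energy hQ; apply/negP; rewrite -ltNge.
have c2 : 0 < c ^+ 2 by rewrite exprn_gt0.
apply: (@lt_le_trans _ _ (J%:R * c ^+ 2)).
  by rewrite -ltr_pdivrMr// truncnS_gt.
have -> : J%:R * c ^+ 2 = \sum_(j < J) c ^+ 2 by rewrite sumr_const card_ord mulr_natl.
apply: ler_sum => j _; have [h _ _] := hQ; have [h1 h2] := h _ (ltn_ord j).
by rewrite lerXn2r ?nnegrE ?snorm_ge0 ?(ltW c0)// hc.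
Qed.

End profile_decomposition.

(** * Return to subsequences and conclusion *)

Lemma norm_le_euclidean (R : realType) (d : nat) (x : 'rV[R]_d) : `|x| <= euclidean_norm x.
Proof.
apply: norm_rV_le => [|i]; first exact: sqrtr_ge0.
rewrite -sqrtr_sqr; apply: ler_wsqrtr; rewrite (bigD1 i)//= lerDl sumr_ge0// => j _.
exact: sqr_ge0.
Qed.

(** Every set of a filter finer than that of the tails contains arbitrarily large indices, so an
    element of [A m] above the previous choice can be picked recursively. *)
Lemma increasing_selection (U : set_system nat) (A : nat -> set nat) :
  ProperFilter U -> (forall N, \forall n \near U, (N < n)%N) -> (forall m, U (A m)) ->
  exists k : nat -> nat, (forall m n, (m < n)%N -> (k m < k n)%N) /\ forall m, A m (k m).
Proof.
move=> FU hU hA.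
have /choice[s hs] (mN : nat * nat) : exists n, (mN.2 < n)%N /\ A mN.1 n.
  by have [n [h1 h2]] := filter_ex (filterI (hU mN.2) (hA mN.1)); exists n.
pose k := fix k m := if m is m'.+1 then s (m, k m') else s (0, 0).
exists k; split; last by case=> [|m]; [have [] := hs (0, 0)%N|have [] := hs (m.+1, k m)].
move=> m n; elim: n => // n ih; have [h _] := hs (n.+1, k n).
by rewrite ltnS leq_eqVlt => /orP[/eqP->//|/ih h']; exact: ltn_trans h' h.
Qed.

Theorem corollary1p2 (R : realType) (d : nat) (alpha p : R)
    (u0 u1 : 'rV[R]_d -> R) (T : \bar R) (u v : R -> 'rV[R]_d -> R)
    (hd : (0 < d)%N) (halpha : 0 < alpha) (hp1 : 1 < p)
    (hp2 : (3 <= d)%N -> p < d%:R / (d - 2)%:R)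
    (hu0 : H1 u0) (hu1 : L2 u1)
    (hu : maximal_solution alpha p u0 u1 T u v) :
  (T < +oo)%E \/
  [/\ T = +oo%E,
      L2norm (v t) @[t --> +oo] --> 0
    & forall t_ : nat -> R, (forall n, 0 <= t_ n) -> t_ n @[n --> \oo] --> +oo ->
      exists (k : nat -> nat) (J : nat) (Q : 'I_J -> 'rV[R]_d -> R)
             (x : 'I_J -> nat -> 'rV[R]_d),
        [/\ forall m n, (m < n)%N -> (k m < k n)%N,
            forall j, equilibrium p (Q j),
            H1norm (fun y => u (t_ (k n)) y - \sum_(j < J) Q j (y - x j n))
              @[n --> \oo] --> 0
          & forall i j, i != j ->
              euclidean_norm (x j n - x i n) @[n --> \oo] --> +oo]].
Proof.
have S2 := @L2_semi R d; have SH := @H1_semi R d.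
have [Tfin|] := ltP T +oo%E; first by left.
rewrite leye_eq => /eqP eT; right; split => //.
all: have hp : @subcritical R d p by split => //; exact: subcritical_rate.
all: have sol : solution alpha p +oo%E u v by case: hu => _; rewrite eT.
all: have ev := solution_evol hp sol.
all: set ut := (fun t => u (Num.max t 0)) in ev; set vt := (fun t => v (Num.max t 0)) in ev.
all: have [B [T0 [B0 T00 hB hps]]] := palais_smale halpha hp ev.
  apply/cvgrPdist_le => e e0; have [T1 hT1] := hps e e0.
  near=> t.
  have t0 : 0 <= t by near: t; exact: nbhs_pinfty_ge.
  have t1 : T1 <= t by near: t; exact: (nbhs_pinfty_ge (num_real T1)).
  have [n1 _] := hT1 t t1.
  have Lv : L2 (v t) by have := evol_L2 ev t; rewrite /vt max_l.
  rewrite sub0r normrN L2normE// ger0_norm ?snorm_ge0//.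
  by move: n1; rewrite /vt max_l.
move=> t_ t_0 t_oo.
have [U [UU UF]] := ultraFilterLemma (eventually_filter : ProperFilter \oo).
have FU : ProperFilter U by exact: ultra_proper.
(* The H^1 bound holds only from [T0] on, while the profile decomposition asks for it at every
   index; the exceptional indices, which are negligible for [U], get the value 0. *)
pose w n := if T0 <= t_ n then ut (t_ n) else 0.
have Hw n : H1 (w n) by rewrite /w; case: ifP => _; [exact: (evol_H1 ev)|exact: (si0 SH)].
have bw n : snorm (@aform R d) (w n) <= B.
  by rewrite /w; case: ifP => [/hB//|_]; rewrite (snorm0 SH) ltW.
have late S : \forall n \near U, S <= t_ n.
  by apply: UF; move: t_oo => /cvgryPge; exact.
have psw : ps U p w.
  move=> k k0; have [T1 hT1] := hps k k0.
  by apply: filterS2 (late T1) (late T0) => n /hT1[_ h1] h2; rewrite /w h2.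
have [J [Q [x [hQ hx hr]]]] := profile_decomposition hp Hw bw psw.
(* The requirements with precision [m], all of them satisfied for most indices; choosing the [m]-th
   index in [A m] turns limits along the ultrafilter into limits of a subsequence. *)
pose A (m : nat) := [set n | [/\ T0 <= t_ n, snorm (@aform R d) (w n - \sum_(j < J) tr (- x j n) (Q j)) <= m.+1%:R^-1 &
  forall i j : 'I_J, i != j -> m%:R <= `|x j n - x i n|]].
have hA m : U (A m).
  have m0 : 0 < m.+1%:R^-1 :> R by rewrite invr_gt0.
  have h1 : \forall n \near U, forall i j : 'I_J, i != j -> m%:R <= `|x j n - x i n|.
    apply: filter_forall => i; apply: filter_forall => j.
    have [->|ij] := eqVneq i j; first by apply: nearW => n; rewrite ?eqxx.
    have := hx i j (ltn_ord i) (ltn_ord j) ij => /cvgryPge /(_ m%:R).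
    by apply: filterS.
  move: hr => /cvgrPdist_le /(_ _ m0) h2.
  apply: filterS3 (late T0) h1 h2 => n a1 a2 a3; split => //.
  by move: a3; rewrite sub0r normrN ger0_norm ?snorm_ge0.
have hN N : \forall n \near U, (N < n)%N by apply: UF; exact: nbhs_infty_gt.
have [k [k1 k2]] := increasing_selection FU hN hA.
exists k, J, (fun j => Q j), (fun j n => x j (k n)); split => //.
- by move=> j; apply: (critical_equilibrium hp); exact: hQ.
- apply/cvgrPdist_le => e e0; near=> n.
  have [a1 a2 _] := k2 n.
  have -> : (fun y => u (t_ (k n)) y - \sum_(j < J) Q j (y - x j (k n))) =
      w (k n) - \sum_(j < J) tr (- x j (k n)) (Q j).
    rewrite /w a1 /ut max_l ?t_0//; apply/funext => y.
    by congr (_ - _); rewrite fct_sumE.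
  have Hb : H1 (w (k n) - \sum_(j < J) tr (- x j (k n)) (Q j)).
    apply: (siB SH) => //; apply: (si_sum SH) => j _; apply: H1_tr.
    by have [] := hQ j (ltn_ord j).
  rewrite sub0r normrN H1normE// ger0_norm ?snorm_ge0//; apply: (le_trans a2).
  apply: ltW; near: n; exact: (near_infty_natSinv_lt (PosNum e0)).
- move=> i j ij; apply/cvgryPge => c; near=> n.
  have [_ _ a3] := k2 n; apply: le_trans (norm_le_euclidean _).
  apply: le_trans (a3 i j ij); near: n; exact: nbhs_infty_ger.
Unshelve. all: by end_near.
Qed.
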